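(* Let $0\leq\delta<1$ and let $\theta^0\in X^0(\mathbb{R}^2)\cap X^{-\delta}(\mathbb{R}^2)$ be such that $\|\theta^0\|_{X^0}<2^{-(3-\delta)}$. Then there exists a unique solution $\theta$ of the system $(S_2)$ with initial data $\theta^0$ in the space $C_b([0,\infty),X^0(\mathbb{R}^2)\cap X^{-\delta}(\mathbb{R}^2))$. Furthermore, $\nabla\theta\in L^1([0,\infty),X^0(\mathbb{R}^2)\cap X^{-\delta}(\mathbb{R}^2))$. Moreover, $$\|\theta(t)\|_{X^0}=o(t^{-\delta}),\qquad t\to\infty.$$
   Context: Fourier transform on $\mathbb{R}^2$: $\widehat f(\xi)=\int_{\mathbb{R}^2}e^{-ix\cdot\xi}f(x)\,dx$. For $\sigma\in\mathbb{R}$, $X^\sigma(\mathbb{R}^2)=\{f\in\mathcal S'(\mathbb{R}^2):\ \widehat f\in L^1_{loc}(\mathbb{R}^2),\ \int_{\mathbb{R}^2}|\xi|^\sigma|\widehat f(\xi)|\,d\xi<\infty\}$, with norm $\|f\|_{X^\sigma}=\int_{\mathbb{R}^2}|\xi|^\sigma|\widehat f(\xi)|\,d\xi$ (for vector-valued $f$, $|\widehat f(\xi)|$ is the Euclidean norm). Intersections $X^0\cap X^{-\delta}$ carry the usual intersection norm (e.g. the maximum of the two norms). $C_b$ denotes bounded continuous functions. $|D|$ is the Fourier multiplier with symbol $|\xi|$, and $e^{-t|D|}$ the one with symbol $e^{-t|\xi|}$. The Riesz transforms are given by $\widehat{R_jf}(\xi)=-\frac{i\xi_j}{|\xi|}\widehat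 f(\xi)$, and $u_\theta=(-R_2\theta,R_1\theta)$, a divergence-free field. We set $u_f\cdot\nabla g=\mathrm{div}(g\,u_f)$. The system $(S_2)$ is $$\partial_t\theta+|D|\theta+u_\theta\cdot\nabla\theta=0\ \text{ in }(0,\infty)\times\mathbb{R}^2,\qquad u_\theta=(-R_2\theta,R_1\theta),\qquad \theta|_{t=0}=\theta^0.$$ Solutions are understood in the integral form $\theta(t)=e^{-t|D|}\theta^0-\int_0^te^{-(t-\tau)|D|}(u_\theta\cdot\nabla\theta)(\tau)\,d\tau$. *)

(* Defs.v *)
From HB Require Import structures.
From mathcomp Require Import all_boot all_order all_algebra.
From mathcomp Require Import complex.
From mathcomp Require Import all_classical all_reals all_analysis.
Set Implicit Arguments.
Unset Strict Implicit.
Unset Printing Implicit Defensive.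
Import Order.TTheory GRing.Theory Num.Theory.
Import numFieldNormedType.Exports.
Local Open Scope classical_set_scope.
Local Open Scope complex_scope.
Local Open Scope ring_scope.

Section Defs.
Context {R : realType}.

Local Notation Re := (@complex.Re R).
Local Notation Im := (@complex.Im R).

Definition plane : Type := (R * R)%type.

(* The two axes are indexed by [false] (first) and [true] (second). *)
Definition coord (j : bool) (x : plane) : R := if j then x.2 else x.1.

Definition basis_vec (j : bool) : plane := if j then (0, 1) else (1, 0).

Definition dotp (x y : plane) : R := x.1 * y.1 + x.2 * y.2.

(* The library norm of R * R is the maximum norm. *)
Definition enorm (x : plane) : R := Num.sqrt (x.1 ^+ 2 + x.2 ^+ 2).

Definition cmod (z : R[i]) : R := Normc.normc z.

Definition expi (a : R) : R[i] := cos a +i* sin a.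

Definition leb2 : {measure set (measurableTypeR R * measurableTypeR R) -> \bar R} :=
  (@lebesgue_measure R \x @lebesgue_measure R)%E.

Definition cintegral d (T : measurableType d) (mu : {measure set T -> \bar R})
    (D : set T) (f : T -> R[i]) : R[i] :=
  Rintegral mu D (Re \o f) +i* Rintegral mu D (Im \o f).

Definition cintegrable (f : plane -> R[i]) : Prop :=
  leb2.-integrable setT (EFin \o (Re \o f)) /\
  leb2.-integrable setT (EFin \o (Im \o f)).

Definition locally_cintegrable (f : plane -> R[i]) : Prop :=
  [/\ measurable_fun setT (Re \o f),
      measurable_fun setT (Im \o f)
    & forall K : set plane, compact K ->
        (\int[leb2]_(x in K) (cmod (f x))%:E < +oo)%E].

Definition cpartial (j : bool) (f : plane -> R[i]) : plane -> R[i] :=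
  fun x => ('D_(basis_vec j) (Re \o f) x : R)
           +i* ('D_(basis_vec j) (Im \o f) x : R).

(* Mixed partial derivative along a word in the two axes. *)
Definition cpartials (s : seq bool) (f : plane -> R[i]) : plane -> R[i] :=
  foldr cpartial f s.

Definition schwartz (f : plane -> R[i]) : Prop :=
  forall s : seq bool,
    (forall x, differentiable (Re \o cpartials s f) x /\
               differentiable (Im \o cpartials s f) x) /\
    (forall N : nat, exists M : R, forall x,
        (1 + enorm x) ^+ N * cmod (cpartials s f x) <= M).

Definition fourier (f : plane -> R[i]) : plane -> R[i] :=
  fun xi => cintegral leb2 setT (fun x => expi (- dotp x xi) * f x).

Definition ifourier (f : plane -> R[i]) : plane -> R[i] :=
  fun x => (((2 * pi) ^- 2 : R)%:C) *
           cintegral leb2 setT (fun xi => expi (dotp x xi) * f xi).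

(* Distributions are total functionals, but only their values on Schwartz
   functions are meaningful: see [tempered] and [dist_eq]. *)
Definition dist : Type := (plane -> R[i]) -> R[i].

(* In the continuity clause, [M] bounds the Schwartz seminorms of [f] up to
   order [N]. *)
Definition tempered (T : dist) : Prop :=
  (forall (a : R[i]) f g, schwartz f -> schwartz g ->
     T (fun x => a * f x + g x) = a * T f + T g) /\
  (exists (N : nat) (C : R), forall f (M : R), schwartz f ->
     (forall (s : seq bool) x, (size s <= N)%N ->
        (1 + enorm x) ^+ N * cmod (cpartials s f x) <= M) ->
     cmod (T f) <= C * M).

Definition dist_eq (S T : dist) : Prop := forall f, schwartz f -> S f = T f.

Definition dsub (S T : dist) : dist := fun f => S f - T f.

Definition dopp (T : dist) : dist := fun f => - T f.

Definition dadd (S T : dist) : dist := fun f => S f + T f.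

Definition dpartial (j : bool) (T : dist) : dist := fun f => - T (cpartial j f).

Definition dfourier (T : dist) : dist := fun f => T (fourier f).

Definition difourier (T : dist) : dist := fun f => T (ifourier f).

Definition dist_of (g : plane -> R[i]) : dist :=
  fun f => cintegral leb2 setT (fun x => g x * f x).

(* Testing against all Schwartz functions, with absolutely convergent pairings;
   for a locally integrable [g] with [|xi|^sigma g] integrable this agrees with
   testing against compactly supported functions only. *)
Definition is_function (T : dist) (g : plane -> R[i]) : Prop :=
  locally_cintegrable g /\
  (forall f, schwartz f ->
     cintegrable (fun x => g x * f x) /\ T f = dist_of g f).

(* The locally integrable function (unique up to a null set) giving [T] when
   there is one, and 0 otherwise. *)
Definition function_of (T : dist) : plane -> R[i] :=
  xget (fun=> 0) [set g | is_function T g].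

Definition hat (T : dist) : plane -> R[i] := function_of (dfourier T).

Definition has_hat (T : dist) : Prop := exists g, is_function (dfourier T) g.

Definition Xnorm (sigma : R) (T : dist) : \bar R :=
  (\int[leb2]_(xi in setT) (enorm xi `^ sigma * cmod (hat T xi))%:E)%E.

Definition inX (sigma : R) (T : dist) : Prop :=
  [/\ tempered T, has_hat T & (Xnorm sigma T < +oo)%E].

Definition Xcapnorm (delta : R) (T : dist) : \bar R :=
  Order.max (Xnorm 0 T) (Xnorm (- delta) T).

Definition inXcap (delta : R) (T : dist) : Prop := inX 0 T /\ inX (- delta) T.

Definition vdist : Type := (dist * dist)%type.

Definition vsub (U V : vdist) : vdist := (dsub U.1 V.1, dsub U.2 V.2).

Definition vXnorm (sigma : R) (V : vdist) : \bar R :=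
  (\int[leb2]_(xi in setT)
     (enorm xi `^ sigma *
      Num.sqrt (cmod (hat V.1 xi) ^+ 2 + cmod (hat V.2 xi) ^+ 2))%:E)%E.

Definition vinX (sigma : R) (V : vdist) : Prop :=
  [/\ tempered V.1 /\ tempered V.2, has_hat V.1 /\ has_hat V.2
    & (vXnorm sigma V < +oo)%E].

Definition vXcapnorm (delta : R) (V : vdist) : \bar R :=
  Order.max (vXnorm 0 V) (vXnorm (- delta) V).

Definition vinXcap (delta : R) (V : vdist) : Prop :=
  vinX 0 V /\ vinX (- delta) V.

Definition multiplier (m : plane -> R[i]) (T : dist) : dist :=
  difourier (dist_of (fun xi => m xi * hat T xi)).

(* e^(-t|D|) *)
Definition poisson (t : R) : dist -> dist :=
  multiplier (fun xi => (expR (- (t * enorm xi)))%:C).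

Definition riesz (j : bool) : dist -> dist :=
  multiplier (fun xi => 0 -i* (coord j xi / enorm xi)).

Definition velocity (theta : dist) : vdist :=
  (dopp (riesz true theta), riesz false theta).

Definition gradient (T : dist) : vdist := (dpartial false T, dpartial true T).

Definition divergence (V : vdist) : dist :=
  dadd (dpartial false V.1) (dpartial true V.2).

(* Pointwise product of the functions giving [S] and [T]: a Fourier transform in
   L^1 forces a distribution to be a bounded continuous function. *)
Definition dmul (S T : dist) : dist :=
  dist_of (fun x => function_of S x * function_of T x).

(* u_f . grad g = div (g u_f) *)
Definition transport (f g : dist) : dist :=
  divergence (dmul g (velocity f).1, dmul g (velocity f).2).

(* The time integral is the weak one: an S'-valued integral is computed after
   pairing with each test function. *)
Definition duhamel (theta : R -> dist) (t : R) : dist :=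
  fun f => cintegral (@lebesgue_measure R) `[0, t]
    (fun tau => poisson (t - tau) (transport (theta tau) (theta tau)) f).

Definition mild_solution (theta0 : dist) (theta : R -> dist) : Prop :=
  forall t, 0 <= t ->
    dist_eq (theta t) (dsub (poisson t theta0) (duhamel theta t)).

(* C_b([0, oo), X^0 cap X^(-delta)); values at negative times are irrelevant. *)
Definition in_Cb (delta : R) (theta : R -> dist) : Prop :=
  [/\ forall t, 0 <= t -> inXcap delta (theta t),
      forall t, 0 <= t ->
        Xcapnorm delta (dsub (theta s) (theta t))
          @[s --> within `[0, +oo[ (nbhs t)] --> 0%E
    & exists M : R, forall t, 0 <= t -> (Xcapnorm delta (theta t) <= M%:E)%E].

Definition simple_vfun (delta : R) (s : R -> vdist) : Prop :=
  [/\ finite_set (range s),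
      forall V, measurable (s @^-1` [set V])
    & forall t, vinXcap delta (s t)].

(* L^1([0, oo), X^0 cap X^(-delta)) in the sense of Bochner: strong
   measurability together with integrability of the norm. *)
Definition in_L1 (delta : R) (V : R -> vdist) : Prop :=
  [/\ {ae (@lebesgue_measure R), forall t, 0 <= t -> vinXcap delta (V t)},
      exists s : nat -> R -> vdist,
        (forall n, simple_vfun delta (s n)) /\
        {ae (@lebesgue_measure R), forall t, 0 <= t ->
           vXcapnorm delta (vsub (s n t) (V t)) @[n --> \oo] --> 0%E}
    & (\int[@lebesgue_measure R]_(t in `[0%R, +oo[) vXcapnorm delta (V t)
         < +oo)%E].

End Defs.

(* Main.v *)
(* On the Fourier side a solution is a function w(t, xi) with
     w(t) = e^(-t|xi|) w(0) - int_0^t e^(-(t-tau)|xi|) B(w, w)(tau) dtau,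
   where the symbol of B is bounded by each of |xi| and the transported frequency. Picard increments are
   estimated frequency by frequency: f is dominated by P when |f(t, xi)| <= P(xi) and
   |xi| int |f(t, xi)| dt <= P(xi). As e^(-t|xi|) has time integral 1/|xi|, the bilinear Duhamel term
   of functions dominated by P and Q is dominated by a damped convolution of P and Q, so for small
   data the majorants of the increments are summable in L^1 and in L^1(|xi|^(-delta)). The sum Q of
   the majorants has mass at most 1/2; boundedness, continuity in time and the integrability of the
   gradient are read off Q.
   Decay: up to time t/2 the heat factor yields o(t^(-delta)); after t/2 the term is at most
   sup_[t/2, t] |theta| times a small multiple of int |grad theta|, and the inequality bootstraps.
   Uniqueness: in L^1 of time and frequency the heat kernel absorbs the derivative, which gives
   |psi| <= |psi| / 8 for the difference psi of two solutions of norm at most 1; this bound on the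
   norms propagates by continuity. *)
From HB Require Import structures.
Require Import Defs.
From mathcomp Require Import all_boot all_order all_algebra.
From mathcomp Require Import complex.
From mathcomp Require Import all_classical all_reals all_analysis.
From mathcomp Require Import measurable_realfun.
From mathcomp Require Import ring lra.
Set Implicit Arguments.
Unset Strict Implicit.
Unset Printing Implicit Defensive.
Import Order.TTheory GRing.Theory Num.Theory.
Import numFieldNormedType.Exports.
Local Open Scope classical_set_scope.
Local Open Scope ring_scope.


(** * Complex-valued integration *)

(** The theorem speaks of functionals on Schwartz functions, and [hat] is a choice among densities
    that agree almost everywhere. Two preliminary blocks answer this: Fourier inversion on Schwartz
    functions, so that a distribution is handled through its spectrum ([spec]), and uniqueness of a
    density tested against Schwartz functions only, so that the choice is immaterial. The delicate
    point is the weight |xi|^(-delta): interpolating the symbol between |xi| and the transported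
    frequency produces a factor |xi|^delta that cancels it and leaves the weight on one of the two
    factors. The size condition on the data enters as mass at most 2^(-2); products carry (2
    pi)^(-2) <= 1/16, which gives the ratio 1/2 of the Picard increments. As the majorant does not
    depend on time, the later limits are dominated convergences in frequency. A second solution is
    only a path of distributions, with no joint measurability in time and frequency; a jointly
    measurable version has to be built before the two spectra can be compared. *)

Section ComplexModulus.
Context {R : realType}.
Local Open Scope complex_scope.
Implicit Types (z w : R[i]) (a : R).
Local Notation Re := (@complex.Re R).
Local Notation Im := (@complex.Im R).

Lemma cmodE z : cmod z = Num.sqrt (Re z ^+ 2 + Im z ^+ 2).
Proof. by case: z. Qed.

Lemma cmod_ge0 z : 0 <= cmod z.
Proof. by rewrite cmodE sqrtr_ge0. Qed.

Lemma cmod0 : cmod (0 : R[i]) = 0.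
Proof. exact: Normc.normc0. Qed.

Lemma cmodM z w : cmod (z * w) = cmod z * cmod w.
Proof. exact: Normc.normcM. Qed.

Lemma le_cmodD z w : cmod (z + w) <= cmod z + cmod w.
Proof. exact: le_normcD. Qed.

Lemma cmodN z : cmod (- z) = cmod z.
Proof. exact: normcN. Qed.

Lemma le_cmodB z w : cmod (z - w) <= cmod z + cmod w.
Proof. by rewrite -(cmodN w) le_cmodD. Qed.

Lemma cmodBC z w : cmod (z - w) = cmod (w - z).
Proof. by rewrite -cmodN opprB. Qed.

Lemma cmod_eq0 z : cmod z = 0 -> z = 0.
Proof. exact: Normc.eq0_normc. Qed.

Lemma cmod_real a : cmod a%:C = `|a|.
Proof. by rewrite cmodE /= expr0n addr0 sqrtr_sqr. Qed.

Lemma cmod_imag a : cmod (0 +i* a) = `|a|.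
Proof. by rewrite cmodE /= expr0n add0r sqrtr_sqr. Qed.

Lemma cmod_sqr z : cmod z ^+ 2 = Re z ^+ 2 + Im z ^+ 2.
Proof. by rewrite cmodE sqr_sqrtr // addr_ge0 // sqr_ge0. Qed.

Lemma ler_Re_cmod z : `|Re z| <= cmod z.
Proof. by rewrite cmodE -sqrtr_sqr ler_wsqrtr// lerDl sqr_ge0. Qed.

Lemma ler_Im_cmod z : `|Im z| <= cmod z.
Proof. by rewrite cmodE -sqrtr_sqr ler_wsqrtr// lerDr sqr_ge0. Qed.

Lemma cmod_le z : cmod z <= `|Re z| + `|Im z|.
Proof.
rewrite -[leRHS]ger0_norm ?addr_ge0// -sqrtr_sqr cmodE ler_wsqrtr//.
by rewrite sqrrD !real_normK ?num_real// lerD2r lerDl mulrn_wge0 ?mulr_ge0.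
Qed.

Lemma ReM z w : Re (z * w) = Re z * Re w - Im z * Im w.
Proof. by case: z w => [a b] [c d]. Qed.

Lemma ImM z w : Im (z * w) = Re z * Im w + Im z * Re w.
Proof. by case: z w => [a b] [c d]. Qed.

Lemma ReD z w : Re (z + w) = Re z + Re w.
Proof. by case: z w => [a b] [c d]. Qed.

Lemma ImD z w : Im (z + w) = Im z + Im w.
Proof. by case: z w => [a b] [c d]. Qed.

Lemma ReN z : Re (- z) = - Re z.
Proof. by case: z. Qed.

Lemma ImN z : Im (- z) = - Im z.
Proof. by case: z. Qed.

Definition ReImE := (ReM, ImM, ReD, ImD, ReN, ImN).

Lemma complex_ext z w : Re z = Re w -> Im z = Im w -> z = w.
Proof. by case: z w => [a b] [c d] /= -> ->. Qed.

Lemma expi0 : expi (0 : R) = 1.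
Proof. by rewrite /expi cos0 sin0. Qed.

Lemma expiD a b : expi (a + b) = expi a * expi b :> R[i].
Proof. by rewrite /expi cosD sinD; apply: complex_ext; rewrite /=; ring. Qed.

Lemma cmod_expi a : cmod (expi a) = 1.
Proof. by rewrite cmodE /= cos2Dsin2 sqrtr1. Qed.

(** The order of [a] and [b] is left free, so the intermediate point is located by its distances to
    both ends instead of by an interval; for [a = b] the point [b] itself serves. *)
Lemma MVT_any (f df : R -> R) (a b : R) :
  (forall x : R, is_derive x (1 : R) f (df x)) ->
  exists2 c, (`|c - a| <= `|b - a|) /\ (`|c - b| <= `|b - a|) & f b - f a = df c * (b - a).
Proof.
move=> fdf.
have fc x : {for x, continuous f}.
  by apply: differentiable_continuous; apply/derivable1_diffP; have [] := fdf x.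
have main u v : u < v -> exists2 c, u <= c <= v & f v - f u = df c * (v - u).
  move=> uv; have [|c] := MVT uv (fun x _ => fdf x); first exact: continuous_subspaceT.
  by rewrite in_itv/= => /andP[uc cv] ->; exists c => //; rewrite !ltW.
have [ab|ba|->] := ltgtP a b.
- have [c /andP[h1 h2] e] := main _ _ ab; exists c => //.
  by rewrite (gtr0_norm (_ : 0 < b - a)) ?subr_gt0//; split; rewrite ler_norml; apply/andP; split; lra.
- have [c /andP[h1 h2] e] := main _ _ ba; exists c; last by rewrite -opprB e; ring.
  by rewrite (ltr0_norm (_ : b - a < 0)) ?subr_lt0//; split; rewrite ler_norml; apply/andP; split; lra.
- by exists b; rewrite ?subrr ?mulr0.
Qed.

Lemma ler_sin_abs a : `|sin a| <= `|a|.
Proof.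
have [c _] := @MVT_any sin cos 0 a (fun x => is_derive_sin x).
rewrite sin0 !subr0 => ->; rewrite normrM ler_piMl//.
by rewrite ler_norml cos_geN1 cos_le1.
Qed.

(** Half-angle formula: 1 - cos a = 2 sin^2(a/2), and |sin| is at most the modulus of its
    argument. *)
Lemma ler_1Bcos a : `|cos a - 1| <= a ^+ 2 / 2.
Proof.
have -> : cos a = cos (a / 2 + a / 2) by rewrite -splitr.
rewrite cosD -!expr2 cos2sin2 -opprB normrN.
have -> : 1 - (1 - sin (a / 2) ^+ 2 - sin (a / 2) ^+ 2) = 2 * sin (a / 2) ^+ 2 by ring.
rewrite ger0_norm; last by rewrite mulr_ge0// sqr_ge0.
have : sin (a / 2) ^+ 2 <= (a / 2) ^+ 2.
  rewrite -[leLHS]real_normK ?num_real// -[leRHS]real_normK ?num_real//.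
  by rewrite lerXn2r ?nnegrE// ler_sin_abs.
have -> : a ^+ 2 / 2 = 2 * (a / 2) ^+ 2 by field.
by move=> h; lra.
Qed.

Lemma ler_cosB1 a : `|cos a - 1| <= `|a|.
Proof.
have [c _] := @MVT_any cos (fun x => - sin x) 0 a (fun x => is_derive_cos x).
rewrite cos0 !subr0 => ->; rewrite normrM ler_piMl// normrN.
by rewrite ler_norml sin_geN1 sin_le1.
Qed.

Lemma ler_sinB a : `|sin a - a| <= a ^+ 2.
Proof.
have [c [c1 _]] := @MVT_any (fun x => sin x - x) (fun x => cos x - 1) 0 a
   (fun x => is_deriveB (is_derive_sin x) (is_derive_id x 1)).
rewrite sin0 !subr0 in c1 *; move=> ->; rewrite normrM -(real_normK (num_real a)) expr2.
by rewrite ler_wpM2r// (le_trans (ler_cosB1 _)).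
Qed.

(** The real part contributes a^2/2 and the imaginary part a^2. This second-order remainder turns
    differentiation of Fourier integrals into bounds on second moments. *)
Lemma cmod_expi_taylor a : cmod (expi a - 1 - (0 +i* a)) <= 2 * a ^+ 2.
Proof.
apply: le_trans (cmod_le _) _ => /=; rewrite !subr0.
have := ler_1Bcos a; have := ler_sinB a; have := sqr_ge0 a.
rewrite /expi /=; lra.
Qed.

End ComplexModulus.

Definition cmeas {R : realType} d (T : measurableType d) (f : T -> R[i]) : Prop :=
  measurable_fun setT (@complex.Re R \o f) /\ measurable_fun setT (@complex.Im R \o f).

Definition cintble {R : realType} d (T : measurableType d)
    (mu : {measure set T -> \bar R}) (f : T -> R[i]) : Prop :=
  mu.-integrable setT (EFin \o (@complex.Re R \o f)) /\
  mu.-integrable setT (EFin \o (@complex.Im R \o f)).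

Section ComplexMeasurable.
Context {R : realType} d (T : measurableType d).
Local Open Scope complex_scope.
Implicit Types (f g : T -> R[i]) (u v : T -> R).
Local Notation Re := (@complex.Re R).
Local Notation Im := (@complex.Im R).

Lemma cmeas_cst (a : R[i]) : cmeas (fun _ : T => a).
Proof. by split; exact: measurable_cst. Qed.

Lemma cmeasD f g : cmeas f -> cmeas g -> cmeas (fun x => f x + g x).
Proof.
move=> [f1 f2] [g1 g2]; split.
  by rewrite (_ : _ \o _ = (Re \o f) \+ (Re \o g)); [exact: measurable_funD|apply/funext => x /=; rewrite ReImE].
by rewrite (_ : _ \o _ = (Im \o f) \+ (Im \o g)); [exact: measurable_funD|apply/funext => x /=; rewrite ReImE].
Qed.

Lemma cmeasN f : cmeas f -> cmeas (fun x => - f x).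
Proof.
move=> [f1 f2]; split.
  by rewrite (_ : _ \o _ = \- (Re \o f)); [exact: measurable_funN|apply/funext => x /=; rewrite ReImE].
by rewrite (_ : _ \o _ = \- (Im \o f)); [exact: measurable_funN|apply/funext => x /=; rewrite ReImE].
Qed.

Lemma cmeasB f g : cmeas f -> cmeas g -> cmeas (fun x => f x - g x).
Proof. by move=> mf mg; apply: cmeasD => //; exact: cmeasN. Qed.

Lemma cmeasM f g : cmeas f -> cmeas g -> cmeas (fun x => f x * g x).
Proof.
move=> [f1 f2] [g1 g2]; split.
  rewrite (_ : _ \o _ = ((Re \o f) \* (Re \o g)) \- ((Im \o f) \* (Im \o g))).
    by apply: measurable_funB; exact: measurable_funM.
  by apply/funext => x /=; rewrite ReImE.
rewrite (_ : _ \o _ = ((Re \o f) \* (Im \o g)) \+ ((Im \o f) \* (Re \o g))).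
  by apply: measurable_funD; exact: measurable_funM.
by apply/funext => x /=; rewrite ReImE.
Qed.

Lemma cmeas_pair u v : measurable_fun setT u -> measurable_fun setT v ->
  cmeas (fun x => u x +i* v x).
Proof. by []. Qed.

Lemma cmeas_real u : measurable_fun setT u -> cmeas (fun x => (u x)%:C).
Proof. by move=> mu; split=> //; exact: measurable_cst. Qed.

Lemma cmeas_cmod f : cmeas f -> measurable_fun setT (fun x => cmod (f x)).
Proof.
move=> [f1 f2]; rewrite (_ : (fun x => _) = Num.sqrt \o (fun x => (Re \o f) x ^+ 2 + (Im \o f) x ^+ 2)).
  apply: measurableT_comp; first by apply: continuous_measurable_fun; exact: sqrt_continuous.
  by apply: measurable_funD; exact: measurable_funX.
by apply/funext => x /=; rewrite cmodE.
Qed.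

Lemma cmeas_expi u : measurable_fun setT u -> cmeas (fun x => expi (u x)).
Proof.
move=> mu; apply: cmeas_pair.
  by apply: measurableT_comp => //; apply: continuous_measurable_fun; exact: continuous_cos.
by apply: measurableT_comp => //; apply: continuous_measurable_fun; exact: continuous_sin.
Qed.

Lemma cmeas_comp d' (T' : measurableType d') f (h : T' -> T) :
  measurable_fun setT h -> cmeas f -> cmeas (fun x => f (h x)).
Proof. by move=> mh [f1 f2]; split; [exact: (measurableT_comp f1 mh)|exact: (measurableT_comp f2 mh)]. Qed.

Lemma emeas_cmod f : cmeas f -> measurable_fun setT (fun x => (cmod (f x))%:E).
Proof. by move=> mf; apply/measurable_EFinP; exact: cmeas_cmod. Qed.

End ComplexMeasurable.

Section ComplexIntegral.
Context {R : realType} d (T : measurableType d) (mu : {measure set T -> \bar R}).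
Local Open Scope complex_scope.
Implicit Types (f g : T -> R[i]) (u v : T -> R).
Local Notation Re := (@complex.Re R).
Local Notation Im := (@complex.Im R).

Local Notation CI := (cintegral mu setT).

Lemma cintbleP f : cintble mu f <-> cmeas f /\ (\int[mu]_x (cmod (f x))%:E < +oo)%E.
Proof.
split.
  move=> [/integrableP[m1 i1] /integrableP[m2 i2]].
  have mf : cmeas f by split; apply/measurable_EFinP.
  split => //; apply: (@le_lt_trans _ _ (\int[mu]_x (`|(Re (f x))%:E| + `|(Im (f x))%:E|))%E).
    apply: ge0_le_integral => //.
    - by move=> x _; rewrite lee_fin cmod_ge0.
    - exact: emeas_cmod.
    - by apply: emeasurable_funD; apply: measurableT_comp.
    - by move=> x _; rewrite lee_fin cmod_le.
  rewrite ge0_integralD//; last 2 first.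
    - exact: measurableT_comp.
    - exact: measurableT_comp.
  by rewrite lte_add_pinfty.
move=> [[m1 m2] i]; split; apply/integrableP; split; try exact/measurable_EFinP;
  apply: le_lt_trans i; apply: ge0_le_integral => //.
- by apply: measurableT_comp => //; exact/measurable_EFinP.
- exact: emeas_cmod.
- by move=> x _; rewrite lee_fin ler_Re_cmod.
- by apply: measurableT_comp => //; exact/measurable_EFinP.
- exact: emeas_cmod.
- by move=> x _; rewrite lee_fin ler_Im_cmod.
Qed.

Lemma cintble_meas f : cintble mu f -> cmeas f.
Proof. by move=> /cintbleP[]. Qed.

Lemma cintble_lty f : cintble mu f -> (\int[mu]_x (cmod (f x))%:E < +oo)%E.
Proof. by move=> /cintbleP[]. Qed.

Lemma le_cintble f (u : T -> \bar R) : cmeas f ->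
  measurable_fun setT u -> (\int[mu]_x u x < +oo)%E ->
  (forall x, ((cmod (f x))%:E <= u x)%E) -> cintble mu f.
Proof.
move=> mf mu' iu fu; apply/cintbleP; split => //; apply: le_lt_trans iu.
apply: ge0_le_integral => //; [|exact: emeas_cmod].
by move=> x _; rewrite lee_fin cmod_ge0.
Qed.

Lemma cintbleD f g : cintble mu f -> cintble mu g -> cintble mu (fun x => f x + g x).
Proof.
move=> /[dup] [[f1 f2]] /cintble_meas mf /[dup] [[g1 g2]] /cintble_meas mg; split.
  rewrite (_ : EFin \o _ = (EFin \o (Re \o f)) \+ (EFin \o (Re \o g))).
    exact: integrableD.
  by apply/funext => x /=; rewrite ReImE.
rewrite (_ : EFin \o _ = (EFin \o (Im \o f)) \+ (EFin \o (Im \o g))).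
  exact: integrableD.
by apply/funext => x /=; rewrite ReImE.
Qed.

Lemma cintbleZ (a : R[i]) f : cintble mu f -> cintble mu (fun x => a * f x).
Proof.
move=> /cintbleP[mf i]; apply/cintbleP; split.
  by apply: cmeasM => //; exact: cmeas_cst.
under eq_integral do rewrite cmodM EFinM.
rewrite ge0_integralZl//; [|exact: emeas_cmod|by move=> x _; rewrite lee_fin cmod_ge0|by rewrite lee_fin cmod_ge0].
by rewrite lte_mul_pinfty// lee_fin cmod_ge0.
Qed.

Lemma cintbleN f : cintble mu f -> cintble mu (fun x => - f x).
Proof. by move=> /(cintbleZ (-1)); under eq_fun do rewrite mulN1r. Qed.

Lemma cintbleB f g : cintble mu f -> cintble mu g -> cintble mu (fun x => f x - g x).
Proof. by move=> mf mg; apply: cintbleD => //; exact: cintbleN. Qed.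

Lemma cintble0 : cintble mu (fun _ => 0).
Proof. by split; exact: integrable0. Qed.

Lemma cintble_bM f g (M : R) : cmeas f -> (forall x, cmod (f x) <= M) ->
  cintble mu g -> cintble mu (fun x => f x * g x).
Proof.
move=> mf fM /cintbleP[mg ig]; apply: (@le_cintble _ (fun x => M%:E * (cmod (g x))%:E)%E).
- exact: cmeasM.
- by apply: measurable_funeM; exact: emeas_cmod.
(* On an empty type [M] may be negative, so the finite bound is taken with its absolute value; a
   point of [T], when there is one, shows below that [M] is nonnegative. *)
- have M0 : 0 <= `|M| by [].
  apply: (@le_lt_trans _ _ (`|M|%:E * \int[mu]_x (cmod (g x))%:E)%E).
    rewrite -ge0_integralZl//; [|exact: emeas_cmod|by move=> x _; rewrite lee_fin cmod_ge0].
    have [T0|/set0P[x _]] := eqVneq [set: T] set0.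
      by rewrite T0 !integral_set0.
    apply: ge0_le_integral => //.
    - move=> y _; rewrite mule_ge0// ?lee_fin ?cmod_ge0//.
      exact: le_trans (cmod_ge0 _) (fM x).
    - by apply: measurable_funeM; exact: emeas_cmod.
    - by apply: measurable_funeM; exact: emeas_cmod.
    - by move=> y _; rewrite lee_wpmul2r// ?lee_fin ?cmod_ge0 ?ler_norm.
  by rewrite lte_mul_pinfty.
- by move=> x; rewrite cmodM EFinM lee_wpmul2r// lee_fin ?cmod_ge0.
Qed.

Lemma cintegralD f g : cintble mu f -> cintble mu g ->
  CI (fun x => f x + g x) = CI f + CI g.
Proof.
move=> [f1 f2] [g1 g2]; rewrite /cintegral; apply: complex_ext => /=.
  by rewrite -RintegralD//; apply: eq_Rintegral => x _; rewrite /= ReImE.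
by rewrite -RintegralD//; apply: eq_Rintegral => x _; rewrite /= ReImE.
Qed.

Lemma cintegralZ (a : R[i]) f : cintble mu f -> CI (fun x => a * f x) = a * CI f.
Proof.
move=> [f1 f2]; rewrite /cintegral; apply: complex_ext; rewrite ?ReImE/=.
- rewrite -!RintegralZl// -RintegralB//.
  + by apply: eq_Rintegral => x _; rewrite /= ReImE.
  + exact: (integrableZl measurableT (Re a) f1).
  + exact: (integrableZl measurableT (Im a) f2).
- rewrite -!RintegralZl// -RintegralD//.
  + by apply: eq_Rintegral => x _; rewrite /= ReImE.
  + exact: (integrableZl measurableT (Re a) f2).
  + exact: (integrableZl measurableT (Im a) f1).
Qed.

Lemma cintegralZr (a : R[i]) f : cintble mu f -> CI (fun x => f x * a) = CI f * a.
Proof. by move=> cf; under eq_fun do rewrite mulrC; rewrite cintegralZ// mulrC. Qed.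

Lemma cintegralN f : cintble mu f -> CI (fun x => - f x) = - CI f.
Proof. by move=> mf; under eq_fun do rewrite -mulN1r; rewrite cintegralZ// mulN1r. Qed.

Lemma cintegralB f g : cintble mu f -> cintble mu g ->
  CI (fun x => f x - g x) = CI f - CI g.
Proof. by move=> mf mg; rewrite cintegralD ?cintegralN//; exact: cintbleN. Qed.

Lemma cintegral0 : CI (fun _ => 0) = 0.
Proof.
rewrite /cintegral; apply: complex_ext => /=.
  by rewrite Rintegral_cst// mul0r.
by rewrite Rintegral_cst// mul0r.
Qed.

Lemma cintegral_ae f g : cmeas f -> cmeas g -> ae_eq mu setT f g -> CI f = CI g.
Proof.
move=> [f1 f2] [g1 g2] fg; rewrite /cintegral /Rintegral; congr (fine _ +i* fine _).
  apply: ae_eq_integral => //; try exact/measurable_EFinP.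
  by apply: filterS fg => x fg _ /=; rewrite fg.
apply: ae_eq_integral => //; try exact/measurable_EFinP.
by apply: filterS fg => x fg _ /=; rewrite fg.
Qed.

Lemma integral_cmod_ae f g : cmeas f -> cmeas g -> ae_eq mu setT f g ->
  (\int[mu]_x (cmod (f x))%:E = \int[mu]_x (cmod (g x))%:E)%E.
Proof.
move=> mf mg fg; apply: ae_eq_integral => //; try exact: emeas_cmod.
by apply: filterS fg => x fg _ /=; rewrite fg.
Qed.

(** Rotation argument: with z the integral and a its conjugate, |z|^2 is the real part of the
    integral of a f, hence at most |z| times the integral of |f|; then |z| cancels. *)
Lemma cmod_cintegral_le_int f : cintble mu f ->
  ((cmod (CI f))%:E <= \int[mu]_x (cmod (f x))%:E)%E.
Proof.
move=> cf; have /cintbleP[mf i] := cf.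
have [z zE] : exists z, z = CI f by exists (CI f).
rewrite -zE; have [->|z0] := eqVneq z 0.
  by rewrite cmod0; apply: integral_ge0 => x _; rewrite lee_fin cmod_ge0.
have m0 : 0 < cmod z.
  by rewrite lt_def cmod_ge0 andbT; apply: contra z0 => /eqP/cmod_eq0 ->.
pose a : R[i] := Re z -i* Im z.
have ma : cmod a = cmod z by rewrite !cmodE /= sqrrN.
have az : Re (a * z) = cmod z ^+ 2 by rewrite cmod_sqr ReImE /= !expr2; ring.
have caf := cintbleZ a cf.
have : ((cmod z ^+ 2)%:E <= \int[mu]_x (cmod z * cmod (f x))%:E)%E.
  rewrite -az {1}zE -cintegralZ//= /Rintegral fineK; last first.
    by apply: integrable_fin_num => //; exact: caf.1.
  apply: (le_trans (lee_abs _)); apply: (le_trans (le_abse_integral _ _ _)) => //.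
    by have [/measurable_int] := caf.
  apply: ge0_le_integral => //.
  - by apply: measurableT_comp => //; have [/measurable_int] := caf.
  - by apply/measurable_EFinP; apply: measurable_funM => //; exact: cmeas_cmod.
  - by move=> x _; rewrite lee_fin -ma -cmodM; exact: ler_Re_cmod.
under eq_integral do rewrite EFinM.
rewrite ge0_integralZl//; [|exact: emeas_cmod|by move=> x _; rewrite lee_fin cmod_ge0|exact: ltW].
by rewrite expr2 EFinM lee_pmul2l.
Qed.

(** When the right-hand side is infinite there is nothing to prove, so pointwise estimates can start
    from measurability, before any integrability is known. *)
Lemma cmod_cintegral_le f : cmeas f -> ((cmod (CI f))%:E <= \int[mu]_x (cmod (f x))%:E)%E.
Proof.
move=> mf; have [i|] := ltP (\int[mu]_x (cmod (f x))%:E)%E +oo%E.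
  by apply: cmod_cintegral_le_int; apply/cintbleP.
by rewrite leye_eq => /eqP ->; rewrite leey.
Qed.

End ComplexIntegral.

(** * Changes of variables and Fubini for complex integrals *)

Section Transfer.
Context {R : realType} d1 d2 (X : measurableType d1) (Y : measurableType d2).
Variables (m1 : {measure set X -> \bar R}) (m2 : {measure set Y -> \bar R}).
Variables (phi : X -> Y) (k : R).
Hypotheses (mphi : measurable_fun setT phi) (k0 : 0 <= k).
Hypothesis phiE : forall u : Y -> \bar R, measurable_fun setT u ->
  (forall y, (0 <= u y)%E) -> (\int[m1]_x u (phi x) = k%:E * \int[m2]_y u y)%E.
Local Notation Re := (@complex.Re R).
Local Notation Im := (@complex.Im R).

Lemma transfer_cintble (f : Y -> R[i]) : cintble m2 f -> cintble m1 (f \o phi).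
Proof.
move=> /cintbleP[mf i]; apply/cintbleP; split; first exact: cmeas_comp.
rewrite (phiE (emeas_cmod mf)); last by move=> y; rewrite lee_fin cmod_ge0.
by rewrite lte_mul_pinfty.
Qed.

Let transfer_integral (u : Y -> R) : m2.-integrable setT (EFin \o u) ->
  (\int[m1]_x (u (phi x))%:E = k%:E * \int[m2]_y (u y)%:E)%E.
Proof.
move=> iu; have mu := measurable_int _ iu.
rewrite [LHS]integralE [in RHS]integralE.
have e1 : (\int[m1]_x (fun x => (u (phi x))%:E)^\+ x = k%:E * \int[m2]_y (EFin \o u)^\+ y)%E.
  rewrite -(phiE (measurable_funepos mu) (fun y => funepos_ge0 _ y)).
  by apply: eq_integral => x _; rewrite !funeposE.
have e2 : (\int[m1]_x (fun x => (u (phi x))%:E)^\- x = k%:E * \int[m2]_y (EFin \o u)^\- y)%E.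
  rewrite -(phiE (measurable_funeneg mu) (fun y => funeneg_ge0 _ y)).
  by apply: eq_integral => x _; rewrite !funenegE.
rewrite e1 e2 -muleBr//.
by apply: fin_num_adde_defl; rewrite fin_numN integrable_neg_fin_num.
Qed.

(** The nonnegative formula [phiE] is applied to the positive and negative parts of the real and
    imaginary parts. It serves affine maps of the plane, the reflection of the line and the swap of
    a product. *)
Lemma transfer_cintegral (f : Y -> R[i]) : cintble m2 f ->
  cintegral m1 setT (f \o phi) = k%:C%C * cintegral m2 setT f.
Proof.
move=> [f1 f2]; rewrite /cintegral /Rintegral; apply: complex_ext; rewrite ?ReImE/= mul0r.
  rewrite (transfer_integral f1) fineM//= ?subr0//; exact: integrable_fin_num.
rewrite (transfer_integral f2) fineM//= ?addr0//; exact: integrable_fin_num.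
Qed.

End Transfer.

Section ComplexFubini.
Context {R : realType} d1 d2 (T1 : measurableType d1) (T2 : measurableType d2).
Variable m1 : {sigma_finite_measure set T1 -> \bar R}.
Variable m2 : {sigma_finite_measure set T2 -> \bar R}.
Local Notation Re := (@complex.Re R).
Local Notation Im := (@complex.Im R).
Implicit Types (f : T1 * T2 -> R[i]).

(** Positive and negative parts have measurable integrals by Tonelli, and [fine] is measurable,
    including where the difference is infinite and a default value is returned; no integrability
    enters. *)
Lemma measurable_Rintegral_param (u : T1 * T2 -> R) : measurable_fun setT u ->
  measurable_fun setT (fun x => Rintegral m2 setT (fun y => u (x, y))).
Proof.
move=> mu; rewrite /Rintegral.
apply: (measurableT_comp (f := fine)); first exact: fine_measurable.
have mE : measurable_fun setT (EFin \o u) by exact/measurable_EFinP.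
rewrite (_ : (fun x => _) = (fun x => \int[m2]_y (EFin \o u)^\+ (x, y)) \-
   (fun x => \int[m2]_y (EFin \o u)^\- (x, y)))%E; last first.
  by apply/funext => x; rewrite integralE; congr (_ - _)%E;
    by apply: eq_integral => y _; rewrite !(funeposE, funenegE).
apply: emeasurable_funB.
  by apply: measurable_fun_fubini_tonelli_F => //; exact: measurable_funepos.
by apply: measurable_fun_fubini_tonelli_F => //; exact: measurable_funeneg.
Qed.

Lemma cmeas_param f : cmeas f -> cmeas (fun x => cintegral m2 setT (fun y => f (x, y))).
Proof.
by move=> [f1 f2]; split; [exact: (measurable_Rintegral_param f1)|exact: (measurable_Rintegral_param f2)].
Qed.

Lemma cmeas_pair1 f x : cmeas f -> cmeas (fun y => f (x, y)).
Proof. by move=> mf; apply: (cmeas_comp (h := pair x)). Qed.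

Lemma cmeas_pair2 f y : cmeas f -> cmeas (fun x => f (x, y)).
Proof. by move=> mf; apply: (cmeas_comp (h := pair^~ y)). Qed.

Lemma cintble_prodP f : cintble (m1 \x m2)%E f <->
  cmeas f /\ (\int[m1]_x \int[m2]_y (cmod (f (x, y)))%:E < +oo)%E.
Proof.
split.
  move=> /cintbleP[mf i]; split => //.
  by move: i; rewrite fubini_tonelli1//; [exact: emeas_cmod|move=> x; rewrite lee_fin cmod_ge0].
move=> [mf i]; apply/cintbleP; split => //.
by rewrite fubini_tonelli1//; [exact: emeas_cmod|move=> x; rewrite lee_fin cmod_ge0].
Qed.

Lemma cintble_ae1 f : cintble (m1 \x m2)%E f ->
  {ae m1, forall x, cintble m2 (fun y => f (x, y))}.
Proof.
move=> [f1 f2]; have h1 := ae_integrable1 f1; have h2 := ae_integrable1 f2.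
by apply: filterS2 h1 h2 => x h1 h2; split.
Qed.

(** On the null set of sections that are not integrable [fine] may return a default value, so the
    inner integrals are compared almost everywhere only. *)
Let Rintegral_fubini (u : T1 * T2 -> R) : (m1 \x m2)%E.-integrable setT (EFin \o u) ->
  Rintegral m1 setT (fun x => Rintegral m2 setT (fun y => u (x, y))) =
  Rintegral (m1 \x m2)%E setT u.
Proof.
move=> iu; rewrite {1 3}/Rintegral -(integral12_prod_meas1 iu).
have mu : measurable_fun setT u by have /measurable_EFinP := measurable_int _ iu.
congr fine; apply: ae_eq_integral => //.
- by apply/measurable_EFinP; exact: measurable_Rintegral_param.
- exact: measurable_fubini_F iu.
- apply: filterS (ae_integrable1 iu) => x ix _; rewrite /fubini_F/= /Rintegral fineK//.
  exact: integrable_fin_num.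
Qed.

Lemma cintegral_fubini1 f : cintble (m1 \x m2)%E f ->
  cintegral m1 setT (fun x => cintegral m2 setT (fun y => f (x, y))) =
  cintegral (m1 \x m2)%E setT f.
Proof.
by move=> [f1 f2]; apply: complex_ext; [exact: (Rintegral_fubini f1)|exact: (Rintegral_fubini f2)].
Qed.

Lemma cintble_fubini1 f : cintble (m1 \x m2)%E f ->
  cintble m1 (fun x => cintegral m2 setT (fun y => f (x, y))).
Proof.
move=> /cintble_prodP[mf i].
apply: (@le_cintble _ _ _ _ _ (fun x => \int[m2]_y (cmod (f (x, y)))%:E)%E) => //.
- exact: cmeas_param.
- apply: (measurable_fun_fubini_tonelli_F (fun z => (cmod (f z))%:E)).
    exact: emeas_cmod.
  by move=> z; rewrite lee_fin cmod_ge0.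
- by move=> x; apply: cmod_cintegral_le; exact: cmeas_pair1.
Qed.

End ComplexFubini.

Section ComplexFubiniSwap.
Context {R : realType} d1 d2 (T1 : measurableType d1) (T2 : measurableType d2).
Variable m1 : {sigma_finite_measure set T1 -> \bar R}.
Variable m2 : {sigma_finite_measure set T2 -> \bar R}.
Implicit Types (f : T1 * T2 -> R[i]).

Lemma integral_swap (u : T1 * T2 -> \bar R) : measurable_fun setT u ->
  (forall y, (0 <= u y)%E) ->
  (\int[m2 \x m1]_p u (unstable.swap p) = \int[m1 \x m2]_p u p)%E.
Proof.
move=> mu u0; rewrite (fubini_tonelli2 (fun p => u (unstable.swap p)))//.
  by rewrite (fubini_tonelli1 u).
exact: (measurableT_comp mu (@measurable_swap _ _ T2 T1)).
Qed.

(** The swap of coordinates preserves nonnegative integrals, with factor 1, so this order of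
    integration is the other one transported by [transfer_cintegral]. *)
Lemma cintegral_fubini2 f : cintble (m1 \x m2)%E f ->
  cintegral m2 setT (fun y => cintegral m1 setT (fun x => f (x, y))) =
  cintegral (m1 \x m2)%E setT f.
Proof.
move=> cf; have h u mu u0 : _ = (1%:E * _)%E :=
  etrans (@integral_swap u mu u0) (esym (mul1e _)).
have := transfer_cintegral h cf; rewrite mul1r => <-.
by rewrite -cintegral_fubini1//; exact: (transfer_cintble (@measurable_swap _ _ T2 T1) ler01 h cf).
Qed.

Lemma cintble_fubini2 f : cintble (m1 \x m2)%E f ->
  cintble m2 (fun y => cintegral m1 setT (fun x => f (x, y))).
Proof.
move=> cf; have h u mu u0 : _ = (1%:E * _)%E :=
  etrans (@integral_swap u mu u0) (esym (mul1e _)).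
exact: (cintble_fubini1 (transfer_cintble (@measurable_swap _ _ T2 T1) ler01 h cf)).
Qed.

Lemma cintegral_exchange f : cintble (m1 \x m2)%E f ->
  cintegral m1 setT (fun x => cintegral m2 setT (fun y => f (x, y))) =
  cintegral m2 setT (fun y => cintegral m1 setT (fun x => f (x, y))).
Proof. by move=> cf; rewrite cintegral_fubini1// cintegral_fubini2. Qed.

End ComplexFubiniSwap.

(* The library attaches no sigma-finite structure to the product of two
   sigma-finite measures: its key is taken by the subprobability instance. *)
Section SigmaFiniteProduct.
Context {R : realType} d1 d2 (T1 : measurableType d1) (T2 : measurableType d2).
Variable m1 : {sigma_finite_measure set T1 -> \bar R}.
Variable m2 : {sigma_finite_measure set T2 -> \bar R}.

Lemma sigma_finite_prod : sigma_finite setT (m1 \x m2)%E.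
Proof.
have /sigma_finiteP[F [TF ndF Foo]] := sigma_finiteT m1.
have /sigma_finiteP[G [TG ndG Goo]] := sigma_finiteT m2.
exists (fun n => F n `*` G n) => [|k]; last first.
  have [mF F_fin] := Foo k; have [mG G_fin] := Goo k.
  by split; [exact: measurableX|rewrite product_measure1E// lte_mul_pinfty// ge0_fin_numE].
apply/esym; rewrite -subTset => -[x y] _.
have : [set: T1] x by []. 
rewrite TF => -[i _ Fx]; have : [set: T2] y by [].
rewrite TG => -[j _ Gy]; exists (maxn i j) => //; split.
  by apply: subsetPset Fx; apply: ndF; exact: leq_maxl.
by apply: subsetPset Gy; apply: ndG; exact: leq_maxr.
Qed.


Definition prodsf : {sigma_finite_measure set (T1 * T2)%type -> \bar R} :=
  HB.pack (m1 \x m2)%E (Measure_isSigmaFinite.Build _ _ _ (m1 \x m2)%E sigma_finite_prod).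

End SigmaFiniteProduct.

(** * Lebesgue measure of the plane: affine maps and open sets *)

Section PlaneMeasure.
Context {R : realType}.
Local Notation mR := (measurableTypeR R).
Local Notation mP := (measurableTypeR R * measurableTypeR R)%type.

Definition lebP : {sigma_finite_measure set mP%type -> \bar R} :=
  prodsf (@lebesgue_measure R) (@lebesgue_measure R).

Lemma measurable_affine (x a : R) : measurable_fun setT (fun y : mR => x + a * y : mR).
Proof. by apply: measurable_funD => //; apply: measurable_funM. Qed.

(** By uniqueness of Lebesgue measure it is enough to test |a| times the image measure on half-open
    intervals; the integral formula is then that of a push-forward. *)
Lemma affine_measure (x a : R) : a != 0 ->
  exists2 nu : {measure set mR -> \bar R},
    (forall A, measurable A -> lebesgue_measure A = nu A) &
    forall u : mR -> \bar R, measurable_fun setT u -> (forall y, (0 <= u y)%E) ->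
      (\int[nu]_y u y = `|a|%:E * \int[lebesgue_measure]_y u (x + a * y)%R)%E.
Proof.
move=> a0; have mphi := @measurable_affine x a.
pose push : {measure set mR -> \bar R} :=
  measure_function_pushforward__canonical__measure_function_Measure lebesgue_measure mphi.
pose nu : {measure set mR -> \bar R} := mscale (NngNum (normr_ge0 a)) push.
exists nu => [A mA|u mu u0]; last first.
  by rewrite ge0_integral_mscale//= (ge0_integral_pushforward mphi).
apply: (@lebesgue_measure_unique _ nu) => // _ [[u v]] _ <-.
change (lebesgue_measure `]u, v]%classic = `|a|%:E *
  lebesgue_measure ((fun y : mR => (x + a * y)%R) @^-1` `]u, v]%classic))%E.
have [a1|a1] := ltP 0 a.
  have -> : (fun y => x + a * y) @^-1` `]u, v]%classic = `](u - x) / a, (v - x) / a]%classic.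
    apply/seteqP; split => y /=; rewrite !in_itv/= ltr_pdivrMr// ler_pdivlMr//;
    by move=> /andP[h1 h2]; apply/andP; split; lra.
  rewrite !lebesgue_measure_itv/= !lte_fin gtr0_norm// ltr_pM2r ?invr_gt0// ltrD2r.
  case: ifPn => _; last by rewrite mule0.
  by rewrite -EFinM; congr EFin; field.
have a2 : a < 0 by rewrite lt_def eq_sym a0.
(* A negative slope exchanges the ends: the preimage is closed on the left and open on the right,
   with the same length. *)
have -> : (fun y => x + a * y) @^-1` `]u, v]%classic = `[(v - x) / a, (u - x) / a[%classic.
  apply/seteqP; split => y /=; rewrite !in_itv/= ler_ndivrMr// ltr_ndivlMr//;
  by move=> /andP[h1 h2]; apply/andP; split; lra.
rewrite !lebesgue_measure_itv/= !lte_fin ltr0_norm// ltr_nM2r ?invr_lt0// ltrD2r.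
case: ifPn => _; last by rewrite mule0.
by rewrite -EFinM; congr EFin; field.
Qed.

Lemma integral_affine1 (x a : R) (u : mR -> \bar R) : a != 0 -> measurable_fun setT u ->
  (forall y, (0 <= u y)%E) ->
  (\int[lebesgue_measure]_y u (x + a * y)%R = `|a|^-1%:E * \int[lebesgue_measure]_y u y)%E.
Proof.
move=> a0 mu u0; have [nu nuE nu_int] := affine_measure x a0.
have -> : (\int[lebesgue_measure]_y u y = \int[nu]_y u y)%E.
  by apply: eq_measure_integral => A mA _; exact: nuE.
by rewrite nu_int// muleA -EFinM mulVf ?normr_eq0// mul1e.
Qed.

Definition aff (x : plane) (a : R) : mP -> mP := fun y => (x.1 + a * y.1, x.2 + a * y.2).

Lemma measurable_aff x a : measurable_fun setT (aff x a).
Proof.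
by apply: measurable_fun_pair; [apply: (measurableT_comp (@measurable_affine x.1 a))|
  apply: (measurableT_comp (@measurable_affine x.2 a))].
Qed.

Lemma integral_aff x a (u : mP -> \bar R) : a != 0 -> measurable_fun setT u ->
  (forall y, (0 <= u y)%E) ->
  (\int[leb2]_y u (aff x a y) = (a ^- 2)%:E * \int[leb2]_y u y)%E.
Proof.
move=> a0 mu u0; rewrite /leb2.
rewrite (fubini_tonelli1 (fun y => u (aff x a y)))//; last first.
  exact: (measurableT_comp mu (measurable_aff x a)).
rewrite (fubini_tonelli1 u)//.
pose G (z : mR) := (\int[lebesgue_measure]_w u (z, w))%E.
have mG : measurable_fun setT G by exact: (measurable_fun_fubini_tonelli_F u).
have G0 z : (0 <= G z)%E by exact: integral_ge0.
transitivity (\int[@lebesgue_measure R]_y (`|a|^-1%:E * G (x.1 + a * y)%R))%E.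
  apply: eq_integral => y _; rewrite /fubini_F /= /aff/=.
  rewrite (@integral_affine1 x.2 a (fun w => u (x.1 + a * y, w)))//.
  exact: (measurableT_comp mu (pair1_measurable _)).
rewrite ge0_integralZl//; last first.
  exact: (measurableT_comp mG (@measurable_affine _ _)).
by rewrite (@integral_affine1 x.1 a G)// muleA -EFinM -invfM -expr2 real_normK ?num_real.
Qed.

Lemma cintble_aff x a (f : mP -> R[i]) : a != 0 -> cintble leb2 f ->
  cintble leb2 (f \o aff x a).
Proof.
move=> a0; apply: (transfer_cintble (measurable_aff x a) (k := a ^- 2)).
  by rewrite invr_ge0 sqr_ge0.
by move=> u mu u0; exact: integral_aff.
Qed.

Lemma cintegral_aff x a (f : mP -> R[i]) : a != 0 -> cintble leb2 f ->
  cintegral leb2 setT (f \o aff x a) = (a ^- 2)%:C%C * cintegral leb2 setT f.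
Proof.
move=> a0; apply: (transfer_cintegral (phi := aff x a) (k := a ^- 2)).
by move=> u mu u0; exact: integral_aff.
Qed.

(** Countably many squares with rational centres and radii 1/(n+1) form a base. This connects the
    topology of the plane with the product sigma-algebra. *)
Lemma open_measurable_plane (U : set plane) : open U -> measurable (U : set mP).
Proof.
move=> oU.
pose B (q : rat * rat * nat) : set mP :=
  ball (ratr q.1.1 : R) q.2.+1%:R^-1 `*` ball (ratr q.1.2 : R) q.2.+1%:R^-1.
have -> : U = \bigcup_(q in [set q | B q `<=` U]) B q.
  apply/seteqP; split => [x Ux|x [q qU Bq]]; last exact: qU.
  have /nbhs_ballP[e /= e0 eU] : nbhs x U by exact: open_nbhs_nbhs.
  (* Twice the radius has to fit into [e], since the triangle inequality passes through the rational
     centre. *)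
  have [n ne] : exists n : nat, 2 * n.+1%:R^-1 < e.
    have [n _ /(_ _ (leqnn n))] := near_infty_natSinv_lt (PosNum (divr_gt0 e0 (@ltr0n R 2))).
    by rewrite /= => h; exists n; move: h; rewrite ltr_pdivlMr// mulrC.
  have : (0:R) < n.+1%:R^-1 by rewrite invr_gt0.
  rewrite /B /= => r0.
  have rq (a : R) : exists q : rat, ball (ratr q : R) n.+1%:R^-1 a.
    have : a - n.+1%:R^-1 < a + n.+1%:R^-1 by rewrite ltrD2l gtrN.
    move=> /rat_in_itvoo[q]; rewrite in_itv/= => /andP[h1 h2]; exists q.
    rewrite -ball_normE /ball_ /= ltr_norml.
    by rewrite ltrBrDr addrC h1/= ltrBlDr addrC h2.
  have [q1 h1] := rq x.1; have [q2 h2] := rq x.2.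
  exists (q1, q2, n); last by split.
  move=> y [y1 y2]; apply: eU; split.
    by apply: (le_ball (ltW ne)); rewrite mulr_natl mulr2n; apply: ball_triangle y1; apply: ball_sym.
  by apply: (le_ball (ltW ne)); rewrite mulr_natl mulr2n; apply: ball_triangle y2; apply: ball_sym.
rewrite bigcup_mkcond; apply: countable_bigcupT_measurable => // q.
by case: ifPn => // _; apply: measurableX; exact: measurable_ball.
Qed.

End PlaneMeasure.

(** * Schwartz functions *)

Section PlaneCalculus.
Context {R : realType}.
Local Notation plane := (@Defs.plane R).
Local Notation coord := (@Defs.coord R).
Local Notation mP := (measurableTypeR R * measurableTypeR R)%type.
Implicit Types (f g : plane -> R) (x h : plane).

Lemma continuous_measurable_plane f : continuous f ->
  measurable_fun (setT : set mP) (f : mP -> measurableTypeR R).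
Proof.
move=> /continuousP cf; apply: (measurability _ (RGenOpens.measurableE R)).
move=> _ [_ [a [b ->] <-]]; rewrite setTI; apply: open_measurable_plane.
by apply: cf; exact: interval_open.
Qed.

(** A quadratic remainder is a little-o of |h|, and the linear part is continuous, so it is the
    differential. The criterion is made for Fourier integrals, whose remainder is controlled by a
    second moment. *)
Lemma plane_taylor_diff f x (a : bool -> R) C :
  (forall h, `|f (h + x) - f x - (a false * h.1 + a true * h.2)| <= C * `|h| ^+ 2) ->
  differentiable f x /\ forall j, 'D_(basis_vec j) f x = a j.
Proof.
move=> fC.
have lin : linear (fun h : R * R => a false * h.1 + a true * h.2 : R).
  by move=> k u v /=; rewrite /GRing.scale/=; ring.
pose M := GRing.isLinear.Build _ _ _ _ _ lin.
pose df : {linear (R * R)%type -> R} := HB.pack (fun h : R * R => a false * h.1 + a true * h.2 : R) M.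
have cdf : continuous df.
  move=> z; apply: cvgD; apply: cvgM; try exact: cvg_cst; [exact: cvg_fst|exact: cvg_snd].
have o : f \o shift x = cst (f x) + df +o_ (0 : R * R) id.
  apply/eqaddoP => e e0; have C1 : 0 < `|C| + 1 by rewrite ltr_wpDl.
  have N : \forall h \near (0 : (R * R)%type), `|h| < e / (`|C| + 1).
    by apply: nbhs0_lt; exact: divr_gt0.
  apply: filterS N => h; rewrite ltr_pdivlMr// => hlt.
  have -> : (f \o shift x - (cst (f x) + df)) h = f (h + x) - f x - (a false * h.1 + a true * h.2).
    by rewrite /= opprD addrA.
  apply: le_trans (fC h) _; rewrite expr2 mulrA ler_wpM2r//.
  apply: le_trans (ltW hlt); rewrite mulrC ler_wpM2l//.
  by rewrite (le_trans (ler_norm _))// lerDl.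
have dE := diff_unique cdf o.
have dfx : differentiable f x by apply/diff_locallyP; rewrite dE.
split=> // j; rewrite deriveE// dE /df/= /basis_vec.
by case: j => /=; rewrite ?mulr0 ?mulr1 ?addr0 ?add0r.
Qed.

Lemma differentiable_coord j x : differentiable (coord j : plane -> R) x.
Proof.
have [] // := @plane_taylor_diff (coord j) x (fun k => (j == k)%:R) 0.
move=> h; rewrite mul0r; case: j => /=; rewrite ?mul0r ?mul1r ?add0r ?addr0;
by rewrite addrK subrr normr0.
Qed.

Lemma derive_coord j k x : 'D_(basis_vec k) (coord j : plane -> R) x = (j == k)%:R.
Proof.
have [] // := @plane_taylor_diff (coord j) x (fun k => (j == k)%:R) 0.
move=> h; rewrite mul0r; case: j => /=; rewrite ?mul0r ?mul1r ?add0r ?addr0;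
by rewrite addrK subrr normr0.
Qed.

Lemma is_derive_line f x (v : R * R) (s : R) : (forall y, differentiable f y) ->
  is_derive s (1 : R) (fun s : R => f (x + s *: v)) ('D_v f (x + s *: v)).
Proof.
move=> df.
have E : (fun s : R => f (x + s *: v)) = f \o (fun s : R => x + s *: v) by [].
have dl : is_diff s (fun s : R => x + s *: v) (fun h : R => h *: v).
  have : is_diff s (cst x + *:%R ^~ v) (0 + *:%R ^~ v) by apply: is_diffD.
  by rewrite add0r.
have dc : is_diff s (f \o (fun s : R => x + s *: v)) ('d f (x + s *: v) \o (fun h : R => h *: v)).
  by apply: is_diff_comp => //; apply: differentiableP.
case: dc => dd dv; apply: DeriveDef; first exact: diff_derivable.
rewrite deriveE; last exact: dd.
by rewrite [X in X 1]dv /= scale1r -deriveE.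
Qed.

End PlaneCalculus.

Section DeriveProducts.
Context {R : realType} {V : normedModType R}.
Implicit Types (f g : V -> R) (x v : V).

Lemma derive_MB f1 g1 f2 g2 x v : derivable f1 x v -> derivable g1 x v ->
  derivable f2 x v -> derivable g2 x v ->
  'D_v (f1 * g1 - f2 * g2) x = (f1 x * 'D_v g1 x + g1 x * 'D_v f1 x) -
    (f2 x * 'D_v g2 x + g2 x * 'D_v f2 x).
Proof.
move=> a1 b1 a2 b2.
by case: (is_deriveB (is_deriveM (derivableP a1) (derivableP b1))
  (is_deriveM (derivableP a2) (derivableP b2))).
Qed.

Lemma derive_MD f1 g1 f2 g2 x v : derivable f1 x v -> derivable g1 x v ->
  derivable f2 x v -> derivable g2 x v ->
  'D_v (f1 * g1 + f2 * g2) x = (f1 x * 'D_v g1 x + g1 x * 'D_v f1 x) +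
    (f2 x * 'D_v g2 x + g2 x * 'D_v f2 x).
Proof.
move=> a1 b1 a2 b2.
by case: (is_deriveD (is_deriveM (derivableP a1) (derivableP b1))
  (is_deriveM (derivableP a2) (derivableP b2))).
Qed.

End DeriveProducts.

Section ComplexPlaneFunctions.
Context {R : realType}.
Local Notation plane := (@Defs.plane R).
Local Notation coord := (@Defs.coord R).
Local Notation Re := (@complex.Re R).
Local Notation Im := (@complex.Im R).
Local Notation mP := (measurableTypeR R * measurableTypeR R)%type.
Implicit Types (f g : plane -> R[i]) (x : plane).

Definition cdiff f := forall x, differentiable (Re \o f) x /\ differentiable (Im \o f) x.

Definition rapid f := forall N : nat, exists M : R, forall x, (1 + enorm x) ^+ N * cmod (f x) <= M.

Lemma cdiff_cmeas f : cdiff f -> cmeas (f : mP -> R[i]).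
Proof.
by move=> df; split; apply: continuous_measurable_plane => x;
  apply: differentiable_continuous; have [] := df x.
Qed.

Lemma ReM_fun f g : Re \o (fun x => f x * g x) = (Re \o f) * (Re \o g) - (Im \o f) * (Im \o g).
Proof. by apply/funext => x /=; rewrite ReImE. Qed.

Lemma ImM_fun f g : Im \o (fun x => f x * g x) = (Re \o f) * (Im \o g) + (Im \o f) * (Re \o g).
Proof. by apply/funext => x /=; rewrite ReImE. Qed.

Lemma ReD_fun f g : Re \o (fun x => f x + g x) = (Re \o f) + (Re \o g).
Proof. by apply/funext => x /=; rewrite ReImE. Qed.

Lemma ImD_fun f g : Im \o (fun x => f x + g x) = (Im \o f) + (Im \o g).
Proof. by apply/funext => x /=; rewrite ReImE. Qed.

Lemma cdiffD f g : cdiff f -> cdiff g -> cdiff (fun x => f x + g x).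
Proof.
move=> df dg x; have [f1 f2] := df x; have [g1 g2] := dg x.
by rewrite ReD_fun ImD_fun; split; exact: differentiableD.
Qed.

Lemma cdiffM f g : cdiff f -> cdiff g -> cdiff (fun x => f x * g x).
Proof.
move=> df dg x; have [f1 f2] := df x; have [g1 g2] := dg x.
rewrite ReM_fun ImM_fun; split; [apply: differentiableB|apply: differentiableD];
  exact: differentiableM.
Qed.

Lemma cdiff_real (u : plane -> R) : (forall x, differentiable u x) -> cdiff (fun x => (u x)%:C%C).
Proof. by move=> du x; split; [exact: du|exact: differentiable_cst]. Qed.

Lemma cdiff_cst (a : R[i]) : cdiff (fun _ => a).
Proof. by move=> x; split; exact: differentiable_cst. Qed.

Lemma cpartialD j f g : cdiff f -> cdiff g ->
  cpartial j (fun x => f x + g x) = (fun x => cpartial j f x + cpartial j g x).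
Proof.
move=> df dg; apply/funext => x; have [f1 f2] := df x; have [g1 g2] := dg x.
rewrite /cpartial ReD_fun ImD_fun; apply: complex_ext; rewrite ?ReImE /=;
by rewrite deriveD//; exact: diff_derivable.
Qed.

Lemma cpartialM j f g : cdiff f -> cdiff g ->
  cpartial j (fun x => f x * g x) = (fun x => cpartial j f x * g x + f x * cpartial j g x).
Proof.
move=> df dg; apply/funext => x; have [f1 f2] := df x; have [g1 g2] := dg x.
have D := diff_derivable (v := basis_vec j); move: (D _ _ _ _ f1) (D _ _ _ _ f2) (D _ _ _ _ g1) (D _ _ _ _ g2) => {D} f1' f2' g1' g2'.
rewrite /cpartial ReM_fun ImM_fun; apply: complex_ext; rewrite ?ReImE /=.
  by rewrite (derive_MB f1' g1' f2' g2') /=; ring.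
by rewrite (derive_MD f1' g2' f2' g1') /=; ring.
Qed.

Lemma cpartial_real j (u : plane -> R) :
  cpartial j (fun x => (u x)%:C%C) = (fun x => ('D_(basis_vec j) u x)%:C%C).
Proof.
apply/funext => x; rewrite /cpartial; apply: complex_ext => //=.
exact: derive_cst.
Qed.

Lemma cpartial_cst j (a : R[i]) : cpartial j (fun _ : plane => a) = (fun _ => 0).
Proof. by apply/funext => x; rewrite /cpartial; apply: complex_ext => /=; exact: derive_cst. Qed.

Lemma cpartialZ j (a : R[i]) f : cdiff f ->
  cpartial j (fun x => a * f x) = (fun x => a * cpartial j f x).
Proof.
move=> df; rewrite cpartialM//; last exact: cdiff_cst.
by rewrite cpartial_cst; apply/funext => x; rewrite mul0r add0r.
Qed.

Lemma enorm_ge0 x : 0 <= enorm x.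
Proof. exact: sqrtr_ge0. Qed.

Lemma enorm_sqr x : enorm x ^+ 2 = x.1 ^+ 2 + x.2 ^+ 2.
Proof. by rewrite sqr_sqrtr// addr_ge0// sqr_ge0. Qed.

Lemma ler_coord_enorm j x : `|coord j x| <= enorm x.
Proof.
rewrite -sqrtr_sqr ler_wsqrtr//; case: j => /=; rewrite ?lerDl ?lerDr; exact: sqr_ge0.
Qed.

Lemma ler_enorm_coord x : enorm x <= `|x.1| + `|x.2|.
Proof.
rewrite -[leRHS]ger0_norm ?addr_ge0// -sqrtr_sqr ler_wsqrtr//.
by rewrite sqrrD !real_normK ?num_real// lerD2r lerDl mulrn_wge0 ?mulr_ge0.
Qed.

Lemma ler_dotp x y : `|dotp x y| <= enorm x * enorm y.
Proof.
rewrite /enorm -sqrtrM; last by rewrite addr_ge0// sqr_ge0.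
rewrite -sqrtr_sqr ler_wsqrtr// /dotp -subr_ge0.
(* Lagrange's identity: the defect in the Cauchy-Schwarz inequality is the square of the cross
   product. *)
have -> : (x.1 ^+ 2 + x.2 ^+ 2) * (y.1 ^+ 2 + y.2 ^+ 2) - (x.1 * y.1 + x.2 * y.2) ^+ 2
  = (x.1 * y.2 - x.2 * y.1) ^+ 2 by ring.
exact: sqr_ge0.
Qed.

Lemma enormD x y : enorm (x + y) <= enorm x + enorm y.
Proof.
rewrite -[leRHS]ger0_norm ?addr_ge0 ?enorm_ge0// -sqrtr_sqr ler_wsqrtr//.
rewrite [leRHS]sqrrD !enorm_sqr/=.
have := le_trans (ler_norm _) (ler_dotp x y); rewrite /dotp mulr2n => h.
by rewrite !sqrrD !mulr2n; lra.
Qed.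

Lemma enormN x : enorm (- x) = enorm x.
Proof. by rewrite /enorm /= !sqrrN. Qed.

Lemma enormZ (a : R) x : enorm (a *: x) = `|a| * enorm x.
Proof.
by rewrite /enorm /= /GRing.scale/= !exprMn -mulrDr sqrtrM ?sqr_ge0// sqrtr_sqr.
Qed.

Lemma enorm0 : enorm (0 : plane) = 0 :> R.
Proof. by rewrite /enorm /= expr0n addr0 sqrtr0. Qed.

Lemma enorm_eq0 x : (enorm x == 0) = (x == 0).
Proof.
apply/eqP/eqP => [h|->]; last exact: enorm0.
have := enorm_sqr x; rewrite h expr0n/= => /esym/eqP.
rewrite paddr_eq0 ?sqr_ge0// !sqrf_eq0 => /andP[/eqP a /eqP b].
by case: x a b {h} => /= ? ? -> ->.
Qed.

Lemma enorm_basis j : enorm (basis_vec j : plane) = 1.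
Proof. by case: j; rewrite /enorm /= ?expr0n ?expr1n ?addr0 ?add0r sqrtr1. Qed.

Lemma rapidD f g : rapid f -> rapid g -> rapid (fun x => f x + g x).
Proof.
move=> rf rg N; have [M1 h1] := rf N; have [M2 h2] := rg N; exists (M1 + M2) => x.
apply: le_trans (lerD (h1 x) (h2 x)); rewrite -mulrDr ler_wpM2l ?le_cmodD//.
by rewrite exprn_ge0// addr_ge0 ?enorm_ge0.
Qed.

Lemma rapid_growth (u : plane -> R[i]) f (C : R) (k : nat) :
  (forall x, cmod (u x) <= C * (1 + enorm x) ^+ k) -> rapid f -> rapid (fun x => u x * f x).
Proof.
move=> uC rf N; have [M h] := rf (N + k)%N; exists (`|C| * M) => x.
have e0 : 0 <= 1 + enorm x by rewrite addr_ge0 ?enorm_ge0.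
rewrite cmodM; apply: le_trans (ler_wpM2l (normr_ge0 C) (h x)).
rewrite exprD !mulrA [leRHS](_ : _ = (1 + enorm x) ^+ N * (`|C| * (1 + enorm x) ^+ k) * cmod (f x)); last by ring.
rewrite ler_wpM2r ?cmod_ge0// ler_wpM2l ?exprn_ge0//.
by apply: le_trans (uC x) _; rewrite ler_wpM2r ?exprn_ge0// ler_norm.
Qed.

Lemma rapidZ (a : R[i]) f : rapid f -> rapid (fun x => a * f x).
Proof.
move=> rf; apply: (@rapid_growth (fun _ => a) f (cmod a) 0) => // x.
by rewrite expr0 mulr1.
Qed.

Lemma rapid_coord j f : rapid f -> rapid (fun x => (coord j x)%:C%C * f x).
Proof.
move=> rf; apply: (@rapid_growth _ f 1 1) => // x.
by rewrite cmod_real mul1r expr1 (le_trans (ler_coord_enorm _ _))// lerDr.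
Qed.

(* Every Schwartz function below is produced by exhibiting a class of smooth
   rapidly decreasing functions that is stable under partial derivatives. *)
Lemma schwartz_class (P : (plane -> R[i]) -> Prop) :
  (forall f, P f -> cdiff f /\ rapid f) ->
  (forall j f, P f -> P (cpartial j f)) -> forall f, P f -> schwartz f.
Proof.
move=> P1 P2 f Pf s; have Ps : P (cpartials s f) by elim: s => //= j s; exact: P2.
by have [d r] := P1 _ Ps; split; [exact: d|exact: r].
Qed.

Lemma schwartz_cdiff f : schwartz f -> cdiff f.
Proof. by move=> /(_ [::])[]. Qed.

Lemma schwartz_rapid f : schwartz f -> rapid f.
Proof. by move=> /(_ [::])[]. Qed.

Lemma schwartz_cpartial j f : schwartz f -> schwartz (cpartial j f).
Proof. by move=> sf s; have := sf (rcons s j); rewrite /cpartials foldr_rcons. Qed.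

Lemma schwartz_cmeas f : schwartz f -> cmeas (f : mP -> R[i]).
Proof. by move=> /schwartz_cdiff/cdiff_cmeas. Qed.

Lemma schwartzDZ (a : R[i]) f g : schwartz f -> schwartz g ->
  schwartz (fun x => a * f x + g x).
Proof.
move=> sf sg.
apply: (@schwartz_class [set h | exists u v, [/\ schwartz u, schwartz v & h = (fun x => a * u x + v x)]]).
- move=> _ [u [v [su sv ->]]]; split.
    apply: cdiffD; last exact: schwartz_cdiff.
    by apply: cdiffM; [exact: cdiff_cst|exact: schwartz_cdiff].
  by apply: rapidD; [apply: rapidZ|]; exact: schwartz_rapid.
- move=> j _ [u [v [su sv ->]]]; exists (cpartial j u), (cpartial j v).
  split; try exact: schwartz_cpartial.
  rewrite cpartialD; [|by apply: cdiffM; [exact: cdiff_cst|exact: schwartz_cdiff]|exact: schwartz_cdiff].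
  by rewrite cpartialZ//; exact: schwartz_cdiff.
- by exists f, g.
Qed.

Lemma schwartz0 : schwartz (fun _ : plane => 0 : R[i]).
Proof.
apply: (@schwartz_class [set h | h = (fun _ => 0)]) => //.
- move=> _ ->; split; first exact: cdiff_cst.
  by move=> N; exists 0 => x; rewrite cmod0 mulr0.
- by move=> j _ ->; exact: cpartial_cst.
Qed.

Lemma schwartzZ (a : R[i]) f : schwartz f -> schwartz (fun x => a * f x).
Proof.
move=> sf; have := schwartzDZ a sf schwartz0.
by under eq_fun do rewrite addr0.
Qed.

(** The class of all x_j u + v with u and v Schwartz is stable under partial derivatives: the
    Leibniz term, which is u or 0, is absorbed into v. *)
Lemma schwartz_coord j f : schwartz f -> schwartz (fun x => (coord j x)%:C%C * f x).
Proof.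
have dc : cdiff (fun x => (coord j x)%:C%C).
  by apply: cdiff_real => x; exact: differentiable_coord.
move=> sf.
apply: (@schwartz_class [set h | exists u v, [/\ schwartz u, schwartz v &
  h = (fun x => (coord j x)%:C%C * u x + v x)]]).
- move=> _ [u [v [su sv ->]]]; split.
    apply: cdiffD; last exact: schwartz_cdiff.
    by apply: cdiffM => //; exact: schwartz_cdiff.
  by apply: rapidD; [apply: rapid_coord|]; exact: schwartz_rapid.
- move=> k _ [u [v [su sv ->]]].
  exists (cpartial k u), (fun x => (j == k)%:R * u x + cpartial k v x).
  split; [exact: schwartz_cpartial|by apply: schwartzDZ => //; exact: schwartz_cpartial|].
  rewrite cpartialD; [|by apply: cdiffM => //; exact: schwartz_cdiff|exact: schwartz_cdiff].
  rewrite cpartialM//; last exact: schwartz_cdiff.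
  apply/funext => x; rewrite cpartial_real derive_coord.
  have -> : ((j == k)%:R : R)%:C%C = (j == k)%:R by case: (j == k).
  by ring.
- exists f, (fun _ => 0); split => //; first exact: schwartz0.
  by apply/funext => x; rewrite addr0.
Qed.

End ComplexPlaneFunctions.

Section DominatedToZero.
Context {R : realType} d (T : measurableType d) (mu : {measure set T -> \bar R}).
Implicit Types (h : nat -> T -> R) (g : T -> R).

Lemma integral_dominated_cvg0 h g :
  (forall n, measurable_fun setT (h n)) -> measurable_fun setT g ->
  (\int[mu]_x (g x)%:E < +oo)%E ->
  (forall n x, 0 <= h n x <= g x) ->
  {ae mu, forall x, h n x @[n --> \oo] --> 0} ->
  (\int[mu]_x (h n x)%:E)%E @[n --> \oo] --> 0%E.
Proof.
move=> mh mg ig hg h0.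
have g0 x : 0 <= g x by have /andP[a b] := hg 0%N x; exact: le_trans a b.
have ig' : mu.-integrable setT (EFin \o g).
  apply/integrableP; split; first exact/measurable_EFinP.
  by under eq_integral do rewrite /= ger0_norm//.
have [] := @dominated_convergence _ _ _ mu setT measurableT
  (fun n => EFin \o h n) (cst 0%E) (EFin \o g).
- by move=> n; exact/measurable_EFinP.
- exact: measurable_cst.
- apply: filterS h0 => x hx _; apply: cvg_EFin; last exact: hx.
  by apply: nearW.
- by [].
- apply: aeW => x n _; have /andP[a b] := hg n x.
  by rewrite /= lee_fin ger0_norm.
- by move=> _ _; rewrite integral0.
Qed.

Lemma fine_cvg0_ex (u : nat -> \bar R) (eps : R) : u n @[n --> \oo] --> 0%E ->
  (forall n, (0 <= u n)%E) -> 0 < eps -> exists N, forall n, (N <= n)%N -> (u n <= eps%:E)%E.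
Proof.
move=> u0 up e0.
have : \forall n \near \oo, (u n < eps%:E)%E.
  by apply: (u0 [set y | (y < eps%:E)%E]); apply: open_ereal_lt'; rewrite lte_fin.
by move=> [N _ hN]; exists N => n Nn; apply: ltW; exact: hN.
Qed.

End DominatedToZero.

(** * Explicit integrals: the Cauchy density and the transform of exp(-|x|) *)

Section PoissonKernel.
Context {R : realType}.
Local Notation mR := (measurableTypeR R).
Local Notation leb := (@lebesgue_measure R).

Lemma integral_cauchy_density : (\int[leb]_x ((1 + x ^+ 2)^-1)%:E = pi%:E)%E.
Proof.
have p0 (x : R) : 0 < 1 + x ^+ 2 by rewrite ltr_pwDl// sqr_ge0.
have cf : continuous (fun x : R => (1 + x ^+ 2)^-1).
  move=> x; apply: cvgV; first by rewrite gt_eqF.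
  by apply: cvgD; [exact: cvg_cst|exact: exprn_continuous].
rewrite ge0_symfun_integralT//; last 2 first.
- by move=> x; rewrite invr_ge0 ltW.
- by move=> x /=; rewrite sqrrN.
rewrite -set_itvcy (@ge0_continuous_FTC2y _ _ atan 0 (pi / 2)).
- by rewrite atan0 sube0 -EFinM mulrC divfK.
- by move=> x _; rewrite invr_ge0 ltW.
- exact: continuous_subspaceT.
- exact: cvgy_atan.
- by move=> x _; exact: derivable_atan.
- by apply: cvg_at_right_filter; exact: continuous_atan.
- by move=> x _; exact: derive1_atan.
Qed.

Lemma integral_expN : (\int[leb]_(x in `[0%R, +oo[) (expR (- x))%:E = 1%:E)%E.
Proof.
rewrite (@ge0_continuous_FTC2y _ _ (fun x => - expR (- x)) 0 0).
- by rewrite oppr0 expR0 sub0e -EFinN opprK.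
- by move=> x _; exact: expR_ge0.
- apply: continuous_subspaceT => x; apply: continuous_comp; last exact: continuous_expR.
  exact: opp_continuous.
- by rewrite -oppr0; apply: cvgN; exact: cvgr_expR.
- by move=> x _.
- apply: cvg_at_right_filter; apply: cvgN; apply: continuous_comp; last exact: continuous_expR.
  exact: opp_continuous.
- move=> x _; rewrite derive1E; apply: derive_val.
  apply: is_derive_eq; rewrite /GRing.scale/=; ring.
Qed.

(** Chosen so that [expR (- x) * osc a x] is a primitive of [expR (- x) * (1 + cos (a * x))]. The
    added 1 keeps the integrand nonnegative, as the fundamental theorem on the half-line asks. *)
Let osc (a x : R) := - 1 + (a * sin (a * x) - cos (a * x)) / (1 + a ^+ 2).

Let is_derive_osc (a x : R) : is_derive x (1 : R) (fun x => expR (- x) * osc a x)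
  (expR (- x) * (1 + cos (a * x))).
Proof.
have p0 : 1 + a ^+ 2 != 0 by rewrite gt_eqF// ltr_pwDl// sqr_ge0.
apply: is_derive_eq.
rewrite /osc /GRing.scale/=; field; exact: p0.
Qed.

Lemma integral_expN_1Dcos (a : R) :
  (\int[leb]_(x in `[0%R, +oo[) (expR (- x) * (1 + cos (a * x)))%:E =
   (1 + (1 + a ^+ 2)^-1)%:E)%E.
Proof.
have p0 : 0 < 1 + a ^+ 2 by rewrite ltr_pwDl// sqr_ge0.
have c1 x : -1 <= cos (a * x) <= 1 by rewrite cos_geN1 cos_le1.
have s1 x : `|sin (a * x)| <= 1 by rewrite ler_norml sin_geN1 sin_le1.
have dF x : derivable (fun x => expR (- x) * osc a x) x 1 by case: (is_derive_osc a x).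
rewrite (@ge0_continuous_FTC2y _ _ (fun x => expR (- x) * osc a x) 0 0).
- by rewrite /osc oppr0 expR0 mulr0 sin0 cos0 mulr0 sub0e -EFinN; congr EFin; field; rewrite gt_eqF.
- by move=> x _; rewrite mulr_ge0 ?expR_ge0//; have /andP[] := c1 x => h _; lra.
- apply: continuous_subspaceT => x; apply: cvgM.
    by apply: continuous_comp; [exact: opp_continuous|exact: continuous_expR].
  apply: cvgD; first exact: cvg_cst.
  apply: continuous_comp; last exact: continuous_cos.
  by apply: cvgM; [exact: cvg_cst|exact: cvg_id].
- have bnd x : `|expR (- x) * osc a x| <= expR (- x) * (2 + `|a|).
    rewrite normrM (ger0_norm (expR_ge0 _)) ler_wpM2l ?expR_ge0//.
    rewrite /osc (le_trans (ler_normD _ _))// normrN normr1.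
    have : `|(a * sin (a * x) - cos (a * x)) / (1 + a ^+ 2)| <= `|a| + 1; last by lra.
    rewrite normrM normfV (gtr0_norm p0) ler_pdivrMr//.
    apply: (@le_trans _ _ (`|a| + 1)).
      apply: (le_trans (ler_normB _ _)); rewrite normrM lerD//.
        by rewrite ler_piMr.
      by rewrite ler_norml.
    by rewrite ler_peMr ?addr_ge0// lerDl sqr_ge0.
  apply/cvgr0Pnorm_le => e e0.
  have : (fun x => expR (- x) * (2 + `|a|)) x @[x --> +oo] --> (0 : R).
    by rewrite -(mul0r (2 + `|a|)); apply: cvgM; [exact: cvgr_expR|exact: cvg_cst].
  move=> /cvgr0Pnorm_le/(_ e e0); apply: filterS => x hx.
  apply: le_trans (bnd x) _; exact: le_trans (ler_norm _) hx.
- by move=> x _.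
- apply: cvg_at_right_filter; apply: (@differentiable_continuous _ _ _ 0).
  by apply/derivable1_diffP.
- by move=> x _; rewrite derive1E; case: (is_derive_osc a x).
Qed.

Lemma continuous_absexp : continuous (fun x : R => expR (- `|x|)).
Proof.
move=> x; apply: continuous_comp; last exact: continuous_expR.
by apply: continuous_comp; [exact: norm_continuous|exact: opp_continuous].
Qed.

Lemma measurable_absexp : measurable_fun setT (fun x : mR => expR (- `|x|)).
Proof. by apply: continuous_measurable_fun; exact: continuous_absexp. Qed.

Lemma integral_absexp_1Dcos (a : R) :
  (\int[leb]_x (expR (- `|x|) * (1 + cos (a * x)))%:E =
   (2 * (1 + (1 + a ^+ 2)^-1))%:E)%E.
Proof.
have c1 x : -1 <= cos (a * x) <= 1 by rewrite cos_geN1 cos_le1.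
have nn x : 0 <= expR (- `|x|) * (1 + cos (a * x)).
  by rewrite mulr_ge0 ?expR_ge0//; have /andP[] := c1 x => h _; lra.
rewrite ge0_symfun_integralT//.
- rewrite -set_itvcy EFinM -integral_expN_1Dcos; congr (_ * _)%E.
  by apply: eq_integral => x; rewrite inE/= in_itv/= andbT => x0; rewrite ger0_norm.
- move=> x; apply: cvgM; first exact: continuous_absexp.
  apply: cvgD; first exact: cvg_cst.
  apply: continuous_comp; last exact: continuous_cos.
  by apply: cvgM; [exact: cvg_cst|exact: cvg_id].
- by move=> x /=; rewrite normrN mulrN cosN.
Qed.

Lemma integral_absexp : (\int[leb]_x (expR (- `|x|))%:E = 2%:E)%E.
Proof.
rewrite ge0_symfun_integralT//.
- rewrite -set_itvcy -[RHS]mule1 -integral_expN; congr (_ * _)%E.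
  by apply: eq_integral => x; rewrite inE/= in_itv/= andbT => x0; rewrite ger0_norm.
- exact: continuous_absexp.
- by move=> x /=; rewrite normrN.
Qed.

(** Linearity removes the auxiliary 1: the mass of exp(-|x|) is 2, and 2 (1 + 1/(1 + a^2)) - 2
    remains. *)
Lemma integral_absexp_cos (a : R) :
  Rintegral leb setT (fun x => cos (a * x) * expR (- `|x|)) = 2 / (1 + a ^+ 2).
Proof.
have mE : measurable_fun setT (fun x : R => expR (- `|x|)).
  by apply: continuous_measurable_fun; exact: continuous_absexp.
have mc : measurable_fun setT (fun x : R => cos (a * x)).
  apply: continuous_measurable_fun => x; apply: continuous_comp; last exact: continuous_cos.
  by apply: cvgM; [exact: cvg_cst|exact: cvg_id].
have iE : leb.-integrable setT (EFin \o (fun x : R => expR (- `|x|))).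
  apply/integrableP; split; first exact/measurable_EFinP.
  under eq_integral do rewrite /= ger0_norm ?expR_ge0//.
  by rewrite integral_absexp ltry.
have icE : leb.-integrable setT (EFin \o (fun x : R => cos (a * x) * expR (- `|x|))).
  apply: le_integrable iE => //.
    by apply/measurable_EFinP; exact: measurable_funM.
  move=> x _; rewrite /= lee_fin normrM ler_piMl//.
  by rewrite ler_norml cos_geN1 cos_le1.
have : Rintegral leb setT (fun x => expR (- `|x|) + cos (a * x) * expR (- `|x|)) =
   2 * (1 + (1 + a ^+ 2)^-1).
  rewrite (_ : (fun x => _) = (fun x : mR => expR (- `|x|) * (1 + cos (a * x)))); last first.
    by apply/funext => x; ring.
  by rewrite /Rintegral integral_absexp_1Dcos.
by rewrite RintegralD// {1}/Rintegral integral_absexp /= mulrDr mulr1 => /addrI.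
Qed.

Let eq_oppr_eq0 (z : R) : - z = z -> z = 0.
Proof. by move=> h; lra. Qed.

(** Odd integrand: the reflection x -> -x, an affine map of slope -1, sends the integral to its
    opposite. *)
Lemma integral_absexp_sin (a : R) :
  Rintegral leb setT (fun x => sin (a * x) * expR (- `|x|)) = 0.
Proof.
set g := fun x => _.
have mg : measurable_fun setT g.
  apply: continuous_measurable_fun => x; apply: cvgM; last exact: continuous_absexp.
  apply: continuous_comp; last exact: continuous_sin.
  by apply: cvgM; [exact: cvg_cst|exact: cvg_id].
have ig : cintble leb (fun x => (g x)%:C%C).
  refine (@le_cintble _ _ _ _ _ (fun x : mR => (expR (- `|x|))%:E) _ _ _ _).
  - exact: cmeas_real.
  - by apply/measurable_EFinP; exact: measurable_absexp.
  - by rewrite integral_absexp ltry.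
  - move=> x; rewrite lee_fin cmod_real /g normrM (ger0_norm (expR_ge0 _)) ler_piMl ?expR_ge0//.
    by rewrite ler_norml sin_geN1 sin_le1.
have : cintegral leb setT ((fun x => (g x)%:C%C) \o (fun x => 0 + -1 * x)) =
    ((`|-1|^-1 : R)%:C)%C * cintegral leb setT (fun x => (g x)%:C%C).
  have n1 : (-1 : R) != 0 by rewrite oppr_eq0 oner_eq0.
  exact: (transfer_cintegral (fun u => @integral_affine1 R 0 (-1) u n1) ig).
rewrite normrN1 invr1 mul1r.
have -> : (fun x => (g x)%:C%C) \o (fun x : R => 0 + -1 * x) = (fun x => - (g x)%:C%C).
  apply/funext => x; rewrite /= /g add0r mulN1r normrN mulrN sinN mulNr.
  by apply: complex_ext; rewrite /= ?oppr0.
rewrite cintegralN// => /(congr1 (@complex.Re R)); rewrite /cintegral/= => h.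
exact: (eq_oppr_eq0 h).
Qed.

Lemma cintble_expi_absexp (a : R) : cintble leb (fun x => expi (a * x) * (expR (- `|x|))%:C%C).
Proof.
refine (@le_cintble _ _ _ _ _ (fun x : mR => (expR (- `|x|))%:E) _ _ _ _).
- apply: cmeasM; first by apply: cmeas_expi; exact: measurable_funM.
  by apply: cmeas_real; exact: measurable_absexp.
- by apply/measurable_EFinP; exact: measurable_absexp.
- by rewrite integral_absexp ltry.
- by move=> x; rewrite cmodM cmod_expi mul1r cmod_real ger0_norm ?expR_ge0.
Qed.

Lemma cintegral_expi_absexp (a : R) :
  cintegral leb setT (fun x => expi (a * x) * (expR (- `|x|))%:C%C) = (2 / (1 + a ^+ 2))%:C%C.
Proof.
apply: complex_ext => /=.
  rewrite -integral_absexp_cos; apply: eq_Rintegral => x _.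
  by rewrite /= mulr0 subr0.
rewrite -(integral_absexp_sin a); apply: eq_Rintegral => x _.
by rewrite /= mulr0 add0r.
Qed.

End PoissonKernel.

Section PlaneProducts.
Context {R : realType}.
Local Notation leb := (@lebesgue_measure R).
Local Notation mR := (measurableTypeR R).
Local Notation mP := (measurableTypeR R * measurableTypeR R)%type.
Local Notation plane := (@Defs.plane R).

Lemma integral_tensor (u v : mR -> \bar R) : measurable_fun setT u -> measurable_fun setT v ->
  (forall x, (0 <= u x)%E) -> (forall x, (0 <= v x)%E) ->
  (\int[leb2]_x (u x.1 * v x.2) = (\int[leb]_x u x) * (\int[leb]_x v x))%E.
Proof.
move=> mu mv u0 v0; rewrite /leb2 (fubini_tonelli1 (fun x : mP => u x.1 * v x.2)%E).
- rewrite -ge0_integralZr//; last exact: integral_ge0.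
  by apply: eq_integral => x _; rewrite /fubini_F/= ge0_integralZl.
- by apply: emeasurable_funM; [exact: (measurableT_comp mu)|exact: (measurableT_comp mv)].
- by move=> x; rewrite mule_ge0.
Qed.

Lemma cintble_tensor (f g : mR -> R[i]) : cintble leb f -> cintble leb g ->
  cintble leb2 (fun x : mP => f x.1 * g x.2).
Proof.
move=> /cintbleP[mf i] /cintbleP[mg j]; apply/cintbleP; split.
  by apply: cmeasM; [exact: (cmeas_comp (h := fst))|exact: (cmeas_comp (h := snd))].
under eq_integral do rewrite cmodM EFinM.
rewrite (integral_tensor (u := fun x => (cmod (f x))%:E) (v := fun x => (cmod (g x))%:E)); try exact: emeas_cmod; try by move=> x; rewrite lee_fin cmod_ge0.
by apply: lte_mul_pinfty => //; [apply: integral_ge0 => x _; rewrite lee_fin cmod_ge0|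
  rewrite ge0_fin_numE//; apply: integral_ge0 => x _; rewrite lee_fin cmod_ge0].
Qed.

Lemma cintegral_tensor (f g : mR -> R[i]) : cintble leb f -> cintble leb g ->
  cintegral leb2 setT (fun x : mP => f x.1 * g x.2) =
  cintegral leb setT f * cintegral leb setT g.
Proof.
move=> cf cg; have := cintble_tensor cf cg => cfg.
rewrite -(cintegral_fubini1 cfg) -cintegralZr//; congr cintegral.
by apply/funext => x /=; rewrite cintegralZ.
Qed.

(** Product of two Cauchy densities, of mass pi^2. It is the common integrable majorant of rapidly
    decreasing functions and, up to a factor 4, the transform of exp(-|x_1| - |x_2|), hence the
    kernel used for inversion. *)
Definition wt (x : plane) : R := (1 + x.1 ^+ 2)^-1 * (1 + x.2 ^+ 2)^-1.

Lemma wt_ge0 x : 0 <= wt x.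
Proof. by rewrite /wt mulr_ge0// invr_ge0 addr_ge0// sqr_ge0. Qed.

Let mcauchy : measurable_fun setT (fun x : R => (1 + x ^+ 2)^-1).
Proof.
apply: continuous_measurable_fun => x; apply: cvgV.
  by rewrite gt_eqF// ltr_pwDl// sqr_ge0.
by apply: cvgD; [exact: cvg_cst|exact: exprn_continuous].
Qed.

Lemma measurable_wt : measurable_fun (setT : set mP) wt.
Proof. by apply: measurable_funM; [exact: (measurableT_comp mcauchy)|exact: (measurableT_comp mcauchy)]. Qed.

Lemma integral_wt : (\int[leb2]_x (wt x)%:E = (pi * pi)%:E)%E.
Proof.
rewrite EFinM -{1}integral_cauchy_density -{1}integral_cauchy_density -integral_tensor//.
- exact/measurable_EFinP.
- exact/measurable_EFinP.
- by move=> x; rewrite lee_fin invr_ge0 addr_ge0// sqr_ge0.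
- by move=> x; rewrite lee_fin invr_ge0 addr_ge0// sqr_ge0.
Qed.

(** Exponent 4 is two for each coordinate, as 1 + x_j^2 <= (1 + |x|)^2. Decay of order 4 therefore
    gives integrability on the plane. *)
Lemma ler_wt x : (1 + enorm x) ^- 4 <= wt x.
Proof.
have h (j : bool) : 1 + Defs.coord j x ^+ 2 <= (1 + enorm x) ^+ 2.
  have := ler_coord_enorm j x; have := enorm_ge0 x => e0 h.
  have : Defs.coord j x ^+ 2 <= enorm x ^+ 2.
    by rewrite -(real_normK (num_real (Defs.coord j x))) lerXn2r ?nnegrE.
  by rewrite sqrrD expr1n mul1r mulr2n; lra.
have p (a : R) : 0 < 1 + a ^+ 2 by rewrite ltr_pwDl// sqr_ge0.
have e0 : 0 < 1 + enorm x by rewrite ltr_pwDl ?enorm_ge0.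
rewrite /wt -invfM lef_pV2 ?posrE ?mulr_gt0 ?exprn_gt0//.
rewrite -[4%N]/(2 + 2)%N exprD; apply: ler_pM; [by rewrite ltW|by rewrite ltW|exact: (h false)|exact: (h true)].
Qed.

Lemma rapid_bound (f : plane -> R[i]) : rapid f ->
  exists2 M : R, 0 <= M & forall x, cmod (f x) <= M * wt x.
Proof.
move=> /(_ 4)[M hM].
have M0 : 0 <= M.
  by apply: le_trans (hM 0); rewrite mulr_ge0 ?exprn_ge0 ?addr_ge0 ?enorm_ge0 ?cmod_ge0.
exists M => // x; apply: le_trans (ler_wpM2l M0 (ler_wt x)).
have e0 : 0 < (1 + enorm x) ^+ 4 by rewrite exprn_gt0// ltr_pwDl ?enorm_ge0.
by rewrite ler_pdivlMr// mulrC.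
Qed.

Lemma cintble_rapid (f : plane -> R[i]) : cmeas (f : mP -> R[i]) -> rapid f -> cintble leb2 f.
Proof.
move=> mf /rapid_bound[M M0 hM].
refine (@le_cintble _ _ _ _ _ (fun x : mP => M%:E * (wt x)%:E)%E _ _ _ _) => //.
- by apply: measurable_funeM; apply/measurable_EFinP; exact: measurable_wt.
- rewrite ge0_integralZl//; [|by apply/measurable_EFinP; exact: measurable_wt|
    by move=> x _; rewrite lee_fin wt_ge0].
  by rewrite integral_wt -EFinM ltry.
Qed.

Lemma cintble_schwartz (f : plane -> R[i]) : schwartz f -> cintble leb2 f.
Proof. by move=> sf; apply: cintble_rapid; [exact: schwartz_cmeas|exact: schwartz_rapid]. Qed.

End PlaneProducts.

(** * Fourier inversion *)

Lemma le_of_eq d (T : porderType d) (x y : T) : x = y -> (x <= y)%O.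
Proof. by move=> ->. Qed.

Section FourierTransform.
Context {R : realType}.
Local Notation mR := (measurableTypeR R).
Local Notation mP := (measurableTypeR R * measurableTypeR R)%type.
Local Notation plane := (@Defs.plane R).
Local Notation coord := (@Defs.coord R).
Local Notation Re := (@complex.Re R).
Local Notation Im := (@complex.Im R).
Local Notation CI := (cintegral leb2 setT).
Implicit Types (f g : plane -> R[i]) (x xi : plane) (t : R).

(* [ft (-1)] is the Fourier transform and [ft 1] its inverse up to the factor
   [(2 pi)^-2]; keeping the sign as a parameter avoids proving everything twice. *)
Definition ft t f xi : R[i] := CI (fun x => expi (t * dotp x xi) * f x).

Lemma dotpC x xi : dotp x xi = dotp xi x.
Proof. by rewrite /dotp mulrC [X in _ + X]mulrC. Qed.

Lemma dotpDl x y xi : dotp (x + y) xi = dotp x xi + dotp y xi.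
Proof. by rewrite /dotp /=; ring. Qed.

Lemma dotpDr x y xi : dotp xi (x + y) = dotp xi x + dotp xi y.
Proof. by rewrite dotpC dotpDl !(dotpC xi). Qed.

Lemma dotpZl (a : R) x xi : dotp (a *: x) xi = a * dotp x xi.
Proof. by rewrite /dotp /= /GRing.scale /=; ring. Qed.

Lemma dotp_basis j x : dotp (basis_vec j) x = coord j x.
Proof. by case: j; rewrite /dotp /= ?mul0r ?mul1r ?addr0 ?add0r. Qed.

Lemma measurable_dotp xi : measurable_fun (setT : set mP) (fun x => dotp x xi : mR).
Proof.
by apply: measurable_funD; apply: measurable_funM.
Qed.

Lemma cmeas_wave t xi : cmeas (fun x : mP => expi (t * dotp x xi)).
Proof. by apply: cmeas_expi; apply: measurable_funM => //; exact: measurable_dotp. Qed.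

Lemma cintble_wave t xi f : cintble leb2 f ->
  cintble leb2 (fun x : mP => expi (t * dotp x xi) * f x).
Proof.
apply: (@cintble_bM _ _ _ _ _ _ 1); first exact: cmeas_wave.
by move=> x; rewrite cmod_expi.
Qed.

Lemma cmod_ft_le t f xi : cintble leb2 f ->
  ((cmod (ft t f xi))%:E <= \int[leb2]_x (cmod (f x))%:E)%E.
Proof.
move=> cf; apply: le_trans (cmod_cintegral_le_int (cintble_wave t xi cf)) _.
by apply: le_of_eq; apply: eq_integral => x _; rewrite cmodM cmod_expi mul1r.
Qed.

Lemma ft_bound t f : cintble leb2 f -> exists M : R, forall xi, cmod (ft t f xi) <= M.
Proof.
move=> cf; exists (fine (\int[leb2]_x (cmod (f x))%:E)) => xi.
rewrite -lee_fin fineK; first exact: cmod_ft_le.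
rewrite ge0_fin_numE; first exact: cintble_lty.
by apply: integral_ge0 => x _; rewrite lee_fin cmod_ge0.
Qed.

Lemma ftD t f g : cintble leb2 f -> cintble leb2 g ->
  ft t (fun x => f x + g x) = (fun xi => ft t f xi + ft t g xi).
Proof.
move=> cf cg; apply/funext => xi; rewrite /ft -cintegralD; try exact: cintble_wave.
by congr cintegral; apply/funext => x; rewrite mulrDr.
Qed.

Lemma ftZ t (a : R[i]) f : cintble leb2 f ->
  ft t (fun x => a * f x) = (fun xi => a * ft t f xi).
Proof.
move=> cf; apply/funext => xi; rewrite /ft -cintegralZ; last exact: cintble_wave.
by congr cintegral; apply/funext => x; rewrite mulrCA.
Qed.

Lemma schwartz_weight2 f : schwartz f ->
  exists C : R, (\int[leb2]_x (enorm x ^+ 2 * cmod (f x))%:E <= C%:E)%E.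
Proof.
move=> sf.
have s2 j : schwartz (fun x => (coord j x)%:C%C * ((coord j x)%:C%C * f x)).
  by do 2 apply: schwartz_coord.
have i j := cintble_lty (cintble_schwartz (s2 j)).
have m j := cintble_meas (cintble_schwartz (s2 j)).
pose J := (\int[leb2]_x ((cmod ((coord false x)%:C%C * ((coord false x)%:C%C * f x)))%:E +
  (cmod ((coord true x)%:C%C * ((coord true x)%:C%C * f x)))%:E))%E.
have Joo : (J < +oo)%E.
  rewrite /J ge0_integralD//; try by move=> x _; rewrite lee_fin cmod_ge0.
  - by rewrite lte_add_pinfty.
  - by apply: emeas_cmod.
  - by apply: emeas_cmod.
exists (fine J); rewrite fineK; last first.
  rewrite ge0_fin_numE//; apply: integral_ge0 => x _.
  by rewrite adde_ge0// lee_fin cmod_ge0.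
apply: le_of_eq; apply: eq_integral => x _; rewrite -EFinD; congr EFin.
by rewrite !cmodM !cmod_real !mulrA -!normrM -!expr2 !ger0_norm ?sqr_ge0// -mulrDl enorm_sqr.
Qed.

Definition dft t j f : plane -> R[i] := ft t (fun x => (0 +i* (t * coord j x))%C * f x).

Lemma schwartz_icoord t j f : schwartz f -> schwartz (fun x => (0 +i* (t * coord j x))%C * f x).
Proof.
move=> /(schwartz_coord j)/(schwartzZ (0 +i* t)%C).
rewrite (_ : (fun x => _) = (fun x => (0 +i* (t * coord j x))%C * f x))//.
by apply/funext => x; rewrite mulrA; congr (_ * _); apply: complex_ext; rewrite /=; ring.
Qed.

(** The remainder is the transform of f times exp(i s) - 1 - i s with s = t (x.h); it is at most 2
    s^2 in modulus, so the second moment of f bounds it by a multiple of |h|^2. *)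
Lemma ft_taylor t f xi : schwartz f -> exists C : R, forall h : plane,
  cmod (ft t f (h + xi) - ft t f xi -
    ((h.1)%:C%C * dft t false f xi + (h.2)%:C%C * dft t true f xi)) <= C * `|h| ^+ 2.
Proof.
move=> sf; have [C hC] := schwartz_weight2 sf.
(* 2 t^2 comes from the remainder of the exponential, C is the second moment, and 4 is the square of
   the 2 that compares the Euclidean norm of h with its maximum norm. *)
exists (2 * t ^+ 2 * (4 * C)) => h.
have cf := cintble_schwartz sf.
have cd j := cintble_wave t xi (cintble_schwartz (schwartz_icoord t j sf)).
rewrite /dft /ft -!cintegralZ; try exact: cd.
rewrite -cintegralD; try by apply: cintbleZ; exact: cd.
rewrite -cintegralB; try exact: cintble_wave.
rewrite -cintegralB; last 2 first.
- by apply: cintbleB; exact: cintble_wave.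
- by apply: cintbleD; apply: cintbleZ; exact: cd.
set F := fun x => _.
have FE x : F x = expi (t * dotp x xi) * f x *
   (expi (t * dotp x h) - 1 - (0 +i* (t * dotp x h))%C).
  rewrite /F dotpDr mulrDr expiD.
  have -> : (0 +i* (t * dotp x h))%C =
    (h.1)%:C%C * (0 +i* (t * coord false x))%C + (h.2)%:C%C * (0 +i* (t * coord true x))%C :> R[i].
    by apply: complex_ext; rewrite /dotp /=; ring.
  by ring.
have mF : cmeas F.
  apply: cmeasB; [apply: cmeasB|apply: cmeasD]; apply: (@cintble_meas _ _ _ leb2);
    by [exact: cintble_wave|apply: cintbleZ; exact: cd].
have bF x : cmod (F x) <= 2 * t ^+ 2 * (4 * `|h| ^+ 2) * (enorm x ^+ 2 * cmod (f x)).
  rewrite FE !cmodM cmod_expi mul1r mulrC [leRHS]mulrA ler_wpM2r ?cmod_ge0//.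
  apply: le_trans (cmod_expi_taylor _) _.
  have e1 := ler_dotp x h.
  have e2 : enorm h <= 2 * `|h|.
    apply: le_trans (ler_enorm_coord h) _; rewrite mulr_natl mulr2n lerD//.
      by rewrite prod_normE le_max lexx.
    by rewrite prod_normE le_max lexx orbT.
  have e3 : `|dotp x h| <= enorm x * (2 * `|h|).
    by apply: le_trans e1 _; rewrite ler_wpM2l ?enorm_ge0.
  have e4 : dotp x h ^+ 2 <= (enorm x * (2 * `|h|)) ^+ 2.
    rewrite -(real_normK (num_real (dotp x h))) lerXn2r ?nnegrE//.
    by rewrite mulr_ge0 ?enorm_ge0// mulr_ge0.
  rewrite exprMn mulrA.
  have -> : 2 * t ^+ 2 * (4 * `|h| ^+ 2) * enorm x ^+ 2 =
    2 * t ^+ 2 * (enorm x * (2 * `|h|)) ^+ 2 by ring.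
  by rewrite ler_wpM2l// mulr_ge0 ?sqr_ge0.
rewrite -lee_fin; have := @cmod_cintegral_le _ _ _ leb2 F mF => /le_trans; apply.
pose K := 2 * t ^+ 2 * (4 * `|h| ^+ 2).
have K0 : 0 <= K by apply: mulr_ge0; apply: mulr_ge0; rewrite ?sqr_ge0.
have mw : measurable_fun (setT : set mP) (fun x => (enorm x ^+ 2 * cmod (f x))%:E).
  apply/measurable_EFinP; apply: measurable_funM; last exact/cmeas_cmod/schwartz_cmeas.
  under eq_fun do rewrite enorm_sqr.
  by apply: measurable_funD; apply: measurable_funX; [exact: measurable_fst|exact: measurable_snd].
apply: (@le_trans _ _ (\int[leb2]_x (K%:E * (enorm x ^+ 2 * cmod (f x))%:E))%E).
  apply: ge0_le_integral => //.
  - by move=> x _; rewrite lee_fin cmod_ge0.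
  - exact: emeas_cmod.
  - exact: measurable_funeM.
  - by move=> x _; rewrite -EFinM lee_fin; exact: bF.
rewrite ge0_integralZl//; last by move=> x _; rewrite lee_fin mulr_ge0 ?sqr_ge0 ?cmod_ge0.
apply: le_trans (lee_wpmul2l _ hC) _; first by rewrite lee_fin.
by rewrite -EFinM lee_fin /K le_of_eq//; ring.
Qed.

Lemma ft_diff t f : schwartz f -> cdiff (ft t f) /\ forall j, cpartial j (ft t f) = dft t j f.
Proof.
move=> sf.
have H xi : (differentiable (Re \o ft t f) xi /\
    forall j, 'D_(basis_vec j) (Re \o ft t f) xi = Re (dft t j f xi)) /\
   (differentiable (Im \o ft t f) xi /\
    forall j, 'D_(basis_vec j) (Im \o ft t f) xi = Im (dft t j f xi)).
  have [C hC] := ft_taylor t xi sf.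
  split.
    apply: (@plane_taylor_diff _ _ _ (fun j => Re (dft t j f xi)) C) => h.
    apply: le_trans (hC h); apply: le_trans (ler_Re_cmod _); rewrite !ReImE/=.
    by apply: le_of_eq; congr `|_|; ring.
  apply: (@plane_taylor_diff _ _ _ (fun j => Im (dft t j f xi)) C) => h.
  apply: le_trans (hC h); apply: le_trans (ler_Im_cmod _); rewrite !ReImE/=.
  by apply: le_of_eq; congr `|_|; ring.
split.
  by move=> xi; have [[h1 _] [h2 _]] := H xi.
by move=> j; apply/funext => xi; have [[_ h1] [_ h2]] := H xi; apply: complex_ext; rewrite /=.
Qed.

End FourierTransform.

Section FourierInversion.
Context {R : realType}.
Local Notation mR := (measurableTypeR R).
Local Notation mP := (measurableTypeR R * measurableTypeR R)%type.
Local Notation plane := (@Defs.plane R).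
Local Notation coord := (@Defs.coord R).
Local Notation Re := (@complex.Re R).
Local Notation Im := (@complex.Im R).
Local Notation CI := (cintegral leb2 setT).
Implicit Types (f g : plane -> R[i]) (x xi : plane) (t : R).

(** Stands for letting h tend to 0: a positive z is contradicted at h = min(1, z / (2 (|C| + 1))),
    where C h <= z/2. Most limiting identities below are closed in this way. *)
Lemma ler0_linear (z C : R) : (forall h : R, 0 < h <= 1 -> z <= C * h) -> z <= 0.
Proof.
move=> zC; rewrite leNgt; apply/negP => z0.
have C0 : 0 < `|C| + 1 by rewrite ltr_wpDl.
pose h := Num.min 1 (z / (2 * (`|C| + 1))).
have h0 : 0 < h by rewrite lt_min ltr01 divr_gt0// mulr_gt0.
have h1 : h <= 1 by rewrite ge_min lexx.
have := zC h; rewrite h0 h1 => /(_ isT).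
have : C * h <= (`|C| + 1) * h.
  apply: ler_wpM2r; first exact: ltW.
  by apply: le_trans (ler_norm _) _; rewrite lerDl.
have : (`|C| + 1) * h <= z / 2.
  have : h <= z / (2 * (`|C| + 1)) by rewrite ge_min lexx orbT.
  move=> /(ler_wpM2l (ltW C0)) => /le_trans; apply.
  by rewrite le_of_eq//; field; rewrite gt_eqF.
lra.
Qed.

Lemma line_taylor (u : plane -> R) (e : plane) (B : R) x (h : R) :
  (forall y, differentiable u y) -> (forall y, differentiable ('D_e u) y) ->
  (forall s, `|s| <= `|h| -> `|'D_e ('D_e u) (x + s *: e)| <= B) ->
  `|u (x + h *: e) - u x - h * 'D_e u x| <= h ^+ 2 * B.
Proof.
move=> du ddu hB.
have d1 s := is_derive_line x e s du; have d2 s := is_derive_line x e s ddu.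
have [c [c1 _]] := @MVT_any _ (fun s => u (x + s *: e)) _ 0 h d1.
have [c' [c'1 _]] := @MVT_any _ (fun s => 'D_e u (x + s *: e)) _ 0 c d2.
rewrite !scale0r !addr0 !subr0 in c1 c'1 * => e2 ->.
rewrite mulrC -mulrBr e2 !normrM -(real_normK (num_real h)) expr2 -mulrA ler_wpM2l//.
rewrite mulrC ler_pM// hB//; exact: le_trans c'1 c1.
Qed.

Lemma rapid_shift_bound f j : rapid f -> exists2 M : R, 0 <= M &
  forall x (s : R), `|s| <= 1 -> cmod (f (x + s *: basis_vec j)) <= M * wt x.
Proof.
move=> /(_ 4)[M hM].
have M0 : 0 <= M.
  by apply: le_trans (hM 0); rewrite mulr_ge0 ?exprn_ge0 ?addr_ge0 ?enorm_ge0 ?cmod_ge0.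
(* A shift of length at most 1 changes 1 + |x| by a factor at most 2, and 16 = 2^4. *)
exists (16 * M) => [|x s s1]; first by rewrite mulr_ge0.
have p y : 0 < 1 + enorm y :> R by rewrite ltr_pwDl ?enorm_ge0.
set y := x + s *: basis_vec j.
have xy : 1 + enorm x <= 2 * (1 + enorm y).
  have : enorm x <= enorm y + enorm (- (s *: basis_vec j)).
    by apply: le_trans (enormD _ _); rewrite /y addrK.
  rewrite enormN enormZ enorm_basis mulr1; have := enorm_ge0 y; lra.
have h1 := hM y.
apply: le_trans (ler_wpM2l _ (ler_wt x)); last by rewrite mulr_ge0.
rewrite ler_pdivlMr ?exprn_gt0//.
have : (1 + enorm x) ^+ 4 <= (2 * (1 + enorm y)) ^+ 4.
  by rewrite lerXn2r ?nnegrE// ?mulr_ge0//; exact: ltW.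
move=> /(ler_wpM2l (cmod_ge0 (f y))) => /le_trans; apply.
have -> : cmod (f y) * (2 * (1 + enorm y)) ^+ 4 = 16 * ((1 + enorm y) ^+ 4 * cmod (f y)) by ring.
by rewrite ler_wpM2l.
Qed.

(** The second derivative along the segment is at most a multiple of [wt] at the base point, by
    [rapid_shift_bound]. The remainder thus has an integrable majorant in x, as needed to pass to
    its Fourier transform. *)
Lemma schwartz_taylor f j : schwartz f -> exists2 C : R, 0 <= C &
  forall x (h : R), `|h| <= 1 ->
  cmod (f (x + h *: basis_vec j) - f x - h%:C%C * cpartial j f x) <= C * h ^+ 2 * wt x.
Proof.
move=> sf; have s1 := schwartz_cpartial j sf; have s2 := schwartz_cpartial j s1.
have [M M0 hM] := rapid_shift_bound j (schwartz_rapid s2).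
exists (2 * M) => [|x h h1]; first by rewrite mulr_ge0.
have Bs s : `|s| <= `|h| -> cmod (cpartial j (cpartial j f) (x + s *: basis_vec j)) <= M * wt x.
  by move=> sh; apply: hM; exact: le_trans sh h1.
apply: le_trans (cmod_le _) _.
have -> : 2 * M * h ^+ 2 * wt x = h ^+ 2 * (M * wt x) + h ^+ 2 * (M * wt x) by ring.
apply: lerD.
  rewrite !ReImE/= mul0r subr0.
  apply: (@line_taylor (Re \o f)) => [y|y|s sh].
  - by have [] := schwartz_cdiff sf y.
  - by have [] := schwartz_cdiff s1 y.
  - apply: le_trans (Bs _ sh); exact: (ler_Re_cmod (cpartial j (cpartial j f) _)).
rewrite !ReImE/= mul0r addr0.
apply: (@line_taylor (Im \o f)) => [y|y|s sh].
- by have [] := schwartz_cdiff sf y.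
- by have [] := schwartz_cdiff s1 y.
- apply: le_trans (Bs _ sh); exact: (ler_Im_cmod (cpartial j (cpartial j f) _)).
Qed.

Lemma addE_aff (v y : plane) : y + v = aff v 1 y.
Proof. by rewrite /aff !mul1r addrC. Qed.

Lemma cintegral_shift v f : cintble leb2 f -> CI (fun y => f (y + v)) = CI f.
Proof.
move=> cf; have := @cintegral_aff R v 1 f (oner_neq0 _) cf.
rewrite expr1n invr1 mul1r => <-; congr cintegral.
by apply/funext => y; rewrite addE_aff.
Qed.

Lemma cintble_shift v f : cintble leb2 f -> cintble leb2 (fun y => f (y + v)).
Proof.
move=> cf; have := @cintble_aff R v 1 f (oner_neq0 _) cf.
by rewrite (_ : _ \o _ = (fun y => f (y + v)))//; apply/funext => y; rewrite addE_aff.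
Qed.

Lemma ft_shift t v f xi : cintble leb2 f ->
  ft t (fun y => f (y + v)) xi = expi (- (t * dotp v xi)) * ft t f xi.
Proof.
move=> cf; rewrite /ft -cintegralZ; last exact: cintble_wave.
rewrite -(@cintegral_shift v (fun x => expi (- (t * dotp v xi)) * (expi (t * dotp x xi) * f x))).
  congr cintegral; apply/funext => y.
  rewrite mulrA -expiD dotpDl; congr (expi _ * _); ring.
by apply: cintbleZ; exact: cintble_wave.
Qed.

(** Difference quotients replace integration by parts. The transform of f(x + h e_j) - f(x) - h d_j
    f(x) is O(h^2); on the frequency side it equals (exp(-i h k) - 1) A - h B. Dividing by h and
    letting h tend to 0 identifies B. *)
Lemma ft_cpartial t j f xi : schwartz f ->
  ft t (cpartial j f) xi = (0 +i* - (t * coord j xi))%C * ft t f xi.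
Proof.
move=> sf; have [C C0 hC] := schwartz_taylor j sf.
have cf := cintble_schwartz sf; have cd := cintble_schwartz (schwartz_cpartial j sf).
set A := ft t f xi; set B := ft t (cpartial j f) xi; pose k := t * coord j xi.
apply/eqP; rewrite eq_sym -subr_eq0; apply/eqP/cmod_eq0/eqP.
(* First term: the Taylor remainder integrated against [wt], of mass pi^2. Second term: the
   remainder of exp(-i h k) multiplied by A. *)
rewrite eq_le cmod_ge0 andbT; apply: (@ler0_linear _ (C * (pi * pi) + 2 * k ^+ 2 * cmod A)).
move=> h /andP[h0 h1].
have hn : `|h| <= 1 by rewrite gtr0_norm.
set v := h *: basis_vec j : plane.
have vk : t * dotp v xi = h * k by rewrite /v dotpZl dotp_basis /k; ring.
pose D x := f (x + v) - f x - h%:C%C * cpartial j f x.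
have cD : cintble leb2 D.
  by apply: cintbleB; [apply: cintbleB => //; exact: cintble_shift|exact: cintbleZ].
have ftDE : ft t D xi = (expi (- (h * k)) - 1) * A - h%:C%C * B.
  have := ftZ t (- h%:C%C) cd => /(congr1 (fun g => g xi)) eZ.
  have := ftZ t (-1) cf => /(congr1 (fun g => g xi)) eN.
  have c1 := cintble_shift v cf; have c2 := cintbleZ (-1) cf.
  have c3 := cintbleZ (- h%:C%C) cd.
  rewrite (_ : D = fun x => (f (x + v) + -1 * f x) + - h%:C%C * cpartial j f x); last first.
    by apply/funext => x; rewrite /D; ring.
  rewrite (ftD t (cintbleD c1 c2) c3) (ftD t c1 c2) eZ eN ft_shift// vk /A /B.
  by ring.
have bD : cmod (ft t D xi) <= C * h ^+ 2 * (pi * pi).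
  rewrite -lee_fin; apply: le_trans (cmod_ft_le t xi cD) _.
  apply: (@le_trans _ _ (\int[leb2]_x ((C * h ^+ 2)%:E * (wt x)%:E))%E).
    apply: ge0_le_integral => //.
    - by move=> x _; rewrite lee_fin cmod_ge0.
    - exact/emeas_cmod/cintble_meas/cD.
    - by apply: measurable_funeM; apply/measurable_EFinP; exact: measurable_wt.
    - by move=> x _; rewrite -EFinM lee_fin; exact: hC.
  rewrite ge0_integralZl//; last 3 first.
  - by apply/measurable_EFinP; exact: measurable_wt.
  - by move=> x _; rewrite lee_fin wt_ge0.
  - by rewrite lee_fin mulr_ge0// sqr_ge0.
  by rewrite integral_wt -EFinM.
rewrite -(ler_pM2l h0).
have -> : h * cmod ((0 +i* - k)%C * A - B) = cmod (h%:C%C * ((0 +i* - k)%C * A - B)).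
  by rewrite cmodM cmod_real gtr0_norm.
have -> : h%:C%C * ((0 +i* - k)%C * A - B) = ft t D xi -
    (expi (- (h * k)) - 1 - (0 +i* (- (h * k)))%C) * A.
  rewrite ftDE (_ : (0 +i* - (h * k))%C = h%:C%C * (0 +i* - k)%C :> R[i]); first by ring.
  by apply: complex_ext; rewrite /=; ring.
apply: le_trans (le_cmodB _ _) _.
have -> : h * ((C * (pi * pi) + 2 * k ^+ 2 * cmod A) * h) =
  C * h ^+ 2 * (pi * pi) + 2 * (- (h * k)) ^+ 2 * cmod A by ring.
by apply: lerD => //; rewrite cmodM ler_wpM2r ?cmod_ge0// cmod_expi_taylor.
Qed.

(** Induction on the order, over all Schwartz functions at once: a factor |xi_j| is paid by one
    derivative of f, and |xi| <= |xi_1| + |xi_2|. *)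
Lemma rapid_ft t f : t != 0 -> schwartz f -> rapid (ft t f).
Proof.
move=> t0 sf N; elim: N f sf => [|N IH] f sf.
  have [M hM] := ft_bound t (cintble_schwartz sf).
  by exists M => xi; rewrite expr0 mul1r.
have [M0 h0] := IH f sf; have [M1 h1] := IH _ (schwartz_cpartial false sf).
have [M2 h2] := IH _ (schwartz_cpartial true sf).
exists (M0 + (M1 + M2) / `|t|) => xi.
have tp : 0 < `|t| by rewrite normr_gt0.
have e0 : 0 <= (1 + enorm xi) ^+ N by rewrite exprn_ge0// addr_ge0 ?enorm_ge0.
have H j : (1 + enorm xi) ^+ N * cmod (ft t (cpartial j f) xi) =
    `|t| * ((1 + enorm xi) ^+ N * (`|coord j xi| * cmod (ft t f xi))).
  by rewrite ft_cpartial// cmodM cmod_imag normrN normrM; ring.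
have a0 := h0 xi.
have a1 : (1 + enorm xi) ^+ N * (`|xi.1| * cmod (ft t f xi)) <= M1 / `|t|.
  by rewrite ler_pdivlMr// mulrC; have := h1 xi; rewrite (H false).
have a2 : (1 + enorm xi) ^+ N * (`|xi.2| * cmod (ft t f xi)) <= M2 / `|t|.
  by rewrite ler_pdivlMr// mulrC; have := h2 xi; rewrite (H true).
rewrite exprSr -mulrA.
apply: (@le_trans _ _ ((1 + enorm xi) ^+ N * ((1 + (`|xi.1| + `|xi.2|)) * cmod (ft t f xi)))).
  by rewrite ler_wpM2l// ler_wpM2r ?cmod_ge0// lerD2l ler_enorm_coord.
rewrite !mulrDl mul1r !mulrDr; apply: lerD => //; exact: lerD.
Qed.

(** The class of transforms of Schwartz functions is stable under partial derivatives, a derivative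
    of a transform being the transform of i t x_j f. *)
Lemma schwartz_ft t f : t != 0 -> schwartz f -> schwartz (ft t f).
Proof.
move=> t0 sf.
apply: (@schwartz_class _ [set h | exists2 g, schwartz g & h = ft t g]); last by exists f.
- move=> _ [g sg ->]; split; last exact: rapid_ft.
  by have [] := ft_diff t sg.
- move=> j _ [g sg ->]; exists (fun x => (0 +i* (t * coord j x))%C * g x).
    exact: schwartz_icoord.
  by have [_ ->] := ft_diff t sg.
Qed.

Lemma cmod_cvg0 (z : nat -> R[i]) : Re (z n) @[n --> \oo] --> 0 -> Im (z n) @[n --> \oo] --> 0 ->
  cmod (z n) @[n --> \oo] --> 0.
Proof.
move=> rz iz.
apply: (@squeeze_cvgr _ _ _ _ (fun _ => 0) (fun n => `|Re (z n)| + `|Im (z n)|)).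
- by apply: nearW => n; rewrite cmod_ge0 cmod_le.
- exact: cvg_cst.
- by rewrite -(addr0 0); apply: cvgD; rewrite -(@normr0 _ R); exact: cvg_norm.
Qed.

Lemma cdiff_seq_cvg f x (y : nat -> plane) : cdiff f -> y n @[n --> \oo] --> x ->
  cmod (f (y n) - f x) @[n --> \oo] --> 0.
Proof.
move=> df yx; have [d1 d2] := df x.
have c1 : (Re \o f) z @[z --> x] --> (Re \o f) x by exact: differentiable_continuous d1.
have c2 : (Im \o f) z @[z --> x] --> (Im \o f) x by exact: differentiable_continuous d2.
apply: cmod_cvg0.
  under eq_fun do rewrite !ReImE.
  by apply/subr_cvg0; exact: cvg_trans (cvg_app _ yx) c1.
under eq_fun do rewrite !ReImE.
by apply/subr_cvg0; exact: cvg_trans (cvg_app _ yx) c2.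
Qed.

(** Damping factor of the inversion integral. Its transform 4 [wt] is nonnegative of mass (2 pi)^2,
    so dilating it gives an approximate identity in space. *)
Let absexp2 (eta : plane) : R := expR (- `|eta.1|) * expR (- `|eta.2|).

Lemma absexp2_itv eta : 0 <= absexp2 eta <= 1.
Proof.
have h (a : R) : 0 <= expR (- `|a|) <= 1 by rewrite expR_ge0 expR_le1 oppr_le0 normr_ge0.
have /andP[a0 a1] := h eta.1; have /andP[b0 b1] := h eta.2.
by rewrite mulr_ge0//= mulr_ile1.
Qed.

Lemma measurable_absexp2 : measurable_fun (setT : set mP) absexp2.
Proof.
by apply: measurable_funM; [exact: (measurableT_comp measurable_absexp measurable_fst)|
  exact: (measurableT_comp measurable_absexp measurable_snd)].
Qed.

Let absexp2E t z eta : expi (t * dotp eta z) * (absexp2 eta)%:C%C =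
  (expi (t * z.1 * eta.1) * (expR (- `|eta.1|))%:C%C) *
  (expi (t * z.2 * eta.2) * (expR (- `|eta.2|))%:C%C).
Proof.
rewrite /absexp2 (_ : t * dotp eta z = t * z.1 * eta.1 + t * z.2 * eta.2).
  by rewrite expiD rmorphM; ring.
by rewrite /dotp; ring.
Qed.

Lemma cintble_absexp2 : cintble leb2 (fun eta : mP => (absexp2 eta)%:C%C).
Proof.
have := cintble_tensor (cintble_expi_absexp (0 : R)) (cintble_expi_absexp (0 : R)).
rewrite (_ : (fun _ => _) = (fun eta : mP => (absexp2 eta)%:C%C))//.
by apply/funext => eta; rewrite !mul0r expi0 !mul1r /absexp2 rmorphM.
Qed.

Lemma ft_absexp2 t z : t ^+ 2 = 1 -> ft t (fun eta => (absexp2 eta)%:C%C) z = (4 * wt z)%:C%C.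
Proof.
move=> t1; rewrite /ft.
under eq_fun do rewrite absexp2E.
rewrite (cintegral_tensor (cintble_expi_absexp (t * z.1)) (cintble_expi_absexp (t * z.2))).
rewrite !cintegral_expi_absexp -rmorphM /wt !exprMn t1 !mul1r.
have -> // : forall a b : R, 2 / a * (2 / b) = 4 * (a^-1 * b^-1) by move=> a b; ring.
Qed.

Lemma cintegral_wt4 : CI (fun z : mP => (4 * wt z)%:C%C) = ((2 * pi) ^+ 2)%:C%C.
Proof.
apply: complex_ext; rewrite /cintegral /=; last by rewrite Rintegral_cst// mul0r.
rewrite /Rintegral; under eq_integral do rewrite /= EFinM.
rewrite ge0_integralZl//; [|by apply/measurable_EFinP; exact: measurable_wt|
  by move=> x _; rewrite lee_fin wt_ge0].
by rewrite integral_wt -EFinM /=; ring.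
Qed.

Lemma cintble_wt4 : cintble leb2 (fun z : mP => (4 * wt z)%:C%C).
Proof.
refine (@le_cintble _ _ _ _ _ (fun x : mP => 4%:E * (wt x)%:E)%E _ _ _ _).
- by apply: cmeas_real; apply: measurable_funM => //; exact: measurable_wt.
- by apply: measurable_funeM; apply/measurable_EFinP; exact: measurable_wt.
- rewrite ge0_integralZl//; [|by apply/measurable_EFinP; exact: measurable_wt|
    by move=> x _; rewrite lee_fin wt_ge0].
  by rewrite integral_wt -EFinM ltry.
- by move=> x; rewrite -EFinM lee_fin cmod_real ger0_norm// mulr_ge0// wt_ge0.
Qed.

Let sc (n : nat) : R := n.+1%:R.

Let cvg_aff_inv x z : (aff x (- (sc n)^-1) z : plane) @[n --> \oo] --> (x : plane).
Proof.
have h (a : R) (b : R) : a + - (sc n)^-1 * b @[n --> \oo] --> a.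
  rewrite -[X in _ --> X]addr0; apply: cvgD; first exact: cvg_cst.
  rewrite -[X in _ --> X](mul0r b); apply: cvgM; last exact: cvg_cst.
  rewrite -oppr0; apply: cvgN; exact: cvg_harmonic.
exact: (cvg_pair (h x.1 z.1) (h x.2 z.2)).
Qed.

(** Approximate identity in rescaled variables: f(x - z/(n+1)) tends to f(x) for each z, and 4 [wt]
    times twice the supremum of |f| dominates. *)
Lemma approx_left f x : schwartz f -> forall e : R, 0 < e -> exists N, forall n, (N <= n)%N ->
  cmod (CI (fun z : mP => f (aff x (- (sc n)^-1) z) * (4 * wt z)%:C%C) -
    f x * ((2 * pi) ^+ 2)%:C%C) <= e.
Proof.
move=> sf e e0; have [M hM] : exists M : R, forall y, cmod (f y) <= M.
  have [M hM] := schwartz_rapid sf 0; exists M => y.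
  by have := hM y; rewrite expr0 mul1r.
have mf : cmeas (f : mP -> R[i]) := schwartz_cmeas sf.
have mfa n : cmeas (fun z : mP => f (aff x (- (sc n)^-1) z)).
  exact: (cmeas_comp (measurable_aff _ _) mf).
have ci n : cintble leb2 (fun z : mP => f (aff x (- (sc n)^-1) z) * (4 * wt z)%:C%C).
  by apply: (@cintble_bM _ _ _ _ _ _ M) => //; exact: cintble_wt4.
pose h n (z : mP) : R := cmod (f (aff x (- (sc n)^-1) z) - f x) * (4 * wt z).
have mw4 : measurable_fun (setT : set mP) (fun z : mP => 4 * wt z).
  by apply: measurable_funM => //; exact: measurable_wt.
have : (\int[leb2]_z (h n z)%:E)%E @[n --> \oo] --> 0%E.
  apply: (@integral_dominated_cvg0 _ _ _ _ _ (fun z : mP => (M + M) * (4 * wt z))).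
  - move=> n; apply: measurable_funM => //; apply: cmeas_cmod; apply: cmeasB => //.
    exact: cmeas_cst.
  - exact: measurable_funM.
  - under eq_integral do rewrite EFinM.
    have i4 : (\int[leb2]_z (4 * @wt R z)%:E < +oo)%E.
      have h4 := cintble_lty cintble_wt4; refine (le_lt_trans _ h4); apply: le_of_eq.
      by apply: eq_integral => z _; rewrite cmod_real ger0_norm// mulr_ge0// wt_ge0.
    have M0 : 0 <= M + M by rewrite addr_ge0// (le_trans _ (hM 0))// cmod_ge0.
    rewrite ge0_integralZl//; [by rewrite lte_mul_pinfty|exact/measurable_EFinP|].
    by move=> z _; rewrite lee_fin mulr_ge0// wt_ge0.
  - move=> n z; have w0 : 0 <= 4 * wt z by rewrite mulr_ge0// wt_ge0.
    rewrite mulr_ge0 ?cmod_ge0//= ler_wpM2r//.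
    by apply: le_trans (le_cmodB _ _) _; exact: lerD.
  - apply: aeW => z; rewrite -(mul0r (4 * wt z)); apply: cvgM; last exact: cvg_cst.
    by apply: cdiff_seq_cvg; [exact: schwartz_cdiff|exact: cvg_aff_inv].
move=> /fine_cvg0_ex/(_ _ e0) => [[n|N hN]].
  apply: integral_ge0 => z _; rewrite lee_fin mulr_ge0 ?cmod_ge0//.
  by rewrite mulr_ge0// wt_ge0.
exists N => n Nn; rewrite -lee_fin; apply: le_trans (hN n Nn).
rewrite -cintegral_wt4 -cintegralZ; last exact: cintble_wt4.
rewrite -cintegralB//; last by apply: cintbleZ; exact: cintble_wt4.
apply: le_trans (cmod_cintegral_le _ _) _.
  apply: cmeasB; apply: (@cintble_meas _ _ _ leb2); first exact: ci.
  by apply: cintbleZ; exact: cintble_wt4.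
apply: le_of_eq; apply: eq_integral => z _; rewrite -mulrBl cmodM cmod_real ger0_norm//.
by rewrite mulr_ge0// wt_ge0.
Qed.

Lemma approx_right t g x : cintble leb2 g -> forall e : R, 0 < e -> exists N, forall n, (N <= n)%N ->
  cmod (CI (fun xi : mP => (absexp2 ((sc n)^-1 *: (xi : plane)))%:C%C * (expi (t * dotp xi x) * g xi)) -
    ft t g x) <= e.
Proof.
move=> cg e e0; have mg := cintble_meas cg.
have mA n : measurable_fun (setT : set mP) (fun xi : mP => absexp2 ((sc n)^-1 *: (xi : plane))).
  have mS : measurable_fun setT (fun xi : mP => (sc n)^-1 *: (xi : plane) : mP).
    have := measurable_aff (0 : plane) (sc n)^-1.
    rewrite (_ : aff _ _ = (fun xi : mP => (sc n)^-1 *: (xi : plane) : mP))//.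
    by apply/funext => xi; rewrite /aff !add0r.
  exact: (measurableT_comp measurable_absexp2 mS).
have cw := cintble_wave t x cg.
have ci n : cintble leb2 (fun xi : mP =>
    (absexp2 ((sc n)^-1 *: (xi : plane)))%:C%C * (expi (t * dotp xi x) * g xi)).
  apply: (@cintble_bM _ _ _ _ _ _ 1) => //; first exact: cmeas_real.
  move=> xi; rewrite cmod_real; have /andP[a b] := absexp2_itv ((sc n)^-1 *: (xi : plane)).
  by rewrite ger0_norm.
pose h n (xi : mP) : R := `|absexp2 ((sc n)^-1 *: (xi : plane)) - 1| * cmod (g xi).
have h0 n xi : 0 <= h n xi by rewrite mulr_ge0 ?cmod_ge0.
have : (\int[leb2]_z (h n z)%:E)%E @[n --> \oo] --> 0%E.
  apply: (@integral_dominated_cvg0 _ _ _ _ _ (fun z : mP => cmod (g z))).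
  - move=> n; apply: measurable_funM; last exact: cmeas_cmod.
    by apply: measurableT_comp => //; exact: measurable_funB.
  - exact: cmeas_cmod.
  - exact: cintble_lty.
  - move=> n xi; rewrite h0/= ler_piMl ?cmod_ge0//.
    have /andP[a b] := absexp2_itv ((sc n)^-1 *: (xi : plane)).
    by rewrite ler_norml; apply/andP; split; lra.
  - apply: aeW => xi; rewrite -(mul0r (cmod (g xi))); apply: cvgM; last exact: cvg_cst.
    rewrite -(@normr0 _ R); apply: cvg_norm; apply/subr_cvg0.
    have hk (a : R) : expR (- `|(sc n)^-1 * a|) @[n --> \oo] --> (1 : R).
      have ca : (sc n)^-1 * a @[n --> \oo] --> (0 : R).
        rewrite -(mul0r a); apply: cvgM; last exact: cvg_cst.
        exact: cvg_harmonic.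
      have := @continuous_absexp R 0; rewrite /continuous_at normr0 oppr0 expR0 => c0.
      exact: cvg_trans (cvg_app _ ca) c0.
    by rewrite -(mulr1 1); apply: cvgM; exact: hk.
move=> /fine_cvg0_ex/(_ _ e0) => [[n|N hN]].
  by apply: integral_ge0 => z _; rewrite lee_fin.
exists N => n Nn; rewrite -lee_fin; apply: le_trans (hN n Nn).
rewrite -cintegralB//; apply: le_trans (cmod_cintegral_le _ _) _.
  by apply: cmeasB; apply: (@cintble_meas _ _ _ leb2).
apply: le_of_eq; apply: eq_integral => z _.
rewrite -[X in _ - X]mul1r -mulrBl !cmodM cmod_expi mul1r.
by rewrite (_ : 1 = (1:R)%:C%C)// -rmorphB cmod_real.
Qed.

(** Fubini for f(x - z/s) exp(i t eta.z) exp(-|eta_1| - |eta_2|) with s = n+1. Integrating first in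
    eta produces the kernel 4 [wt]. Integrating first in z and substituting y = x - z/s, then xi = s
    eta, produces the damped inversion integral; the Jacobians s^2 and s^(-2) cancel. *)
Lemma approx_exchange t f x n : t ^+ 2 = 1 -> schwartz f ->
  CI (fun z : mP => f (aff x (- (sc n)^-1) z) * (4 * wt z)%:C%C) =
  CI (fun xi : mP => (absexp2 ((sc n)^-1 *: (xi : plane)))%:C%C *
     (expi (t * dotp xi x) * ft (- t) f xi)).
Proof.
move=> t1 sf; have cf := cintble_schwartz sf.
have s0 : sc n != 0 by rewrite gt_eqF.
have sN0 : - (sc n)^-1 != 0 by rewrite oppr_eq0 invr_eq0.
have cfa := cintble_aff x sN0 cf.
pose F (p : mP * mP) := f (aff x (- (sc n)^-1) p.1) *
  (expi (t * dotp p.2 p.1) * (absexp2 p.2)%:C%C).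
have mF : cmeas F.
  apply: cmeasM.
    exact: (cmeas_comp (h := fst) _ (cintble_meas cfa)).
  apply: cmeasM; last first.
    by apply: cmeas_real; exact: (measurableT_comp measurable_absexp2).
  apply: cmeas_expi; apply: measurable_funM => //; rewrite /dotp.
  apply: measurable_funD; apply: measurable_funM.
  - exact: (measurableT_comp (f := fst)).
  - exact: (measurableT_comp (f := fst)).
  - exact: (measurableT_comp (f := snd)).
  - exact: (measurableT_comp (f := snd)).
have cF : cintble (lebP \x lebP)%E F.
  apply/cintble_prodP; split => //.
  have i2 := cintble_lty cintble_absexp2.
  set I2 := (X in (X < _)%E) in i2.
  have i2_ge0 : (0 <= I2)%E by apply: integral_ge0 => ? _; rewrite lee_fin cmod_ge0.
  rewrite (eq_integral (fun z : mP => (cmod (f (aff x (- (sc n)^-1) z)))%:E * I2)%E).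
    rewrite ge0_integralZr//; [|exact: (emeas_cmod (cintble_meas cfa))|
      by move=> ? _; rewrite lee_fin cmod_ge0].
    apply: lte_mul_pinfty => //.
      by apply: integral_ge0 => ? _; rewrite lee_fin cmod_ge0.
    rewrite ge0_fin_numE//; last by apply: integral_ge0 => ? _; rewrite lee_fin cmod_ge0.
    exact: (cintble_lty cfa).
  move=> z _; rewrite -ge0_integralZl//; [|exact: (emeas_cmod (cintble_meas cintble_absexp2))|
      by move=> ? _; rewrite lee_fin cmod_ge0|by rewrite lee_fin cmod_ge0].
  by apply: eq_integral => eta _; rewrite /F !cmodM cmod_expi mul1r EFinM.
have -> : CI (fun z : mP => f (aff x (- (sc n)^-1) z) * (4 * wt z)%:C%C) =
   cintegral lebP setT (fun z => cintegral lebP setT (fun eta => F (z, eta))).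
  congr cintegral; apply/funext => z; rewrite -(ft_absexp2 z t1) /ft -cintegralZ//.
  exact: cintble_wave cintble_absexp2.
rewrite (cintegral_exchange cF).
pose G (xi : plane) := (absexp2 ((sc n)^-1 *: xi))%:C%C * (expi (t * dotp xi x) * ft (- t) f xi).
have inner eta : cintegral lebP setT (fun z => F (z, eta)) =
   ((sc n) ^+ 2)%:C%C * G (aff 0 (sc n) eta).
  pose H (y : plane) := expi (- t * dotp y (sc n *: (eta : plane))) * f y.
  have cH : cintble leb2 H by exact: cintble_wave.
  have := cintegral_aff x sN0 cH.
  have -> : (- (sc n)^-1) ^- 2 = (sc n) ^+ 2.
    by rewrite sqrrN -exprVn invrK.
  have -> : ((sc n) ^+ 2)%:C%C * CI H = ((sc n) ^+ 2)%:C%C * ft (- t) f (sc n *: (eta : plane)) by [].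
  have aE : aff 0 (sc n) eta = sc n *: (eta : plane) :> plane by rewrite /aff !add0r.
  rewrite /G aE scalerA mulVf// scale1r => h.
  have FE z : F (z, eta) = ((absexp2 eta)%:C%C * expi (t * dotp (sc n *: (eta : plane)) x)) *
      (H \o aff x (- (sc n)^-1)) z.
    rewrite /F /H /=.
    have -> : t * dotp eta z = t * dotp (sc n *: (eta : plane)) x +
       - t * dotp (aff x (- (sc n)^-1) z) (sc n *: (eta : plane)).
      by rewrite /dotp /aff /= /GRing.scale /=; field.
    by rewrite expiD; ring.
  under eq_fun do rewrite FE.
  by rewrite (cintegralZ _ (cintble_aff x sN0 cH)) h; ring.
under eq_fun do rewrite inner.
have cG : cintble leb2 G.
  apply: (@cintble_bM _ _ _ _ _ _ 1).
  - apply: cmeas_real.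
    have mS : measurable_fun setT (fun xi : mP => (sc n)^-1 *: (xi : plane) : mP).
      have := measurable_aff (0 : plane) (sc n)^-1.
      rewrite (_ : aff _ _ = (fun xi : mP => (sc n)^-1 *: (xi : plane) : mP))//.
      by apply/funext => xi; rewrite /aff !add0r.
    exact: (measurableT_comp measurable_absexp2 mS).
  - move=> xi; rewrite cmod_real; have /andP[a b] := absexp2_itv ((sc n)^-1 *: (xi : plane)).
    by rewrite ger0_norm.
  - apply: cintble_wave; apply: cintble_schwartz; apply: schwartz_ft => //.
    by rewrite oppr_eq0; apply: contra_eq_neq t1 => ->; rewrite expr0n eq_sym oner_eq0.
have cGa := cintble_aff (0 : plane) s0 cG.
rewrite (cintegralZ _ cGa) (cintegral_aff (0 : plane) s0 cG) mulrA -rmorphM.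
by rewrite divff ?expf_neq0// mul1r.
Qed.

(** One and the same damped integral is close to f(x) times (2 pi)^2 by [approx_left] and close to
    the iterated transform by [approx_right]. As t is 1 or -1, both orders of composition are
    covered. *)
Theorem ft_inversion t f x : t ^+ 2 = 1 -> schwartz f ->
  ft t (ft (- t) f) x = ((2 * pi) ^+ 2)%:C%C * f x.
Proof.
move=> t1 sf.
have t0 : - t != 0.
  by rewrite oppr_eq0; apply: contra_eq_neq t1 => ->; rewrite expr0n eq_sym oner_eq0.
apply/eqP; rewrite -subr_eq0; apply/eqP/cmod_eq0/eqP.
rewrite eq_le cmod_ge0 andbT; apply: (@ler0_linear _ 2) => e /andP[e0 _].
have [N1 h1] := approx_left x sf e0.
have [N2 h2] := approx_right t x (cintble_schwartz (schwartz_ft t0 sf)) e0.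
have := h1 _ (leq_maxl N1 N2); have := h2 _ (leq_maxr N1 N2).
rewrite (approx_exchange x _ t1 sf); set A := CI _ => a b.
have -> : ft t (ft (- t) f) x - ((2 * pi) ^+ 2)%:C%C * f x =
  (A - f x * ((2 * pi) ^+ 2)%:C%C) - (A - ft t (ft (- t) f) x) by ring.
by apply: le_trans (le_cmodB _ _) _; lra.
Qed.

End FourierInversion.

(** * Uniqueness of densities *)

Section SigmoidAlgebra.
Context {R : realType}.
Local Notation mR := (measurableTypeR R).
Local Notation mP := (measurableTypeR R * measurableTypeR R)%type.
Local Notation plane := (@Defs.plane R).
Local Notation coord := (@Defs.coord R).
Implicit Types (u v : plane -> R) (x : plane).

(** The logistic function s: its derivative s (1 - s) is again a polynomial in s. *)
Definition sigmoid (t : R) : R := (1 + expR (- t))^-1.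

Lemma sigmoid_den_gt0 (t : R) : 0 < 1 + expR t.
Proof. by rewrite addr_gt0// expR_gt0. Qed.

Lemma sigmoid_itv t : 0 < sigmoid t < 1.
Proof.
rewrite /sigmoid invr_gt0 sigmoid_den_gt0/= invf_lt1 ?sigmoid_den_gt0//.
by rewrite ltrDl expR_gt0.
Qed.

Lemma is_derive_sigmoid k a (t : R) : is_derive t (1 : R) (fun t => sigmoid (k * t + a))
  (k * (sigmoid (k * t + a) * (1 - sigmoid (k * t + a)))).
Proof.
have h := lt0r_neq0 (sigmoid_den_gt0 (- (k * t + a))).
rewrite /sigmoid; apply: is_derive_eq; rewrite /GRing.scale/=.
by field.
Qed.

Lemma sigmoidN t : sigmoid t = 1 - sigmoid (- t).
Proof.
have h1 := lt0r_neq0 (sigmoid_den_gt0 (- t)); have h2 := lt0r_neq0 (sigmoid_den_gt0 t).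
have h3 := lt0r_neq0 (expR_gt0 t); rewrite /sigmoid opprK expRN.
move: h1; rewrite expRN => h1; field.
by apply/andP; split; [exact: h2|exact: h3].
Qed.

(** Both s(t) <= exp(t) and 1 - s(t) = s(-t) <= exp(-t) hold; the sign of t decides which factor is
    estimated and which is bounded by 1. *)
Lemma sigmoid_decay t : sigmoid t * (1 - sigmoid t) <= expR (- `|t|).
Proof.
have e : 1 - sigmoid t = sigmoid (- t) by rewrite sigmoidN subKr.
have le t' : sigmoid t' <= expR t'.
  rewrite /sigmoid -[leRHS]invrK -expRN lef_pV2 ?posrE ?sigmoid_den_gt0 ?expR_gt0//.
  by rewrite lerDr.
rewrite e; have [s1 s2] := andP (sigmoid_itv t); have [s3 s4] := andP (sigmoid_itv (- t)).
have [t0|/ltW t0] := ger0P t.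
  by rewrite -[leRHS]mul1r; apply: ler_pM; [exact: ltW|exact: ltW|exact: ltW|exact: le].
by rewrite opprK -[leRHS]mulr1; apply: ler_pM; [exact: ltW|exact: ltW|exact: le|exact: ltW].
Qed.

(** Bounded smooth functions closed under sums, products and partial derivatives, rich enough to
    approximate indicators of quadrants pointwise. They take the place of compactly supported test
    functions. *)
Inductive sigalg : (plane -> R) -> Prop :=
| sigalg_cst c : sigalg (fun _ => c)
| sigalg_gen j k a : sigalg (fun x => sigmoid (k * coord j x + a))
| sigalg_add u v : sigalg u -> sigalg v -> sigalg (fun x => u x + v x)
| sigalg_mul u v : sigalg u -> sigalg v -> sigalg (fun x => u x * v x).

Let dder u x (e : plane) : differentiable u x -> derivable u x e.
Proof. exact: diff_derivable. Qed.

Lemma sigalg_diff u : sigalg u -> (forall x, differentiable u x).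
Proof.
elim=> [c|j k a|u' v _ du _ dv|u' v _ du _ dv] x.
- exact: differentiable_cst.
- apply: (@differentiable_comp _ _ _ _ (coord j) (fun t => sigmoid (k * t + a))).
    exact: differentiable_coord.
  by apply/derivable1_diffP; have [] := is_derive_sigmoid k a (coord j x).
- exact: differentiableD.
- exact: differentiableM.
Qed.

Lemma sigalg_bounded u : sigalg u -> exists M : R, forall x, `|u x| <= M.
Proof.
elim=> [c|j k a|u' v _ [M1 du] _ [M2 dv]|u' v _ [M1 du] _ [M2 dv]].
- by exists `|c|.
- exists 1 => x; have /andP[a1 a2] := sigmoid_itv (k * coord j x + a).
  by rewrite ger0_norm ltW.
- by exists (M1 + M2) => x; apply: le_trans (ler_normD _ _) _; exact: lerD.
- by exists (M1 * M2) => x; rewrite normrM ler_pM.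
Qed.

Lemma sigalg_derive i u : sigalg u -> exists2 v, sigalg v & forall x, 'D_(basis_vec i) u x = v x.
Proof.
elim=> [c|j k a|u' v su [u1 s1 du] sv [v1 s2 dv]|u' v su [u1 s1 du] sv [v1 s2 dv]].
- by exists (fun _ => 0); [exact: sigalg_cst|move=> x; exact: derive_cst].
- pose g x := sigmoid (k * coord j x + a).
  exists (fun x => (k * (j == i)%:R) * (g x * (1 + (- 1) * g x))).
    apply: sigalg_mul; first exact: sigalg_cst.
    apply: sigalg_mul; first exact: sigalg_gen.
    by apply: sigalg_add; [|apply: sigalg_mul]; [exact: sigalg_cst..|exact: sigalg_gen].
  move=> x; have dg := is_derive_sigmoid k a (coord j x).
  have dd : differentiable (fun t => sigmoid (k * t + a)) (coord j x).
    by apply/derivable1_diffP; case: dg.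
  have dc := differentiable_coord j x.
  rewrite (deriveE _ (differentiable_comp dc dd)) diff_comp//= diff1E//.
  rewrite -(deriveE _ dc) derive_coord derive1E (@derive_val _ _ _ _ _ _ _ dg).
  by rewrite /g /GRing.scale/=; ring.
- exists (fun x => u1 x + v1 x); first exact: sigalg_add.
  move=> x; rewrite -du -dv; apply: deriveD; apply: diff_derivable; exact: sigalg_diff.
- exists (fun x => u' x * v1 x + v x * u1 x).
    by apply: sigalg_add; exact: sigalg_mul.
  move=> x; rewrite -du -dv; apply: deriveM; apply: diff_derivable; exact: sigalg_diff.
Qed.

(** Positive, exponentially decreasing, and with logarithmic derivatives 1 - 2 s in [sigalg]; so the
    products of [window] with elements of [sigalg] are Schwartz and stable under derivation. *)
Definition window x : R := (sigmoid x.1 * (1 - sigmoid x.1)) * (sigmoid x.2 * (1 - sigmoid x.2)).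

Lemma window_gt0 x : 0 < window x.
Proof.
have /andP[a b] := sigmoid_itv x.1; have /andP[c d] := sigmoid_itv x.2.
by rewrite /window !mulr_gt0// subr_gt0.
Qed.

Let sigE j : (fun x => sigmoid (coord j x)) = (fun x => sigmoid (1 * coord j x + 0)).
Proof. by apply/funext => x; rewrite mul1r addr0. Qed.

Lemma sigalg_sig j : sigalg (fun x => sigmoid (coord j x)).
Proof. rewrite sigE; exact: sigalg_gen. Qed.

Lemma sigalg_1Bsig j : sigalg (fun x => 1 - sigmoid (coord j x)).
Proof.
rewrite (_ : (fun x => _) = (fun x => 1 + (-1) * sigmoid (coord j x))); last first.
  by apply/funext => x; rewrite mulN1r.
apply: sigalg_add; first exact: sigalg_cst.
by apply: sigalg_mul; [exact: sigalg_cst|exact: sigalg_sig].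
Qed.

Lemma sigalg_window : sigalg window.
Proof.
apply: (@sigalg_mul (fun x => sigmoid x.1 * (1 - sigmoid x.1))
  (fun x => sigmoid x.2 * (1 - sigmoid x.2))).
- exact: (sigalg_mul (sigalg_sig false) (sigalg_1Bsig false)).
- exact: (sigalg_mul (sigalg_sig true) (sigalg_1Bsig true)).
Qed.

Lemma window_derive j : exists2 v, sigalg v & forall x, 'D_(basis_vec j) window x = window x * v x.
Proof.
exists (fun x => 1 + (-2) * sigmoid (coord j x)).
  apply: sigalg_add; first exact: sigalg_cst.
  by apply: sigalg_mul; [exact: sigalg_cst|exact: sigalg_sig].
move=> x.
have D1 i : differentiable (fun x => sigmoid (coord i x)) x by apply: sigalg_diff; exact: sigalg_sig.
have D2 i : differentiable (fun x => 1 - sigmoid (coord i x)) x by apply: sigalg_diff; exact: sigalg_1Bsig.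
have E i : 'D_(basis_vec j) (fun x => sigmoid (coord i x)) x =
   (i == j)%:R * (sigmoid (coord i x) * (1 - sigmoid (coord i x))).
  have dg := is_derive_sigmoid 1 0 (coord i x).
  have dd : differentiable (fun t : R => sigmoid (1 * t + 0)) (coord i x).
    by apply/derivable1_diffP; case: dg.
  have dc := differentiable_coord i x.
  rewrite sigE (deriveE _ (differentiable_comp dc dd)) diff_comp//= diff1E//.
  rewrite -(deriveE _ dc) derive_coord derive1E (@derive_val _ _ _ _ _ _ _ dg).
  by rewrite /GRing.scale/= mul1r addr0 mul1r.
have E2 i : 'D_(basis_vec j) (fun x => 1 - sigmoid (coord i x)) x =
   - ((i == j)%:R * (sigmoid (coord i x) * (1 - sigmoid (coord i x)))).
  rewrite -E (_ : (fun x => 1 - _) = cst 1 - (fun x => sigmoid (coord i x)))//.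
  rewrite deriveB; [|exact: derivable_cst|exact: dder].
  by rewrite derive_cst sub0r.
have E3 i : 'D_(basis_vec j) (fun x => sigmoid (coord i x) * (1 - sigmoid (coord i x))) x =
   (sigmoid (coord i x) * (1 - sigmoid (coord i x))) * ((i == j)%:R * (1 - 2 * sigmoid (coord i x))).
  rewrite (_ : (fun x => _ * _) = (fun x => sigmoid (coord i x)) * (fun x => 1 - sigmoid (coord i x)))//.
  rewrite (deriveM (dder (D1 i)) (dder (D2 i))) E E2 /GRing.scale/=; ring.
have D3 i : differentiable (fun x => sigmoid (coord i x) * (1 - sigmoid (coord i x))) x.
  exact: differentiableM.
rewrite [X in 'D_(basis_vec j) X x](_ : _ = (fun x => sigmoid (coord false x) * (1 - sigmoid (coord false x))) *
   (fun x => sigmoid (coord true x) * (1 - sigmoid (coord true x))))//.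
rewrite (deriveM (dder (D3 _)) (dder (D3 _))) !E3 /GRing.scale/=.
by rewrite /window; case: j {E E2 E3} => /=; ring.
Qed.

(** From 1 + y <= (N+1) (1 + y/(N+1)) <= (N+1) exp(y/(N+1)), raised to the power N. Dividing by N+1
    rather than N covers N = 0. *)
Lemma exprn1D_le_expR (N : nat) (y : R) : 0 <= y -> (1 + y) ^+ N <= N.+1%:R ^+ N * expR y.
Proof.
move=> y0; have n0 : (0 : R) < N.+1%:R by rewrite ltr0n.
have h : 1 + y <= N.+1%:R * expR (y / N.+1%:R).
  apply: (@le_trans _ _ (N.+1%:R * (1 + y / N.+1%:R))).
    rewrite mulrDr mulr1 mulrC divfK ?gt_eqF// lerD2r.
    by rewrite -[leLHS]/(1%:R) ler_nat.
  apply: ler_wpM2l; [exact: ltW|exact: expR_ge1Dx].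
apply: (@le_trans _ _ ((N.+1%:R * expR (y / N.+1%:R)) ^+ N)).
  by rewrite lerXn2r// ?nnegrE ?addr_ge0// mulr_ge0 ?expR_ge0// ltW.
rewrite exprMn; apply: ler_wpM2l; first by rewrite exprn_ge0// ltW.
rewrite -expRM_natl ler_expR.
rewrite mulrA ler_pdivrMr// mulrC; apply: ler_wpM2l => //.
by rewrite ler_nat.
Qed.

Lemma window_rapid (N : nat) : exists M : R, forall x, (1 + enorm x) ^+ N * window x <= M.
Proof.
exists (N.+1%:R ^+ N * N.+1%:R ^+ N) => x.
have c0 : (0 : R) <= N.+1%:R ^+ N by rewrite exprn_ge0.
have h : 1 + enorm x <= (1 + `|x.1|) * (1 + `|x.2|).
  by have := ler_enorm_coord x; have := normr_ge0 x.1; have := normr_ge0 x.2; nra.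
apply: (@le_trans _ _ (((1 + `|x.1|) * (1 + `|x.2|)) ^+ N * (expR (- `|x.1|) * expR (- `|x.2|)))).
  apply: ler_pM.
  - by rewrite exprn_ge0// addr_ge0// enorm_ge0.
  - by rewrite ltW// window_gt0.
  - by rewrite lerXn2r// nnegrE ?mulr_ge0 ?addr_ge0 ?enorm_ge0.
  - have := window_gt0 x; rewrite /window => w0.
    have /andP[a b] := sigmoid_itv x.1; have /andP[c d] := sigmoid_itv x.2.
    have h0 t : 0 <= sigmoid t * (1 - sigmoid t).
      by have /andP[? ?] := sigmoid_itv t; rewrite mulr_ge0 ?subr_ge0 ?ltW.
    by apply: ler_pM => //; exact: sigmoid_decay.
rewrite exprMn mulrACA; apply: ler_pM.
- by rewrite mulr_ge0 ?exprn_ge0 ?addr_ge0 ?expR_ge0.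
- by rewrite mulr_ge0 ?exprn_ge0 ?addr_ge0 ?expR_ge0.
- by rewrite expRN ler_pdivrMr ?expR_gt0// exprn1D_le_expR.
- by rewrite expRN ler_pdivrMr ?expR_gt0// exprn1D_le_expR.
Qed.

Lemma schwartz_window u : sigalg u -> schwartz (fun x => (window x * u x)%:C%C).
Proof.
move=> su; apply: (@schwartz_class _ [set f | exists2 u, sigalg u & f = (fun x => (window x * u x)%:C%C)]);
  last by exists u.
- move=> _ [v sv ->]; split.
    by apply: cdiff_real; apply: sigalg_diff; apply: sigalg_mul => //; exact: sigalg_window.
  move=> N; have [M hM] := window_rapid N; have [C hC] := sigalg_bounded sv.
  exists (M * C) => x; rewrite cmod_real normrM mulrA ler_pM//.
    by rewrite mulr_ge0// exprn_ge0// addr_ge0// enorm_ge0.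
  by rewrite gtr0_norm// window_gt0.
- move=> j _ [v sv ->]; have [v1 s1 d1] := sigalg_derive j sv.
  have [w1 sw dw] := window_derive j.
  exists (fun x => w1 x * v x + v1 x).
    by apply: sigalg_add => //; exact: sigalg_mul.
  rewrite cpartial_real; apply/funext => x; congr (_%:C)%C.
  rewrite (_ : (fun x => window x * v x) = window * v)//.
  rewrite (deriveM (dder (sigalg_diff sigalg_window x)) (dder (sigalg_diff sv x))).
  by rewrite dw d1 /GRing.scale/=; ring.
Qed.

End SigmoidAlgebra.

(** * From test functions to quadrants, and from quadrants to measurable sets *)

Section Quadrants.
Context {R : realType}.
Local Notation mR := (measurableTypeR R).
Local Notation mP := (measurableTypeR R * measurableTypeR R)%type.
Local Notation plane := (@Defs.plane R).
Local Notation coord := (@Defs.coord R).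
Local Notation CI := (cintegral leb2 setT).

Definition quadrant (a c : R) : set mP := [set x : mP | a <= x.1 /\ c <= x.2].

Definition quadrants : set (set mP) := [set A | exists a c, A = quadrant a c].

Lemma measurable_quadrant a c : measurable (quadrant a c).
Proof.
have -> : quadrant a c = (fst @^-1` `[a, +oo[) `&` (snd @^-1` `[c, +oo[).
  by apply/seteqP; split => x; rewrite /quadrant /= !in_itv/= !andbT.
by apply: measurableI; rewrite -[X in measurable X]setTI; [exact: measurable_fst|exact: measurable_snd].
Qed.

Let R_nat_lower (z : R) : exists n : nat, - n%:R <= z.
Proof.
exists (Num.truncn `|z|).+1; rewrite lerNl (le_trans (ler_norm _))// normrN ltW//.
by rewrite truncnS_gt.
Qed.

(** A closed half-plane is the countable union of the quadrants whose other corner coordinate is -n,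
    so both coordinates are measurable for the generated sigma-algebra. *)
Lemma measurable_plane_quadrants : @measurable _ mP = <<s quadrants >>.
Proof.
apply/seteqP; split; last first.
  apply: smallest_sub; first exact: sigma_algebra_measurable.
  by move=> _ [a [c ->]]; exact: measurable_quadrant.
pose T' := g_sigma_algebraType quadrants.
have m1 : measurable_fun (setT : set T') (fst : T' -> mR).
  apply: (measurability _ (RGenCInfty.measurableE R)) => _ [_ [a ->] <-].
  rewrite setTI (_ : fst @^-1` _ = \bigcup_n quadrant a (- n%:R)).
    by apply: bigcupT_measurable => n; apply: sub_sigma_algebra; do 2 eexists.
  apply/seteqP; split => x; rewrite /= in_itv/= andbT.
    by move=> ax; have [n hn] := R_nat_lower x.2; exists n.
  by move=> [n _ []].
have m2 : measurable_fun (setT : set T') (snd : T' -> mR).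
  apply: (measurability _ (RGenCInfty.measurableE R)) => _ [_ [a ->] <-].
  rewrite setTI (_ : snd @^-1` _ = \bigcup_n quadrant (- n%:R) a).
    by apply: bigcupT_measurable => n; apply: sub_sigma_algebra; do 2 eexists.
  apply/seteqP; split => x; rewrite /= in_itv/= andbT.
    by move=> ax; have [n hn] := R_nat_lower x.1; exists n.
  by move=> [n _ []].
have m12 := measurable_fun_pair m1 m2.
move=> A mA; have := m12 measurableT A mA; rewrite setTI.
by congr (<<s _ >> _); apply/seteqP; split => -[].
Qed.

(** Dynkin's argument: quadrants are stable under intersection, and the sets over which r integrates
    to 0 are stable under complement, as the total integral is 0, and under disjoint countable
    union. *)
Lemma integral_quadrants_ae0 (r : mP -> R) : leb2.-integrable setT (EFin \o r) ->
  (\int[leb2]_x (r x)%:E = 0)%E ->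
  (forall a c, \int[leb2]_(x in quadrant a c) (r x)%:E = 0)%E -> ae_eq leb2 setT r (cst 0).
Proof.
move=> ir r0 rq.
have P B : <<s quadrants >> B -> (\int[leb2]_(x in B) (r x)%:E = 0)%E.
  apply: (@dynkin_induction _ mP quadrants (fun A => (\int[leb2]_(x in A) (r x)%:E = 0)%E)).
  - exact: measurable_plane_quadrants.
  - move=> _ _ [a1 [c1 ->]] [a2 [c2 ->]].
    exists (Num.max a1 a2), (Num.max c1 c2); apply/seteqP; split => x; rewrite /quadrant /= !ge_max.
      by move=> [[-> ->] [-> ->]].
    by move=> [/andP[-> ->] /andP[-> ->]].
  - exact: r0.
  - by move=> _ [a [c ->]]; exact: rq.
  - move=> A mA /= rA; have := r0; rewrite -(setUv A) integral_setU//.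
    + by rewrite rA add0e.
    + exact: measurableC.
    + by rewrite setUv; exact: measurable_int ir.
    + exact/disj_setPCl.
  - move=> F mF tF h /=; rewrite integral_bigcup//.
      by rewrite eseries0// => n _ _; exact: h.
    by apply: integrableS ir => //; exact: bigcupT_measurable.
have : ae_eq leb2 setT (EFin \o r) (EFin \o cst 0).
  apply: (integral_ae_eq measurableT ir) => [|A _ mA]; first by apply/measurable_EFinP; exact: measurable_cst.
  by rewrite integral0; apply: P; rewrite -measurable_plane_quadrants.
by apply: filterS => x /(_ I) h _; case: (h).
Qed.

(** The argument is n^2 (y - a) + n. The extra n forces the limit 1 at y = a itself, so that the
    limit is the indicator of the closed half-line everywhere and not merely almost everywhere. *)
Let step (n : nat) (a y : R) : R := sigmoid ((n%:R ^+ 2) * y + (n%:R - n%:R ^+ 2 * a)).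

Let expR_cvg0 (u : nat -> R) : u n @[n --> \oo] --> +oo%R -> expR (- u n) @[n --> \oo] --> (0 : R).
Proof.
move=> uoo; apply/cvgrPdist_le => e e0.
have /cvgryPge/(_ (e^-1)) := uoo; apply: filterS => n hn.
rewrite sub0r normrN ger0_norm ?expR_ge0// expRN -[leRHS]invrK lef_pV2 ?posrE ?expR_gt0 ?invr_gt0//.
by apply: le_trans hn (le_trans _ (expR_ge1Dx _)); rewrite lerDr.
Qed.

Let sigmoid_cvg1 (u : nat -> R) : u n @[n --> \oo] --> +oo%R -> sigmoid (u n) @[n --> \oo] --> (1 : R).
Proof.
move=> uoo; rewrite /sigmoid -[X in _ --> X]invr1; apply: cvgV; first exact: oner_neq0.
by rewrite -[X in _ --> X]addr0; apply: cvgD; [exact: cvg_cst|exact: expR_cvg0].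
Qed.

Let step_cvg a y : step n a y @[n --> \oo] --> ((a <= y)%R%:R : R).
Proof.
have idoo : (n%:R : R) @[n --> \oo] --> +oo%R by exact: cvgr_idn.
have [ay|ya] := lerP a y.
  apply: sigmoid_cvg1; apply/cvgryPge => M.
  have /cvgryPge/(_ M) := idoo; apply: filterS => n Mn.
  have h : 0 <= (n%:R ^+ 2 : R) * (y - a) by rewrite mulr_ge0 ?exprn_ge0 ?subr_ge0.
  have -> : n%:R ^+ 2 * y + (n%:R - n%:R ^+ 2 * a) = n%:R + n%:R ^+ 2 * (y - a) by ring.
  by rewrite (le_trans Mn)// lerDl.
have -> : (fun n => step n a y) =
    (fun n => 1 - sigmoid (- (n%:R ^+ 2 * y + (n%:R - n%:R ^+ 2 * a)))).
  by apply/funext => n; rewrite /step sigmoidN.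
rewrite -[X in _ --> X](subrr (1 : R)); apply: cvgB; first exact: cvg_cst.
apply: sigmoid_cvg1; apply/cvgryPge => M.
have d0 : 0 < a - y by rewrite subr_gt0.
have /cvgryPge/(_ ((`|M| + 1) / (a - y) + (a - y)^-1 + 1)) := idoo; apply: filterS => n Mn.
have n1 : 1 <= (n%:R : R).
  apply: le_trans Mn; rewrite lerDr addr_ge0 ?invr_ge0 ?divr_ge0 ?ltW ?addr_ge0//.
have h : `|M| + 1 + 1 <= (a - y) * n%:R.
  rewrite -ler_pdivrMl//; apply: le_trans Mn.
  by rewrite mulrDr mulr1 [_^-1 * _]mulrC lerDl.
have -> : - (n%:R ^+ 2 * y + (n%:R - n%:R ^+ 2 * a)) = n%:R * ((a - y) * n%:R - 1) by ring.
apply: (@le_trans _ _ (1 * (`|M| + 1))); first by rewrite mul1r (le_trans (ler_norm M))// lerDl.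
by apply: ler_pM => //; rewrite ?addr_ge0//; lra.
Qed.

Lemma quadrant_sigmoid_cvg a c (x : plane) :
  (step n a x.1 * step n c x.2) @[n --> \oo] --> (\1_(quadrant a c) x : R).
Proof.
have -> : (\1_(quadrant a c) x : R) = (a <= x.1)%R%:R * (c <= x.2)%R%:R.
  rewrite indicE -natrM mulnb; congr (nat_of_bool _)%:R.
  apply/idP/idP => [/set_mem[-> ->]//|/andP[? ?]]; exact/mem_set.
by apply: cvgM; exact: step_cvg.
Qed.

Lemma sigalg_step n a c : sigalg (fun x : plane => step n a x.1 * step n c x.2).
Proof.
exact: (sigalg_mul (sigalg_gen false (n%:R ^+ 2) (n%:R - n%:R ^+ 2 * a))
  (sigalg_gen true (n%:R ^+ 2) (n%:R - n%:R ^+ 2 * c))).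
Qed.

Lemma sigalg_measurable (u : plane -> R) : sigalg u -> measurable_fun (setT : set mP) (u : mP -> R).
Proof.
move=> su; apply: continuous_measurable_plane => x; apply: differentiable_continuous.
exact: sigalg_diff.
Qed.

(** The indicator is a pointwise limit of [sigalg] functions with values in [0, 1], and |h|
    dominates the differences. *)
Lemma cintegral_sigalg_quadrant (h : mP -> R[i]) a c : cintble leb2 h ->
  (forall u, sigalg u -> CI (fun x => (u x)%:C%C * h x) = 0) ->
  CI (fun x => (\1_(quadrant a c) x : R)%:C%C * h x) = 0.
Proof.
move=> ch h0; have mh := cintble_meas ch.
pose q (x : mP) : R := \1_(quadrant a c) x.
have mq : measurable_fun setT q by apply: measurable_indic; exact: measurable_quadrant.
pose s n (x : mP) : R := step n a x.1 * step n c x.2.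
have ms n : measurable_fun setT (s n) by apply: sigalg_measurable; exact: sigalg_step.
have s01 n x : 0 <= s n x <= 1.
  have /andP[a1 a2] := sigmoid_itv ((n%:R ^+ 2) * x.1 + (n%:R - n%:R ^+ 2 * a)).
  have /andP[a3 a4] := sigmoid_itv ((n%:R ^+ 2) * x.2 + (n%:R - n%:R ^+ 2 * c)).
  rewrite /s /step; apply/andP; split; first by rewrite mulr_ge0// ltW.
  by apply: mulr_ile1; exact: ltW.
have q01 x : 0 <= q x <= 1 by rewrite /q indicE; case: (_ \in _); rewrite /= ?lexx ?ler01.
have cq : cintble leb2 (fun x => (q x)%:C%C * h x).
  apply: (@cintble_bM _ _ _ _ _ _ 1) => //; first exact: cmeas_real.
  by move=> x; have /andP[? ?] := q01 x; rewrite cmod_real ger0_norm.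
have cs n : cintble leb2 (fun x => (s n x)%:C%C * h x).
  apply: (@cintble_bM _ _ _ _ _ _ 1) => //; first exact: cmeas_real.
  by move=> x; have /andP[? ?] := s01 n x; rewrite cmod_real ger0_norm.
pose d n x := `|s n x - q x| * cmod (h x).
have : (\int[leb2]_z (d n z)%:E)%E @[n --> \oo] --> 0%E.
  apply: (@integral_dominated_cvg0 _ _ _ _ _ (fun z : mP => cmod (h z))).
  - move=> n; apply: measurable_funM; last exact: cmeas_cmod.
    by apply: measurableT_comp => //; exact: measurable_funB.
  - exact: cmeas_cmod.
  - exact: cintble_lty.
  - move=> n x; rewrite mulr_ge0 ?cmod_ge0//= ler_piMl ?cmod_ge0//.
    have /andP[? ?] := q01 x; have /andP[? ?] := s01 n x.
    by rewrite ler_norml; apply/andP; split; lra.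
  - apply: aeW => x; rewrite -(mul0r (cmod (h x))); apply: cvgM; last exact: cvg_cst.
    rewrite -(@normr0 _ R); apply: cvg_norm; apply/subr_cvg0.
    exact: (@quadrant_sigmoid_cvg a c x).
move=> /fine_cvg0_ex dN; apply: cmod_eq0; apply/eqP; rewrite eq_le cmod_ge0 andbT.
apply: (@ler0_linear _ _ 1) => e /andP[e0 _]; rewrite mul1r.
have [|N hN] := dN _ _ e0.
  by move=> n; apply: integral_ge0 => z _; rewrite lee_fin mulr_ge0 ?cmod_ge0.
rewrite -lee_fin; apply: le_trans (hN _ (leqnn N)).
have -> : CI (fun x => (q x)%:C%C * h x) = CI (fun x => (q x)%:C%C * h x - (s N x)%:C%C * h x).
  by rewrite cintegralB// (h0 _ (sigalg_step N a c)) subr0.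
apply: le_trans (cmod_cintegral_le _ _) _.
  by apply: cmeasB; apply: (@cintble_meas _ _ _ leb2).
apply: le_of_eq; apply: eq_integral => z _.
by rewrite -mulrBl cmodM -rmorphB cmod_real distrC.
Qed.

Lemma sigalg_ae0 (h : mP -> R[i]) : cintble leb2 h ->
  (forall u, sigalg u -> CI (fun x => (u x)%:C%C * h x) = 0) -> ae_eq leb2 setT h (cst 0).
Proof.
move=> ch h0; have [c1 c2] := ch.
have hT : CI h = 0.
  by rewrite -[RHS](h0 _ (sigalg_cst 1)); congr cintegral; apply/funext => x; rewrite mul1r.
have hQ a c := cintegral_sigalg_quadrant a c ch h0.
have fin (r : mP -> R) A : measurable A -> leb2.-integrable setT (EFin \o r) ->
    Rintegral leb2 setT (fun x => \1_A x * r x) = 0 -> (\int[leb2]_(x in A) (r x)%:E = 0)%E.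
  move=> mA ir E.
  have <- : (\int[leb2]_x (\1_A x * r x)%:E = \int[leb2]_(x in A) (r x)%:E)%E.
    rewrite [RHS]integral_mkcond; apply: eq_integral => x _; rewrite restrict_EFin/= patchE indicE.
    by case: (x \in A); rewrite ?mul1r ?mul0r.
  have := E; rewrite /Rintegral => E'; rewrite -(fineK (x := \int[leb2]_x _)%E) ?E'//.
  rewrite (_ : (\int[leb2]_x _)%E = (\int[leb2]_(x in A) (EFin \o r) x)%E); last first.
    rewrite [RHS]integral_mkcond; apply: eq_integral => x _; rewrite restrict_EFin/= patchE indicE.
    by case: (x \in A); rewrite ?mul1r ?mul0r.
  by apply: integrable_fin_num => //; apply: integrableS ir.
have key (r : mP -> R) : leb2.-integrable setT (EFin \o r) -> Rintegral leb2 setT r = 0 ->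
    (forall a c, Rintegral leb2 setT (fun x => \1_(quadrant a c) x * r x) = 0) ->
    ae_eq leb2 setT r (cst 0).
  move=> ir r0 rq; apply: integral_quadrants_ae0 => //.
    by apply: fin => //; rewrite -[RHS]r0; congr Rintegral; apply/funext => x; rewrite indicT mul1r.
  by move=> a c; apply: fin => //; exact: measurable_quadrant.
have e1 : ae_eq leb2 setT (@complex.Re R \o h) (cst 0).
  apply: key => //; first by move: hT => [].
  move=> a c; have := hQ a c => -[+ _]; rewrite /Rintegral => <-; congr fine.
  by apply: eq_integral => x _ /=; rewrite ReImE/= mul0r subr0.
have e2 : ae_eq leb2 setT (@complex.Im R \o h) (cst 0).
  apply: key => //; first by move: hT => [].
  move=> a c; have := hQ a c => -[_]; rewrite /Rintegral => <-; congr fine.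
  by apply: eq_integral => x _ /=; rewrite ReImE/= mul0r addr0.
move: e1 e2; apply: filterS2 => x a b _.
by apply: complex_ext; [exact: a|exact: b].
Qed.

(* Testing against [window * u] is testing the integrable function [window * g] against [u]. *)
Lemma schwartz_ae0 (g : mP -> R[i]) :
  (forall f, schwartz f -> cintble leb2 (fun x => g x * f x) /\ CI (fun x => g x * f x) = 0) ->
  ae_eq leb2 setT g (cst 0).
Proof.
move=> H; pose h (x : mP) := (window x)%:C%C * g x.
have E u x : g x * (window x * u x)%:C%C = (u x)%:C%C * h x.
  by rewrite /h rmorphM /=; ring.
have ch : cintble leb2 h.
  have [c _] := H _ (schwartz_window (sigalg_cst 1)).
  by move: c; under eq_fun do rewrite E mul1r.
have h0 : ae_eq leb2 setT h (cst 0).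
  apply: sigalg_ae0 => // u su; have [_ <-] := H _ (schwartz_window su).
  by congr cintegral; apply/funext => x; rewrite E.
apply: filterS h0 => x hx _; have := hx I; rewrite /h /= => /eqP.
rewrite mulf_eq0 => /orP[|/eqP//] /eqP/(congr1 (@complex.Re R))/= w0.
by have := window_gt0 x; rewrite w0 ltxx.
Qed.

End Quadrants.

(** * Distributions with a Fourier density *)

Section Tame.
Context {R : realType}.
Local Notation mR := (measurableTypeR R).
Local Notation mP := (measurableTypeR R * measurableTypeR R)%type.
Local Notation plane := (@Defs.plane R).
Local Notation coord := (@Defs.coord R).
Local Notation CI := (cintegral leb2 setT).
Implicit Types (f : plane -> R[i]) (g h : mP -> R[i]) (S T : @dist R).

Lemma measurable_enorm : measurable_fun setT (fun x : mP => enorm x : mR).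
Proof.
rewrite (_ : (fun x : mP => _) = Num.sqrt \o (fun x : mP => x.1 ^+ 2 + x.2 ^+ 2))//.
apply: measurableT_comp; first by apply: continuous_measurable_fun; exact: sqrt_continuous.
by apply: measurable_funD; apply: measurable_funX.
Qed.

Lemma enorm1_gt0 (x : plane) : 0 < 1 + enorm x.
Proof. by rewrite ltr_pwDl// enorm_ge0. Qed.

Lemma measurable_enorm1V : measurable_fun setT (fun x : mP => (1 + enorm x)^-1 : mR).
Proof.
have e : (fun x : mP => (1 + enorm x)^-1) = (@GRing.inv R) \o (fun x : mP => 1 + enorm x) by [].
rewrite e; apply: (measurable_comp (F := [set y : R | 0 < y])).
- by rewrite (_ : [set y : R | 0 < y] = `]0, +oo[%classic)//; apply/seteqP; split => x /=; rewrite in_itv/= andbT.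
- by move=> _ [x _ <-] /=; exact: enorm1_gt0.
- apply: open_continuous_measurable_fun; first exact: open_gt.
  by move=> y /set_mem /= y0; apply: inv_continuous; rewrite gt_eqF.
- by apply: measurable_funD => //; exact: measurable_enorm.
Qed.

(** The fourth power is integrable on the plane and still absorbs one factor |x|; every Schwartz
    function is at most a multiple of it. *)
Definition tamew (x : plane) : R := (1 + enorm x)^-1 ^+ 4.

Lemma tamew_gt0 x : 0 < tamew x.
Proof. by rewrite exprn_gt0// invr_gt0 enorm1_gt0. Qed.

Lemma tamew_ge0 x : 0 <= tamew x.
Proof. exact: ltW (tamew_gt0 x). Qed.

Lemma tamew_le1 x : tamew x <= 1.
Proof.
apply: exprn_ile1; first by rewrite invr_ge0 ltW// enorm1_gt0.
by rewrite invf_le1 ?enorm1_gt0// lerDl enorm_ge0.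
Qed.

Lemma enorm_tamew_le1 x : enorm x * tamew x <= 1.
Proof.
have h := enorm1_gt0 x; have i0 : 0 <= (1 + enorm x)^-1 by rewrite invr_ge0 ltW.
have i1 : (1 + enorm x)^-1 <= 1 by rewrite invf_le1// lerDl enorm_ge0.
rewrite /tamew exprS mulrA; apply: mulr_ile1 => //.
- by rewrite mulr_ge0 ?enorm_ge0.
- by rewrite exprn_ge0.
- by rewrite ler_pdivrMr// mul1r lerDr.
- by rewrite exprn_ile1.
Qed.

(* The growth allowed for spectra and densities: it covers bounded functions, and integrable
   functions multiplied by [|xi|] (the derivatives and the nonlinearity lose one power of [|xi|]). *)
Definition tame g : Prop :=
  cmeas g /\ (\int[leb2]_x (cmod (g x) * tamew x)%:E < +oo)%E.

Lemma measurable_cmod_tamew g : cmeas g ->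
  measurable_fun setT (fun x : mP => cmod (g x) * tamew x : mR).
Proof.
move=> mg; apply: measurable_funM; first exact: cmeas_cmod.
by apply: measurable_funX; exact: measurable_enorm1V.
Qed.

Lemma le_tame g (u : mP -> R) : cmeas g -> measurable_fun setT u -> (\int[leb2]_x (u x)%:E < +oo)%E ->
  (forall x, cmod (g x) * tamew x <= u x) -> tame g.
Proof.
move=> mg mu uoo gu; split => //; apply: le_lt_trans uoo.
apply: ge0_le_integral => //.
- by move=> x _; rewrite lee_fin mulr_ge0 ?cmod_ge0// tamew_ge0.
- by apply/measurable_EFinP; exact: measurable_cmod_tamew.
- exact/measurable_EFinP.
- by move=> x _; rewrite lee_fin.
Qed.

Lemma le_tame_tame g h (M : R) : cmeas g -> tame h -> 0 <= M ->
  (forall x, cmod (g x) <= M * cmod (h x)) -> tame g.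
Proof.
move=> mg [mh ih] M0 gh.
have m1 := measurable_cmod_tamew mh.
apply: (@le_tame g (fun x => M * (cmod (h x) * tamew x))) => //.
- exact: measurable_funM.
- under eq_integral do rewrite EFinM.
  rewrite ge0_integralZl//; [exact: lte_mul_pinfty|exact/measurable_EFinP|].
  by move=> x _; rewrite lee_fin mulr_ge0 ?cmod_ge0// tamew_ge0.
- by move=> x; rewrite mulrA ler_wpM2r ?tamew_ge0.
Qed.

Lemma cintble_tame g : cintble leb2 g -> tame g.
Proof.
move=> cg; have mg := cintble_meas cg.
apply: (@le_tame g (fun x => cmod (g x))) => //; [exact: cmeas_cmod|exact: cintble_lty|].
by move=> x; rewrite ler_piMr ?cmod_ge0// tamew_le1.
Qed.

Lemma bounded_tame g (M : R) : cmeas g -> (forall x, cmod (g x) <= M) -> tame g.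
Proof.
move=> mg gM; have M0 : 0 <= M by apply: le_trans (cmod_ge0 _) (gM 0).
apply: (@le_tame g (fun x => M * wt x)) => //.
- by apply: measurable_funM => //; exact: measurable_wt.
- under eq_integral do rewrite EFinM.
  rewrite ge0_integralZl//; [rewrite integral_wt -EFinM ltry//|by apply/measurable_EFinP; exact: measurable_wt|].
  by move=> x _; rewrite lee_fin wt_ge0.
- move=> x; apply: ler_pM; rewrite ?cmod_ge0 ?tamew_ge0//.
  by rewrite /tamew exprVn ler_wt.
Qed.

Lemma cintble_tame_icoord j g : cintble leb2 g -> tame (fun x => (0 +i* coord j x)%C * g x).
Proof.
move=> cg; have mg := cintble_meas cg.
apply: (@le_tame _ (fun x => cmod (g x))) => //; [|exact: cmeas_cmod|exact: cintble_lty|].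
  apply: cmeasM => //; apply: cmeas_pair; first exact: measurable_cst.
  by case: (j); [exact: measurable_snd|exact: measurable_fst].
move=> x; rewrite cmodM cmod_imag mulrAC ler_piMl ?cmod_ge0//.
apply: le_trans (enorm_tamew_le1 x); rewrite ler_wpM2r ?tamew_ge0//; exact: ler_coord_enorm.
Qed.

Lemma tameD g h : tame g -> tame h -> tame (fun x => g x + h x).
Proof.
move=> [mg ig] [mh ih].
have m1 := measurable_cmod_tamew mg; have m2 := measurable_cmod_tamew mh.
apply: (@le_tame _ (fun x => cmod (g x) * tamew x + cmod (h x) * tamew x)).
- exact: cmeasD.
- exact: measurable_funD.
- under eq_integral do rewrite EFinD.
  rewrite ge0_integralD//; first exact: lte_add_pinfty.
  + by move=> x _; rewrite lee_fin mulr_ge0 ?cmod_ge0// tamew_ge0.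
  + exact/measurable_EFinP.
  + by move=> x _; rewrite lee_fin mulr_ge0 ?cmod_ge0// tamew_ge0.
  + exact/measurable_EFinP.
- by move=> x; rewrite -mulrDl ler_wpM2r ?tamew_ge0// le_cmodD.
Qed.

Lemma tameN g : tame g -> tame (fun x => - g x).
Proof.
move=> tg; apply: (@le_tame_tame _ g 1) => //; first by apply: cmeasN; case: tg.
by move=> x; rewrite cmodN mul1r.
Qed.

Lemma tame_bM m g (M : R) : cmeas m -> (forall x, cmod (m x) <= M) -> tame g ->
  tame (fun x => m x * g x).
Proof.
move=> mm mM tg; apply: (@le_tame_tame _ g M) => //.
- by apply: cmeasM => //; case: tg.
- by apply: le_trans (cmod_ge0 _) (mM 0).
- by move=> x; rewrite cmodM ler_wpM2r ?cmod_ge0.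
Qed.

Lemma tame_ae g h : tame g -> cmeas h -> ae_eq leb2 setT g h -> tame h.
Proof.
move=> [mg ig] mh gh; split => //.
have m1 := measurable_cmod_tamew mg; have m2 := measurable_cmod_tamew mh.
rewrite (ae_eq_integral (fun x => (cmod (g x) * tamew x)%:E))//.
- exact/measurable_EFinP.
- exact/measurable_EFinP.
- by apply: filterS gh => x /[apply] ->.
Qed.

Lemma tame_pairing g f : tame g -> schwartz f -> cintble leb2 (fun x : mP => g x * f x).
Proof.
move=> [mg ig] sf; have [M hM] := schwartz_rapid sf 4.
have m1 := measurable_cmod_tamew mg.
have M0 : 0 <= M by apply: le_trans (hM 0); rewrite mulr_ge0 ?cmod_ge0// exprn_ge0// ltW// enorm1_gt0.
refine (@le_cintble _ _ _ _ _ (fun x : mP => M%:E * (cmod (g x) * tamew x)%:E)%E _ _ _ _).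
- by apply: cmeasM => //; exact: schwartz_cmeas.
- by apply: emeasurable_funM; [exact: measurable_cst|exact/measurable_EFinP].
- rewrite ge0_integralZl//; [exact: lte_mul_pinfty|exact/measurable_EFinP|].
  by move=> x _; rewrite lee_fin mulr_ge0 ?cmod_ge0// tamew_ge0.
- move=> x; rewrite -EFinM lee_fin cmodM mulrCA ler_wpM2l ?cmod_ge0//.
  by rewrite /tamew exprVn ler_pdivlMr ?exprn_gt0 ?enorm1_gt0// mulrC.
Qed.

Lemma ler_enorm_norm (x : plane) : enorm x <= 2 * `|x|.
Proof.
apply: le_trans (ler_enorm_coord x) _.
by rewrite mulr_natl mulr2n lerD// prod_normE le_max lexx ?orbT.
Qed.

Lemma tame_locally_cintegrable g : tame g -> locally_cintegrable g.
Proof.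
move=> [[g1 g2] ig]; have mg : cmeas g by split.
have m1 := measurable_cmod_tamew mg.
split => // K cK; have mK : measurable (K : set mP).
  have oK : open (~` K : set plane).
    by apply: closed_openC; apply: compact_closed cK; exact: norm_hausdorff.
  by rewrite -(setCK K); apply: measurableC; exact: open_measurable_plane.
have [M [_ hM]] := compact_bounded cK.
have {}hM (x : plane) : K x -> `|x| <= M + 1 by move=> Kx; apply: (hM (M + 1)) => //; rewrite ltrDl.
(* Inverse of a lower bound of [tamew] on K: the maximum norm is at most M + 1 there, and the
   Euclidean norm at most twice the maximum norm. *)
pose C := (1 + 2 * (`|M| + 1)) ^+ 4.
have C0 : 0 <= C by rewrite exprn_ge0// !addr_ge0// mulr_ge0// addr_ge0.
have n0 x : 0 <= cmod (g x) * tamew x by rewrite mulr_ge0 ?cmod_ge0// tamew_ge0.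
apply: (@le_lt_trans _ _ (\int[leb2]_(x in K) (C%:E * (cmod (g x) * tamew x)%:E))%E).
  apply: ge0_le_integral => //.
  - by move=> x _; rewrite lee_fin cmod_ge0.
  - by apply: measurable_funTS; exact: emeas_cmod.
  - by apply: measurable_funTS; apply: emeasurable_funM; [exact: measurable_cst|exact/measurable_EFinP].
  - move=> x Kx; rewrite -EFinM lee_fin mulrCA ler_peMr ?cmod_ge0//.
    rewrite /tamew exprVn ler_pdivlMr ?exprn_gt0 ?enorm1_gt0// mul1r.
    apply: lerXn2r; rewrite ?nnegrE ?addr_ge0 ?enorm_ge0 ?mulr_ge0 ?addr_ge0//.
    rewrite lerD2l (le_trans (ler_enorm_norm x))// ler_wpM2l//.
    by rewrite (le_trans (hM _ Kx))// lerD2r ler_norm.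
apply: (@le_lt_trans _ _ (\int[leb2]_x (C%:E * (cmod (g x) * tamew x)%:E))%E).
  apply: ge0_subset_integral => //.
    by apply: emeasurable_funM; [exact: measurable_cst|exact/measurable_EFinP].
  by move=> x _; rewrite -EFinM lee_fin mulr_ge0.
rewrite ge0_integralZl//; [exact: lte_mul_pinfty|exact/measurable_EFinP|].
by move=> x _; rewrite lee_fin.
Qed.

Lemma tame_is_function T g : tame g -> (forall f, schwartz f -> T f = CI (fun x : mP => g x * f x)) ->
  is_function T g.
Proof.
move=> tg Tg; split; first exact: tame_locally_cintegrable.
by move=> f sf; split; [exact: tame_pairing|exact: Tg].
Qed.

(** The difference of two densities pairs to 0 with every Schwartz function, so [schwartz_ae0]
    applies. Through this, the density chosen by [function_of] may be replaced by any explicit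
    one. *)
Lemma is_function_ae T g h : is_function T g -> is_function T h -> ae_eq leb2 setT g h.
Proof.
move=> [_ Tg] [_ Th].
have : ae_eq leb2 setT (fun x => g x - h x) (cst 0).
  apply: schwartz_ae0 => f sf; have [ig eg] := Tg f sf; have [ih eh] := Th f sf.
  under eq_fun do rewrite mulrBl.
  split; first exact: cintbleB.
  by rewrite cintegralB// -[X in X - _]eg -[X in _ - X]eh subrr.
by apply: filterS => x /[apply] /eqP; rewrite subr_eq0 => /eqP.
Qed.

Lemma is_function_cmeas T g : is_function T g -> cmeas g.
Proof. by move=> [[? ? _] _]. Qed.

Lemma function_ofP T g : is_function T g -> is_function T (function_of T).
Proof. by move=> Tg; apply: (@xgetPex _ _ [set g | is_function T g]); exists g. Qed.

Lemma function_of_ae T g : is_function T g -> ae_eq leb2 setT (function_of T) g.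
Proof. by move=> Tg; apply: is_function_ae (function_ofP Tg) Tg. Qed.

End Tame.

(** * Inverse transforms and the multiplication formula *)

Section FourierPair.
Context {R : realType}.
Local Notation mR := (measurableTypeR R).
Local Notation mP := (measurableTypeR R * measurableTypeR R)%type.
Local Notation plane := (@Defs.plane R).
Local Notation coord := (@Defs.coord R).
Local Notation CI := (cintegral leb2 setT).
Implicit Types (f : plane -> R[i]) (g h : mP -> R[i]) (S T : @dist R).

(** Normalisation of the inverse transform. It reappears in [conv] and [bil], the transform of a
    product being (2 pi)^(-2) times a convolution, and supplies the smallness of the contraction. *)
Definition c2pi : R := (2 * pi) ^- 2.

Lemma c2pi_gt0 : 0 < c2pi.
Proof. by rewrite invr_gt0 exprn_gt0// mulr_gt0// pi_gt0. Qed.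

Lemma fourierE f : fourier f = ft (-1) f.
Proof.
apply/funext => xi; rewrite /fourier /ft; congr cintegral.
by apply/funext => x; rewrite mulN1r.
Qed.

Lemma ifourierE f : ifourier f = (fun x => c2pi%:C%C * ft 1 f x).
Proof.
apply/funext => x; rewrite /ifourier /ft; congr (_ * _); congr cintegral.
by apply/funext => xi; rewrite mul1r dotpC.
Qed.

Lemma schwartz_fourier f : schwartz f -> schwartz (fourier f).
Proof. by rewrite fourierE; exact: schwartz_ft. Qed.

Lemma schwartz_ifourier f : schwartz f -> schwartz (ifourier f).
Proof.
by move=> sf; rewrite ifourierE; apply: schwartzZ; apply: schwartz_ft => //; exact: oner_neq0.
Qed.

Let c2piK : c2pi%:C%C * ((2 * pi) ^+ 2)%:C%C = 1 :> R[i].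
Proof.
rewrite -rmorphM /= mulVf// expf_neq0// mulf_neq0// gt_eqF//; exact: pi_gt0.
Qed.

Lemma fourierK f : schwartz f -> ifourier (fourier f) = f.
Proof.
move=> sf; rewrite ifourierE fourierE; apply/funext => x.
by rewrite ft_inversion ?expr1n// mulrA c2piK mul1r.
Qed.

Lemma ifourierK f : schwartz f -> fourier (ifourier f) = f.
Proof.
move=> sf; have s1 : schwartz (ft 1 f) by apply: schwartz_ft => //; exact: oner_neq0.
rewrite ifourierE fourierE ftZ; last exact: cintble_schwartz.
apply/funext => x.
have := @ft_inversion _ (-1) f x; rewrite opprK => -> //; last by rewrite sqrrN expr1n.
by rewrite mulrA c2piK mul1r.
Qed.

Lemma ifourierDZ (a : R[i]) f g : schwartz f -> schwartz g ->
  ifourier (fun x => a * f x + g x) = (fun x => a * ifourier f x + ifourier g x).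
Proof.
move=> sf sg; have cf := cintble_schwartz sf; have cg := cintble_schwartz sg.
rewrite !ifourierE ftD//; last exact: cintbleZ.
by rewrite ftZ//; apply/funext => x; ring.
Qed.

Lemma ifourier_cpartial j f xi : schwartz f ->
  ifourier (cpartial j f) xi = - ((0 +i* coord j xi)%C * ifourier f xi).
Proof.
move=> sf; rewrite !ifourierE ft_cpartial// mul1r.
have -> : (0 +i* - coord j xi)%C = - (0 +i* coord j xi)%C by apply: complex_ext; rewrite /= ?oppr0.
by ring.
Qed.

Lemma cmod_ifourier_le g xi : cintble leb2 g ->
  ((cmod (ifourier g xi))%:E <= c2pi%:E * \int[leb2]_x (cmod (g x))%:E)%E.
Proof.
move=> cg; rewrite ifourierE cmodM cmod_real (ger0_norm (ltW c2pi_gt0)) EFinM.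
by apply: lee_wpmul2l; [rewrite lee_fin ltW// c2pi_gt0|exact: cmod_ft_le].
Qed.

Lemma cmeas_ifourier g : cintble leb2 g -> cmeas (ifourier g).
Proof.
move=> cg; rewrite ifourierE; apply: cmeasM; first exact: cmeas_cst.
have := @cmeas_param R _ _ mP mP lebP (fun p : mP * mP => expi (1 * dotp p.2 p.1) * g p.2).
apply; apply: cmeasM; last exact: (cmeas_comp (h := snd) _ (cintble_meas cg)).
apply: cmeas_expi; apply: measurable_funM => //; rewrite /dotp.
apply: measurable_funD; apply: measurable_funM.
- exact: (measurableT_comp (f := fst)).
- exact: (measurableT_comp (f := fst)).
- exact: (measurableT_comp (f := snd)).
- exact: (measurableT_comp (f := snd)).
Qed.

(** Multiplication formula: the kernel exp(i x.y) is symmetric, and g(y) h(x) is integrable on the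
    product, so Fubini moves the transform from one factor to the other. *)
Lemma cintegral_ifourierC g h : cintble leb2 g -> cintble leb2 h ->
  CI (fun x => ifourier g x * h x) = CI (fun x => g x * ifourier h x).
Proof.
move=> cg ch.
pose F (p : mP * mP) := (expi (1 * dotp p.2 p.1) * g p.2) * h p.1.
have mE : cmeas (fun p : mP * mP => expi (1 * dotp p.2 p.1)).
  apply: cmeas_expi; apply: measurable_funM => //; rewrite /dotp.
  apply: measurable_funD; apply: measurable_funM.
  - exact: (measurableT_comp (f := fst)).
  - exact: (measurableT_comp (f := fst)).
  - exact: (measurableT_comp (f := snd)).
  - exact: (measurableT_comp (f := snd)).
have cF : cintble (lebP \x lebP)%E F.
  apply/cintble_prodP; split.
    apply: cmeasM; last exact: (cmeas_comp (h := fst) _ (cintble_meas ch)).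
    by apply: cmeasM => //; exact: (cmeas_comp (h := snd) _ (cintble_meas cg)).
  have i2 := cintble_lty cg; set I2 := (X in (X < _)%E) in i2.
  have i2_ge0 : (0 <= I2)%E by apply: integral_ge0 => ? _; rewrite lee_fin cmod_ge0.
  rewrite (eq_integral (fun x : mP => (cmod (h x))%:E * I2)%E).
    rewrite ge0_integralZr//; [|exact: (emeas_cmod (cintble_meas ch))|
      by move=> ? _; rewrite lee_fin cmod_ge0].
    apply: lte_mul_pinfty => //.
      by apply: integral_ge0 => ? _; rewrite lee_fin cmod_ge0.
    rewrite ge0_fin_numE//; last by apply: integral_ge0 => ? _; rewrite lee_fin cmod_ge0.
    exact: (cintble_lty ch).
  move=> x _; rewrite -ge0_integralZl//; [|exact: (emeas_cmod (cintble_meas cg))|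
      by move=> ? _; rewrite lee_fin cmod_ge0|by rewrite lee_fin cmod_ge0].
  by apply: eq_integral => y _; rewrite /F !cmodM cmod_expi mul1r EFinM muleC.
have e1 : CI (fun x => ifourier g x * h x) =
    c2pi%:C%C * cintegral lebP setT (fun x => cintegral lebP setT (fun y => F (x, y))).
  rewrite -cintegralZ; last exact: (cintble_fubini1 cF).
  congr cintegral; apply/funext => x; rewrite ifourierE -mulrA; congr (_ * _).
  exact: (esym (cintegralZr (h x) (cintble_wave 1 x cg))).
have e2 : CI (fun x => g x * ifourier h x) =
    c2pi%:C%C * cintegral lebP setT (fun y => cintegral lebP setT (fun x => F (x, y))).
  rewrite -cintegralZ; last exact: (cintble_fubini2 cF).
  congr cintegral; apply/funext => y; rewrite ifourierE mulrCA; congr (_ * _).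
  rewrite /ft -cintegralZ; last exact: cintble_wave.
  by congr cintegral; apply/funext => x; rewrite /F /= dotpC; ring.
rewrite e1 e2; congr (_ * _); exact: (cintegral_exchange cF).
Qed.

End FourierPair.

Section Spectrum.
Context {R : realType}.
Local Notation mR := (measurableTypeR R).
Local Notation mP := (measurableTypeR R * measurableTypeR R)%type.
Local Notation plane := (@Defs.plane R).
Local Notation coord := (@Defs.coord R).
Local Notation CI := (cintegral leb2 setT).
Implicit Types (f : plane -> R[i]) (g h : mP -> R[i]) (S T : @dist R).

(* [T] is a distribution with Fourier transform [g]: by inversion, testing [T] against
   [fourier f] is the same as testing it against [f] and [g] against [ifourier f]. *)
Definition spec T g : Prop :=
  tame g /\ forall f, schwartz f -> T f = CI (fun x : mP => g x * ifourier f x).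

Lemma spec_is_function T g : spec T g -> is_function (dfourier T) g.
Proof.
move=> [tg Tg]; apply: tame_is_function => // f sf.
by rewrite /dfourier Tg ?fourierK//; exact: schwartz_fourier.
Qed.

Lemma spec_hat T g : spec T g -> ae_eq leb2 setT (hat T) g.
Proof. by move=> /spec_is_function; exact: function_of_ae. Qed.

Lemma spec_hat_cmeas T g : spec T g -> cmeas (hat T).
Proof. by move=> /spec_is_function/function_ofP/is_function_cmeas. Qed.

Lemma spec_has_hat T g : spec T g -> has_hat T.
Proof. by move=> /spec_is_function; exists g. Qed.

Lemma spec_ae T g h : spec T g -> cmeas h -> ae_eq leb2 setT g h -> spec T h.
Proof.
move=> [tg Tg] mh gh; split; first exact: tame_ae gh.
move=> f sf; rewrite Tg//; apply: cintegral_ae.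
- by apply: cintble_meas; apply: tame_pairing => //; exact: schwartz_ifourier.
- by apply: cmeasM => //; apply: schwartz_cmeas; exact: schwartz_ifourier.
- by apply: filterS gh => x /[apply] ->.
Qed.

Lemma spec_unique T g h : spec T g -> spec T h -> ae_eq leb2 setT g h.
Proof. by move=> /spec_is_function sg /spec_is_function; exact: is_function_ae. Qed.

Lemma spec_dist_eq S T g : spec S g -> spec T g -> dist_eq S T.
Proof. by move=> [_ Sg] [_ Tg] f sf; rewrite Sg// Tg. Qed.

Lemma dist_eq_spec S T g : dist_eq S T -> spec T g -> spec S g.
Proof. by move=> ST [tg Tg]; split => // f sf; rewrite ST// Tg. Qed.

(** [powR] with exponent 0 is 1 everywhere, the origin included, so finiteness of the norm is
    integrability of [hat T]; the pairing formula follows from [ifourierK]. *)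
Lemma inX0_spec T : inX 0 T -> spec T (hat T) /\ cintble leb2 (hat T).
Proof.
move=> [_ [g Tg] hoo]; have [loc pair] := function_ofP Tg.
have ch : cintble leb2 (hat T).
  apply/cintbleP; split; first exact: (is_function_cmeas (function_ofP Tg)).
  apply: le_lt_trans hoo; apply: le_of_eq; apply: eq_integral => x _.
  by rewrite powRr0 mul1r.
split=> //; split; first exact: cintble_tame.
move=> f sf; have [_] := pair _ (schwartz_ifourier sf).
by rewrite /dfourier ifourierK.
Qed.

Lemma difourier_spec g : tame g -> spec (difourier (dist_of g)) g.
Proof. by move=> tg; split. Qed.

(** [multiplier] is defined with the chosen density [hat T], which agrees with g almost everywhere
    only; hence the passage through [spec_ae]. *)
Lemma spec_multiplier m T g (M : R) : cmeas (m : mP -> R[i]) -> (forall x, cmod (m x) <= M) ->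
  spec T g -> spec (multiplier m T) (fun x => m x * g x).
Proof.
move=> mm mM sT; have [tg _] := sT.
have th : tame (hat T).
  by apply: tame_ae tg (spec_hat_cmeas sT) _; apply: filterS (spec_hat sT) => x /[apply].
apply: (@spec_ae _ (fun x => m x * hat T x)).
- by apply: difourier_spec; exact: (tame_bM mm mM).
- by apply: cmeasM => //; case: tg.
- by apply: filterS (spec_hat sT) => x /[apply] ->.
Qed.

Lemma spec_dpartial j T g : spec T g -> tame (fun x => (0 +i* coord j x)%C * g x) ->
  spec (dpartial j T) (fun x => (0 +i* coord j x)%C * g x).
Proof.
move=> [tg Tg] tjg; split => // f sf.
rewrite /dpartial Tg; last exact: schwartz_cpartial.
rewrite -cintegralN; last first.
  by apply: tame_pairing => //; apply: schwartz_ifourier; exact: schwartz_cpartial.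
by congr cintegral; apply/funext => x; rewrite ifourier_cpartial//; ring.
Qed.

Lemma spec_dopp T g : spec T g -> spec (Defs.dopp T) (fun x => - g x).
Proof.
move=> [tg Tg]; split; first exact: tameN.
move=> f sf; rewrite /Defs.dopp Tg// -cintegralN.
  by congr cintegral; apply/funext => x; rewrite mulNr.
by apply: tame_pairing => //; exact: schwartz_ifourier.
Qed.

Lemma spec_dadd S T g h : spec S g -> spec T h -> spec (Defs.dadd S T) (fun x => g x + h x).
Proof.
move=> [tg Sg] [th Th]; split; first exact: tameD.
move=> f sf; have si := schwartz_ifourier sf.
rewrite /Defs.dadd Sg// Th// -cintegralD; try exact: tame_pairing.
by congr cintegral; apply/funext => x; rewrite mulrDl.
Qed.

Lemma spec_dsub S T g h : spec S g -> spec T h -> spec (Defs.dsub S T) (fun x => g x - h x).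
Proof. by move=> sS sT; exact: (spec_dadd sS (spec_dopp sT)). Qed.

Lemma spec_linear T g (a : R[i]) f1 f2 : spec T g -> schwartz f1 -> schwartz f2 ->
  T (fun x => a * f1 x + f2 x) = a * T f1 + T f2.
Proof.
move=> [tg Tg] s1 s2; rewrite !Tg//; last exact: schwartzDZ.
have i1 := schwartz_ifourier s1; have i2 := schwartz_ifourier s2.
rewrite ifourierDZ// -cintegralZ; last exact: tame_pairing.
rewrite -cintegralD; [|by apply: cintbleZ; exact: tame_pairing|exact: tame_pairing].
by congr cintegral; apply/funext => x; ring.
Qed.

Lemma spec_tempered T g : spec T g -> cintble leb2 g -> tempered T.
Proof.
move=> sT cg; split; first by move=> a f h sf sh; exact: (spec_linear a sT sf sh).
have [_ Tg] := sT.
pose G := fine (\int[leb2]_x (cmod (g x))%:E)%E.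
have GE : (\int[leb2]_x (cmod (g x))%:E)%E = G%:E.
  rewrite fineK// ge0_fin_numE; first exact: cintble_lty.
  by apply: integral_ge0 => x _; rewrite lee_fin cmod_ge0.
(* Order 4 bounds |f| by M [wt]; the mass of [wt] is pi^2, the inverse transform contributes [c2pi],
   and G is the mass of the spectrum. *)
exists 4%N, (c2pi * (pi * pi) * G) => f M sf hM.
have cf := cintble_schwartz sf.
have fM x : cmod (f x) <= M * wt x.
  have := hM [::] x isT => /= h; have := ler_wt x; have e := enorm1_gt0 x => w.
  have e4 : 0 < (1 + enorm x) ^+ 4 by rewrite exprn_gt0.
  have M0 : 0 <= M by apply: le_trans h; rewrite mulr_ge0 ?cmod_ge0// ltW.
  by apply: le_trans (ler_wpM2l M0 w); rewrite ler_pdivlMr// mulrC.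
have M0 : 0 <= M.
  by apply: le_trans (hM [::] 0 isT); rewrite mulr_ge0 ?cmod_ge0// exprn_ge0// ltW// enorm1_gt0.
have iM xi : cmod (ifourier f xi) <= c2pi * (pi * pi) * M.
  rewrite -lee_fin; apply: le_trans (cmod_ifourier_le xi cf) _.
  rewrite -mulrA EFinM; apply: lee_wpmul2l; first by rewrite lee_fin ltW// c2pi_gt0.
  apply: (@le_trans _ _ (\int[leb2]_x (M%:E * (wt x)%:E))%E).
    apply: ge0_le_integral => //.
    - by move=> x _; rewrite lee_fin cmod_ge0.
    - exact: (emeas_cmod (cintble_meas cf)).
    - by apply: emeasurable_funM; [exact: measurable_cst|apply/measurable_EFinP; exact: measurable_wt].
    - by move=> x _; rewrite -EFinM lee_fin.
  rewrite ge0_integralZl//; [|by apply/measurable_EFinP; exact: measurable_wt|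
    by move=> x _; rewrite lee_fin wt_ge0].
  by rewrite integral_wt -EFinM mulrC.
rewrite Tg// -lee_fin.
apply: le_trans (cmod_cintegral_le_int _) _.
  by apply: tame_pairing; [exact: cintble_tame|exact: schwartz_ifourier].
apply: (@le_trans _ _ (\int[leb2]_x ((c2pi * (pi * pi) * M)%:E * (cmod (g x))%:E))%E).
  apply: ge0_le_integral => //.
  - by move=> x _; rewrite lee_fin cmod_ge0.
  - apply: emeas_cmod; apply: cmeasM; first exact: cintble_meas cg.
    by apply: schwartz_cmeas; exact: schwartz_ifourier.
  - by apply: emeasurable_funM; [exact: measurable_cst|exact: (emeas_cmod (cintble_meas cg))].
  - by move=> x _; rewrite -EFinM lee_fin cmodM mulrC ler_wpM2r ?cmod_ge0.
rewrite ge0_integralZl//; [|exact: (emeas_cmod (cintble_meas cg))|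
  by move=> x _; rewrite lee_fin cmod_ge0|by rewrite lee_fin (le_trans (cmod_ge0 _) (iM 0))].
by rewrite GE -EFinM lee_fin mulrAC.
Qed.

Lemma Xnorm_spec sigma T g : spec T g ->
  Xnorm sigma T = (\int[leb2]_x (enorm x `^ sigma * cmod (g x))%:E)%E.
Proof.
move=> sT; have [[mg _] _] := sT.
have mw : measurable_fun setT (fun x : mP => enorm x `^ sigma).
  exact: (measurableT_comp (measurable_powR sigma) measurable_enorm).
apply: ae_eq_integral => //.
- by apply/measurable_EFinP; apply: measurable_funM => //; apply: cmeas_cmod; exact: spec_hat_cmeas sT.
- by apply/measurable_EFinP; apply: measurable_funM => //; exact: cmeas_cmod.
- by apply: filterS (spec_hat sT) => x /[apply] ->.
Qed.

Lemma spec_inX sigma T g : spec T g -> cintble leb2 g ->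
  (\int[leb2]_x (enorm x `^ sigma * cmod (g x))%:E < +oo)%E -> inX sigma T.
Proof.
move=> sT cg goo; split; [exact: spec_tempered cg|exact: spec_has_hat sT|].
by rewrite (Xnorm_spec _ sT).
Qed.

End Spectrum.

(** * Products and the nonlinearity *)

Section Convolution.
Context {R : realType}.
Local Notation mR := (measurableTypeR R).
Local Notation mP := (measurableTypeR R * measurableTypeR R)%type.
Local Notation plane := (@Defs.plane R).
Local Notation coord := (@Defs.coord R).
Local Notation CI := (cintegral leb2 setT).
Implicit Types (f : plane -> R[i]) (g h w : mP -> R[i]) (S T : @dist R).

Definition psub (x y : mP) : mP := ((x : plane) - (y : plane)).

Lemma measurable_psub : measurable_fun setT (fun p : mP * mP => psub p.1 p.2).
Proof.
apply: measurable_fun_pair; apply: measurable_funB.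
- exact: (measurableT_comp (f := fst)).
- exact: (measurableT_comp (f := fst)).
- exact: (measurableT_comp (f := snd)).
- exact: (measurableT_comp (f := snd)).
Qed.

Lemma psub_aff y x : psub x y = aff (- (y : plane)) 1 x.
Proof. by rewrite /psub /aff !mul1r ![- _ + _]addrC. Qed.

Lemma measurable_psub1 y : measurable_fun setT (fun x : mP => psub x y).
Proof. by under eq_fun do rewrite psub_aff; exact: measurable_aff. Qed.

Lemma measurable_psub2 x : measurable_fun setT (fun y : mP => psub x y).
Proof.
have := measurable_aff (x : plane) (-1); congr (measurable_fun _ _).
by apply/funext => y; rewrite /psub /aff !mulN1r.
Qed.

Lemma integral_psub (u : mP -> \bar R) y : measurable_fun setT u -> (forall x, (0 <= u x)%E) ->
  (\int[leb2]_x u (psub x y) = \int[leb2]_x u x)%E.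
Proof.
move=> mu u0; under eq_integral do rewrite psub_aff.
by rewrite integral_aff ?oner_neq0// expr1n invr1 mul1e.
Qed.

(** Tonelli and translation invariance. Stated for extended nonnegative functions, it also serves
    majorants that may be infinite somewhere. *)
Lemma integral_conv (u v : mP -> \bar R) : measurable_fun setT u -> measurable_fun setT v ->
  (forall x, (0 <= u x)%E) -> (forall x, (0 <= v x)%E) ->
  (\int[leb2]_x \int[leb2]_y (u y * v (psub x y)) = (\int[leb2]_x u x) * (\int[leb2]_x v x))%E.
Proof.
move=> mu mv u0 v0.
rewrite (@fubini_tonelli _ _ _ _ _ lebP lebP (fun p : mP * mP => u p.2 * v (psub p.1 p.2))%E).
- rewrite -ge0_integralZr//; last exact: integral_ge0.
  apply: eq_integral => y _ /=; rewrite ge0_integralZl//; first by rewrite integral_psub.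
  exact: (measurableT_comp mv (measurable_psub1 y)).
- apply: emeasurable_funM; first exact: (measurableT_comp mu).
  exact: (measurableT_comp mv measurable_psub).
- by move=> p; exact: mule_ge0.
Qed.

Lemma cintble_conv g h : cintble leb2 g -> cintble leb2 h ->
  cintble (lebP \x lebP)%E (fun p : mP * mP => g p.2 * h (psub p.1 p.2)).
Proof.
move=> /cintbleP[mg ig] /cintbleP[mh ih]; apply/cintble_prodP; split.
  apply: cmeasM; first exact: (cmeas_comp (h := snd)).
  exact: (cmeas_comp measurable_psub).
under eq_integral do under eq_integral do rewrite cmodM EFinM.
rewrite (integral_conv (emeas_cmod mg) (emeas_cmod mh)).
- apply: lte_mul_pinfty => //.
    by apply: integral_ge0 => ? _; rewrite lee_fin cmod_ge0.
  by rewrite ge0_fin_numE//; apply: integral_ge0 => ? _; rewrite lee_fin cmod_ge0.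
- by move=> x; rewrite lee_fin cmod_ge0.
- by move=> x; rewrite lee_fin cmod_ge0.
Qed.

Definition conv g h : mP -> R[i] :=
  fun x => c2pi%:C%C * CI (fun y => g y * h (psub x y)).

Lemma cintble_cconv g h : cintble leb2 g -> cintble leb2 h -> cintble leb2 (conv g h).
Proof.
by move=> cg ch; apply: cintbleZ; exact: (cintble_fubini1 (cintble_conv cg ch)).
Qed.

(** An integrable spectrum has a bounded inverse transform, and the multiplication formula says that
    T is integration against it. This gives a meaning to the pointwise products in [dmul]. *)
Lemma is_function_ifourier T g : spec T g -> cintble leb2 g -> is_function T (ifourier g).
Proof.
move=> [tg Tg] cg; have [M hM] := ft_bound 1 cg.
have tig : tame (ifourier g).
  apply: (@bounded_tame _ _ (c2pi * M)); first exact: cmeas_ifourier.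
  move=> x; rewrite ifourierE cmodM cmod_real (ger0_norm (ltW c2pi_gt0)).
  by rewrite ler_wpM2l// ltW// c2pi_gt0.
apply: tame_is_function => // f sf; rewrite Tg// cintegral_ifourierC//.
exact: cintble_schwartz.
Qed.

Lemma ifourier_wave f eta x : cintble leb2 f ->
  ifourier (fun y => expi (dotp eta y) * f y) x = ifourier f ((x : plane) + eta).
Proof.
move=> cf; rewrite !ifourierE; congr (_ * _); rewrite /ft; congr cintegral.
apply/funext => y; rewrite mulrA -expiD; congr (expi _ * _).
by rewrite !mul1r dotpDr (dotpC eta).
Qed.

(** The product pairs with f as g against the inverse transform of (ifourier h) f. A second use of
    the multiplication formula and a translation turn this into a double integral of g(y) h(x - y)
    against [ifourier f]; Fubini finishes. *)
Lemma spec_dmul S T g h : spec S g -> cintble leb2 g -> spec T h -> cintble leb2 h ->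
  spec (dmul S T) (conv g h).
Proof.
move=> sS cg sT ch; split; first by apply: cintble_tame; exact: cintble_cconv.
move=> f sf; have cf := cintble_schwartz sf.
have fS := is_function_ifourier sS cg; have fT := is_function_ifourier sT ch.
have mS := is_function_cmeas (function_ofP fS); have mT := is_function_cmeas (function_ofP fT).
have mf : cmeas (f : mP -> R[i]) := schwartz_cmeas sf.
have [Mh hMh] := ft_bound 1 ch.
have chf : cintble leb2 (fun x : mP => ifourier h x * f x).
  apply: (@cintble_bM _ _ _ _ _ _ (c2pi * Mh)) => //; first exact: cmeas_ifourier.
  move=> x; rewrite ifourierE cmodM cmod_real (ger0_norm (ltW c2pi_gt0)).
  by rewrite ler_wpM2l// ltW// c2pi_gt0.
have -> : dmul S T f = CI (fun x => ifourier g x * (ifourier h x * f x)).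
  apply: cintegral_ae.
  - by apply: cmeasM => //; exact: cmeasM.
  - by apply: cmeasM; [exact: cmeas_ifourier|apply: cmeasM => //; exact: cmeas_ifourier].
  - move: (function_of_ae fS) (function_of_ae fT); apply: filterS2 => x a b _.
    by rewrite (a I) (b I) mulrA.
rewrite (cintegral_ifourierC cg chf).
pose phi := ifourier f.
have sphi : schwartz phi by exact: schwartz_ifourier.
have [Mf hMf] : exists M : R, forall x, cmod (phi x) <= M.
  have [M hM] := schwartz_rapid sphi 0; exists M => x.
  by have := hM x; rewrite expr0 mul1r.
pose F (p : mP * mP) := (g p.2 * h (psub p.1 p.2)) * phi p.1.
have cF : cintble (lebP \x lebP)%E F.
  have c := cintble_conv cg ch.
  rewrite (_ : F = (fun p => phi p.1 * (g p.2 * h (psub p.1 p.2)))); last first.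
    by apply/funext => p; rewrite /F mulrC.
  apply: (@cintble_bM _ _ _ _ _ _ Mf) => //.
  exact: (cmeas_comp (h := fst) _ (schwartz_cmeas sphi)).
have E1 eta : g eta * ifourier (fun x => ifourier h x * f x) eta =
    c2pi%:C%C * cintegral lebP setT (fun x => F (x, eta)).
  have cwf : cintble leb2 (fun y : mP => expi (dotp eta y) * f y).
    have := cintble_wave 1 eta cf; congr (cintble _ _).
    by apply/funext => y; rewrite mul1r dotpC.
  rewrite ifourierE mulrCA; congr (_ * _).
  have -> : ft 1 (fun x => ifourier h x * f x) eta =
      CI (fun x => ifourier h x * (expi (dotp eta x) * f x)).
    by congr cintegral; apply/funext => x; rewrite mul1r dotpC; ring.
  rewrite (cintegral_ifourierC ch cwf).
  have chs : cintble leb2 (fun x : mP => h (psub x eta)).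
    have := cintble_aff (- (eta : plane)) (oner_neq0 R) ch; congr (cintble _ _).
    by apply/funext => x /=; rewrite psub_aff.
  have cH : cintble leb2 (fun x : mP => h (psub x eta) * phi x).
    under eq_fun do rewrite mulrC.
    by apply: (@cintble_bM _ _ _ _ _ _ Mf) => //; exact: schwartz_cmeas.
  have -> : CI (fun x => h x * ifourier (fun y => expi (dotp eta y) * f y) x) =
      CI (fun x => h (psub x eta) * phi x).
    (* Modulating f by [eta] translates its inverse transform; shifting the integration variable
       moves the translation onto h. *)
    rewrite -(cintegral_shift eta cH); congr cintegral; apply/funext => x.
    rewrite ifourier_wave//; congr (h _ * _).
    by rewrite /psub addrK.
  rewrite -cintegralZ//; congr cintegral; apply/funext => x.
  by rewrite /F mulrA.
under eq_fun do rewrite E1.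
rewrite cintegralZ; last exact: (cintble_fubini2 cF).
rewrite -[X in _ * X](cintegral_exchange cF) -cintegralZ; last exact: (cintble_fubini1 cF).
have := cintble_ae1 (cintble_conv cg ch) => aec.
apply: cintegral_ae.
- by apply: cmeasM; [exact: cmeas_cst|exact: (cintble_meas (cintble_fubini1 cF))].
- apply: cmeasM; last exact: schwartz_cmeas.
  exact: (cintble_meas (cintble_cconv cg ch)).
- apply: filterS aec => x cx _.
  by rewrite /conv -mulrA; congr (_ * _); rewrite /F /= cintegralZr.
Qed.

End Convolution.

Lemma measurable_integral_param {R : realType} d1 d2 (T1 : measurableType d1) (T2 : measurableType d2)
    (m2 : {sigma_finite_measure set T2 -> \bar R}) (f : T1 * T2 -> \bar R) :
  measurable_fun setT f -> (forall p, (0 <= f p)%E) ->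
  measurable_fun setT (fun x => \int[m2]_y f (x, y))%E.
Proof. by move=> mf f0; apply: measurable_fun_fubini_tonelli_F. Qed.

Lemma measurable_ler_set {R : realType} d (T : measurableType d) (f g : T -> measurableTypeR R) :
  measurable_fun setT f -> measurable_fun setT g -> measurable [set x | f x <= g x].
Proof.
move=> mf mg; have := measurable_fun_ler mf mg measurableT (Y := [set true]) I.
by rewrite setTI; congr measurable; apply/seteqP; split.
Qed.

Lemma cintble_ae2 {R : realType} d1 d2 (T1 : measurableType d1) (T2 : measurableType d2)
    (m1 : {sigma_finite_measure set T1 -> \bar R}) (m2 : {sigma_finite_measure set T2 -> \bar R})
    (f : T1 * T2 -> R[i]) : cintble (m1 \x m2)%E f ->
  {ae m2, forall y, cintble m1 (fun x => f (x, y))}.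
Proof.
by move=> [f1 f2]; move: (ae_integrable2 f1) (ae_integrable2 f2); apply: filterS2 => y a b; split.
Qed.

(** For a nonzero constant, integrability of f is recovered by dividing; for the constant 0 both
    sides vanish whatever f is. This matters when the constant is a heat factor outside its time
    interval. *)
Lemma cintegralZr_any {R : realType} d (T : measurableType d) (mu : {measure set T -> \bar R})
    (f : T -> R[i]) (a : R[i]) : cintble mu (fun x => f x * a) ->
  cintegral mu setT (fun x => f x * a) = cintegral mu setT f * a.
Proof.
have [->|a0] := eqVneq a 0.
  by under eq_fun do rewrite mulr0; rewrite cintegral0 mulr0.
move=> /(cintbleZ a^-1).
have -> : (fun x => a^-1 * (f x * a)) = f by apply/funext => x; rewrite mulrC mulfK.
exact: cintegralZr.
Qed.

(** * The symbol of the nonlinearity and the Duhamel integral *)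

Section Nonlinearity.
Context {R : realType}.
Local Notation mR := (measurableTypeR R).
Local Notation mP := (measurableTypeR R * measurableTypeR R)%type.
Local Notation plane := (@Defs.plane R).
Local Notation coord := (@Defs.coord R).
Local Notation CI := (cintegral leb2 setT).
Local Notation leb := (@lebesgue_measure R).
Implicit Types (f : plane -> R[i]) (g h w : mP -> R[i]) (S T : @dist R).

(* The symbol of [u . grad], the transported function carrying the frequency [xi - zeta] and the
   velocity the frequency [zeta]. *)
Definition kern (xi zeta : plane) : R := (xi.2 * zeta.1 - xi.1 * zeta.2) / enorm zeta.

Let rot (x : plane) : plane := (x.2, - x.1).

Let enorm_rot x : enorm (rot x) = enorm x.
Proof. by rewrite /enorm /= sqrrN addrC. Qed.

(** [kern] is the scalar product of [xi] turned by a right angle with the unit vector along [zeta];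
    Cauchy-Schwarz applies. For zeta = 0 the division convention makes it 0. *)
Lemma ler_kern xi zeta : `|kern xi zeta| <= enorm xi.
Proof.
rewrite /kern; have [->|z0] := eqVneq (enorm zeta) 0.
  by rewrite invr0 mulr0 normr0 enorm_ge0.
have zp : 0 < enorm zeta by rewrite lt_neqAle eq_sym z0 enorm_ge0.
rewrite normrM [`|_^-1|]ger0_norm ?invr_ge0 ?enorm_ge0// ler_pdivrMr// -(enorm_rot xi).
apply: le_trans (ler_dotp (rot xi) zeta); rewrite /dotp /=.
by apply: le_of_eq; congr (`|_|); ring.
Qed.

(** The cross product of [zeta] with itself is 0: this is the vanishing divergence of the velocity,
    seen on the Fourier side. It yields the second bound of the symbol, by the transported
    frequency. *)
Lemma kern_sub xi zeta : kern xi zeta = kern ((xi : plane) - zeta) zeta.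
Proof. by rewrite /kern /=; congr (_ / _); ring. Qed.

Lemma ler_kern_sub xi zeta : `|kern xi zeta| <= enorm (xi - zeta).
Proof. by rewrite kern_sub ler_kern. Qed.

Lemma kern0 xi : kern xi 0 = 0.
Proof. by rewrite /kern enorm0 invr0 mulr0. Qed.

Lemma measurable_enormV : measurable_fun setT (fun x : mP => (enorm x)^-1 : mR).
Proof.
have := measurableT_comp (measurable_powR (-1)) (@measurable_enorm R).
by congr (measurable_fun _ _); apply/funext => x /=; rewrite powR_inv1// enorm_ge0.
Qed.

Lemma measurable_kern : measurable_fun setT (fun p : mP * mP => kern p.1 p.2 : mR).
Proof.
have m (k : mP -> mR) : measurable_fun setT k ->
    measurable_fun setT (fun p : mP * mP => k p.1) /\ measurable_fun setT (fun p : mP * mP => k p.2).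
  by move=> mk; split; exact: (measurableT_comp mk).
have [a1 b1] := m fst measurable_fst; have [a2 b2] := m snd measurable_snd.
apply: measurable_funM; last exact: (m _ measurable_enormV).2.
by apply: measurable_funB; exact: measurable_funM.
Qed.

Definition bil g h : mP -> R[i] :=
  fun x => c2pi%:C%C * CI (fun y => (kern x (psub x y))%:C%C * (g y * h (psub x y))).

Lemma enorm_neq0 (x : plane) : enorm x != 0 -> 0 < enorm x.
Proof. by move=> h; rewrite lt_neqAle eq_sym h enorm_ge0. Qed.

Lemma coord_enorm_le1 j (x : plane) : `|coord j x / enorm x| <= 1.
Proof.
have [->|x0] := eqVneq (enorm x) 0; first by rewrite invr0 mulr0 normr0.
have xp := enorm_neq0 x0.
by rewrite normrM [`|_^-1|]ger0_norm ?invr_ge0 ?enorm_ge0// ler_pdivrMr// mul1r ler_coord_enorm.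
Qed.

Lemma cmeas_riesz_symbol j : cmeas (fun x : mP => (0 -i* (coord j x / enorm x))%C).
Proof.
apply: cmeas_pair; first exact: measurable_cst.
apply: measurableT_comp => //; apply: measurable_funM; last exact: measurable_enormV.
by case: (j); [exact: measurable_snd|exact: measurable_fst].
Qed.

Lemma spec_riesz j T g : spec T g ->
  spec (riesz j T) (fun x => (0 -i* (coord j x / enorm x))%C * g x).
Proof.
move=> sT; apply: (@spec_multiplier _ _ _ _ 1) => //; first exact: cmeas_riesz_symbol.
by move=> x; rewrite cmod_imag normrN coord_enorm_le1.
Qed.

Lemma cintble_riesz j g : cintble leb2 g ->
  cintble leb2 (fun x : mP => (0 -i* (coord j x / enorm x))%C * g x).
Proof.
apply: (@cintble_bM _ _ _ _ _ _ 1); first exact: cmeas_riesz_symbol.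
by move=> x; rewrite cmod_imag normrN coord_enorm_le1.
Qed.

Lemma cmeas_bil_kernel g h : cmeas g -> cmeas h ->
  cmeas (fun p : mP * mP => (kern p.1 (psub p.1 p.2))%:C%C * (g p.2 * h (psub p.1 p.2))).
Proof.
move=> mg mh; apply: cmeasM.
  apply: cmeas_real; apply: (measurableT_comp measurable_kern (g := fun p : mP * mP => (p.1, psub p.1 p.2))).
  by apply: measurable_fun_pair => //; exact: measurable_psub.
apply: cmeasM; first exact: (cmeas_comp (h := snd)).
exact: (cmeas_comp measurable_psub).
Qed.

Lemma cmeas_bil g h : cmeas g -> cmeas h -> cmeas (bil g h).
Proof.
move=> mg mh; apply: cmeasM; first exact: cmeas_cst.
exact: (cmeas_param lebP (cmeas_bil_kernel mg mh)).
Qed.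

(** The factors i xi_j of the divergence meet the Riesz symbols of the velocity, and their
    combination is [kern]. The two convolutions can be merged at those x where both converge
    absolutely, hence almost everywhere. *)
Lemma conv_riesz_bil g : cintble leb2 g -> ae_eq leb2 setT
  (fun x => (0 +i* coord false x)%C *
      conv g (fun x => - ((0 -i* (coord true x / enorm x))%C * g x)) x +
    (0 +i* coord true x)%C * conv g (fun x => (0 -i* (coord false x / enorm x))%C * g x) x)
  (bil g g).
Proof.
move=> cg; have h2 := cintble_ae1 (cintble_conv cg (cintble_riesz false cg)).
have h1 := cintble_ae1 (cintble_conv cg (cintbleN (cintble_riesz true cg))).
move: h1 h2; apply: filterS2 => x /= h1 h2 _.
rewrite /conv /bil mulrCA [X in _ + X]mulrCA -mulrDr; congr (_ * _).
rewrite -(cintegralZ _ h1) -(cintegralZ _ h2) -cintegralD; [|exact: cintbleZ|exact: cintbleZ].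
congr cintegral; apply/funext => y; set z := psub x y.
have -> : (kern x z)%:C%C = (0 +i* coord false x)%C * - (0 -i* (coord true z / enorm z))%C +
   (0 +i* coord true x)%C * (0 -i* (coord false z / enorm z))%C.
  by rewrite /kern; apply: complex_ext => /=; ring.
ring.
Qed.

Lemma spec_transport T g : spec T g -> cintble leb2 g -> spec (transport T T) (bil g g).
Proof.
move=> sT cg; have mg := cintble_meas cg.
have s1 := spec_dopp (spec_riesz true sT); have c1 := cintbleN (cintble_riesz true cg).
have s2 := spec_riesz false sT; have c2 := cintble_riesz false cg.
have m1 := spec_dmul sT cg s1 c1; have m2 := spec_dmul sT cg s2 c2.
have p1 := spec_dpartial m1 (cintble_tame_icoord false (cintble_cconv cg c1)).
have p2 := spec_dpartial m2 (cintble_tame_icoord true (cintble_cconv cg c2)).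
apply: spec_ae (spec_dadd p1 p2) (cmeas_bil mg mg) _.
exact: conv_riesz_bil.
Qed.

Lemma cintegral_mkcond (D : set mR) (f : mR -> R[i]) :
  cintegral leb D f = cintegral leb setT (fun x => (\1_D x : R)%:C%C * f x).
Proof.
rewrite /cintegral; apply: complex_ext => /=; rewrite Rintegral_mkcond; congr Rintegral;
  apply/funext => x; rewrite patchE /= ReImE/= indicE;
  by case: (x \in D); rewrite ?mul1r ?mul0r ?subr0 ?addr0.
Qed.

(** Symbol of the semigroup with the time truncation built in, so that Duhamel integrals run over
    the whole line and Tonelli applies without moving domains. For t >= 0, [heat t 0] is the free
    propagator. *)
Definition heat (t tau : R) (xi : plane) : R :=
  \1_`[0, t]%classic tau * expR (- ((t - tau) * enorm xi)).

Definition duh (u : mR * mP -> R[i]) (t : R) (xi : mP) : R[i] :=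
  cintegral leb setT (fun tau => (heat t tau xi)%:C%C *
    bil (fun y => u (tau, y)) (fun y => u (tau, y)) xi).

Lemma heat_itv t tau xi : 0 <= heat t tau xi <= \1_`[0, t]%classic tau.
Proof.
rewrite /heat indicE; have [|_] := boolP (_ \in _); last by rewrite mul0r lexx.
rewrite inE /= in_itv/= => /andP[_ h]; rewrite mul1r expR_ge0/=.
by rewrite -expR0 ler_expR oppr_le0 mulr_ge0 ?enorm_ge0// subr_ge0.
Qed.

Lemma measurable_heat_comp d (T : measurableType d) (a b : T -> mR) (h : T -> mP) :
  measurable_fun setT a -> measurable_fun setT b -> measurable_fun setT h ->
  measurable_fun setT (fun x => heat (a x) (b x) (h x) : mR).
Proof.
move=> ma mb mh; apply: measurable_funM; last first.
  apply: measurableT_comp => //; apply: measurableT_comp => //.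
  apply: measurable_funM; first exact: measurable_funB.
  exact: (measurableT_comp measurable_enorm mh).
pose D : set T := [set x | 0 <= b x <= a x].
have mD : measurable D.
  rewrite (_ : D = [set x | 0 <= b x] `&` [set x | b x <= a x]); last first.
    by apply/seteqP; split => q; [move=> /andP[]|move=> [? ?]; apply/andP].
  by apply: measurableI; apply: measurable_ler_set.
have mI : measurable_fun setT (\1_D : T -> mR) by exact: measurable_indic.
by move: mI; congr (measurable_fun _ _).
Qed.

Lemma measurable_heat t : measurable_fun setT (fun p : mR * mP => heat t p.1 p.2 : mR).
Proof. exact: measurable_heat_comp. Qed.

Lemma measurable_heat2 t tau : measurable_fun setT (fun x : mP => heat t tau x : mR).
Proof. exact: measurable_heat_comp. Qed.

Lemma cmeas_bil_time (u v : mR * mP -> R[i]) : cmeas u -> cmeas v ->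
  cmeas (fun p : mR * mP => bil (fun y => u (p.1, y)) (fun y => v (p.1, y)) p.2).
Proof.
move=> mu mv; apply: cmeasM; first exact: cmeas_cst.
apply: (cmeas_param lebP (f := fun q : (mR * mP) * mP =>
  (kern q.1.2 (psub q.1.2 q.2))%:C%C * (u (q.1.1, q.2) * v (q.1.1, psub q.1.2 q.2)))).
have m1 : measurable_fun setT (fun q : (mR * mP) * mP => q.1.1).
  exact: (measurableT_comp measurable_fst measurable_fst).
have m2 : measurable_fun setT (fun q : (mR * mP) * mP => q.1.2).
  exact: (measurableT_comp measurable_snd measurable_fst).
have m3 : measurable_fun setT (fun q : (mR * mP) * mP => psub q.1.2 q.2).
  apply: (measurableT_comp measurable_psub (g := fun q : (mR * mP) * mP => (q.1.2, q.2))).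
  exact: measurable_fun_pair.
apply: cmeasM.
  apply: cmeas_real; apply: (measurableT_comp measurable_kern
    (g := fun q : (mR * mP) * mP => (q.1.2, psub q.1.2 q.2))).
  exact: measurable_fun_pair.
apply: cmeasM.
  by apply: (cmeas_comp (h := fun q : (mR * mP) * mP => (q.1.1, q.2))) => //; exact: measurable_fun_pair.
by apply: (cmeas_comp (h := fun q : (mR * mP) * mP => (q.1.1, psub q.1.2 q.2))) => //; exact: measurable_fun_pair.
Qed.

Lemma cmeas_duh (u : mR * mP -> R[i]) : cmeas u -> cmeas (fun p : mR * mP => duh u p.1 p.2).
Proof.
move=> mu; apply: (cmeas_param leb (f := fun q : (mR * mP) * mR =>
  (heat q.1.1 q.2 q.1.2)%:C%C * bil (fun y => u (q.2, y)) (fun y => u (q.2, y)) q.1.2)).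
have m1 : measurable_fun setT (fun q : (mR * mP) * mR => q.1.1).
  exact: (measurableT_comp measurable_fst measurable_fst).
have m2 : measurable_fun setT (fun q : (mR * mP) * mR => q.1.2).
  exact: (measurableT_comp measurable_snd measurable_fst).
have m3 : measurable_fun setT (fun q : (mR * mP) * mR => q.2) by exact: measurable_snd.
apply: cmeasM; last first.
  apply: (cmeas_comp (h := fun q : (mR * mP) * mR => (q.2, q.1.2)) _ (cmeas_bil_time mu mu)).
  exact: measurable_fun_pair.
by apply: cmeas_real; exact: measurable_heat_comp.
Qed.

Lemma cmod_bil_le g h x : cmeas g -> cmeas h ->
  ((cmod (bil g h x))%:E <=
   c2pi%:E * \int[leb2]_y (`|kern x (psub x y)| * (cmod (g y) * cmod (h (psub x y))))%:E)%E.
Proof.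
move=> mg mh; rewrite /bil cmodM cmod_real (ger0_norm (ltW c2pi_gt0)) EFinM.
apply: lee_wpmul2l; first by rewrite lee_fin ltW// c2pi_gt0.
have := cmeas_pair1 x (cmeas_bil_kernel mg mh) => m.
apply: le_trans (cmod_cintegral_le leb2 m) _.
apply: le_of_eq; apply: eq_integral => y _ /=.
by rewrite !cmodM cmod_real.
Qed.

(** Version with the output frequency: |x| comes out of the integral, and a plain convolution of
    moduli remains. *)
Lemma cmod_bil_le_conv g h x : cmeas g -> cmeas h ->
  ((cmod (bil g h x))%:E <=
   (c2pi * enorm x)%:E * \int[leb2]_y ((cmod (g y))%:E * (cmod (h (psub x y)))%:E))%E.
Proof.
move=> mg mh; apply: le_trans (cmod_bil_le x mg mh) _.
rewrite EFinM -muleA; apply: lee_wpmul2l; first by rewrite lee_fin ltW// c2pi_gt0.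
have mk : measurable_fun setT (fun y : mP => (cmod (g y))%:E * (cmod (h (psub x y)))%:E)%E.
  apply: emeasurable_funM; first exact: emeas_cmod.
  exact: (measurableT_comp (emeas_cmod mh) (measurable_psub2 x)).
rewrite -ge0_integralZl//; last 2 first.
- by move=> y _; rewrite -EFinM lee_fin mulr_ge0 ?cmod_ge0.
- by rewrite lee_fin enorm_ge0.
apply: ge0_le_integral => //.
- by move=> y _; rewrite lee_fin !mulr_ge0 ?cmod_ge0.
- apply/measurable_EFinP; apply: measurable_funM.
    apply: measurableT_comp => //; apply: (measurableT_comp measurable_kern
      (g := fun y : mP => (x, psub x y))).
    by apply: measurable_fun_pair => //; exact: measurable_psub2.
  apply: measurable_funM; first exact: cmeas_cmod.
  exact: (measurableT_comp (cmeas_cmod mh) (measurable_psub2 x)).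
- by apply: emeasurable_funM; first exact: measurable_cst.
- by move=> y _; rewrite -!EFinM lee_fin ler_wpM2r ?mulr_ge0 ?cmod_ge0// ler_kern.
Qed.

Lemma spec_poisson t T g : 0 <= t -> spec T g ->
  spec (poisson t T) (fun x => (expR (- (t * enorm x)))%:C%C * g x).
Proof.
move=> t0 sT; apply: (@spec_multiplier _ _ _ _ 1) => //.
  apply: cmeas_real; apply: measurableT_comp => //; apply: measurableT_comp => //.
  by apply: measurable_funM => //; exact: measurable_enorm.
move=> x; rewrite cmod_real ger0_norm ?expR_ge0// -expR0 ler_expR oppr_le0.
by rewrite mulr_ge0 ?enorm_ge0.
Qed.

Section Duhamel.
Variables (u : mR * mP -> R[i]) (A : R) (t : R).
Hypotheses (mu : cmeas u) (A0 : 0 <= A) (t0 : 0 <= t).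
Hypothesis uA : forall tau, 0 <= tau <= t -> (\int[leb2]_x (cmod (u (tau, x)))%:E <= A%:E)%E.

Let ut tau : cmeas (fun x => u (tau, x)) := cmeas_pair1 tau mu.

Let B (p : mR * mP) := bil (fun y => u (p.1, y)) (fun y => u (p.1, y)) p.2.

(* One weight [1 / (1 + |xi|)] makes the Duhamel integrand absolutely integrable. *)
Lemma cintble_duhamel (m : mP -> R) (M : R) : measurable_fun setT m ->
  (forall x, 0 <= m x) -> (forall x, enorm x * m x <= M) ->
  cintble (leb \x lebP)%E (fun p : mR * mP => (heat t p.1 p.2 * m p.2)%:C%C * B p).
Proof.
move=> mm m0 mM; have M0 : 0 <= M by apply: le_trans (mM 0); rewrite mulr_ge0 ?enorm_ge0.
apply/cintble_prodP; split.
  apply: cmeasM; last exact: cmeas_bil_time.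
  apply: cmeas_real; apply: measurable_funM; first exact: measurable_heat.
  exact: (measurableT_comp mm).
(* At each time in [0, t]: M bounds |xi| m(xi), and A times A is the mass of the convolution of the
   moduli. *)
pose C := c2pi * M * (A * A).
have C0 : 0 <= C by rewrite !mulr_ge0// ltW// c2pi_gt0.
apply: (@le_lt_trans _ _ (\int[leb]_tau (C * \1_`[0, t]%classic tau)%:E)%E); last first.
  under eq_integral do rewrite EFinM.
  rewrite ge0_integralZl//; [|by apply/measurable_EFinP; exact: measurable_indic].
  rewrite integral_indic// setIT; apply: lte_mul_pinfty => //.
  rewrite [X in (X < _)%E](lebesgue_measure_itv `[0, t]) /=.
  by case: ifPn => _; rewrite ?ltry// -EFinB ltry.
apply: ge0_le_integral => //.
- by move=> tau _; apply: integral_ge0 => x _; rewrite lee_fin cmod_ge0.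
- apply: (measurable_integral_param lebP
    (f := fun p : mR * mP => (cmod ((heat t p.1 p.2 * m p.2)%:C%C * B p))%:E));
    last by move=> x; rewrite lee_fin cmod_ge0.
  apply: emeas_cmod; apply: cmeasM; last exact: cmeas_bil_time.
  apply: cmeas_real; apply: measurable_funM; first exact: measurable_heat.
  exact: (measurableT_comp mm).
- by apply/measurable_EFinP; apply: measurable_funM => //; exact: measurable_indic.
move=> tau _; have [tt|nt] := boolP (tau \in `[0, t]%classic); last first.
  rewrite integral0_eq => [|x _]; first by rewrite lee_fin mulr_ge0// indicE.
  by rewrite cmodM cmod_real /heat indicE (negbTE nt) !mul0r normr0 mul0r.
rewrite indicE tt mulr1; have t01 : 0 <= tau <= t by move: tt; rewrite inE /= in_itv.
pose K x := (\int[leb2]_y ((cmod (u (tau, y)))%:E * (cmod (u (tau, psub x y)))%:E))%E.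
have K0 x : (0 <= K x)%E by apply: integral_ge0 => y _; rewrite -EFinM lee_fin mulr_ge0 ?cmod_ge0.
have mK : measurable_fun setT K.
  apply: (measurable_integral_param lebP
    (f := fun p : mP * mP => ((cmod (u (tau, p.2)))%:E * (cmod (u (tau, psub p.1 p.2)))%:E)%E)); last first.
    by move=> p; rewrite -EFinM lee_fin mulr_ge0 ?cmod_ge0.
  apply: emeasurable_funM; first exact: (measurableT_comp (emeas_cmod (ut tau))).
  exact: (measurableT_comp (emeas_cmod (ut tau)) measurable_psub).
apply: (@le_trans _ _ (\int[leb2]_x ((c2pi * M)%:E * K x))%E).
  apply: ge0_le_integral => //.
  - by move=> x _; rewrite lee_fin cmod_ge0.
  - apply: emeas_cmod; apply: cmeasM; last exact: (cmeas_bil (ut tau) (ut tau)).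
    apply: cmeas_real; apply: measurable_funM; last exact: mm.
    exact: measurable_heat2.
  - by apply: emeasurable_funM; first exact: measurable_cst.
  - move=> x _; have /andP[h0 h1] := heat_itv t tau x.
    have hle1 : heat t tau x <= 1 by apply: le_trans h1 _; rewrite indicE tt.
    rewrite cmodM cmod_real ger0_norm ?mulr_ge0// EFinM.
    apply: (@le_trans _ _ ((m x)%:E * ((c2pi * enorm x)%:E * K x))%E).
      apply: lee_pmul => //; first by rewrite lee_fin mulr_ge0.
        by rewrite lee_fin cmod_ge0.
        by rewrite lee_fin ler_piMl.
      exact: cmod_bil_le_conv.
    rewrite muleA -EFinM; apply: lee_wpmul2r => //; rewrite lee_fin.
    rewrite mulrCA; apply: ler_wpM2l; first by rewrite ltW// c2pi_gt0.
    by rewrite mulrC.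
rewrite ge0_integralZl//; last by rewrite lee_fin mulr_ge0// ltW// c2pi_gt0.
rewrite /K (integral_conv (emeas_cmod (ut tau)) (emeas_cmod (ut tau))); last 2 first.
- by move=> x; rewrite lee_fin cmod_ge0.
- by move=> x; rewrite lee_fin cmod_ge0.
rewrite /C [X in (_ <= X)%E]EFinM; apply: lee_wpmul2l; first by rewrite lee_fin mulr_ge0// ltW// c2pi_gt0.
rewrite [X in (_ <= X)%E]EFinM; apply: lee_pmul; try exact: uA.
- by apply: integral_ge0 => x _; rewrite lee_fin cmod_ge0.
- by apply: integral_ge0 => x _; rewrite lee_fin cmod_ge0.
Qed.

(** [cintble_duhamel] with the weight |f|: rapid decay absorbs the power |xi| lost by the
    nonlinearity. *)
Lemma cintble_duh_pairing f : schwartz f ->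
  cintble (leb \x lebP)%E (fun p : mR * mP => (heat t p.1 p.2)%:C%C * B p * f p.2).
Proof.
move=> sf; have [M hM] := schwartz_rapid sf 1.
have [M' hM'] : exists M' : R, forall x, cmod (f x) <= M'.
  by exists M => x; apply: le_trans (hM x); rewrite ler_peMl ?cmod_ge0// expr1 lerDl enorm_ge0.
have mf := schwartz_cmeas sf.
have c := @cintble_duhamel (fun x => cmod (f x)) M (cmeas_cmod mf) (fun x => cmod_ge0 _).
have {}c : cintble (leb \x lebP)%E (fun p : mR * mP => (heat t p.1 p.2 * cmod (f p.2))%:C%C * B p).
  apply: c => x; apply: le_trans (hM x); rewrite ler_wpM2r ?cmod_ge0//.
  by rewrite expr1 lerDr.
have /cintbleP[_ i] := c; apply/cintbleP; split.
  apply: cmeasM; last exact: (cmeas_comp (h := snd)).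
  by apply: cmeasM; [apply: cmeas_real; exact: measurable_heat|exact: cmeas_bil_time].
apply: le_lt_trans i; apply: le_of_eq; apply: eq_integral => p _.
congr EFin; move: (B p) => b; rewrite !cmodM !cmod_real.
have /andP[h0 _] := heat_itv t p.1 p.2.
rewrite (ger0_norm h0) ger0_norm; first by rewrite mulrAC.
by rewrite mulr_ge0// cmod_ge0.
Qed.

(** [cintble_duhamel] with the weight [tamew], followed by Tonelli to integrate in time first. *)
Lemma tame_duh : tame (duh u t).
Proof.
have mG : cmeas (fun p : mR * mP => (heat t p.1 p.2)%:C%C * B p).
  by apply: cmeasM; [apply: cmeas_real; exact: measurable_heat|exact: cmeas_bil_time].
have mw : measurable_fun setT (@tamew R : mP -> mR).
  by apply: measurable_funX; exact: measurable_enorm1V.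
have c := @cintble_duhamel (@tamew R) 1 mw (@tamew_ge0 R) (@enorm_tamew_le1 R).
have mBx x : cmeas (fun tau : mR => (heat t tau x)%:C%C * B (tau, x)) := cmeas_pair2 x mG.
split; first exact: (cmeas_pair1 t (cmeas_duh mu)).
apply: le_lt_trans (cintble_lty c).
have mc := emeas_cmod (cintble_meas c).
have c0 (p : mR * mP) : (0 <= (cmod ((heat t p.1 p.2 * tamew p.2)%:C%C * B p))%:E)%E.
  by rewrite lee_fin cmod_ge0.
rewrite (fubini_tonelli2 _ mc c0) /fubini_G; apply: ge0_le_integral => //.
- by move=> x _; rewrite lee_fin mulr_ge0 ?cmod_ge0// tamew_ge0.
- apply/measurable_EFinP; apply: measurable_funM => //; apply: cmeas_cmod.
  exact: (cmeas_pair1 t (cmeas_duh mu)).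
- exact: (measurable_fun_fubini_tonelli_G _ mc c0).
move=> x _; rewrite mulrC EFinM.
apply: (@le_trans _ _ ((tamew x)%:E * \int[leb]_tau (cmod ((heat t tau x)%:C%C * B (tau, x)))%:E)%E).
  by apply: lee_wpmul2l; [rewrite lee_fin tamew_ge0|exact: (cmod_cintegral_le leb (mBx x))].
rewrite -ge0_integralZl//; last 3 first.
- exact: (emeas_cmod (mBx x)).
- by move=> tau _; rewrite lee_fin cmod_ge0.
- by rewrite lee_fin tamew_ge0.
apply: le_of_eq; apply: eq_integral => tau _.
rewrite -EFinM; congr EFin; move: (B (tau, x)) => b; rewrite !cmodM !cmod_real.
have -> : `|heat t tau x * tamew x| = `|heat t tau x| * tamew x.
  by rewrite normrM (ger0_norm (tamew_ge0 x)).
by rewrite mulrA [tamew x * _]mulrC.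
Qed.

(** The distribution integrates in time after pairing with a test function, whereas [duh] integrates
    in time at fixed frequency; Fubini exchanges the two orders thanks to the pairing with a
    Schwartz function. *)
Lemma spec_duhamel (theta : R -> @dist R) :
  (forall tau, 0 <= tau <= t -> spec (theta tau) (fun x => u (tau, x))) ->
  spec (duhamel theta t) (duh u t).
Proof.
move=> su; split; first exact: tame_duh.
move=> f sf; have si := schwartz_ifourier sf.
rewrite /duhamel cintegral_mkcond.
have c := cintble_duh_pairing si.
have -> : CI (fun x => duh u t x * ifourier f x) =
    cintegral lebP setT (fun x => cintegral leb setT (fun tau =>
      (heat t tau x)%:C%C * B (tau, x) * ifourier f x)).
  apply: cintegral_ae.
  - by apply: cintble_meas; apply: tame_pairing => //; exact: tame_duh.
  - exact: (cintble_meas (cintble_fubini2 c)).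
  - have := cintble_ae2 c; apply: filterS => x cx _.
    symmetry; exact: (@cintegralZr_any R _ _ leb
      (fun tau : mR => (heat t tau x)%:C%C * B (tau, x)) (ifourier f x) cx).
rewrite -(cintegral_exchange c); congr cintegral; apply/funext => tau.
have [tt|nt] := boolP (tau \in `[0, t]%classic); last first.
  rewrite indicE (negbTE nt) mul0r (_ : (fun x => _) = (fun=> 0)) ?cintegral0//.
  by apply/funext => x; rewrite /heat indicE (negbTE nt) !mul0r.
have t01 : 0 <= tau <= t by move: tt; rewrite inE /= in_itv.
have cu : cintble leb2 (fun x => u (tau, x)).
  by apply/cintbleP; split => //; apply: le_lt_trans (uA t01) (ltry _).
have tt0 : 0 <= t - tau by rewrite subr_ge0; case/andP: t01.
have [_ ->//] := spec_poisson tt0 (spec_transport (su _ t01) cu).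
rewrite indicE tt mul1r; congr cintegral; apply/funext => x.
by rewrite /heat indicE tt mul1r.
Qed.

End Duhamel.
End Nonlinearity.

(** * Majorants and the fixed point *)

Section NonnegativeIntegral.
Context {R : realType} d (T : measurableType d) (mu : {measure set T -> \bar R}).
Local Open Scope ereal_scope.
Implicit Types f g h : T -> \bar R.

Lemma le_int f g : measurable_fun setT f -> measurable_fun setT g -> (forall x, 0 <= f x) ->
  (forall x, f x <= g x) -> \int[mu]_x f x <= \int[mu]_x g x.
Proof. by move=> mf mg f0 fg; exact: ge0_le_integral. Qed.

Lemma int_ge0 f : (forall x, 0 <= f x) -> 0 <= \int[mu]_x f x.
Proof. by move=> f0; exact: integral_ge0. Qed.

Lemma intZl k f : measurable_fun setT f -> (forall x, 0 <= f x) -> 0 <= k ->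
  \int[mu]_x (k * f x) = k * \int[mu]_x f x.
Proof. by move=> mf f0 k0; exact: ge0_integralZl. Qed.

Lemma intZr k f : measurable_fun setT f -> (forall x, 0 <= f x) -> 0 <= k ->
  \int[mu]_x (f x * k) = \int[mu]_x f x * k.
Proof. by move=> mf f0 k0; exact: ge0_integralZr. Qed.

Lemma intD f g : measurable_fun setT f -> (forall x, 0 <= f x) -> measurable_fun setT g ->
  (forall x, 0 <= g x) -> \int[mu]_x (f x + g x) = \int[mu]_x f x + \int[mu]_x g x.
Proof. by move=> mf f0 mg g0; exact: ge0_integralD. Qed.

Lemma intD3 f g h : measurable_fun setT f -> measurable_fun setT g -> measurable_fun setT h ->
  (forall x, 0 <= f x) -> (forall x, 0 <= g x) -> (forall x, 0 <= h x) ->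
  \int[mu]_x (f x + (g x + h x)) = \int[mu]_x f x + (\int[mu]_x g x + \int[mu]_x h x).
Proof.
move=> mf mg mh f0 g0 h0; rewrite intD//; last by move=> x; exact: adde_ge0.
  by rewrite intD.
exact: emeasurable_funD.
Qed.

End NonnegativeIntegral.

Section Majorants.
Context {R : realType}.
Local Notation mR := (measurableTypeR R).
Local Notation mP := (measurableTypeR R * measurableTypeR R)%type.
Local Notation plane := (@Defs.plane R).
Local Notation leb := (@lebesgue_measure R).
Implicit Types (f g : mR * mP -> R[i]) (P Q : mP -> \bar R).

Lemma heat_ge0 t tau (xi : plane) : 0 <= heat t tau xi.
Proof. by have /andP[] := heat_itv t tau xi. Qed.

Lemma heatE t tau (xi : plane) : 0 <= tau -> tau <= t -> heat t tau xi = expR (- ((t - tau) * enorm xi)).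
Proof.
move=> t0 tt; rewrite /heat indicE (_ : _ \in _ = true) ?mul1r//.
by apply: mem_set => /=; rewrite in_itv/= t0 tt.
Qed.

Lemma heat_eq0 t tau (xi : plane) : ~~ (0 <= tau <= t) -> heat t tau xi = 0.
Proof.
move=> h; rewrite /heat indicE (_ : _ \in _ = false) ?mul0r//.
by apply/negbTE; rewrite notin_setE /= in_itv /=; exact/negP.
Qed.

Lemma heat_le1 t tau (xi : plane) : heat t tau xi <= 1.
Proof.
have /andP[_ h] := heat_itv t tau xi; apply: le_trans h _.
by rewrite indicE; case: (_ \in _).
Qed.

Lemma measurable_heat_time tau (xi : plane) : measurable_fun setT (fun t : mR => heat t tau xi : mR).
Proof. exact: measurable_heat_comp. Qed.

(** The substitution s = |xi| (t - tau) reduces to the unit mass of exp(-s). An inequality only: the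
    left side is 0 at the origin and for negative [tau]. *)
Lemma integral_heat tau (xi : plane) :
  ((enorm xi)%:E * \int[leb]_t (heat t tau xi)%:E <= 1)%E.
Proof.
have [e0|e0] := eqVneq (enorm xi) 0; first by rewrite e0 mul0e.
have ep : 0 < enorm xi by rewrite lt_neqAle eq_sym e0 enorm_ge0.
pose U : mR -> R := fun s => \1_`[0, +oo[%classic s * expR (- s).
have mU : measurable_fun setT U.
  apply: measurable_funM; first exact: measurable_indic.
  by apply: measurableT_comp => //; exact: measurableT_comp.
have U0 s : 0 <= U s by rewrite mulr_ge0 ?expR_ge0// indicE.
have iU : (\int[leb]_s (U s)%:E = 1)%E.
  rewrite -[RHS]integral_expN [RHS]integral_mkcond; apply: eq_integral => s _.
  by rewrite restrict_EFin/= patchE /U indicE; case: (s \in _); rewrite ?mul1r ?mul0r.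
have h t : ((heat t tau xi)%:E <= (U (- (enorm xi * tau) + enorm xi * t))%:E)%E.
  rewrite lee_fin; have [/andP[t0 t1]|n] := boolP (0 <= tau <= t); last by rewrite (heat_eq0 _ n).
  rewrite (heatE _ t0 t1) /U indicE (_ : _ \in _ = true).
    by rewrite mul1r ler_expR; apply: le_of_eq; congr (- _); ring.
  apply: mem_set => /=; rewrite in_itv/= andbT addrC -mulrBr mulr_ge0 ?subr_ge0//; exact: ltW.
apply: (@le_trans _ _ ((enorm xi)%:E * \int[leb]_t (U (- (enorm xi * tau) + enorm xi * t))%:E)%E).
  apply: lee_wpmul2l; first by rewrite lee_fin ltW.
  apply: le_int => //; last by move=> t; rewrite lee_fin heat_ge0.
  - by apply/measurable_EFinP; exact: measurable_heat_time.
  - by apply/measurable_EFinP; apply: (measurableT_comp mU); exact: measurable_affine.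
rewrite (@integral_affine1 _ _ _ (fun s => (U s)%:E)) ?gt_eqF//.
- by rewrite iU mule1 -EFinM gtr0_norm// divff.
- exact/measurable_EFinP.
Qed.

(* [f] is controlled by [P] in L^oo_t and, with one extra power of [|xi|], in L^1_t: the two norms
   of the fixed point argument, frequency by frequency. *)
Definition dom f P : Prop :=
  (forall t xi, ((cmod (f (t, xi)))%:E <= P xi)%E) /\
  (forall xi, ((enorm xi)%:E * \int[leb]_t (cmod (f (t, xi)))%:E <= P xi)%E).

Lemma dom_ge0 f P xi : dom f P -> (0 <= P xi)%E.
Proof. by move=> [/(_ 0 xi) h _]; apply: le_trans h; rewrite lee_fin cmod_ge0. Qed.

Lemma dom_le f P Q : (forall xi, (P xi <= Q xi)%E) -> dom f P -> dom f Q.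
Proof.
by move=> PQ [h1 h2]; split => [t|] xi; apply: le_trans (PQ xi).
Qed.

Let mcm f xi : cmeas f -> measurable_fun setT (fun t => (cmod (f (t, xi)))%:E).
Proof. by move=> mf; apply: emeas_cmod; exact: cmeas_pair2. Qed.

Lemma domD f g P Q : cmeas f -> cmeas g -> dom f P -> dom g Q ->
  dom (fun p => f p + g p) (fun xi => P xi + Q xi)%E.
Proof.
move=> mf mg [f1 f2] [g1 g2]; split => [t xi|xi].
  by apply: le_trans (leeD (f1 t xi) (g1 t xi)); rewrite -EFinD lee_fin le_cmodD.
apply: le_trans (leeD (f2 xi) (g2 xi)).
rewrite -ge0_muleDr ?int_ge0//; try by move=> t; rewrite lee_fin cmod_ge0.
apply: lee_wpmul2l; first by rewrite lee_fin enorm_ge0.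
rewrite -intD; try exact: mcm; try by move=> t; rewrite lee_fin cmod_ge0.
apply: le_int.
- exact: (@mcm _ xi (cmeasD mf mg)).
- by apply: emeasurable_funD; exact: mcm.
- by move=> t; rewrite lee_fin cmod_ge0.
- by move=> t; rewrite -EFinD lee_fin le_cmodD.
Qed.

Lemma domN f P : dom f P -> dom (fun p => - f p) P.
Proof.
move=> [f1 f2]; split => [t xi|xi]; first by rewrite cmodN.
by under eq_integral do rewrite cmodN.
Qed.

Lemma dom0 : dom (fun=> 0) (fun=> 0%E).
Proof.
split => [t xi|xi]; first by rewrite cmod0.
by under eq_integral do rewrite cmod0; rewrite integral0 mule0.
Qed.

Lemma dom_heat (w : mP -> R[i]) : cmeas w ->
  dom (fun p => (heat p.1 0 p.2)%:C%C * w p.2) (fun xi => (cmod (w xi))%:E).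
Proof.
move=> mw; split => [t xi|xi] /=.
  by rewrite lee_fin cmodM cmod_real ger0_norm ?heat_ge0// ler_piMl ?cmod_ge0// heat_le1.
under eq_integral do rewrite cmodM cmod_real ger0_norm ?heat_ge0// EFinM.
rewrite intZr; last 3 first.
- by apply/measurable_EFinP; exact: measurable_heat_time.
- by move=> t; rewrite lee_fin heat_ge0.
- by rewrite lee_fin cmod_ge0.
rewrite muleA -[leRHS]mul1e; apply: lee_wpmul2r; first by rewrite lee_fin cmod_ge0.
exact: integral_heat.
Qed.

Lemma dom_mask f P (G : set mP) : cmeas f -> (forall xi, (0 <= P xi)%E) ->
  (forall t xi, G xi -> ((cmod (f (t, xi)))%:E <= P xi)%E) ->
  (forall xi, G xi -> ((enorm xi)%:E * \int[leb]_t (cmod (f (t, xi)))%:E <= P xi)%E) ->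
  dom (fun p => (\1_G p.2 : R)%:C%C * f p) P.
Proof.
move=> mf P0 f1 f2; split => [t xi|xi] /=.
  have [xG|xG] := boolP (xi \in G); rewrite indicE ?xG ?(negbTE xG) ?mul1r ?mul0r ?cmod0//.
  by apply: f1; exact/set_mem.
have [xG|xG] := boolP (xi \in G); rewrite indicE ?xG ?(negbTE xG).
  by under eq_integral do rewrite mul1r; apply: f2; exact/set_mem.
by under eq_integral do rewrite mul0r cmod0; rewrite integral0 mule0.
Qed.

Section Kernel.
Variable delta : R.
Hypotheses (d0 : 0 <= delta) (d1 : delta < 1).
Local Notation nrm xi := (enorm (xi : plane)).

(** The minimum keeps two estimates in one kernel: the bound 1 gives the L^1 estimate of a product,
    and the other bound cancels the weight |xi|^(-delta) and leaves it on one factor. *)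
Definition mker (xi y : mP) : R :=
  Num.min 1 (nrm xi `^ delta * (nrm y `^ (- delta) + nrm (psub xi y) `^ (- delta))).

Lemma mker_itv xi y : 0 <= mker xi y <= 1.
Proof.
rewrite /mker ge_min lexx andbT le_min ler01/=.
by rewrite mulr_ge0 ?addr_ge0 ?powR_ge0.
Qed.

Lemma measurable_mker : measurable_fun setT (fun p : mP * mP => mker p.1 p.2 : mR).
Proof.
have mpow (r : R) (h : mP * mP -> mP) : measurable_fun setT h ->
    measurable_fun setT (fun p : mP * mP => nrm (h p) `^ r : mR).
  move=> mh; apply: (measurableT_comp (measurable_powR r)).
  exact: (measurableT_comp (@measurable_enorm R) mh).
apply: measurable_minr => //; apply: measurable_funM; first exact: mpow.
apply: measurable_funD; first exact: mpow.
by apply: mpow; exact: measurable_psub.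
Qed.

(** Writing |k| = |k|^delta |k|^(1-delta) and using both bounds of the symbol gives |xi|^delta
    |y|^(1-delta); comparing |y| with |z| gives one of the two terms. In each term a full power of
    one frequency is spent on a time integral, while the weight falls on the other frequency. *)
Lemma kern_interp xi y (z := psub xi y) :
  `|kern xi z| <= nrm xi `^ delta * (nrm z * nrm y `^ (- delta) + nrm y * nrm z `^ (- delta)).
Proof.
have rhs0 : 0 <= nrm xi `^ delta * (nrm z * nrm y `^ (- delta) + nrm y * nrm z `^ (- delta)).
  by rewrite mulr_ge0 ?addr_ge0 ?mulr_ge0 ?powR_ge0 ?enorm_ge0.
have kx := ler_kern xi z; have ky : `|kern xi z| <= nrm y.
  by apply: le_trans (ler_kern_sub _ _) _; rewrite /z /psub subKr.
have [k0|k0] := eqVneq `|kern xi z| 0; first by rewrite k0.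
have kp : 0 < `|kern xi z| by rewrite lt_neqAle eq_sym k0 normr_ge0.
have xp : 0 < nrm xi by exact: lt_le_trans kx.
have yp : 0 < nrm y by exact: lt_le_trans ky.
have zp : 0 < nrm z.
  rewrite lt_neqAle enorm_ge0 andbT eq_sym; apply: contraNneq k0 => /eqP.
  by rewrite enorm_eq0 => /eqP ->; rewrite kern0 normr0.
have e1 : `|kern xi z| <= nrm xi `^ delta * nrm y `^ (1 - delta).
  have -> : `|kern xi z| = `|kern xi z| `^ delta * `|kern xi z| `^ (1 - delta).
    by rewrite -powRD ?subrKC ?powRr1// k0 implybT.
  apply: ler_pM; rewrite ?powR_ge0//; apply: ge0_ler_powR; rewrite ?nnegrE ?subr_ge0 ?enorm_ge0//.
  exact: ltW.
apply: le_trans e1 _; apply: ler_wpM2l; first exact: powR_ge0.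
have -> : nrm y `^ (1 - delta) = nrm y * nrm y `^ (- delta).
  by rewrite powRD ?powRr1 ?enorm_ge0// (gt_eqF yp) implybT.
have [yz|zy] := lerP (nrm y) (nrm z).
  apply: (@le_trans _ _ (nrm z * nrm y `^ (- delta))); first by rewrite ler_wpM2r ?powR_ge0.
  by rewrite lerDl mulr_ge0 ?powR_ge0 ?enorm_ge0.
apply: (@le_trans _ _ (nrm y * nrm z `^ (- delta))); last first.
  by rewrite lerDr mulr_ge0 ?powR_ge0 ?enorm_ge0.
rewrite ler_wpM2l ?enorm_ge0// !powRN lef_pV2 ?posrE ?powR_gt0//.
by apply: ge0_ler_powR; rewrite ?nnegrE ?enorm_ge0// ltW.
Qed.

Definition Maj P Q (xi : mP) : \bar R :=
  (c2pi%:E * \int[leb2]_y ((mker xi y)%:E * (P y * Q (psub xi y))))%E.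

(** A factor |y| lets f be integrated in time with g bounded in time; a factor |z| does the
    converse. Each gives P(y) Q(z), and the symbol is at most |y| or the interpolated
    combination. *)
Lemma kern_dom f g P Q xi y (z := psub xi y) : cmeas f -> cmeas g -> dom f P -> dom g Q ->
  (`|kern xi z|%:E * \int[leb]_tau (cmod (f (tau, y)) * cmod (g (tau, z)))%:E <=
   (mker xi y)%:E * (P y * Q z))%E.
Proof.
move=> mf mg df dg; have P0 := dom_ge0 y df; have Q0 := dom_ge0 z dg.
have [f1 f2] := df; have [g1 g2] := dg.
set X := (\int[leb]_tau _)%E.
have mfg : measurable_fun setT (fun tau => (cmod (f (tau, y)) * cmod (g (tau, z)))%:E).
  apply/measurable_EFinP; apply: measurable_funM; apply: cmeas_cmod; exact: cmeas_pair2.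
have fg0 tau : (0 <= (cmod (f (tau, y)) * cmod (g (tau, z)))%:E)%E.
  by rewrite lee_fin mulr_ge0 ?cmod_ge0.
have c0 (h : mR * mP -> R[i]) x tau : (0 <= (cmod (h (tau, x)))%:E)%E by rewrite lee_fin cmod_ge0.
have X0 : (0 <= X)%E by exact: int_ge0.
have nX (a : R) : 0 <= a -> (0 <= a%:E)%E by rewrite lee_fin.
have yX : ((nrm y)%:E * X <= P y * Q z)%E.
  apply: (@le_trans _ _ ((nrm y)%:E * ((\int[leb]_tau (cmod (f (tau, y)))%:E) * Q z))%E).
    apply: lee_wpmul2l; first by rewrite lee_fin enorm_ge0.
    rewrite -intZr//; last exact: mcm.
    apply: le_int => //; first by apply: emeasurable_funM; [exact: mcm|exact: measurable_cst].
    by move=> tau; rewrite EFinM; apply: lee_wpmul2l; [exact: c0|exact: g1].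
  by rewrite muleA; apply: lee_wpmul2r.
have zX : ((nrm z)%:E * X <= P y * Q z)%E.
  apply: (@le_trans _ _ ((nrm z)%:E * (P y * (\int[leb]_tau (cmod (g (tau, z)))%:E)))%E).
    apply: lee_wpmul2l; first by rewrite lee_fin enorm_ge0.
    rewrite -intZl//; last exact: mcm.
    apply: le_int => //; first by apply: emeasurable_funM; [exact: measurable_cst|exact: mcm].
    by move=> tau; rewrite EFinM; apply: lee_wpmul2r; [exact: c0|exact: f1].
  by rewrite muleCA; apply: lee_wpmul2l.
have A1 : (`|kern xi z|%:E * X <= P y * Q z)%E.
  apply: le_trans yX; apply: lee_wpmul2r => //; rewrite lee_fin.
  by apply: le_trans (ler_kern_sub _ _) _; rewrite /z /psub subKr.
rewrite /mker /Num.min; case: ifPn => _; first by rewrite mul1e.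
apply: (@le_trans _ _ ((nrm xi `^ delta * (nrm z * nrm y `^ (- delta) + nrm y * nrm z `^ (- delta)))%:E * X)%E).
  by apply: lee_wpmul2r => //; rewrite lee_fin; exact: kern_interp.
rewrite !EFinM -!muleA; apply: lee_wpmul2l; first by rewrite lee_fin powR_ge0.
rewrite !EFinD !EFinM ge0_muleDl; [|by rewrite mule_ge0// nX// ?enorm_ge0 ?powR_ge0..].
rewrite ge0_muleDl; [|by rewrite nX// powR_ge0..].
apply: leeD.
- by rewrite [X in (X * _)%E]muleC -muleA; apply: lee_wpmul2l; [rewrite nX// powR_ge0|].
- by rewrite [X in (X * _)%E]muleC -muleA; apply: lee_wpmul2l; [rewrite nX// powR_ge0|].
Qed.

End Kernel.
End Majorants.

(** * The bilinear Duhamel operator and its majorant *)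

Section BilinearDuhamel.
Context {R : realType}.
Local Notation mR := (measurableTypeR R).
Local Notation mP := (measurableTypeR R * measurableTypeR R)%type.
Local Notation plane := (@Defs.plane R).
Local Notation leb := (@lebesgue_measure R).
Implicit Types (f g : mR * mP -> R[i]) (P Q : mP -> \bar R).

Definition phik f g (q : mR * mP) (p : mR * mP) : R[i] :=
  (heat q.1 p.1 q.2)%:C%C * ((kern q.2 (psub q.2 p.2))%:C%C * (f p * g (p.1, psub q.2 p.2))).

(* The Duhamel term as one integral over time and frequency. *)
Definition Phi f g (q : mR * mP) : R[i] :=
  c2pi%:C%C * cintegral (prodsf leb lebP) setT (phik f g q).

Definition absk f g (xi : mP) (p : mR * mP) : R :=
  `|kern xi (psub xi p.2)| * (cmod (f p) * cmod (g (p.1, psub xi p.2))).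

(** The heat factor is dropped. The result bounds both halves of [dom] for [Phi]: the supremum in
    time because the factor is at most 1, and |xi| times the time integral because of
    [integral_heat]. *)
Definition Ab f g (xi : mP) : \bar R :=
  (c2pi%:E * \int[prodsf leb lebP]_p (absk f g xi p)%:E)%E.

Lemma absk_ge0 f g xi p : 0 <= absk f g xi p.
Proof. by rewrite !mulr_ge0 ?cmod_ge0. Qed.

Lemma cmod_phik f g q p : cmod (phik f g q p) = heat q.1 p.1 q.2 * absk f g q.2 p.
Proof.
have h0 := heat_ge0 q.1 p.1 (q.2 : plane).
move: h0; rewrite /phik /absk; move: (heat _ _ _) (kern _ _) => h k h0.
by rewrite !cmodM !cmod_real (ger0_norm h0).
Qed.

Let mshift d (T : measurableType d) (a : T -> mR) (b c : T -> mP) g : cmeas g ->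
  measurable_fun setT a -> measurable_fun setT b -> measurable_fun setT c ->
  cmeas (fun x => g (a x, psub (b x) (c x))).
Proof.
move=> mg ma mb mc; apply: (cmeas_comp (h := fun x => (a x, psub (b x) (c x))) _ mg).
apply: measurable_fun_pair => //.
apply: (measurableT_comp (@measurable_psub R) (g := fun x => (b x, c x))).
exact: measurable_fun_pair.
Qed.

Let mkern d (T : measurableType d) (b c : T -> mP) :
  measurable_fun setT b -> measurable_fun setT c ->
  measurable_fun setT (fun x => kern (b x) (psub (b x) (c x)) : mR).
Proof.
move=> mb mc; apply: (measurableT_comp (@measurable_kern R) (g := fun x => (b x, psub (b x) (c x)))).
apply: measurable_fun_pair => //.
apply: (measurableT_comp (@measurable_psub R) (g := fun x => (b x, c x))).
exact: measurable_fun_pair.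
Qed.

Lemma cmeas_phik f g : cmeas f -> cmeas g ->
  cmeas (fun z : (mR * mP) * (mR * mP) => phik f g z.1 z.2).
Proof.
move=> mf mg.
have m11 : measurable_fun setT (fun z : (mR * mP) * (mR * mP) => z.1.1).
  exact: (measurableT_comp measurable_fst measurable_fst).
have m12 : measurable_fun setT (fun z : (mR * mP) * (mR * mP) => z.1.2).
  exact: (measurableT_comp measurable_snd measurable_fst).
have m21 : measurable_fun setT (fun z : (mR * mP) * (mR * mP) => z.2.1).
  exact: (measurableT_comp measurable_fst measurable_snd).
have m22 : measurable_fun setT (fun z : (mR * mP) * (mR * mP) => z.2.2).
  exact: (measurableT_comp measurable_snd measurable_snd).
apply: cmeasM; first by apply: cmeas_real; exact: measurable_heat_comp.
apply: cmeasM; first by apply: cmeas_real; exact: mkern.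
apply: cmeasM; first exact: (cmeas_comp (h := snd)).
exact: mshift.
Qed.

Lemma cmeas_Phi f g : cmeas f -> cmeas g -> cmeas (Phi f g).
Proof.
move=> mf mg; apply: cmeasM; first exact: cmeas_cst.
exact: (cmeas_param (prodsf leb lebP) (cmeas_phik mf mg)).
Qed.

Lemma measurable_absk f g xi : cmeas f -> cmeas g -> measurable_fun setT (absk f g xi : mR * mP -> mR).
Proof.
move=> mf mg; apply: measurable_funM.
  by apply: measurableT_comp => //; apply: mkern.
apply: measurable_funM; apply: cmeas_cmod; first exact: mf.
exact: mshift.
Qed.

Let ma f g xi : cmeas f -> cmeas g -> measurable_fun setT (fun p => (absk f g xi p)%:E).
Proof. by move=> mf mg; apply/measurable_EFinP; exact: measurable_absk. Qed.

Let a0 f g xi p : (0 <= (absk f g xi p)%:E)%E.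
Proof. by rewrite lee_fin absk_ge0. Qed.

Let c0 : (0 <= (@c2pi R)%:E)%E. Proof. by rewrite lee_fin ltW// c2pi_gt0. Qed.

Lemma cmod_Phi_le f g q : cmeas f -> cmeas g -> ((cmod (Phi f g q))%:E <= Ab f g q.2)%E.
Proof.
move=> mf mg; rewrite /Phi cmodM cmod_real (ger0_norm (ltW c2pi_gt0)) EFinM.
apply: lee_wpmul2l => //; have m := cmeas_pair1 q (cmeas_phik mf mg).
apply: le_trans (cmod_cintegral_le _ m) _.
apply: le_int => //; [exact: emeas_cmod|exact: ma|by move=> p; rewrite lee_fin cmod_ge0|].
by move=> p; rewrite cmod_phik lee_fin ler_piMl ?absk_ge0// heat_le1.
Qed.

Lemma cintble_phik f g q : cmeas f -> cmeas g -> (Ab f g q.2 < +oo)%E ->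
  cintble (prodsf leb lebP) (phik f g q).
Proof.
move=> mf mg h; have m := cmeas_pair1 q (cmeas_phik mf mg).
apply/cintbleP; split => //.
apply: (@le_lt_trans _ _ (\int[prodsf leb lebP]_p (absk f g q.2 p)%:E)%E).
  apply: le_int => //; [exact: emeas_cmod|exact: ma|by move=> p; rewrite lee_fin cmod_ge0|].
  by move=> p; rewrite cmod_phik lee_fin ler_piMl ?absk_ge0// heat_le1.
move: h; rewrite /Ab; set I := (\int[_]_p _)%E.
have I0 : (0 <= I)%E by apply: int_ge0.
case: I I0 => [r _ _|_|//]; first exact: ltry.
by rewrite gt0_muley ?lte_fin ?c2pi_gt0.
Qed.

(** Tonelli, integrating first in the final time t: only the heat factor depends on it, and its
    integral times |xi| is at most 1. *)
Lemma integral_time_Phi_le f g xi : cmeas f -> cmeas g ->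
  ((enorm (xi : plane))%:E * \int[leb]_t (cmod (Phi f g (t, xi)))%:E <= Ab f g xi)%E.
Proof.
move=> mf mg.
have e0 : (0 <= (enorm (xi : plane))%:E)%E by rewrite lee_fin enorm_ge0.
have mphi t : cmeas (phik f g (t, xi)) := cmeas_pair1 (t, xi) (cmeas_phik mf mg).
have mj : measurable_fun setT (fun z : mR * (mR * mP) => (heat z.1 z.2.1 xi * absk f g xi z.2)%:E).
  apply/measurable_EFinP; apply: measurable_funM.
    apply: measurable_heat_comp; [exact: measurable_fst| |exact: measurable_cst].
    exact: (measurableT_comp measurable_fst measurable_snd).
  exact: (measurableT_comp (measurable_absk xi mf mg)).
have j0 (z : mR * (mR * mP)) : (0 <= (heat z.1 z.2.1 xi * absk f g xi z.2)%:E)%E.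
  by rewrite lee_fin mulr_ge0 ?heat_ge0 ?absk_ge0.
have mI : measurable_fun setT (fun t => \int[prodsf leb lebP]_p (heat t p.1 xi * absk f g xi p)%:E)%E.
  exact: (measurable_integral_param (prodsf leb lebP) mj j0).
apply: (@le_trans _ _ ((enorm (xi : plane))%:E * \int[leb]_t
    (c2pi%:E * \int[prodsf leb lebP]_p (heat t p.1 xi * absk f g xi p)%:E))%E).
  apply: lee_wpmul2l => //; apply: le_int.
  - by apply: emeas_cmod; exact: (cmeas_pair2 xi (cmeas_Phi mf mg)).
  - by apply: emeasurable_funM => //; exact: measurable_cst.
  - by move=> t; rewrite lee_fin cmod_ge0.
  - move=> t; rewrite /Phi cmodM cmod_real (ger0_norm (ltW c2pi_gt0)) EFinM.
    apply: lee_wpmul2l => //; apply: le_trans (cmod_cintegral_le _ (mphi t)) _.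
    by apply: le_of_eq; apply: eq_integral => p _; rewrite cmod_phik.
rewrite intZl//; last by move=> t; apply: int_ge0 => p; exact: (j0 (t, p)).
rewrite muleCA; apply: lee_wpmul2l => //.
rewrite (@fubini_tonelli _ _ _ _ _ leb (prodsf leb lebP)
  (fun z : mR * (mR * mP) => (heat z.1 z.2.1 xi * absk f g xi z.2)%:E))//.
have mh tau : measurable_fun setT (fun t : mR => (heat t tau xi)%:E).
  by apply/measurable_EFinP; exact: measurable_heat_time.
have h0 t tau : (0 <= (heat t tau xi)%:E)%E by rewrite lee_fin heat_ge0.
have E p : (\int[leb]_t (heat t p.1 xi * absk f g xi p)%:E =
    (\int[leb]_t (heat t p.1 xi)%:E) * (absk f g xi p)%:E)%E.
  by under eq_integral do rewrite EFinM; rewrite intZr.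
under eq_integral do rewrite E.
have mG : measurable_fun setT (fun p : mR * mP => (\int[leb]_t (heat t p.1 xi)%:E)%E).
  apply: (measurableT_comp (f := fun tau => (\int[leb]_t (heat t tau xi)%:E)%E) _ measurable_fst).
  apply: (measurable_integral_param leb (f := fun z : mR * mR => (heat z.2 z.1 xi)%:E)) => //.
  by apply/measurable_EFinP; apply: measurable_heat_comp.
rewrite -intZl//; last 2 first.
- by apply: emeasurable_funM => //; exact: ma.
- by move=> p; rewrite mule_ge0// int_ge0.
apply: le_int.
- by apply: emeasurable_funM; [exact: measurable_cst|apply: emeasurable_funM => //; exact: ma].
- exact: ma.
- by move=> p; rewrite !mule_ge0// int_ge0.
- move=> p; rewrite muleA -[leRHS]mul1e; apply: lee_wpmul2r => //.
  exact: integral_heat.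
Qed.

Section Delta.
Variable delta : R.
Hypotheses (d0 : 0 <= delta) (d1 : delta < 1).
Local Notation Majd := (Maj delta).
Local Notation mkd := (mker delta).

Let mk0 xi y : (0 <= (mkd xi y)%:E)%E.
Proof. by rewrite lee_fin; have /andP[] := mker_itv delta xi y. Qed.

Lemma measurable_Maj_kernel P Q : measurable_fun setT P -> measurable_fun setT Q ->
  measurable_fun setT (fun p : mP * mP => (mkd p.1 p.2)%:E * (P p.2 * Q (psub p.1 p.2)))%E.
Proof.
move=> mP' mQ; apply: emeasurable_funM.
  by apply/measurable_EFinP; exact: measurable_mker.
apply: emeasurable_funM; first exact: (measurableT_comp mP').
exact: (measurableT_comp mQ (@measurable_psub R)).
Qed.

Let mMk P Q xi : measurable_fun setT P -> measurable_fun setT Q ->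
  measurable_fun setT (fun y => (mkd xi y)%:E * (P y * Q (psub xi y)))%E.
Proof.
move=> hP hQ; have h := measurable_Maj_kernel hP hQ.
exact: (measurableT_comp h (measurable_pair1 xi)).
Qed.

Lemma measurable_Maj P Q : measurable_fun setT P -> measurable_fun setT Q ->
  (forall x, (0 <= P x)%E) -> (forall x, (0 <= Q x)%E) -> measurable_fun setT (Majd P Q).
Proof.
move=> hP hQ P0 Q0; apply: emeasurable_funM; first exact: measurable_cst.
apply: (measurable_integral_param lebP (measurable_Maj_kernel hP hQ)).
by move=> p; rewrite !mule_ge0.
Qed.

Lemma Maj_ge0 P Q xi : (forall x, (0 <= P x)%E) -> (forall x, (0 <= Q x)%E) -> (0 <= Majd P Q xi)%E.
Proof. by move=> P0 Q0; apply: mule_ge0 => //; apply: int_ge0 => y; rewrite !mule_ge0. Qed.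

Lemma Ab_le_Maj f g P Q xi : cmeas f -> cmeas g -> measurable_fun setT P -> measurable_fun setT Q ->
  dom f P -> dom g Q -> (Ab f g xi <= Majd P Q xi)%E.
Proof.
move=> mf mg hP hQ df dg; apply: lee_wpmul2l => //.
rewrite (@fubini_tonelli2 _ _ _ _ _ leb lebP _ (ma xi mf mg) (a0 f g xi)) /fubini_G.
have E y : (\int[leb]_x (absk f g xi (x, y))%:E = `|kern xi (psub xi y)|%:E *
    \int[leb]_tau (cmod (f (tau, y)) * cmod (g (tau, psub xi y)))%:E)%E.
  rewrite -intZl//.
  - apply/measurable_EFinP; apply: measurable_funM; apply: cmeas_cmod; exact: cmeas_pair2.
  - by move=> t; rewrite lee_fin mulr_ge0 ?cmod_ge0.
apply: le_int.
- exact: (measurable_fun_fubini_tonelli_G _ (ma xi mf mg) (a0 f g xi)).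
- exact: mMk.
- by move=> y; apply: int_ge0.
- by move=> y; rewrite E; exact: kern_dom.
Qed.

Lemma dom_Phi f g P Q : cmeas f -> cmeas g -> measurable_fun setT P -> measurable_fun setT Q ->
  dom f P -> dom g Q -> dom (Phi f g) (Majd P Q).
Proof.
move=> mf mg hP hQ df dg; split => [t xi|xi].
  by apply: le_trans (cmod_Phi_le (t, xi) mf mg) _; exact: Ab_le_Maj.
by apply: le_trans (integral_time_Phi_le xi mf mg) _; exact: Ab_le_Maj.
Qed.

Local Notation w xi := ((enorm (xi : plane) `^ (- delta))%:E).

Let mw : measurable_fun setT (fun xi : mP => w xi).
Proof.
by apply/measurable_EFinP; exact: (measurableT_comp (measurable_powR (- delta)) (@measurable_enorm R)).
Qed.

Let w0 (xi : mP) : (0 <= w xi)%E. Proof. by rewrite lee_fin powR_ge0. Qed.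

Lemma integral_Maj P Q : measurable_fun setT P -> measurable_fun setT Q ->
  (forall x, (0 <= P x)%E) -> (forall x, (0 <= Q x)%E) ->
  (\int[leb2]_xi Majd P Q xi <= c2pi%:E * ((\int[leb2]_x P x) * (\int[leb2]_x Q x)))%E.
Proof.
move=> hP hQ P0 Q0; rewrite -integral_conv// -intZl//; last 2 first.
- apply: (measurable_integral_param lebP (f := fun p : mP * mP => (P p.2 * Q (psub p.1 p.2))%E)).
    apply: emeasurable_funM; first exact: (measurableT_comp hP).
    exact: (measurableT_comp hQ (@measurable_psub R)).
  by move=> p; rewrite mule_ge0.
- by move=> x; apply: int_ge0 => y; rewrite mule_ge0.
have mPQ x : measurable_fun setT (fun y => P y * Q (psub x y))%E.
  by apply: emeasurable_funM => //; exact: (measurableT_comp hQ (measurable_psub2 x)).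
apply: le_int.
- exact: measurable_Maj.
- apply: emeasurable_funM; first exact: measurable_cst.
  apply: (measurable_integral_param lebP (f := fun p : mP * mP => (P p.2 * Q (psub p.1 p.2))%E)).
    apply: emeasurable_funM; first exact: (measurableT_comp hP).
    exact: (measurableT_comp hQ (@measurable_psub R)).
  by move=> p; rewrite mule_ge0.
- by move=> x; exact: Maj_ge0.
- move=> x; apply: lee_wpmul2l => //; apply: le_int => //.
  + exact: mMk.
  + by move=> y; rewrite !mule_ge0.
  + move=> y; rewrite -[leRHS]mul1e; apply: lee_wpmul2r; first by rewrite mule_ge0.
    by rewrite lee_fin; have /andP[] := mker_itv delta x y.
Qed.

Lemma weight_mker xi y :
  enorm (xi : plane) `^ (- delta) * mkd xi y <=
  enorm (y : plane) `^ (- delta) + enorm (psub xi y : plane) `^ (- delta).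
Proof.
set s := _ `^ _ + _ `^ _; have s0 : 0 <= s by rewrite addr_ge0 ?powR_ge0.
(* At the origin [powR] is 1 for exponent 0 and 0 for a nonzero exponent, so delta = 0 is treated
   apart. *)
have [x0|x0] := eqVneq (enorm (xi : plane)) 0.
  have [dz|dz] := eqVneq delta 0.
    rewrite /s dz oppr0 !powRr0 mul1r; have /andP[_ h] := mker_itv 0 xi y.
    by apply: le_trans h _; rewrite lerDl.
  by rewrite x0 powR0 ?oppr_eq0// mul0r.
have xp : 0 < enorm (xi : plane) `^ delta by rewrite powR_gt0// lt_neqAle eq_sym x0 enorm_ge0.
rewrite powRN ler_pdivrMl//; rewrite /mker.
by rewrite ge_min lexx orbT.
Qed.

(** By [weight_mker] the output weight is traded for the sum of the weights of the two inputs, so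
    each term is a convolution with exactly one weighted factor. *)
Lemma integral_weight_Maj P Q : measurable_fun setT P -> measurable_fun setT Q ->
  (forall x, (0 <= P x)%E) -> (forall x, (0 <= Q x)%E) ->
  (\int[leb2]_xi (w xi * Majd P Q xi) <=
   c2pi%:E * ((\int[leb2]_x (w x * P x)) * (\int[leb2]_x Q x) +
              (\int[leb2]_x P x) * (\int[leb2]_x (w x * Q x))))%E.
Proof.
move=> hP hQ P0 Q0.
have mwP : measurable_fun setT (fun x => w x * P x)%E by exact: emeasurable_funM.
have mwQ : measurable_fun setT (fun x => w x * Q x)%E by exact: emeasurable_funM.
have wP0 x : (0 <= w x * P x)%E by rewrite mule_ge0.
have wQ0 x : (0 <= w x * Q x)%E by rewrite mule_ge0.
have mc (u v : mP -> \bar R) : measurable_fun setT u -> measurable_fun setT v ->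
    measurable_fun setT (fun p : mP * mP => u p.2 * v (psub p.1 p.2))%E.
  move=> mu mv; apply: emeasurable_funM; first exact: (measurableT_comp mu).
  exact: (measurableT_comp mv (@measurable_psub R)).
have mc1 (u v : mP -> \bar R) x : measurable_fun setT u -> measurable_fun setT v ->
    measurable_fun setT (fun y => u y * v (psub x y))%E.
  by move=> mu mv; exact: (measurableT_comp (mc _ _ mu mv) (measurable_pair1 x)).
have mci (u v : mP -> \bar R) : measurable_fun setT u -> measurable_fun setT v ->
    (forall x, 0 <= u x)%E -> (forall x, 0 <= v x)%E ->
    measurable_fun setT (fun x => \int[leb2]_y (u y * v (psub x y)))%E.
  move=> mu mv u0 v0; apply: (measurable_integral_param lebP (mc _ _ mu mv)).
  by move=> p; rewrite mule_ge0.
have ci0 (u v : mP -> \bar R) x : (forall x, 0 <= u x)%E -> (forall x, 0 <= v x)%E ->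
    (0 <= \int[leb2]_y (u y * v (psub x y)))%E.
  by move=> u0 v0; apply: int_ge0 => y; rewrite mule_ge0.
have A1 := mci _ _ mwP hQ wP0 Q0; have A2 := mci _ _ hP mwQ P0 wQ0.
have n1 x := ci0 _ _ x wP0 Q0; have n2 x := ci0 _ _ x P0 wQ0.
rewrite -!integral_conv// -intD//.
rewrite -intZl//; last 2 first.
- by apply: emeasurable_funD; [exact: A1|exact: A2].
- by move=> x; apply: adde_ge0.
apply: le_int.
- by apply: emeasurable_funM => //; exact: measurable_Maj.
- by apply: emeasurable_funM; [exact: measurable_cst|apply: emeasurable_funD; [exact: A1|exact: A2]].
- by move=> x; rewrite mule_ge0// Maj_ge0.
- move=> x; rewrite /Maj muleCA; apply: lee_wpmul2l => //.
  have B1 := mc1 _ _ x mwP hQ; have B2 := mc1 _ _ x hP mwQ.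
  rewrite -intD//; [|by move=> y; rewrite !mule_ge0|by move=> y; rewrite !mule_ge0].
  rewrite -intZl//; [|exact: mMk|by move=> y; rewrite !mule_ge0].
  apply: le_int.
  + by apply: emeasurable_funM; [exact: measurable_cst|exact: mMk].
  + by apply: emeasurable_funD; [exact: B1|exact: B2].
  + by move=> y; rewrite !mule_ge0.
  + move=> y; rewrite [X in (_ + X)%E]muleCA -!muleA -ge0_muleDl//.
    rewrite [X in (X <= _)%E]muleA; apply: lee_wpmul2r; first by rewrite mule_ge0.
    by rewrite -EFinM -EFinD lee_fin weight_mker.
Qed.

End Delta.

Lemma PhiBl f f' g q : cmeas f -> cmeas f' -> cmeas g ->
  (Ab f g q.2 < +oo)%E -> (Ab f' g q.2 < +oo)%E ->
  Phi (fun p => f p - f' p) g q = Phi f g q - Phi f' g q.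
Proof.
move=> mf mf' mg h h'; rewrite /Phi -mulrBr -cintegralB; try exact: cintble_phik.
by congr (_ * cintegral _ _ _); apply/funext => p; rewrite /phik; ring.
Qed.

Lemma PhiBr f g g' q : cmeas f -> cmeas g -> cmeas g' ->
  (Ab f g q.2 < +oo)%E -> (Ab f g' q.2 < +oo)%E ->
  Phi f (fun p => g p - g' p) q = Phi f g q - Phi f g' q.
Proof.
move=> mf mg mg' h h'; rewrite /Phi -mulrBr -cintegralB; try exact: cintble_phik.
by congr (_ * cintegral _ _ _); apply/funext => p; rewrite /phik; ring.
Qed.

Lemma Phi_duh u t xi : cmeas u -> (Ab u u xi < +oo)%E -> Phi u u (t, xi) = duh u t xi.
Proof.
move=> mu h; have c := @cintble_phik u u (t, xi) mu mu h.
have ae_c := cintble_ae1 (m1 := leb) (m2 := lebP) c.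
rewrite /Phi -[X in _ * X](cintegral_fubini1 (m1 := leb) (m2 := lebP) c).
rewrite -(cintegralZ _ (cintble_fubini1 (m1 := leb) (m2 := lebP) c)).
apply: cintegral_ae.
- by apply: cmeasM; [exact: cmeas_cst|exact: (cintble_meas (cintble_fubini1 (m1 := leb) (m2 := lebP) c))].
- apply: (cmeas_pair2 xi (f := fun p : mR * mP => (heat t p.1 p.2)%:C%C *
    bil (fun y => u (p.1, y)) (fun y => u (p.1, y)) p.2)).
  by apply: cmeasM; [apply: cmeas_real; exact: measurable_heat|exact: cmeas_bil_time].
apply: filterS ae_c => tau ctau _.
pose F (y : mP) := (kern xi (psub xi y))%:C%C * (u (tau, y) * u (tau, psub xi y)).
have FE : (fun y => phik u u (t, xi) (tau, y)) = (fun y => F y * (heat t tau xi)%:C%C).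
  by apply/funext => y; rewrite /phik /F /= mulrC.
(* The heat factor vanishes for times outside [0, t], where the integrability of F is not known. *)
have hz := @cintegralZr_any R _ _ lebP F (heat t tau xi)%:C%C.
move: ctau; rewrite FE => /hz ->.
by rewrite mulrA mulrC.
Qed.

End BilinearDuhamel.

Section ComplexSequences.
Context {R : realType}.
Local Notation Re := (@complex.Re R).
Local Notation Im := (@complex.Im R).

Lemma cvg_summable_increments (x : nat -> R) (e : nat -> R) :
  (forall k, `|x k.+1 - x k| <= e k) -> (\sum_(k <oo) (e k)%:E < +oo)%E -> cvgn x.
Proof.
move=> xe eoo; have e0 k : 0 <= e k by apply: le_trans (xe k).
have -> : x = (fun n => x 0 + series (telescope x) n).
  by apply/funext => n; rewrite [LHS]eq_sum_telescope.
apply: is_cvgD; first exact: is_cvg_cst.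
apply: normed_cvg; apply: nondecreasing_is_cvgn.
  by apply/nondecreasing_seqP => n; rewrite /= /series/= big_nat_recr//= lerDl.
exists (fine (\sum_(k <oo) (e k)%:E)%E) => _ [n _ <-].
rewrite -lee_fin fineK; last first.
  by rewrite ge0_fin_numE//; apply: nneseries_ge0 => k _ _; rewrite lee_fin.
apply: (@le_trans _ _ (\sum_(0 <= k < n) (e k)%:E)%E); last first.
  by apply: nneseries_lim_ge => k _ _; rewrite lee_fin.
rewrite /series/= sumEFin lee_fin; apply: ler_sum => k _; exact: xe.
Qed.

(** Summable increments give a limit at every point. The explicit tail bound is kept so that
    domination of the error can be read off by [dom_series]. *)
Lemma cseq_lim d (T : measurableType d) (w : nat -> T -> R[i]) :
  (forall k, cmeas (w k)) ->
  (forall x, (\sum_(k <oo) (cmod (w k.+1 x - w k x))%:E < +oo)%E) ->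
  exists2 u : T -> R[i], cmeas u & forall n x,
    ((cmod (u x - w n x))%:E <= \sum_(i <oo) (cmod (w (n + i).+1 x - w (n + i)%N x))%:E)%E.
Proof.
move=> mw wx.
have c1 x : cvgn (fun k => Re (w k x)).
  by apply: cvg_summable_increments (wx x) => k; rewrite -ReN -ReD ler_Re_cmod.
have c2 x : cvgn (fun k => Im (w k x)).
  by apply: cvg_summable_increments (wx x) => k; rewrite -ImN -ImD ler_Im_cmod.
pose u x := (limn (fun k => Re (w k x)) +i* limn (fun k => Im (w k x)))%C.
have cu x : cmod (u x - w n x) @[n --> \oo] --> 0.
  apply: cmod_cvg0; under eq_fun do rewrite ?ReImE.
    by rewrite -(subrr (Re (u x))); apply: cvgB; [exact: cvg_cst|exact: c1].
  by rewrite -(subrr (Im (u x))); apply: cvgB; [exact: cvg_cst|exact: c2].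
exists u.
  split.
    by apply: (@measurable_fun_cvg _ _ _ _ (fun k x => Re (w k x))) => [k|x _]; [case: (mw k)|exact: c1].
  by apply: (@measurable_fun_cvg _ _ _ _ (fun k x => Im (w k x))) => [k|x _]; [case: (mw k)|exact: c2].
move=> n x; set B := (X in (_ <= X)%E).
have step m : ((cmod (w (n + m)%N x - w n x))%:E <= B)%E.
  apply: (@le_trans _ _ (\sum_(0 <= i < m) (cmod (w (n + i).+1 x - w (n + i)%N x))%:E)%E); last first.
    by apply: nneseries_lim_ge => k _ _; rewrite lee_fin cmod_ge0.
  elim: m => [|m IH]; first by rewrite addn0 subrr cmod0 big_geq.
  rewrite big_nat_recr//= addnS; apply: le_trans (leeD IH (lexx _)).
  rewrite -EFinD lee_fin -[X in cmod X](subrKA (w (n + m)%N x)) addrC.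
  exact: le_cmodD.
have B0 : (0 <= B)%E by apply: nneseries_ge0 => k _ _; rewrite lee_fin cmod_ge0.
move: B0 step; case: B => [b _ step|_ _|//]; last by rewrite leey.
rewrite lee_fin -subr_le0; apply: (@ler0_linear _ _ 1) => h /andP[h0 _]; rewrite mul1r.
have /cvgrPdist_le/(_ _ h0)[N _ hN] := cu x.
have := hN (n + N)%N (leq_addl _ _); rewrite /= sub0r normrN ger0_norm ?cmod_ge0// => a.
have := step N; rewrite lee_fin => b'.
rewrite lerBlDr -[X in cmod X](subrKA (w (n + N)%N x)).
by apply: le_trans (le_cmodD _ _) _; exact: lerD.
Qed.

End ComplexSequences.

Section SeriesOfMajorants.
Context {R : realType}.
Local Notation mR := (measurableTypeR R).
Local Notation mP := (measurableTypeR R * measurableTypeR R)%type.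
Local Notation plane := (@Defs.plane R).
Local Notation leb := (@lebesgue_measure R).

Lemma measurable_nneseries d (T : measurableType d) (h : nat -> T -> \bar R) :
  (forall k x, (0 <= h k x)%E) -> (forall k, measurable_fun setT (h k)) ->
  measurable_fun setT (fun x => \sum_(i <oo) h i x)%E.
Proof. by move=> h0 mh; apply: ge0_emeasurable_sum. Qed.

(** Both halves of [dom] pass to countable sums of nonnegative terms, the second one by exchanging
    sum and time integral. *)
Lemma dom_series (f : mR * mP -> R[i]) (e : nat -> mR * mP -> R[i]) (D : nat -> mP -> \bar R) :
  cmeas f -> (forall k, cmeas (e k)) -> (forall k, dom (e k) (D k)) ->
  (forall p, ((cmod (f p))%:E <= \sum_(k <oo) (cmod (e k p))%:E)%E) ->
  dom f (fun xi => \sum_(k <oo) D k xi)%E.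
Proof.
move=> mf me eD fe.
have D0 k xi : (0 <= D k xi)%E := dom_ge0 xi (eD k).
have c0 k p : (0 <= (cmod (e k p))%:E)%E by rewrite lee_fin cmod_ge0.
have mc k xi : measurable_fun setT (fun t => (cmod (e k (t, xi)))%:E).
  by apply: emeas_cmod; exact: cmeas_pair2.
split => [t xi|xi].
  by apply: le_trans (fe _) _; apply: lee_nneseries => // k _; case: (eD k).
apply: (@le_trans _ _ ((enorm (xi : plane))%:E * \int[leb]_t \sum_(k <oo) (cmod (e k (t, xi)))%:E)%E).
  apply: lee_wpmul2l; first by rewrite lee_fin enorm_ge0.
  apply: le_int => //; last by move=> t; rewrite lee_fin cmod_ge0.
    by apply: emeas_cmod; exact: cmeas_pair2.
  exact: measurable_nneseries.
rewrite integral_nneseries// -nneseriesZl; last by move=> k _; exact: int_ge0.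
apply: lee_nneseries => [k _ _|k _]; last by case: (eD k).
by rewrite mule_ge0 ?int_ge0// lee_fin enorm_ge0.
Qed.

Lemma nneseries_le_bound (a : nat -> \bar R) (M : \bar R) : (forall k, (0 <= a k)%E) ->
  (forall n, (\sum_(0 <= k < n) a k <= M)%E) -> (\sum_(k <oo) a k <= M)%E.
Proof.
move=> a0 aM; apply: lime_le; first exact: is_cvg_nneseries.
exact: nearW.
Qed.

Lemma geometric_partial_sum n : \sum_(0 <= k < n) (2^-1 : R) ^+ k = 2 * (1 - 2^-1 ^+ n).
Proof.
elim: n => [|n IH]; first by rewrite big_geq// expr0 subrr mulr0.
by rewrite big_nat_recr//= IH exprS; field.
Qed.

Lemma ler_geometric_partial_sum n : \sum_(0 <= k < n) (2^-1 : R) ^+ k <= 2.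
Proof.
by rewrite geometric_partial_sum ler_piMr// lerBlDr lerDl exprn_ge0.
Qed.

End SeriesOfMajorants.

(** * The Picard iteration and its limit *)

Section Picard.
Context {R : realType}.
Local Notation mR := (measurableTypeR R).
Local Notation mP := (measurableTypeR R * measurableTypeR R)%type.
Local Notation plane := (@Defs.plane R).
Local Notation leb := (@lebesgue_measure R).
Variables (delta : R) (w0 : mP -> R[i]) (a0 b0 : R).
Hypotheses (d0 : 0 <= delta) (d1 : delta < 1) (mw0 : cmeas w0).
Local Notation w xi := ((enorm (xi : plane) `^ (- delta))%:E).
Hypotheses (a0_ge0 : 0 <= a0) (b0_ge0 : 0 <= b0) (a0_le : a0 <= 4^-1).
Hypothesis w0a : (\int[leb2]_x (cmod (w0 x))%:E <= a0%:E)%E.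
Hypothesis w0b : (\int[leb2]_x (w x * (cmod (w0 x))%:E) <= b0%:E)%E.
Local Notation Majd := (Maj delta).

(* [D k] dominates the k-th Picard increment and [S k] the k-th iterate. *)
Fixpoint DS (k : nat) : (mP -> \bar R) * (mP -> \bar R) :=
  if k is k'.+1 then
    (fun x => Majd (DS k').1 (fun y => (DS k').2 y + (DS k').1 y)%E x +
              Majd (DS k').2 (DS k').1 x, fun x => (DS k').2 x + (DS k').1 x)%E
  else (fun x => (cmod (w0 x))%:E, fun=> 0%E).

Let D k := (DS k).1.
Let S k := (DS k).2.

Let DE k x : D k.+1 x = (Majd (D k) (S k.+1) x + Majd (S k) (D k) x)%E. Proof. by []. Qed.
Let SE k x : S k.+1 x = (S k x + D k x)%E. Proof. by []. Qed.

Let DS_facts k : [/\ measurable_fun setT (D k), measurable_fun setT (S k),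
  (forall x, 0 <= D k x)%E & (forall x, 0 <= S k x)%E].
Proof.
elim: k => [|k [mD mS D0 S0]].
  split; [exact: emeas_cmod|exact: measurable_cst| |by []].
  by move=> x; rewrite lee_fin cmod_ge0.
have mS1 : measurable_fun setT (S k.+1) by exact: emeasurable_funD.
have S1 x : (0 <= S k.+1 x)%E by rewrite SE; apply: adde_ge0.
split => //.
- by apply: emeasurable_funD; exact: measurable_Maj.
- by move=> x; apply: adde_ge0; exact: Maj_ge0.
Qed.

Let mD k : measurable_fun setT (D k). Proof. by case: (DS_facts k). Qed.
Let mS k : measurable_fun setT (S k). Proof. by case: (DS_facts k). Qed.
Let D_ge0 k x : (0 <= D k x)%E. Proof. by case: (DS_facts k). Qed.
Let S_ge0 k x : (0 <= S k x)%E. Proof. by case: (DS_facts k). Qed.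

Let mw : measurable_fun setT (fun xi : mP => w xi).
Proof.
by apply/measurable_EFinP; exact: (measurableT_comp (measurable_powR (- delta)) (@measurable_enorm R)).
Qed.

Let w_ge0 (xi : mP) : (0 <= w xi)%E. Proof. by rewrite lee_fin powR_ge0. Qed.

Let mwf (f : mP -> \bar R) : measurable_fun setT f -> measurable_fun setT (fun x => w x * f x)%E.
Proof. by move=> mf; exact: emeasurable_funM. Qed.

Let wf_ge0 (f : mP -> \bar R) : (forall x, 0 <= f x)%E -> (forall x, 0 <= w x * f x)%E.
Proof. by move=> f0 x; rewrite mule_ge0. Qed.

(** Here pi >= 2 is precise enough: (2 pi)^2 >= 16. *)
Lemma c2pi_le16 : (c2pi : R) <= 16^-1.
Proof.
rewrite /c2pi lef_pV2 ?posrE ?exprn_gt0 ?mulr_gt0 ?pi_gt0//.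
have := @pi_ge2 R => h; rewrite (_ : 16 = 4 ^+ 2 :> R); last by ring.
by apply: lerXn2r; rewrite ?nnegrE ?mulr_ge0 ?pi_ge0//; lra.
Qed.

Let half_pow_le1 k : (2^-1 : R) ^+ k <= 1.
Proof. by rewrite exprn_ile1// invf_le1// ler1n. Qed.

Let quarter (a y : R) : 0 <= y -> a <= 4^-1 -> 4 * (a * y) <= 8 * y.
Proof. by move=> y0 h; have := ler_wpM2r y0 h; move: (a * y) => z; lra. Qed.

Let quarter2 (a y : R) : 0 <= y -> a <= 4^-1 -> 8 * (a * y) <= 8 * y.
Proof. by move=> y0 h; have := ler_wpM2r y0 h; move: (a * y) => z; lra. Qed.

(** Induction. The unweighted mass of the next increment is at most 4 [c2pi] a0 times the present
    one; in the weighted case the two ways of placing the weight double this to 8 [c2pi] a0. The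
    partial sums are geometric, whence the factors 1 - 2^(-k). *)
Let DS_bounds k : [/\ (\int[leb2]_x D k x <= (a0 * 2^-1 ^+ k)%:E)%E,
  (\int[leb2]_x S k x <= (2 * a0 * (1 - 2^-1 ^+ k))%:E)%E,
  (\int[leb2]_x (w x * D k x) <= (b0 * 2^-1 ^+ k)%:E)%E &
  (\int[leb2]_x (w x * S k x) <= (2 * b0 * (1 - 2^-1 ^+ k))%:E)%E].
Proof.
elim: k => [|k [iD iS iwD iwS]].
  split; rewrite ?expr0 ?subrr ?mulr0 ?mulr1//.
    by rewrite integral0.
  by under eq_integral do rewrite mule0; rewrite integral0.
set r : R := 2^-1 ^+ k in iD iS iwD iwS *.
have r0 : 0 <= r by rewrite exprn_ge0.
have r1 : r <= 1 by exact: half_pow_le1.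
have iS1 : (\int[leb2]_x S k.+1 x <= (2 * a0 * (1 - 2^-1 ^+ k.+1))%:E)%E.
  under eq_integral do rewrite SE; rewrite intD//; apply: le_trans (leeD iS iD) _.
  by rewrite -EFinD lee_fin exprS -/r; apply: le_of_eq; field.
have iwS1 : (\int[leb2]_x (w x * S k.+1 x) <= (2 * b0 * (1 - 2^-1 ^+ k.+1))%:E)%E.
  under eq_integral do rewrite SE ge0_muleDr//.
  rewrite intD//; [|exact: mwf|exact: wf_ge0|exact: mwf|exact: wf_ge0].
  apply: le_trans (leeD iwS iwD) _.
  by rewrite -EFinD lee_fin exprS -/r; apply: le_of_eq; field.
have S1a : (\int[leb2]_x S k.+1 x <= (2 * a0)%:E)%E.
  apply: le_trans iS1 _; rewrite lee_fin; apply: ler_piMr; first by rewrite mulr_ge0.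
  by rewrite lerBlDr lerDl exprn_ge0.
have S0a : (\int[leb2]_x S k x <= (2 * a0)%:E)%E.
  apply: le_trans iS _; rewrite lee_fin; apply: ler_piMr; first by rewrite mulr_ge0.
  by rewrite lerBlDr lerDl.
have S1b : (\int[leb2]_x (w x * S k.+1 x) <= (2 * b0)%:E)%E.
  apply: le_trans iwS1 _; rewrite lee_fin; apply: ler_piMr; first by rewrite mulr_ge0.
  by rewrite lerBlDr lerDl exprn_ge0.
have S0b : (\int[leb2]_x (w x * S k x) <= (2 * b0)%:E)%E.
  apply: le_trans iwS _; rewrite lee_fin; apply: ler_piMr; first by rewrite mulr_ge0.
  by rewrite lerBlDr lerDl.
have mM1 : measurable_fun setT (Majd (D k) (S k.+1)) by exact: measurable_Maj.
have mM2 : measurable_fun setT (Majd (S k) (D k)) by exact: measurable_Maj.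
have M1_ge0 x : (0 <= Majd (D k) (S k.+1) x)%E by exact: Maj_ge0.
have M2_ge0 x : (0 <= Majd (S k) (D k) x)%E by exact: Maj_ge0.
have cge0 : (0 <= (@c2pi R)%:E)%E by rewrite lee_fin ltW// c2pi_gt0.
have c16 := c2pi_le16; have cg := @c2pi_gt0 R.
have i0 (f : mP -> \bar R) : (forall x, 0 <= f x)%E -> (0 <= \int[leb2]_x f x)%E by exact: int_ge0.
have iw0 (f : mP -> \bar R) : (forall x, 0 <= f x)%E -> (0 <= \int[leb2]_x (w x * f x))%E.
  by move=> f0; apply: int_ge0; exact: wf_ge0.
(* The ratio 1/2 of the increments is 8 times the bound 1/16 of [c2pi]. *)
have final (x y : R) : 0 <= y -> x <= c2pi * (8 * y) -> x <= y * 2^-1.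
  move=> y0 h; apply: le_trans h _.
  by rewrite mulrCA mulrA [_ * y]mulrC ler_wpM2l//; lra.
split => //.
- under eq_integral do rewrite DE; rewrite intD//.
  apply: le_trans (leeD (integral_Maj delta (mD k) (mS k.+1) (D_ge0 k) (S_ge0 k.+1))
    (integral_Maj delta (mS k) (mD k) (S_ge0 k) (D_ge0 k))) _.
  apply: (@le_trans _ _ (c2pi%:E * ((a0 * r)%:E * (2 * a0)%:E) + c2pi%:E * ((2 * a0)%:E * (a0 * r)%:E))%E).
    by apply: leeD; apply: lee_wpmul2l => //; apply: lee_pmul => //; exact: i0.
  have -> : a0 * 2^-1 ^+ k.+1 = a0 * r * 2^-1 by rewrite exprS -/r; ring.
  rewrite -!EFinM -EFinD lee_fin; apply: final; first by rewrite mulr_ge0.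
  rewrite -mulrDr; apply: ler_wpM2l; first exact: ltW.
  have h' : 0 <= a0 * r by rewrite mulr_ge0.
  by apply: le_trans _ (quarter h' a0_le); apply: le_of_eq; ring.
- under eq_integral do rewrite DE ge0_muleDr//.
  rewrite intD//; [|exact: mwf|exact: wf_ge0|exact: mwf|exact: wf_ge0].
  apply: le_trans (leeD (integral_weight_Maj delta (mD k) (mS k.+1) (D_ge0 k) (S_ge0 k.+1))
    (integral_weight_Maj delta (mS k) (mD k) (S_ge0 k) (D_ge0 k))) _.
  apply: (@le_trans _ _ (c2pi%:E * ((b0 * r)%:E * (2 * a0)%:E + (a0 * r)%:E * (2 * b0)%:E) +
      c2pi%:E * ((2 * b0)%:E * (a0 * r)%:E + (2 * a0)%:E * (b0 * r)%:E))%E).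
    by apply: leeD; apply: lee_wpmul2l => //; apply: leeD; apply: lee_pmul => //; (exact: i0 || exact: iw0).
  have -> : b0 * 2^-1 ^+ k.+1 = b0 * r * 2^-1 by rewrite exprS -/r; ring.
  rewrite -!(EFinM, EFinD) lee_fin; apply: final; first by rewrite mulr_ge0.
  rewrite -mulrDr; apply: ler_wpM2l; first exact: ltW.
  have h' : 0 <= b0 * r by rewrite mulr_ge0.
  by apply: le_trans _ (quarter2 h' a0_le); apply: le_of_eq; ring.
Qed.

(** Remainder of the series of majorants from index n on; the whole series [Sinf] becomes the
    majorant Q of the solution. *)
Let tailD n x : \bar R := (\sum_(i <oo) D (n + i)%N x)%E.
Let Sinf := tailD 0.

Let mtail n : measurable_fun setT (tailD n).
Proof. by apply: measurable_nneseries. Qed.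

Let tail_ge0 n x : (0 <= tailD n x)%E.
Proof. by apply: nneseries_ge0. Qed.

Let integral_tail n : (\int[leb2]_x tailD n x <= (2 * a0 * 2^-1 ^+ n)%:E)%E.
Proof.
rewrite integral_nneseries//; apply: nneseries_le_bound => [k|m]; first exact: int_ge0.
apply: (@le_trans _ _ (\sum_(0 <= i < m) (a0 * 2^-1 ^+ n * 2^-1 ^+ i)%:E)%E).
  apply: lee_sum => i _; have [h _ _ _] := DS_bounds (n + i); apply: le_trans h _.
  by rewrite exprD mulrA.
rewrite sumEFin lee_fin -mulr_sumr.
apply: (@le_trans _ _ (a0 * 2^-1 ^+ n * 2)); last by apply: le_of_eq; ring.
by apply: ler_wpM2l; [rewrite mulr_ge0// exprn_ge0|exact: ler_geometric_partial_sum].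
Qed.

Let integral_weight_Sinf : (\int[leb2]_x (w x * Sinf x) <= (2 * b0)%:E)%E.
Proof.
have E x : (w x * Sinf x = \sum_(i <oo) (w x * D i x))%E by rewrite nneseriesZl.
under eq_integral do rewrite E.
rewrite integral_nneseries//; [|by move=> k; exact: mwf|by move=> k x _; exact: wf_ge0].
apply: nneseries_le_bound => [k|m]; first by apply: int_ge0; exact: wf_ge0.
apply: (@le_trans _ _ (\sum_(0 <= i < m) (b0 * 2^-1 ^+ i)%:E)%E).
  by apply: lee_sum => i _; have [_ _ h _] := DS_bounds i.
by rewrite sumEFin lee_fin -mulr_sumr mulrC ler_wpM2r// ler_geometric_partial_sum.
Qed.

Let S_le k x : (S k x <= Sinf x)%E.
Proof.
have -> : S k x = (\sum_(0 <= i < k) D i x)%E.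
  by elim: k => [|k IH]; [rewrite big_geq|rewrite big_nat_recr//= SE IH].
by apply: nneseries_lim_ge.
Qed.

Let D_le k x : (D k x <= Sinf x)%E.
Proof. by apply: le_trans (S_le k.+1 x); rewrite SE leeDr. Qed.

Let tail_le n x : (tailD n x <= Sinf x)%E.
Proof.
apply: nneseries_le_bound => // m; apply: (@le_trans _ _ (S (n + m)%N x)); last exact: S_le.
elim: m => [|m IH]; first by rewrite big_geq.
by rewrite big_nat_recr//= addnS SE; apply: leeD.
Qed.

(** Good frequencies: there the series of increments converges at all times and the Duhamel
    integrals are absolutely convergent. The complement is null, and one set serves all times. *)
Let G : set mP := [set x | (Sinf x < +oo)%E /\ (Majd Sinf Sinf x < +oo)%E].

Let mMS : measurable_fun setT (Majd Sinf Sinf).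
Proof. by apply: measurable_Maj; (exact: (mtail 0) || exact: (tail_ge0 0)). Qed.

Let mG : measurable G.
Proof.
have h (f : mP -> \bar R) : measurable_fun setT f -> measurable [set x | (f x < +oo)%E].
  by move=> mf; rewrite -[X in measurable X]setTI; exact: emeasurable_fun_infty_o.
by rewrite (_ : G = [set x | (Sinf x < +oo)%E] `&` [set x | (Majd Sinf Sinf x < +oo)%E])//;
  apply: measurableI; [exact: (h _ (mtail 0))|exact: (h _ mMS)].
Qed.

Let aeG : {ae leb2, forall x, G x}.
Proof.
have h (f : mP -> \bar R) : measurable_fun setT f -> (forall x, 0 <= f x)%E ->
    (\int[leb2]_x f x < +oo)%E -> {ae leb2, forall x, (f x < +oo)%E}.
  move=> mf f0 foo; have : leb2.-integrable setT f.
    apply/integrableP; split => //; apply: le_lt_trans foo; apply: le_of_eq.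
    by apply: eq_integral => x _; rewrite gee0_abs.
  move=> /integrable_ae => /(_ measurableT); apply: filterS => x /(_ I) fx.
  by rewrite -ge0_fin_numE.
have a1 := h _ (mtail 0) (tail_ge0 0) (le_lt_trans (integral_tail 0) (ltry _)).
have a2 : {ae leb2, forall x, (Majd Sinf Sinf x < +oo)%E}.
  apply: h => //; first by move=> x; exact: (Maj_ge0 delta x (tail_ge0 0) (tail_ge0 0)).
  apply: le_lt_trans (integral_Maj delta (mtail 0) (mtail 0) (tail_ge0 0) (tail_ge0 0)) _.
  have f : (\int[leb2]_x tailD 0 x \is a fin_num)%E.
    by rewrite ge0_fin_numE ?int_ge0//; exact: le_lt_trans (integral_tail 0) (ltry _).
  by rewrite -(fineK f) -!EFinM ltry.
by move: a1 a2; apply: filterS2 => x; split.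
Qed.

Let mask (f : mR * mP -> R[i]) : mR * mP -> R[i] := fun p => (\1_G p.2 : R)%:C%C * f p.

Let cmeas_mask f : cmeas f -> cmeas (mask f).
Proof.
move=> mf; apply: cmeasM => //; apply: cmeas_real.
have mI : measurable_fun setT (\1_G : mP -> mR) by have := mG => ?; exact: measurable_indic.
exact: (measurableT_comp mI measurable_snd).
Qed.

Let wlin (p : mR * mP) : R[i] := (heat p.1 0 p.2)%:C%C * w0 p.2.

Let mwlin : cmeas wlin.
Proof.
apply: cmeasM; last exact: (cmeas_comp (h := snd)).
apply: cmeas_real; exact: measurable_heat_comp.
Qed.

(** Every iterate is set to 0 off G, so the sequence converges everywhere, not merely almost
    everywhere, and the limit is jointly measurable. Starting from 0 makes the first increment the
    free evolution on G. *)
Fixpoint wk (k : nat) : mR * mP -> R[i] :=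
  if k is k'.+1 then mask (fun p => wlin p - Phi (wk k') (wk k') p) else fun=> 0.

Let mwk k : cmeas (wk k).
Proof.
elim: k => [|k IH]; first exact: cmeas_cst.
by apply: cmeas_mask; apply: cmeasB => //; exact: cmeas_Phi.
Qed.

Let ek k p := wk k.+1 p - wk k p.

Let mek k : cmeas (ek k). Proof. exact: cmeasB. Qed.

Let Phi00 p : Phi (fun=> 0) (fun=> 0) p = 0 :> R[i].
Proof.
rewrite /Phi (_ : phik _ _ _ = fun=> 0) ?cintegral0 ?mulr0//.
by apply/funext => q; rewrite /phik !mulr0.
Qed.

(* Differences of Duhamel terms may be split only where the absolute integrals are finite. *)
Let Ab_fin f g xi : cmeas f -> cmeas g -> dom f Sinf -> dom g Sinf -> G xi -> (Ab f g xi < +oo)%E.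
Proof.
move=> mf mg df dg [_ h]; apply: le_lt_trans h.
exact: (Ab_le_Maj d0 d1 xi mf mg (mtail 0) (mtail 0) df dg).
Qed.

Let Phi_diff f g p : cmeas f -> cmeas g -> dom f Sinf -> dom g Sinf ->
  dom (fun p => f p - g p) Sinf -> G p.2 ->
  Phi f f p - Phi g g p = Phi (fun p => f p - g p) f p + Phi g (fun p => f p - g p) p.
Proof.
move=> mf mg df dg dfg Gp.
by rewrite PhiBl ?PhiBr//; try exact: Ab_fin; rewrite addrA subrK.
Qed.

Let dom_wk_ek k : dom (wk k) (S k) /\ dom (ek k) (D k).
Proof.
elim: k => [|k [dw de]].
  split; first exact: dom0.
  have -> : ek 0 = mask wlin.
    by apply/funext => p; rewrite /ek /= subr0 /mask Phi00 subr0.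
  have [h1 h2] := dom_heat mw0.
  exact: (dom_mask mwlin (D_ge0 0) (fun t xi _ => h1 t xi) (fun xi _ => h2 xi)).
have dw1 : dom (wk k.+1) (S k.+1).
  have -> : wk k.+1 = (fun p => wk k p + ek k p).
    by apply/funext => p; rewrite /ek addrC subrK.
  exact: domD.
have dwS := dom_le (S_le k) dw; have dw1S := dom_le (S_le k.+1) dw1.
have deS := dom_le (D_le k) de.
have mP1 : cmeas (Phi (ek k) (wk k.+1)) by exact: cmeas_Phi.
have mP2 : cmeas (Phi (wk k) (ek k)) by exact: cmeas_Phi.
split => //.
have -> : ek k.+1 = mask (fun p => - (Phi (ek k) (wk k.+1) p + Phi (wk k) (ek k) p)).
  apply/funext => p; rewrite {1}/ek [wk k.+2]/= [X in _ - X](_ : _ =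
    mask (fun p => wlin p - Phi (wk k) (wk k) p) p)// /mask -mulrBr.
  have [Gp|Gp] := pselect (G p.2); last by rewrite indicE memNset// !mul0r.
  congr (_ * _); rewrite -Phi_diff//; ring.
have [h1 h2] : dom (fun p => - (Phi (ek k) (wk k.+1) p + Phi (wk k) (ek k) p)) (D k.+1).
  apply: domN; apply: domD => //.
    exact: (dom_Phi d0 d1 (mek k) (mwk k.+1) (mD k) (mS k.+1) de dw1).
  exact: (dom_Phi d0 d1 (mwk k) (mek k) (mS k) (mD k) dw de).
apply: (dom_mask _ (D_ge0 k.+1) (fun t xi _ => h1 t xi) (fun xi _ => h2 xi)).
by apply: cmeasN; exact: cmeasD.
Qed.

Let sum_ek_fin p : (\sum_(k <oo) (cmod (ek k p))%:E < +oo)%E.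
Proof.
have [Gp|Gp] := pselect (G p.2).
  apply: le_lt_trans (proj1 Gp); apply: lee_nneseries => [k _ _|k _].
    by rewrite lee_fin cmod_ge0.
  by have [_ [h _]] := dom_wk_ek k; move: p Gp (h) => [t xi] _; exact.
have w0E k : wk k p = 0 by case: k => //= k; rewrite /mask indicE memNset// mul0r.
rewrite eseries0 ?ltry// => k _ _.
by rewrite /ek !w0E subrr cmod0.
Qed.

(** The solution is the pointwise limit of the iterates, and Q the sum of the majorants, of mass at
    most 2 a0 <= 1/2. The equation is verified at each fixed time by showing that its residual has
    integral 0; the exceptional null set may depend on t. *)
Theorem picard : exists (u : mR * mP -> R[i]) (Q : mP -> \bar R),
  [/\ cmeas u /\ measurable_fun setT Q, dom u Q,
      (\int[leb2]_x Q x <= (2^-1)%R%:E)%E, (\int[leb2]_x (w x * Q x) < +oo)%E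
    & forall t, ae_eq leb2 setT (fun xi => u (t, xi))
        (fun xi => (heat t 0 xi)%:C%C * w0 xi - duh u t xi)].
Proof.
have [u mu uw] := cseq_lim mwk sum_ek_fin.
have dtail n : dom (fun p => u p - wk n p) (tailD n).
  apply: (@dom_series _ _ (fun i => ek (n + i)%N) (fun i => D (n + i)%N)).
  - exact: cmeasB.
  - by move=> k.
  - by move=> k; case: (dom_wk_ek (n + k)).
  - exact: uw.
have du : dom u Sinf.
  by have := dtail 0; congr dom; apply/funext => p /=; rewrite subr0.
exists u, Sinf; split => //.
- by split => //; exact: (mtail 0).
- apply: le_trans (integral_tail 0) _; rewrite lee_fin expr0 mulr1.
  by move: a0_le; lra.
- exact: le_lt_trans integral_weight_Sinf (ltry _).
move=> t.
pose v p := wlin p - Phi u u p.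
have mv : cmeas v by apply: cmeasB => //; exact: cmeas_Phi.
pose r p := u p - mask v p.
have mr : cmeas r by apply: cmeasB => //; exact: cmeas_mask.
(* The residual is the distance to the next iterate plus the change of the quadratic term between
   the limit and the n-th iterate; both are dominated through remainders of the series. *)
have rle n xi : ((cmod (r (t, xi)))%:E <=
    tailD n.+1 xi + (Majd (tailD n) Sinf xi + Majd Sinf (tailD n) xi))%E.
  have dn := dtail n; have dnS := dom_le (tail_le n) dn.
  have dwS := dom_le (S_le n) (proj1 (dom_wk_ek n)).
  have mun : cmeas (fun p => u p - wk n p) by exact: cmeasB.
  have -> : r (t, xi) = (u (t, xi) - wk n.+1 (t, xi)) +
      mask (fun p => Phi (fun p => u p - wk n p) u p + Phi (wk n) (fun p => u p - wk n p) p) (t, xi).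
    rewrite /r /= -/wk /mask /=.
    have [Gp|Gp] := pselect (G xi); last by rewrite indicE memNset// !mul0r addr0.
    by rewrite -Phi_diff// indicE mem_set// !mul1r /v; ring.
  apply: (@le_trans _ _ ((cmod (u (t, xi) - wk n.+1 (t, xi)))%:E +
     ((cmod (Phi (fun p => u p - wk n p) u (t, xi)))%:E +
      (cmod (Phi (wk n) (fun p => u p - wk n p) (t, xi)))%:E))%E).
    rewrite -!EFinD lee_fin; apply: le_trans (le_cmodD _ _) _; rewrite lerD2l.
    apply: le_trans (le_cmodD _ _); rewrite cmodM cmod_real ger0_norm; last by rewrite indicE.
    by rewrite ler_piMl ?cmod_ge0// indicE; case: (_ \in _).
  apply: leeD; first by case: (dtail n.+1).
  apply: leeD.
    have [h _] := dom_Phi d0 d1 mun mu (mtail n) (mtail 0) dn du; exact: h.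
  have [h _] := dom_Phi d0 d1 (mwk n) mun (mtail 0) (mtail n) dwS dn; exact: h.
have r0 : (\int[leb2]_xi (cmod (r (t, xi)))%:E = 0)%E.
  apply/eqP; rewrite eq_le int_ge0 ?andbT; last by move=> x; rewrite lee_fin cmod_ge0.
  apply/lee_addgt0Pr => e e0; rewrite add0e.
  (* The tail has mass at most 2 a0 2^(-n), and each of the two damped convolutions pairs such a
     tail with the whole series, of mass at most 2 a0. *)
  pose C := 2 * a0 + 2 * (c2pi * (2 * a0 * (2 * a0))).
  have cg := @c2pi_gt0 R; have C0 : 0 <= C by rewrite addr_ge0 ?mulr_ge0// ltW.
  have [n hn] : exists n, C * 2^-1 ^+ n <= e.
    have cC : C * 2^-1 ^+ n @[n --> \oo] --> (0 : R).
      rewrite -(mulr0 C); apply: cvgM; first exact: cvg_cst.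
      by apply: cvg_expr; rewrite ger0_norm// invf_lt1// ltr1n.
    have /cvgrPdist_le/(_ _ e0)[n _ hn] := cC; exists n.
    by have := hn n (leqnn n); rewrite /= sub0r normrN => /(le_trans (ler_norm _)).
  have St : (\int[leb2]_x Sinf x <= (2 * a0)%:E)%E.
    by apply: le_trans (integral_tail 0) _; rewrite lee_fin expr0 mulr1.
  have mM1 : measurable_fun setT (Majd (tailD n) Sinf).
    exact: (measurable_Maj delta (mtail n) (mtail 0) (tail_ge0 n) (tail_ge0 0)).
  have mM2 : measurable_fun setT (Majd Sinf (tailD n)).
    exact: (measurable_Maj delta (mtail 0) (mtail n) (tail_ge0 0) (tail_ge0 n)).
  have n1 x : (0 <= Majd (tailD n) Sinf x)%E := Maj_ge0 delta x (tail_ge0 n) (tail_ge0 0).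
  have n2 x : (0 <= Majd Sinf (tailD n) x)%E := Maj_ge0 delta x (tail_ge0 0) (tail_ge0 n).
  have i0 (f : mP -> \bar R) : (forall x, 0 <= f x)%E -> (0 <= \int[leb2]_x f x)%E by exact: int_ge0.
  apply: (@le_trans _ _ (\int[leb2]_xi (tailD n.+1 xi + (Majd (tailD n) Sinf xi + Majd Sinf (tailD n) xi)))%E).
    apply: le_int.
    - by apply: emeas_cmod; exact: (cmeas_pair1 t mr).
    - exact: (emeasurable_funD (mtail n.+1) (emeasurable_funD mM1 mM2)).
    - by move=> x; rewrite lee_fin cmod_ge0.
    - by move=> x; exact: rle.
  rewrite (intD3 leb2 (mtail n.+1) mM1 mM2 (tail_ge0 n.+1) n1 n2).
  have T1 : (\int[leb2]_x tailD n.+1 x <= (2 * a0 * 2^-1 ^+ n)%:E)%E.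
    apply: le_trans (integral_tail n.+1) _; rewrite lee_fin exprS ler_wpM2l ?mulr_ge0//.
    by rewrite ler_piMl ?exprn_ge0// invf_le1// ler1n.
  apply: (@le_trans _ _ ((2 * a0 * 2^-1 ^+ n)%:E +
     (c2pi%:E * ((2 * a0 * 2^-1 ^+ n)%:E * (2 * a0)%:E) +
      c2pi%:E * ((2 * a0)%:E * (2 * a0 * 2^-1 ^+ n)%:E)))%E).
    apply: leeD => //; apply: leeD.
      apply: le_trans (integral_Maj delta (mtail n) (mtail 0) (tail_ge0 n) (tail_ge0 0)) _.
      apply: lee_wpmul2l; first by rewrite lee_fin ltW.
      by apply: lee_pmul => //; (exact: i0 || exact: integral_tail).
    apply: le_trans (integral_Maj delta (mtail 0) (mtail n) (tail_ge0 0) (tail_ge0 n)) _.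
    apply: lee_wpmul2l; first by rewrite lee_fin ltW.
    by apply: lee_pmul => //; (exact: i0 || exact: integral_tail).
  rewrite -!EFinM -!EFinD lee_fin; apply: le_trans hn; apply: le_of_eq; rewrite /C; ring.
have : ae_eq leb2 setT (fun xi => (cmod (r (t, xi)))%:E) (cst 0%E).
  apply/ae_eq_integral_abs => //; first by apply: emeas_cmod; exact: (cmeas_pair1 t mr).
  by rewrite -[RHS]r0; apply: eq_integral => x _; rewrite gee0_abs// lee_fin cmod_ge0.
move: aeG; apply: filterS2 => xi Gxi /(_ I)[] /cmod_eq0/eqP.
rewrite /r subr_eq0 => /eqP -> _.
rewrite /mask indicE mem_set// mul1r /v Phi_duh//.
exact: Ab_fin.
Qed.

End Picard.

(** * The solution and its gradient *)

Section MildSpectrum.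
Context {R : realType}.
Local Notation mR := (measurableTypeR R).
Local Notation mP := (measurableTypeR R * measurableTypeR R)%type.
Local Notation plane := (@Defs.plane R).
Local Notation leb := (@lebesgue_measure R).

Lemma spec_mild (theta0 : @dist R) (theta : R -> @dist R) (w0 : mP -> R[i]) (u : mR * mP -> R[i]) (A t : R) :
  spec theta0 w0 -> cmeas u -> 0 <= A -> 0 <= t ->
  (forall tau, 0 <= tau <= t -> (\int[leb2]_x (cmod (u (tau, x)))%:E <= A%:E)%E) ->
  (forall tau, 0 <= tau <= t -> spec (theta tau) (fun x => u (tau, x))) ->
  spec (Defs.dsub (poisson t theta0) (duhamel theta t))
    (fun x => (heat t 0 x)%:C%C * w0 x - duh u t x).
Proof.
move=> s0 mu A0 t0 uA su.
have := spec_dsub (spec_poisson t0 s0) (spec_duhamel mu A0 uA su).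
by congr spec; apply/funext => x; rewrite heatE// subr0.
Qed.

Lemma cvge0_le (T : Type) (F : set_system T) (FF : Filter F) (f : T -> \bar R) :
  (forall x, (0 <= f x)%E) -> (forall e : R, 0 < e -> \forall x \near F, (f x <= e%:E)%E) ->
  f x @[x --> F] --> 0%E.
Proof.
move=> f0 fe; apply/fine_cvgP; split.
  by apply: filterS (fe 1 ltr01) => x h; rewrite ge0_fin_numE// (le_lt_trans h)// ltry.
apply/cvgrPdist_le => e e0; apply: filterS (fe e e0) => x h /=.
rewrite sub0r normrN ger0_norm ?fine_ge0// -lee_fin fineK// ge0_fin_numE//.
by rewrite (le_lt_trans h)// ltry.
Qed.

Lemma Xnorm_ge0 r (T : @dist R) : (0 <= Xnorm r T)%E.
Proof. by apply: int_ge0 => x; rewrite lee_fin mulr_ge0 ?powR_ge0 ?cmod_ge0. Qed.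

Lemma expRN_lip (x y : R) : 0 <= x -> x <= y -> 0 <= expR (- x) - expR (- y) <= y - x.
Proof.
move=> x0 xy; rewrite subr_ge0 ler_expR lerN2 xy/=.
have -> : expR (- y) = expR (- x) * expR (- (y - x)) by rewrite -expRD; congr expR; ring.
rewrite -[X in X - _]mulr1 -mulrBr.
have h1 : expR (- x) <= 1 by rewrite -expR0 ler_expR oppr_le0.
have h2 : 1 - expR (- (y - x)) <= y - x.
  by have := expR_ge1Dx (- (y - x)); lra.
have h3 : 0 <= 1 - expR (- (y - x)) by rewrite subr_ge0 -expR0 ler_expR oppr_le0 subr_ge0.
by apply: le_trans h2; rewrite ler_piMl.
Qed.

Lemma lebesgue_cc (a b : R) : a <= b -> (leb `[a, b]%classic = (b - a)%:E)%E.
Proof.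
move=> ab; rewrite [LHS](lebesgue_measure_itv `[a, b]) /= lte_fin.
case: ltP => [_|ba]; first by rewrite -EFinB.
by have -> : b = a; [apply/eqP; rewrite eq_le ba ab|rewrite subrr].
Qed.

Lemma lebesgue_oc (a b : R) : a <= b -> (leb `]a, b]%classic = (b - a)%:E)%E.
Proof.
move=> ab; rewrite [LHS](lebesgue_measure_itv `]a, b]) /= lte_fin.
case: ltP => [_|ba]; first by rewrite -EFinB.
by have -> : b = a; [apply/eqP; rewrite eq_le ba ab|rewrite subrr].
Qed.

(** For [tau] up to s both kernels are exponentials, Lipschitz in time with constant |xi|; on ]s, t]
    one of them vanishes and the other is at most 1. *)
Lemma heat_modulus s t tau (xi : plane) : 0 <= s -> s <= t ->
  `|heat t tau xi - heat s tau xi| <=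
  (t - s) * enorm xi * \1_(`[0, s]%classic) tau + \1_(`]s, t]%classic) tau.
Proof.
move=> s0 st; have e0 := enorm_ge0 xi.
have ts0 : 0 <= t - s by rewrite subr_ge0.
have [t1|t1] := boolP (0 <= tau <= s).
  have /andP[tau0 taus] := t1.
  rewrite indicE mem_set; last by rewrite /= in_itv.
  rewrite indicE memNset ?addr0 ?mulr1; last first.
    by rewrite /= in_itv/= => /andP[]; rewrite ltNge taus.
  rewrite (heatE _ tau0 taus) (heatE _ tau0 (le_trans taus st)).
  have := @expRN_lip ((s - tau) * enorm xi) ((t - tau) * enorm xi).
  rewrite mulr_ge0 ?subr_ge0// ler_wpM2r ?lerD2r// => /(_ isT isT)/andP[h1 h2].
  rewrite distrC ger0_norm ?subr_ge0//; apply: le_trans h2 _; apply: le_of_eq; ring.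
rewrite (heat_eq0 _ t1) subr0 ger0_norm ?heat_ge0//.
rewrite [X in _ * X + _]indicE memNset ?mulr0 ?add0r; last first.
  by rewrite /= in_itv/=; exact/negP.
have [t2|t2] := boolP (0 <= tau <= t); last by rewrite heat_eq0// indicE.
rewrite indicE mem_set ?heat_le1// /= in_itv/=.
by have /andP[a ->] := t2; rewrite andbT ltNge; move: t1; rewrite a.
Qed.

End MildSpectrum.

Section Solution.
Context {R : realType}.
Local Notation mR := (measurableTypeR R).
Local Notation mP := (measurableTypeR R * measurableTypeR R)%type.
Local Notation plane := (@Defs.plane R).
Local Notation leb := (@lebesgue_measure R).
Local Notation w s xi := (enorm (xi : plane) `^ s).
Variables (w0 : mP -> R[i]) (u : mR * mP -> R[i]) (Q : mP -> \bar R).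
Hypotheses (mw0 : cmeas w0) (mu : cmeas u) (mQ : measurable_fun setT Q) (du : dom u Q).
Hypothesis iQ : (\int[leb2]_x Q x < +oo)%E.
Hypothesis ueq : forall t, ae_eq leb2 setT (fun xi => u (t, xi))
        (fun xi => (heat t 0 xi)%:C%C * w0 xi - duh u t xi).

Lemma Q_ge0 x : (0 <= Q x)%E.
Proof. exact: dom_ge0 du. Qed.

Lemma measurable_weight s : measurable_fun setT (fun x : mP => w s x : mR).
Proof. exact: (measurableT_comp (measurable_powR s) (@measurable_enorm R)). Qed.

Let wQ_ge0 s x : (0 <= (w s x)%:E * Q x)%E.
Proof. by rewrite mule_ge0 ?Q_ge0// lee_fin powR_ge0. Qed.

Let mwQ s : measurable_fun setT (fun x => (w s x)%:E * Q x)%E.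
Proof. by apply: emeasurable_funM => //; apply/measurable_EFinP; exact: measurable_weight. Qed.

Lemma integral_weight_slice s t :
  (\int[leb2]_x (w s x * cmod (u (t, x)))%:E <= \int[leb2]_x ((w s x)%:E * Q x))%E.
Proof.
apply: le_int => //.
- apply/measurable_EFinP; apply: measurable_funM; first exact: measurable_weight.
  by apply: cmeas_cmod; exact: cmeas_pair1.
- exact: mwQ.
- by move=> x; rewrite lee_fin mulr_ge0 ?powR_ge0 ?cmod_ge0.
- move=> x; rewrite EFinM; apply: lee_wpmul2l; first by rewrite lee_fin powR_ge0.
  by case: du.
Qed.

Lemma integral_slice t : (\int[leb2]_x (cmod (u (t, x)))%:E <= \int[leb2]_x Q x)%E.
Proof.
apply: le_int => //.
- by apply: emeas_cmod; exact: cmeas_pair1.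
- by move=> x; rewrite lee_fin cmod_ge0.
- by move=> x; case: du.
Qed.

Lemma cintble_slice t : cintble leb2 (fun x => u (t, x)).
Proof.
apply/cintbleP; split; first exact: cmeas_pair1.
exact: le_lt_trans (integral_slice t) iQ.
Qed.

Definition sol (t : R) : @dist R := difourier (dist_of (fun xi => u (t, xi))).

Lemma spec_sol t : spec (sol t) (fun xi => u (t, xi)).
Proof. by apply: difourier_spec; apply: cintble_tame; exact: cintble_slice. Qed.

Lemma Xnorm_sol s t : Xnorm s (sol t) = (\int[leb2]_x (w s x * cmod (u (t, x)))%:E)%E.
Proof. exact: Xnorm_spec (spec_sol t). Qed.

Lemma sol_inX s t : (\int[leb2]_x ((w s x)%:E * Q x) < +oo)%E -> inX s (sol t).
Proof.
move=> h; apply: spec_inX (spec_sol t) (cintble_slice t) _.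
exact: le_lt_trans (integral_weight_slice s t) h.
Qed.

Lemma sol_mild theta0 : spec theta0 w0 -> mild_solution theta0 sol.
Proof.
move=> s0 t t0.
have f : (\int[leb2]_x Q x \is a fin_num)%E.
  by rewrite ge0_fin_numE//; apply: int_ge0; exact: Q_ge0.
have A0 : 0 <= fine (\int[leb2]_x Q x)%E by apply: fine_ge0; apply: int_ge0; exact: Q_ge0.
apply: (@spec_dist_eq _ _ _ (fun xi => (heat t 0 xi)%:C%C * w0 xi - duh u t xi)).
  apply: spec_ae (spec_sol t) _ (ueq t); apply: cmeasB.
    by apply: cmeasM => //; apply: cmeas_real; exact: measurable_heat_comp.
  exact: (cmeas_pair1 t (cmeas_duh mu)).
apply: (spec_mild s0 mu A0 t0) => tau _; last exact: spec_sol.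
by rewrite fineK//; exact: integral_slice.
Qed.

(** Self-convolution of the majorant: |x| K(x) bounds the nonlinearity at all times, and K is
    integrable, hence finite almost everywhere. *)
Let K (x : mP) : \bar R := (c2pi%:E * \int[leb2]_y (Q y * Q (psub x y)))%E.

Let mK : measurable_fun setT K.
Proof.
apply: emeasurable_funM; first exact: measurable_cst.
apply: (measurable_integral_param lebP (f := fun p : mP * mP => (Q p.2 * Q (psub p.1 p.2))%E)).
  apply: emeasurable_funM; first exact: (measurableT_comp mQ).
  exact: (measurableT_comp mQ (@measurable_psub R)).
by move=> p; rewrite mule_ge0 ?Q_ge0.
Qed.

Let K_ge0 x : (0 <= K x)%E.
Proof.
apply: mule_ge0; first by rewrite lee_fin ltW// c2pi_gt0.
by apply: int_ge0 => y; rewrite mule_ge0 ?Q_ge0.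
Qed.

Let ae_fin (f : mP -> \bar R) : measurable_fun setT f -> (forall x, 0 <= f x)%E ->
  (\int[leb2]_x f x < +oo)%E -> {ae leb2, forall x, f x \is a fin_num}.
Proof.
move=> mf f0 foo; have : leb2.-integrable setT f.
  apply/integrableP; split => //; apply: le_lt_trans foo; apply: le_of_eq.
  by apply: eq_integral => x _; rewrite gee0_abs.
by move=> /integrable_ae => /(_ measurableT); apply: filterS => x /(_ I).
Qed.

Let K_fin : {ae leb2, forall x, K x \is a fin_num}.
Proof.
apply: ae_fin => //; rewrite /K intZl ?integral_conv//; try exact: Q_ge0.
- have f : (\int[leb2]_x Q x \is a fin_num)%E.
    by rewrite ge0_fin_numE//; apply: int_ge0; exact: Q_ge0.
  by rewrite -(fineK f) -!EFinM ltry.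
- apply: (measurable_integral_param lebP (f := fun p : mP * mP => (Q p.2 * Q (psub p.1 p.2))%E)).
    apply: emeasurable_funM; first exact: (measurableT_comp mQ).
    exact: (measurableT_comp mQ (@measurable_psub R)).
  by move=> p; rewrite mule_ge0 ?Q_ge0.
- by move=> x; apply: int_ge0 => y; rewrite mule_ge0 ?Q_ge0.
- by rewrite lee_fin ltW// c2pi_gt0.
Qed.

Let bil_le tau x : ((cmod (bil (fun y => u (tau, y)) (fun y => u (tau, y)) x))%:E <=
  (enorm (x : plane))%:E * K x)%E.
Proof.
have m := cmeas_pair1 tau mu.
apply: le_trans (cmod_bil_le_conv x m m) _.
rewrite /K EFinM -muleA muleCA; apply: lee_wpmul2l; first by rewrite lee_fin enorm_ge0.
apply: lee_wpmul2l; first by rewrite lee_fin ltW// c2pi_gt0.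
apply: le_int.
- apply: emeasurable_funM; first exact: emeas_cmod.
  exact: (measurableT_comp (emeas_cmod m) (measurable_psub2 x)).
- by apply: emeasurable_funM => //; exact: (measurableT_comp mQ (measurable_psub2 x)).
- by move=> y; rewrite mule_ge0// lee_fin cmod_ge0.
- move=> y; have [h _] := du; apply: lee_pmul; rewrite ?lee_fin ?cmod_ge0//.
Qed.

(** [heat_modulus] integrated against the bound |x| K(x): the segment [0, s] contributes (t - s) |x|
    s, and the segment ]s, t] contributes t - s. *)
Let duh_modulus s t x : K x \is a fin_num -> 0 <= s -> s <= t ->
  cmod (duh u t x - duh u s x) <=
  (t - s) * ((1 + t * enorm (x : plane)) * (enorm (x : plane) * fine (K x))).
Proof.
move=> Kx s0 st; set e := enorm (x : plane); set kap := e * fine (K x).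
have e0 : 0 <= e by exact: enorm_ge0.
have kap0 : 0 <= kap by rewrite mulr_ge0// fine_ge0// K_ge0.
have ts0 : 0 <= t - s by rewrite subr_ge0.
pose b (tau : mR) := bil (fun y => u (tau, y)) (fun y => u (tau, y)) x.
have mb : cmeas b := cmeas_pair2 x (cmeas_bil_time mu mu).
have bk tau : cmod (b tau) <= kap.
  by rewrite -lee_fin; apply: le_trans (bil_le tau x) _; rewrite /kap EFinM fineK.
have mh (r : R) : measurable_fun setT (fun tau : mR => heat r tau x : mR).
  exact: measurable_heat_comp.
have mi (D : set mR) : measurable D -> measurable_fun setT (fun tau : mR => \1_D tau : mR).
  by move=> mD; exact: measurable_indic.
have lebi a r : (leb `[a, r]%classic < +oo)%E.
  rewrite [X in (X < _)%E](lebesgue_measure_itv `[a, r]) /=.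
  by case: ifPn => _; rewrite ?ltry// -EFinB ltry.
have ch r : cintble leb (fun tau : mR => (heat r tau x)%:C%C * b tau).
  refine (@le_cintble _ _ _ _ _ (fun tau : mR => kap%:E * (\1_(`[0, r]%classic) tau)%:E)%E _ _ _ _).
  - by apply: cmeasM => //; apply: cmeas_real; exact: mh.
  - by apply: emeasurable_funM; [exact: measurable_cst|apply/measurable_EFinP; exact: mi].
  - rewrite intZl//; [|by apply/measurable_EFinP; exact: mi].
    by rewrite integral_indic// setIT; apply: lte_mul_pinfty => //; exact: lebi.
  - move=> tau; rewrite -EFinM lee_fin cmodM cmod_real ger0_norm ?heat_ge0// mulrC.
    apply: ler_pM; rewrite ?cmod_ge0 ?heat_ge0//.
    by have /andP[] := heat_itv r tau (x : plane).
rewrite /duh -cintegralB//.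
have -> : (fun tau => (heat t tau x)%:C%C * b tau - (heat s tau x)%:C%C * b tau) =
    (fun tau => (heat t tau x - heat s tau x)%:C%C * b tau).
  by apply/funext => tau; rewrite -mulrBl -rmorphB.
rewrite -lee_fin; apply: le_trans (cmod_cintegral_le leb _) _.
  by apply: cmeasM => //; apply: cmeas_real; apply: measurable_funB; exact: mh.
pose U (tau : mR) : R := (t - s) * e * \1_(`[0, s]%classic) tau + \1_(`]s, t]%classic) tau.
have mU : measurable_fun setT U.
  by apply: measurable_funD; [apply: measurable_funM => //; exact: mi|exact: mi].
have U0 tau : 0 <= U tau by rewrite addr_ge0 ?mulr_ge0.
apply: (@le_trans _ _ (\int[leb]_tau (kap%:E * (U tau)%:E))%E).
  apply: le_int.
  - apply: emeas_cmod; apply: cmeasM => //; apply: cmeas_real; apply: measurable_funB; exact: mh.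
  - by apply: emeasurable_funM; [exact: measurable_cst|exact/measurable_EFinP].
  - by move=> tau; rewrite lee_fin cmod_ge0.
  - move=> tau; rewrite -EFinM lee_fin cmodM cmod_real mulrC.
    by apply: ler_pM; rewrite ?cmod_ge0//; exact: heat_modulus.
rewrite intZl//; [|exact/measurable_EFinP].
have -> : (\int[leb]_tau (U tau)%:E = ((t - s) * e * s + (t - s))%:E)%E.
  under eq_integral do rewrite EFinD EFinM.
  rewrite intD; last 4 first.
  - by apply: emeasurable_funM; [exact: measurable_cst|apply/measurable_EFinP; exact: mi].
  - by move=> tau; rewrite -EFinM lee_fin mulr_ge0// mulr_ge0.
  - by apply/measurable_EFinP; exact: mi.
  - by move=> tau; rewrite lee_fin.
  rewrite intZl//; [|by apply/measurable_EFinP; exact: mi|by rewrite lee_fin mulr_ge0].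
  rewrite !integral_indic// !setIT.
  by rewrite [X in (_ * X + _)%E](lebesgue_cc s0) [X in (_ + X)%E](lebesgue_oc st) -EFinM -EFinD subr0.
rewrite -EFinM lee_fin mulrC [leRHS]mulrA; apply: ler_wpM2r => //.
rewrite mulrDr mulr1 addrC lerD2l -mulrA; apply: ler_wpM2l => //.
by rewrite mulrC ler_wpM2r.
Qed.

(** Lipschitz constant in time at a fixed frequency on [0, T]. It carries extra powers of |x| and is
    not claimed to be integrable, so it is used only under a minimum with 2 Q. *)
Let lip T (x : mP) : R := enorm (x : plane) * cmod (w0 x) +
  (1 + T * enorm (x : plane)) * (enorm (x : plane) * fine (K x)).

Let slice_modulus T s t : 0 <= s -> s <= t -> t <= T -> {ae leb2, forall x,
  cmod (u (t, x) - u (s, x)) <= Num.min (2 * fine (Q x)) ((t - s) * lip T x)}.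
Proof.
move=> s0 st tT; have t0 := le_trans s0 st.
have F1 : {ae leb2, forall x, u (t, x) = (heat t 0 x)%:C%C * w0 x - duh u t x /\
    u (s, x) = (heat s 0 x)%:C%C * w0 x - duh u s x}.
  by apply: (filterS2 _ _ (ueq t) (ueq s)) => x /(_ I) a /(_ I) b; split; [exact: a|exact: b].
have F2 : {ae leb2, forall x, K x \is a fin_num /\ Q x \is a fin_num}.
  by move: K_fin (ae_fin mQ Q_ge0 iQ); apply: filterS2 => x a b.
move: F1 F2; apply: filterS2 => x [e1 e2] [Kx Qx].
have uQ r : cmod (u (r, x)) <= fine (Q x).
  by rewrite -lee_fin fineK//; case: du.
rewrite le_min; apply/andP; split.
  by apply: le_trans (le_cmodB _ _) _; rewrite mulr_natl mulr2n lerD.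
rewrite e1 e2 (_ : _ - _ = (heat t 0 x - heat s 0 x)%:C%C * w0 x - (duh u t x - duh u s x)); last first.
  move: (heat t 0 x) (heat s 0 x) (duh u t x) (duh u s x) (w0 x) => a b c d e.
  by rewrite rmorphB /=; ring.
apply: le_trans (le_cmodB _ _) _; rewrite /lip mulrDr; apply: lerD.
  rewrite cmodM cmod_real mulrA; apply: ler_wpM2r; first exact: cmod_ge0.
  apply: le_trans (heat_modulus 0 x s0 st) _.
  rewrite indicE mem_set; last by rewrite /= in_itv/= lexx.
  rewrite indicE memNset ?addr0 ?mulr1//.
  by rewrite /= in_itv/= => /andP[]; rewrite ltNge s0.
apply: le_trans (duh_modulus Kx s0 st) _.
have e0 := enorm_ge0 (x : plane).
have k0 : 0 <= enorm (x : plane) * fine (K x) by rewrite mulr_ge0// fine_ge0.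
apply: ler_wpM2l; first by rewrite subr_ge0.
by apply: ler_wpM2r => //; rewrite lerD2l ler_wpM2r.
Qed.

Let lip_ge0 T x : 0 <= T -> 0 <= lip T x.
Proof.
move=> T0; have e0 := enorm_ge0 (x : plane).
by rewrite addr_ge0 ?mulr_ge0 ?cmod_ge0 ?addr_ge0 ?mulr_ge0// fine_ge0.
Qed.

Let mlip T : measurable_fun setT (lip T : mP -> mR).
Proof.
have me := @measurable_enorm R.
apply: measurable_funD; apply: measurable_funM => //; first exact: cmeas_cmod.
  by apply: measurable_funD => //; exact: measurable_funM.
by apply: measurable_funM => //; exact: (measurableT_comp (@fine_measurable R _ measurableT)).
Qed.

(** The minimum of 2 Q and [lip] over n+1 is dominated by 2 Q and tends to 0 at each frequency. As
    it does not involve s and t, continuity comes out uniform on [0, T], for any weight that is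
    integrable against Q. *)
Lemma time_modulus r T e : (\int[leb2]_x ((w r x)%:E * Q x) < +oo)%E -> 0 <= T -> 0 < e ->
  exists n : nat, forall s t, 0 <= s <= T -> 0 <= t <= T -> `|t - s| <= n.+1%:R^-1 ->
    (\int[leb2]_x (w r x * cmod (u (t, x) - u (s, x)))%:E <= e%:E)%E.
Proof.
move=> iw T0 e0.
have mq : measurable_fun setT (fun x => fine (Q x) : mR).
  exact: (measurableT_comp (@fine_measurable R _ measurableT)).
have q0 x : 0 <= fine (Q x) by rewrite fine_ge0// Q_ge0.
pose h (n : nat) (x : mP) : R := w r x * Num.min (2 * fine (Q x)) (n.+1%:R^-1 * lip T x).
have m0 n x : 0 <= Num.min (2 * fine (Q x)) (n.+1%:R^-1 * lip T x).
  by rewrite le_min !mulr_ge0//= lip_ge0.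
have mh n : measurable_fun setT (h n : mP -> mR).
  apply: measurable_funM; first exact: measurable_weight.
  apply: measurable_minr; first exact: measurable_funM.
  by apply: measurable_funM => //; exact: mlip.
have : (\int[leb2]_z (h n z)%:E)%E @[n --> \oo] --> 0%E.
  apply: (@integral_dominated_cvg0 _ _ _ _ _ (fun z : mP => w r z * (2 * fine (Q z)))).
  - exact: mh.
  - apply: measurable_funM; first exact: measurable_weight.
    by apply: measurable_funM.
  - apply: (@le_lt_trans _ _ (\int[leb2]_x (2%:E * ((w r x)%:E * Q x)))%E).
      apply: le_int.
      + apply/measurable_EFinP; apply: measurable_funM; first exact: measurable_weight.
        by apply: measurable_funM.
      + by apply: emeasurable_funM; [exact: measurable_cst|exact: mwQ].
      + by move=> x; rewrite lee_fin mulr_ge0 ?powR_ge0 ?mulr_ge0.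
      + move=> x; rewrite mulrCA !EFinM; apply: lee_wpmul2l => //.
        apply: lee_wpmul2l; first by rewrite lee_fin powR_ge0.
        by have := Q_ge0 x; case: (Q x) => [q|_|]//=; rewrite leey.
    by rewrite intZl//; [exact: lte_mul_pinfty|exact: mwQ].
  - move=> n x; rewrite mulr_ge0 ?powR_ge0//= ler_wpM2l ?powR_ge0//.
    by rewrite ge_min lexx.
  - apply: aeW => x; rewrite -(mulr0 (w r x)); apply: cvgM; first exact: cvg_cst.
    apply: (@squeeze_cvgr _ _ _ _ (fun=> 0) (fun n => n.+1%:R^-1 * lip T x)).
    + by apply: nearW => n; rewrite m0/= ge_min lexx orbT.
    + exact: cvg_cst.
    + rewrite -(mul0r (lip T x)); apply: cvgM; last exact: cvg_cst.
      exact: cvg_harmonic.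
move=> /fine_cvg0_ex/(_ _ e0)[n|n hn].
  by apply: int_ge0 => x; rewrite lee_fin mulr_ge0 ?powR_ge0.
exists n => s t; wlog st : s t / s <= t => [H sT tT|].
  case/orP: (le_total s t) => [st|ts]; first exact: (H _ _ st sT tT).
  rewrite distrC => /(H _ _ ts tT sT); apply: le_trans; apply: le_of_eq.
  by apply: eq_integral => x _; rewrite cmodBC.
move=> /andP[s0 sT] /andP[t0 tT] stn; apply: le_trans (hn n (leqnn n)).
have mc : measurable_fun setT (fun x => w r x * cmod (u (t, x) - u (s, x)) : mR).
  apply: measurable_funM; first exact: measurable_weight.
  by apply: cmeas_cmod; apply: cmeasB; exact: cmeas_pair1.
apply: ae_ge0_le_integral => //.
- by move=> x _; rewrite lee_fin mulr_ge0 ?powR_ge0 ?cmod_ge0.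
- exact/measurable_EFinP.
- by move=> x _; rewrite lee_fin mulr_ge0 ?powR_ge0.
- by apply/measurable_EFinP; exact: mh.
apply: filterS (slice_modulus s0 st tT) => x hx _.
rewrite lee_fin ler_wpM2l ?powR_ge0//; apply: le_trans hx _.
rewrite le_min ge_min lexx/= ge_min; apply/orP; right.
rewrite ler_wpM2r ?lip_ge0//.
by move: stn; rewrite ger0_norm// subr_ge0.
Qed.

Lemma sol_in_Cb delta : (\int[leb2]_x ((w (- delta) x)%:E * Q x) < +oo)%E -> in_Cb delta sol.
Proof.
move=> iw; have i0 : (\int[leb2]_x ((w 0 x)%:E * Q x) < +oo)%E.
  by under eq_integral do rewrite powRr0 mul1e.
split.
- by move=> t t0; split; exact: sol_inX.
- move=> t t0; apply: cvge0_le => [s|e e0]; first by rewrite le_max Xnorm_ge0.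
  (* Uniform continuity is available on bounded time intervals; [0, t + 1] contains the nonnegative
     times at distance at most 1 from t. *)
  have T0 : 0 <= t + 1 by rewrite addr_ge0.
  have [n1 h1] := time_modulus i0 T0 e0; have [n2 h2] := time_modulus iw T0 e0.
  pose d : R := (maxn n1 n2).+1%:R^-1.
  have d0 : 0 < d by rewrite invr_gt0.
  have dn (n : nat) : (n <= maxn n1 n2)%N -> d <= n.+1%:R^-1.
    by move=> nm; rewrite lef_pV2 ?posrE// ler_nat.
  have d1 : d <= 1 by rewrite invf_le1// ler1n.
  rewrite /within /=; apply: filterS (nbhsx_ballx t _ d0) => s /= ts.
  rewrite in_itv/= andbT => s0.
  have {}ts : `|s - t| <= d by rewrite distrC; exact: ltW.
  have sT : 0 <= s <= t + 1.
    by rewrite s0 /= -lerBlDl; apply: le_trans (ler_norm _) (le_trans ts d1).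
  have tT : 0 <= t <= t + 1 by rewrite t0/= lerDl ler01.
  have sp := spec_dsub (spec_sol s) (spec_sol t).
  rewrite /Xcapnorm ge_max !(Xnorm_spec _ sp); apply/andP; split.
    by apply: h1 => //; apply: le_trans ts _; apply: dn; exact: leq_maxl.
  by apply: h2 => //; apply: le_trans ts _; apply: dn; exact: leq_maxr.
- pose B r := fine (\int[leb2]_x ((w r x)%:E * Q x))%E.
  have BE r : (\int[leb2]_x ((w r x)%:E * Q x) < +oo)%E ->
      (\int[leb2]_x ((w r x)%:E * Q x) = (B r)%:E)%E.
    by move=> h; rewrite fineK// ge0_fin_numE//; apply: int_ge0; exact: wQ_ge0.
  exists (Num.max (B 0) (B (- delta))) => t t0.
  rewrite /Xcapnorm ge_max !Xnorm_sol; apply/andP; split.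
    apply: le_trans (integral_weight_slice 0 t) (le_trans (le_of_eq (BE 0 i0)) _).
    by rewrite lee_fin le_max; apply/orP; left; exact: lexx.
  apply: le_trans (integral_weight_slice _ t) (le_trans (le_of_eq (BE (- delta) iw)) _).
  by rewrite lee_fin le_max; apply/orP; right; exact: lexx.
Qed.

End Solution.

Section AlmostEverywhere.
Context {R : realType} d (T : measurableType d) (mu : {measure set T -> \bar R}).
Implicit Types P Q : T -> Prop.

Lemma ae_and P Q : {ae mu, forall x, P x} -> {ae mu, forall x, Q x} -> {ae mu, forall x, P x /\ Q x}.
Proof. by apply: filterS2 => x. Qed.

Lemma ae_imply P Q : (forall x, P x -> Q x) -> {ae mu, forall x, P x} -> {ae mu, forall x, Q x}.
Proof. by move=> PQ; apply: filterS. Qed.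

End AlmostEverywhere.

(** * Time grids and Bochner integrability of the gradient *)

Section TimeGrid.
Context {R : realType}.
Local Notation mR := (measurableTypeR R).

(** Index of the left endpoint in a mesh of step 1/(k+1) on [0, N), with 0 elsewhere; the finite
    range is what simple functions need. *)
Definition grid (N k : nat) (t : R) : nat :=
  if 0 <= t < N%:R then Num.truncn (t * k.+1%:R) else 0%N.

Lemma grid_bound N k t : (grid N k t <= N * k.+1)%N.
Proof.
rewrite /grid; case: ifPn => // /andP[t0 tN]; rewrite -(ler_nat R).
have h : 0 <= t * k.+1%:R by rewrite mulr_ge0.
have /andP[a _] := truncn_itv h; apply: le_trans a _.
by rewrite natrM ler_wpM2r// ltW.
Qed.

Lemma grid_near N k (t : R) : 0 <= t < N%:R ->
  0 <= ((grid N k t)%:R / k.+1%:R : R) <= t /\ `|t - (grid N k t)%:R / k.+1%:R| <= (k.+1%:R^-1 : R).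
Proof.
move=> tN; rewrite /grid tN; have /andP[t0 _] := tN.
have h : 0 <= t * k.+1%:R by rewrite mulr_ge0.
have /andP[a b] := truncn_itv h; set m := Num.truncn _ in a b *.
have k0 : (0 : R) < k.+1%:R by rewrite ltr0n.
have mt : m%:R / k.+1%:R <= t by rewrite ler_pdivrMr.
split; first by rewrite mt andbT mulr_ge0// invr_ge0 ltW.
rewrite ger0_norm ?subr_ge0// lerBlDr -[X in X + _]mul1r -mulrDl ler_pdivlMr//.
by rewrite addrC natr1 ltW.
Qed.

Lemma measurable_grid N k (j : nat) : measurable [set t : mR | grid N k t = j].
Proof.
pose I : set mR := [set t | 0 <= t < N%:R].
pose J : set mR := [set t | j%:R <= t * k.+1%:R < j.+1%:R].
have itv (f : mR -> mR) (a b : R) : measurable_fun setT f -> measurable [set t : mR | a <= f t < b].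
  move=> mf; rewrite (_ : [set t | _] = f @^-1` `[a, b[%classic); last first.
    by apply/seteqP; split => t /=; rewrite in_itv.
  by rewrite -[X in measurable X]setTI; exact: mf.
have mI : measurable I by apply: itv; exact: measurable_id.
have mJ : measurable J by apply: itv; exact: measurable_funM.
have -> : [set t : mR | grid N k t = j] = (I `&` J) `|` (if j == 0%N then ~` I else set0).
  apply/seteqP; split => t; rewrite /grid /=.
    case: ifPn => [It tj|It <-]; last by right; rewrite eqxx; exact/negP.
    left; split => //; rewrite /J /= -tj; apply: truncn_itv.
    by have /andP[t0 _] := It; rewrite mulr_ge0.
  move=> [[It Jt]|]; first by rewrite It; exact: truncn_def.
  by case: eqP => [-> /negP/negbTE ->//|].
by apply: measurableU; [exact: measurableI|case: ifP => _ //; exact: measurableC].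
Qed.

End TimeGrid.

Section Gradient.
Context {R : realType}.
Local Notation mR := (measurableTypeR R).
Local Notation mP := (measurableTypeR R * measurableTypeR R)%type.
Local Notation plane := (@Defs.plane R).
Local Notation coord := (@Defs.coord R).
Local Notation leb := (@lebesgue_measure R).
Local Notation w s xi := (enorm (xi : plane) `^ s).
Implicit Types (V : @vdist R) (T : @dist R) (g : mP -> R[i]).

(** A gradient field is recorded by one scalar spectrum g, so that its Euclidean norm in frequency
    is |xi| |g| and differences of gradients reduce to differences of scalars. *)
Definition gspec V g : Prop :=
  forall j, spec (if j then V.2 else V.1) (fun x => (0 +i* coord j x)%C * g x).

Lemma gspec_gradient T g : spec T g -> cintble leb2 g -> gspec (gradient T) g.
Proof.
by move=> sT cg [] /=; apply: spec_dpartial => //; exact: cintble_tame_icoord.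
Qed.

Lemma gspec_vsub V W g h : gspec V g -> gspec W h -> gspec (vsub V W) (fun x => g x - h x).
Proof.
move=> sV sW j; have := spec_dsub (sV j) (sW j).
rewrite (_ : (fun x => _ - _) = (fun x => (0 +i* coord j x)%C * (g x - h x))).
  by case: j.
by apply/funext => x; rewrite mulrBr.
Qed.

Lemma sqrt_grad (x : plane) (z : R[i]) :
  Num.sqrt (cmod ((0 +i* coord false x)%C * z) ^+ 2 + cmod ((0 +i* coord true x)%C * z) ^+ 2) =
  enorm x * cmod z.
Proof.
rewrite !cmodM !cmod_imag !exprMn -mulrDl !real_normK ?num_real//= sqrtrM.
  by rewrite sqrtr_sqr ger0_norm ?cmod_ge0.
by rewrite addr_ge0 ?sqr_ge0.
Qed.

Lemma vXnorm_gspec s V g : gspec V g -> cmeas g ->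
  vXnorm s V = (\int[leb2]_x (w s x * (enorm (x : plane) * cmod (g x)))%:E)%E.
Proof.
move=> sV mg; have h1 := spec_hat (sV false); have h2 := spec_hat (sV true).
have m1 := spec_hat_cmeas (sV false); have m2 := spec_hat_cmeas (sV true).
apply: ae_eq_integral => //.
- apply/measurable_EFinP; apply: measurable_funM; first exact: measurable_weight.
  apply: measurableT_comp; first by apply: continuous_measurable_fun; exact: sqrt_continuous.
  by apply: measurable_funD; apply: measurable_funX; exact: cmeas_cmod.
- apply/measurable_EFinP; apply: measurable_funM; first exact: measurable_weight.
  by apply: measurable_funM; [exact: measurable_enorm|exact: cmeas_cmod].
- move: h1 h2; apply: filterS2 => x /(_ I) /= -> /(_ I) /= -> _.
  by rewrite sqrt_grad.
Qed.

Lemma vXnorm_ge0 s V : (0 <= vXnorm s V)%E.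
Proof. by apply: int_ge0 => x; rewrite lee_fin mulr_ge0 ?powR_ge0 ?sqrtr_ge0. Qed.

(** Temperedness is derived from integrable spectra, hence the unweighted bound beside the one for
    the norm in question. *)
Lemma gspec_vinX s V g : gspec V g -> cmeas g ->
  (\int[leb2]_x (enorm (x : plane) * cmod (g x))%:E < +oo)%E ->
  (\int[leb2]_x (w s x * (enorm (x : plane) * cmod (g x)))%:E < +oo)%E -> vinX s V.
Proof.
move=> sV mg i0 i1.
have cj j : cintble leb2 (fun x : mP => (0 +i* coord j x)%C * g x).
  apply/cintbleP; split; first by case: (sV j) => -[].
  apply: le_lt_trans i0; apply: le_int.
  - by apply: emeas_cmod; case: (sV j) => -[].
  - apply/measurable_EFinP; apply: measurable_funM; first exact: measurable_enorm.
    exact: cmeas_cmod.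
  - by move=> x; rewrite lee_fin cmod_ge0.
  - by move=> x; rewrite lee_fin cmodM cmod_imag ler_wpM2r ?cmod_ge0// ler_coord_enorm.
split.
- by split; [exact: (spec_tempered (sV false) (cj false))|exact: (spec_tempered (sV true) (cj true))].
- by split; [exact: (spec_has_hat (sV false))|exact: (spec_has_hat (sV true))].
- by rewrite (vXnorm_gspec _ sV mg).
Qed.

Section InL1.
Variables (w0 : mP -> R[i]) (u : mR * mP -> R[i]) (Q : mP -> \bar R) (delta : R).
Hypotheses (mw0 : cmeas w0) (mu : cmeas u) (mQ : measurable_fun setT Q) (du : dom u Q).
Hypothesis iQ : (\int[leb2]_x Q x < +oo)%E.
Hypothesis ueq : forall t, ae_eq leb2 setT (fun xi => u (t, xi))
        (fun xi => (heat t 0 xi)%:C%C * w0 xi - duh u t xi).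
Hypothesis iw : (\int[leb2]_x ((w (- delta) x)%:E * Q x) < +oo)%E.

Let Q0 := Q_ge0 du.
Let csl := cintble_slice mu mQ du iQ.
Let ssol := spec_sol mu mQ du iQ.
Let msl t : cmeas (fun x => u (t, x)) := cmeas_pair1 t mu.

Let i0 : (\int[leb2]_x ((w 0 x)%:E * Q x) < +oo)%E.
Proof. by under eq_integral do rewrite powRr0 mul1e. Qed.

Let F s (t : R) (x : mP) : R := w s x * (enorm (x : plane) * cmod (u (t, x))).

Let F_ge0 s t x : 0 <= F s t x.
Proof. by rewrite !mulr_ge0 ?powR_ge0 ?cmod_ge0 ?enorm_ge0. Qed.

Let mF s t : measurable_fun setT (F s t : mP -> mR).
Proof.
apply: measurable_funM; first exact: measurable_weight.
by apply: measurable_funM; [exact: measurable_enorm|exact: cmeas_cmod].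
Qed.

Let mF2 s : measurable_fun setT (fun p : mR * mP => F s p.1 p.2 : mR).
Proof.
apply: measurable_funM; first exact: (measurableT_comp (measurable_weight s) measurable_snd).
apply: measurable_funM; first exact: (measurableT_comp (@measurable_enorm R) measurable_snd).
have -> : (fun p : mR * mP => cmod (u (p.1, p.2))) = (fun p => cmod (u p)).
  by apply/funext => -[].
exact: cmeas_cmod.
Qed.

Let J s (t : R) : \bar R := (\int[leb2]_x (F s t x)%:E)%E.

Let J_ge0 s t : (0 <= J s t)%E.
Proof. by apply: int_ge0 => x; rewrite lee_fin. Qed.

Let mJ s : measurable_fun setT (J s : mR -> \bar R).
Proof.
apply: (measurable_integral_param lebP (f := fun p : mR * mP => (F s p.1 p.2)%:E)).
  by apply/measurable_EFinP; exact: mF2.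
by move=> p; rewrite lee_fin.
Qed.

(** Tonelli and the second half of [dom]: |x| times the time integral of |u| is at most Q(x). *)
Lemma integral_time_grad s :
  (\int[leb]_t \int[leb2]_x (w s x * (enorm (x : plane) * cmod (u (t, x))))%:E <=
   \int[leb2]_x ((w s x)%:E * Q x))%E.
Proof.
rewrite (@fubini_tonelli _ _ _ _ _ leb lebP (fun p : mR * mP => (F s p.1 p.2)%:E)); last 2 first.
- by apply/measurable_EFinP; exact: mF2.
- by move=> p; rewrite lee_fin.
have mc x : measurable_fun setT (fun t : mR => (cmod (u (t, x)))%:E).
  by apply: emeas_cmod; exact: cmeas_pair2.
have c0 x t : (0 <= (cmod (u (t, x)))%:E)%E by rewrite lee_fin cmod_ge0.
have E x : (\int[leb]_t (F s t x)%:E =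
    (w s x)%:E * ((enorm (x : plane))%:E * \int[leb]_t (cmod (u (t, x)))%:E))%E.
  rewrite -intZl//; last by rewrite lee_fin enorm_ge0.
  rewrite -intZl//; last by rewrite lee_fin powR_ge0.
  - by apply: emeasurable_funM; [exact: measurable_cst|exact: mc].
  - by move=> t; rewrite mule_ge0// lee_fin enorm_ge0.
under eq_integral do rewrite E.
have mI : measurable_fun setT (fun x => \int[leb]_t (cmod (u (t, x)))%:E)%E.
  apply: (measurable_integral_param leb (f := fun p : mP * mR => (cmod (u (p.2, p.1)))%:E)).
    apply: emeas_cmod; apply: (cmeas_comp (h := fun p : mP * mR => (p.2, p.1)) _ mu).
    exact: measurable_fun_pair.
  by move=> p; rewrite lee_fin cmod_ge0.
have mw' : measurable_fun setT (fun x : mP => (w s x)%:E).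
  by apply/measurable_EFinP; exact: measurable_weight.
apply: le_int.
- apply: emeasurable_funM => //; apply: emeasurable_funM => //.
  by apply/measurable_EFinP; exact: measurable_enorm.
- exact: emeasurable_funM.
- by move=> x; rewrite !mule_ge0 ?lee_fin ?powR_ge0 ?enorm_ge0// int_ge0.
- by move=> x; apply: lee_wpmul2l; [rewrite lee_fin powR_ge0|case: du].
Qed.

Let ae_J s : (\int[leb2]_x ((w s x)%:E * Q x) < +oo)%E -> {ae leb, forall t, (J s t < +oo)%E}.
Proof.
move=> h; have : leb.-integrable setT (J s : mR -> \bar R).
  apply/integrableP; split => //; apply: le_lt_trans h.
  apply: le_trans (integral_time_grad s); apply: le_of_eq.
  by apply: eq_integral => x _; rewrite gee0_abs.
move=> /integrable_ae => /(_ measurableT); apply: filterS => t /(_ I).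
by rewrite ge0_fin_numE.
Qed.

Let J0E t : J 0 t = (\int[leb2]_x (enorm (x : plane) * cmod (u (t, x)))%:E)%E.
Proof. by apply: eq_integral => x _; rewrite /F powRr0 mul1r. Qed.

Let gsol t : gspec (gradient (sol u t)) (fun x => u (t, x)).
Proof. exact: gspec_gradient. Qed.

(** The gradient of a slice is known to lie in the space for almost every time only. Cutting
    frequencies at n bounds the lost factor |x| by n, so truncated gradients lie in the space at
    every time and can be sampled at grid points. *)
Let cutoff (n : nat) (x : mP) : R := if enorm (x : plane) <= n%:R then 1 else 0.

Let cutoff_itv n x : 0 <= cutoff n x <= 1.
Proof. by rewrite /cutoff; case: ifP; rewrite /= ?lexx ?ler01. Qed.

Let mcutoff n : measurable_fun setT (cutoff n : mP -> mR).
Proof.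
have mD : measurable [set x : mP | enorm (x : plane) <= n%:R].
  by apply: measurable_ler_set; [exact: measurable_enorm|exact: measurable_cst].
have mI : measurable_fun setT (\1_[set x : mP | enorm (x : plane) <= n%:R] : mP -> mR).
  exact: measurable_indic.
move: mI; congr (measurable_fun _ _); apply/funext => x; rewrite indicE /cutoff.
by case: ifPn => h; [rewrite mem_set|rewrite memNset//; exact/negP].
Qed.

Let cutu n t (x : mP) : R[i] := (cutoff n x)%:C%C * u (t, x).

Let mcutu n t : cmeas (cutu n t).
Proof. by apply: cmeasM => //; apply: cmeas_real; exact: mcutoff. Qed.

Let ccutu n t : cintble leb2 (cutu n t).
Proof.
apply: (@cintble_bM _ _ _ _ _ _ 1) => //; first by apply: cmeas_real; exact: mcutoff.
by move=> x; have /andP[a b] := cutoff_itv n x; rewrite cmod_real ger0_norm.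
Qed.

Let gcut n t := gradient (difourier (dist_of (cutu n t))).

Let gspec_cut n t : gspec (gcut n t) (cutu n t).
Proof. by apply: gspec_gradient => //; apply: difourier_spec; exact: cintble_tame. Qed.

Let cut_le n x : enorm (x : plane) * cutoff n x <= n%:R.
Proof. by rewrite /cutoff; case: ifPn => h; rewrite ?mulr1 ?mulr0. Qed.

Let cutu_int s n t : (\int[leb2]_x ((w s x)%:E * Q x) < +oo)%E ->
  (\int[leb2]_x (w s x * (enorm (x : plane) * cmod (cutu n t x)))%:E < +oo)%E.
Proof.
move=> h; apply: (@le_lt_trans _ _ (\int[leb2]_x (n%:R%:E * (w s x * cmod (u (t, x)))%:E))%E).
  apply: le_int.
  - apply/measurable_EFinP; apply: measurable_funM; first exact: measurable_weight.
    by apply: measurable_funM; [exact: measurable_enorm|apply: cmeas_cmod; exact: mcutu].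
  - apply: emeasurable_funM; first exact: measurable_cst.
    apply/measurable_EFinP; apply: measurable_funM; first exact: measurable_weight.
    exact: cmeas_cmod.
  - by move=> x; rewrite lee_fin !mulr_ge0 ?powR_ge0 ?enorm_ge0 ?cmod_ge0.
  - move=> x; rewrite -EFinM lee_fin [leRHS]mulrCA; apply: ler_wpM2l; first exact: powR_ge0.
    have /andP[a b] := cutoff_itv n x.
    rewrite cmodM cmod_real ger0_norm// mulrA; apply: ler_wpM2r; first exact: cmod_ge0.
    exact: cut_le.
rewrite intZl//.
- by apply: lte_mul_pinfty => //; exact: le_lt_trans (integral_weight_slice mu mQ du s t) h.
- by apply/measurable_EFinP; apply: measurable_funM; [exact: measurable_weight|exact: cmeas_cmod].
- by move=> x; rewrite lee_fin mulr_ge0 ?powR_ge0 ?cmod_ge0.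
Qed.

Let cut_vinXcap n t : vinXcap delta (gcut n t).
Proof.
have h0 : (\int[leb2]_x (enorm (x : plane) * cmod (cutu n t x))%:E < +oo)%E.
  have := @cutu_int 0 n t i0; under eq_integral do rewrite powRr0 mul1r.
  by [].
by split; apply: gspec_vinX (gspec_cut n t) (mcutu n t) h0 _; exact: cutu_int.
Qed.

Let tail s n t : \bar R := (\int[leb2]_x (F s t x * (1 - cutoff n x))%:E)%E.

Let tail_cvg s t e : (J s t < +oo)%E -> 0 < e ->
  exists N, forall n, (N <= n)%N -> (tail s n t <= e%:E)%E.
Proof.
move=> Joo e0.
have c01 n x : 0 <= 1 - cutoff n x <= 1.
  by have /andP[a b] := cutoff_itv n x; rewrite subr_ge0 b/= lerBlDr lerDl.
apply: fine_cvg0_ex => //; last first.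
  move=> n; apply: int_ge0 => x; rewrite lee_fin mulr_ge0//.
  by have /andP[] := c01 n x.
apply: (@integral_dominated_cvg0 _ _ _ _ _ (F s t)) => //.
- by move=> n; apply: measurable_funM; [exact: mF|apply: measurable_funB => //; exact: mcutoff].
- exact: mF.
- move=> n x; have /andP[a b] := c01 n x.
  by rewrite mulr_ge0//= ler_piMr.
- apply: aeW => x; rewrite -(mulr0 (F s t x)); apply: cvgM; first exact: cvg_cst.
  apply: cvg_near_cst; exists (Num.truncn (enorm (x : plane))).+1 => // n /= hn.
  have h : enorm (x : plane) <= n%:R.
    by apply: le_trans (ltW (truncnS_gt _)) _; rewrite ler_nat.
  by rewrite /cutoff h subrr.
Qed.

(** The tolerance (n+1)^(-2) anticipates the factor n paid for the gradient below the cutoff, so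
    that 1/(n+1) remains. *)
Let mesh_ex n : exists k : nat, forall r, r = 0 \/ r = - delta ->
  forall s t, 0 <= s <= n%:R -> 0 <= t <= n%:R -> `|t - s| <= k.+1%:R^-1 ->
  (\int[leb2]_x (w r x * cmod (u (t, x) - u (s, x)))%:E <= ((n.+1%:R ^+ 2)^-1 : R)%:E)%E.
Proof.
have T0 : 0 <= n%:R :> R by [].
have e0 : 0 < (n.+1%:R ^+ 2)^-1 :> R by rewrite invr_gt0 exprn_gt0.
have [k1 h1] := time_modulus mw0 mu mQ du iQ ueq i0 T0 e0.
have [k2 h2] := time_modulus mw0 mu mQ du iQ ueq iw T0 e0.
have dn (m : nat) : (m <= maxn k1 k2)%N -> (maxn k1 k2).+1%:R^-1 <= m.+1%:R^-1 :> R.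
  by move=> nm; rewrite lef_pV2 ?posrE// ler_nat.
exists (maxn k1 k2) => r [->|->] s t hs ht st.
  by apply: h1 => //; apply: le_trans st _; apply: dn; exact: leq_maxl.
by apply: h2 => //; apply: le_trans st _; apply: dn; exact: leq_maxr.
Qed.

(** The error splits into the cutoff of u(t) - u(tn), where |x| is at most n, and the high-frequency
    part of u(t) itself. *)
Let approx_bound r n t tn : (\int[leb2]_x ((w r x)%:E * Q x) < +oo)%E ->
  (\int[leb2]_x (w r x * cmod (u (t, x) - u (tn, x)))%:E <= ((n.+1%:R ^+ 2)^-1 : R)%:E)%E ->
  (vXnorm r (vsub (gcut n tn) (gradient (sol u t))) <= (n.+1%:R^-1)%:E + tail r n t)%E.
Proof.
move=> iwr h.
have gs := gspec_vsub (gspec_cut n tn) (gsol t).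
have mg : cmeas (fun x => cutu n tn x - u (t, x)) by exact: cmeasB.
rewrite (vXnorm_gspec _ gs mg).
have mdiff : measurable_fun setT (fun x : mP => w r x * cmod (u (t, x) - u (tn, x)) : mR).
  apply: measurable_funM; first exact: measurable_weight.
  by apply: cmeas_cmod; exact: cmeasB.
have mt : measurable_fun setT (fun x : mP => F r t x * (1 - cutoff n x) : mR).
  by apply: measurable_funM; [exact: mF|apply: measurable_funB => //; exact: mcutoff].
have c01 x : 0 <= 1 - cutoff n x.
  by have /andP[a b] := cutoff_itv n x; rewrite subr_ge0.
apply: (@le_trans _ _ (\int[leb2]_x (n%:R%:E * (w r x * cmod (u (t, x) - u (tn, x)))%:E +
    (F r t x * (1 - cutoff n x))%:E))%E).
  apply: le_int.
  - apply/measurable_EFinP; apply: measurable_funM; first exact: measurable_weight.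
    by apply: measurable_funM; [exact: measurable_enorm|exact: cmeas_cmod].
  - apply: emeasurable_funD; last exact/measurable_EFinP.
    by apply: emeasurable_funM; [exact: measurable_cst|exact/measurable_EFinP].
  - by move=> x; rewrite lee_fin !mulr_ge0 ?powR_ge0 ?enorm_ge0 ?cmod_ge0.
  - move=> x; rewrite -EFinM -EFinD lee_fin /F.
    have -> : n%:R * (w r x * cmod (u (t, x) - u (tn, x))) +
        w r x * (enorm (x : plane) * cmod (u (t, x))) * (1 - cutoff n x) =
        w r x * (n%:R * cmod (u (t, x) - u (tn, x)) +
          enorm (x : plane) * cmod (u (t, x)) * (1 - cutoff n x)) by ring.
    apply: ler_wpM2l; first exact: powR_ge0.
    have -> : cutu n tn x - u (t, x) = - ((cutoff n x)%:C%C * (u (t, x) - u (tn, x)) +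
        (1 - cutoff n x)%:C%C * u (t, x)).
      rewrite /cutu rmorphB rmorph1; ring.
    have /andP[a b] := cutoff_itv n x; have e0 := enorm_ge0 (x : plane).
    rewrite cmodN; apply: le_trans (ler_wpM2l e0 (le_cmodD _ _)) _.
    rewrite !cmodM !cmod_real !ger0_norm// mulrDr; apply: lerD.
      rewrite mulrA; apply: ler_wpM2r; first exact: cmod_ge0.
      exact: cut_le.
    by apply: le_of_eq; ring.
rewrite intD; last 4 first.
- by apply: emeasurable_funM; [exact: measurable_cst|exact/measurable_EFinP].
- by move=> x; rewrite -EFinM lee_fin !mulr_ge0 ?powR_ge0 ?cmod_ge0.
- exact/measurable_EFinP.
- by move=> x; rewrite lee_fin mulr_ge0.
rewrite intZl//; [|exact/measurable_EFinP|by move=> x; rewrite lee_fin mulr_ge0 ?powR_ge0 ?cmod_ge0].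
apply: leeD => //.
apply: le_trans (lee_wpmul2l _ h) _; first by rewrite lee_fin.
rewrite -EFinM lee_fin expr2 invfM mulrA ler_piMl ?invr_ge0//.
by rewrite ler_pdivrMr// mul1r ler_nat.
Qed.

Lemma gradient_in_L1 : in_L1 delta (fun t => gradient (sol u t)).
Proof.
have aeJ : {ae leb, forall t, (J 0 t < +oo)%E /\ (J (- delta) t < +oo)%E}.
  exact: ae_and (ae_J i0) (ae_J iw).
have vX r t : vXnorm r (gradient (sol u t)) = J r t by exact: vXnorm_gspec.
have [k hk] := choice mesh_ex.
split.
- apply: (ae_imply _ aeJ) => t [J1 J2] t0.
  have J1' := J1; rewrite J0E in J1'.
  by split; exact: (gspec_vinX (gsol t) (msl t) J1').
(* Gradients cut at frequency n and sampled on a mesh of [0, n) that is fine enough for that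
   cutoff. *)
- exists (fun n t => gcut n ((grid n (k n) t)%:R / (k n).+1%:R)); split.
    move=> n; split.
    + apply: (@sub_finite_set _ _ ((fun j : nat => gcut n (j%:R / (k n).+1%:R)) @`
        `I_(n * (k n).+1).+1)).
        by move=> _ [t _ <-]; exists (grid n (k n) t) => //=; rewrite ltnS grid_bound.
      by apply: finite_image; exact: finite_II.
    (* Several grid points may give the same value V, so its preimage is the union of the cells
       whose sample equals V. *)
    + move=> V; pose D (j : nat) : set mR :=
        [set t | gcut n (j%:R / (k n).+1%:R) = V /\ grid n (k n) t = j].
      have mD j : measurable (D j).
        have [jV|jV] := pselect (gcut n (j%:R / (k n).+1%:R) = V).
          have -> : D j = [set t | grid n (k n) t = j].
            by apply/seteqP; split => t; [case|split].
          exact: measurable_grid.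
        have -> : D j = set0 by apply/seteqP; split => t //; case.
        exact: measurable0.
      have -> : (fun t => gcut n ((grid n (k n) t)%:R / (k n).+1%:R)) @^-1` [set V] = \bigcup_j D j.
        apply/seteqP; split => t; first by move=> tV; exists (grid n (k n) t).
        by move=> [j _ [jV tj]]; rewrite /preimage /= tj.
      exact: bigcupT_measurable.
    + by move=> t; exact: cut_vinXcap.
  apply: (ae_imply _ aeJ) => t [J1 J2] t0; apply: cvge0_le => [n|e e0].
    by rewrite le_max vXnorm_ge0.
  have e2 : 0 < e / 2 by rewrite divr_gt0.
  have [N1 hN1] := tail_cvg J1 e2; have [N2 hN2] := tail_cvg J2 e2.
  have /cvgrPdist_le/(_ _ e2)[N3 _ hN3] := @cvg_harmonic R.
  (* Four conditions: both high-frequency tails at most e/2, the sampling error 1/(n+1) at most e/2,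
     and n beyond t, so that t lies within the grid. *)
  exists (maxn (maxn N1 N2) (maxn N3 (Num.truncn t).+1)) => // n /=.
  rewrite !geq_max => /andP[/andP[n1 n2] /andP[n3 n4]].
  have tn : 0 <= t < n%:R.
    by rewrite t0/=; apply: lt_le_trans (truncnS_gt _) _; rewrite ler_nat.
  have [/andP[g0 g1] g2] := grid_near (k n) tn.
  have gn : 0 <= ((grid n (k n) t)%:R / (k n).+1%:R : R) <= n%:R.
    by rewrite g0 (le_trans g1)// ltW//; case/andP: tn.
  have tn' : 0 <= t <= n%:R by case/andP: tn => -> /ltW ->.
  have h3 : n.+1%:R^-1 <= e / 2.
    by have := hN3 n n3; rewrite /= sub0r normrN ger0_norm ?invr_ge0.
  have fin r : r = 0 \/ r = - delta -> (tail r n t <= (e / 2)%:E)%E ->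
      (\int[leb2]_x ((w r x)%:E * Q x) < +oo)%E ->
      (vXnorm r (vsub (gcut n ((grid n (k n) t)%:R / (k n).+1%:R)%R) (gradient (sol u t))) <= e%:E)%E.
    move=> rr ht iwr; apply: le_trans (approx_bound iwr (hk n r rr _ _ gn tn' g2)) _.
    have -> : e%:E = ((e / 2)%:E + (e / 2)%:E)%E by rewrite -EFinD -splitr.
    by apply: leeD => //; rewrite lee_fin; exact: h3.
  rewrite /vXcapnorm ge_max; apply/andP; split.
    by apply: fin => //; [left|exact: hN1].
  by apply: fin => //; [right|exact: hN2].
- have E : (\int[@lebesgue_measure R]_(t in `[0%R, +oo[) vXcapnorm delta (gradient (sol u t)) =
      \int[leb]_(t in `[0%R, +oo[) Order.max (J 0 t) (J (- delta) t))%E.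
    by apply: eq_integral => t _; rewrite /vXcapnorm !vX.
  rewrite E; apply: (@le_lt_trans _ _ (\int[leb]_t (J 0 t + J (- delta) t))%E).
    have mS : measurable_fun setT (fun t => J 0 t + J (- delta) t)%E.
      by apply: emeasurable_funD; exact: mJ.
    apply: (@le_trans _ _ (\int[leb]_(t in `[0%R, +oo[) (J 0 t + J (- delta) t))%E).
      apply: ge0_le_integral => //.
      + by move=> t _; rewrite le_max J_ge0.
      + by apply: measurable_funTS; apply: measurable_maxe; exact: mJ.
      + exact: measurable_funTS.
      + by move=> t _; rewrite ge_max leeDl//= leeDr.
    by apply: ge0_subset_integral => // t _; rewrite adde_ge0.
  rewrite intD//; apply: lte_add_pinfty.
    exact: le_lt_trans (integral_time_grad 0) i0.
  exact: le_lt_trans (integral_time_grad (- delta)) iw.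
Qed.

End InL1.
End Gradient.

(** * Decay *)

Section HalvingDecay.
Context {R : realType}.

Lemma geometric_small (K e : R) : 0 < e -> exists k : nat, K * 2^-1 ^+ k <= e.
Proof.
move=> e0; have [K0|K0] := lerP K 0.
  by exists 0%N; rewrite expr0 mulr1 (le_trans K0)// ltW.
pose k := (Num.truncn (K / e)).+1; exists k.
have h : K / e <= k%:R by apply: ltW; exact: truncnS_gt.
have k2 : k%:R <= 2 ^+ k :> R by rewrite -natrX ler_nat ltnW// ltn_expl.
rewrite exprVn ler_pdivrMr ?exprn_gt0// mulrC -ler_pdivrMr//.
exact: le_trans h k2.
Qed.

(* Any bound for [f] on a halving window improves, so that [f] is bounded and then tends to 0. *)
Lemma halving_decay (f z : R -> R) :
  (forall t, 0 < t -> 0 <= f t) ->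
  (forall T, exists X, forall t, 0 < t -> t <= T -> f t <= X) ->
  (forall t Y, 0 < t -> (forall s, t / 2 < s -> s <= t -> f s <= Y) -> f t <= z t + Y / 4) ->
  (forall e, 0 < e -> exists T, forall t, T <= t -> z t <= e) ->
  forall e, 0 < e -> exists2 T, 0 < T & forall t, T <= t -> f t <= e.
Proof.
move=> f0 fX fz z0.
have [T1 hT1] := z0 1 ltr01; pose T0 := Num.max 1 T1.
have T0p : 0 < T0 by rewrite lt_max ltr01.
(* C absorbs the values up to T0, before z is known to be at most 1; C >= 2 makes 1 + C/4 <= C. *)
have [X0 hX0] := fX T0; pose C := `|X0| + 2.
have C2 : 2 <= C by rewrite lerDr.
have fC t : 0 < t -> f t <= C.
  move=> tp; have [X hX] := fX t.
  (* The a priori bound X on ]0, t] depends on t. Each use of the inequality at least halves its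
     share, until C, which does not depend on t, is all that remains. *)
  have step k s : 0 < s -> s <= t -> f s <= C + `|X| * 2^-1 ^+ k.
    elim: k s => [|k IH] s sp st.
      by rewrite expr0 mulr1 (le_trans (hX s sp st))// (le_trans (ler_norm _))// lerDr; lra.
    have K0 : 0 <= `|X| * 2^-1 ^+ k by rewrite mulr_ge0// exprn_ge0// invr_ge0.
    have [sT|Ts] := leP s T0.
      apply: le_trans (hX0 s sp sT) _; apply: le_trans (ler_norm _) _.
      by rewrite exprSr mulrA; rewrite /C; lra.
    have zs : z s <= 1 by apply: hT1; rewrite (le_trans _ (ltW Ts))// le_max lexx orbT.
    have := fz s (C + `|X| * 2^-1 ^+ k) sp; move=> /(_ _)/le_trans; apply.
      move=> r rs1 rs2; apply: IH; last exact: le_trans st.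
      by apply: le_lt_trans rs1; rewrite divr_ge0// ltW.
    by rewrite exprSr mulrA; lra.
  apply/ler_addgt0Pr => e e0; have [k hk] := geometric_small `|X| e0.
  by apply: le_trans (step k t tp (lexx _)) _; rewrite lerD2l.
have dec k : exists2 T, 0 < T & forall t, T <= t -> f t <= C * 2^-1 ^+ k.
  elim: k => [|k [T Tp hT]]; first by exists 1 => // t t1; rewrite expr0 mulr1 fC// (lt_le_trans ltr01).
  have K0 : 0 < C * 2^-1 ^+ k.
    by rewrite mulr_gt0 ?exprn_gt0 ?invr_gt0//; apply: lt_le_trans C2.
  have [Tz hTz] := z0 (C * 2^-1 ^+ k / 4) ltac:(by rewrite divr_gt0).
  (* For t >= 2 T the window ]t/2, t] lies beyond T, where the previous bound holds; z and Y/4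
     contribute a quarter of it each. *)
  exists (Num.max (2 * T) Tz); first by rewrite lt_max mulr_gt0.
  move=> t; rewrite ge_max => /andP[t1 t2].
  have tp : 0 < t by apply: lt_le_trans t1; rewrite mulr_gt0.
  apply: le_trans (fz t (C * 2^-1 ^+ k) tp _) _.
    move=> s s1 _; apply: hT; apply: le_trans (ltW s1).
    by rewrite ler_pdivlMr// mulrC.
  have := hTz t t2; rewrite exprSr mulrA; move: K0; move: (C * _) => y; lra.
move=> e e0; have [k hk] := geometric_small C e0.
by have [T Tp hT] := dec k; exists T => // t /hT h; exact: le_trans h hk.
Qed.

Lemma powR_le_1D (s r : R) : 0 <= s -> 0 <= r -> r <= 1 -> s `^ r <= 1 + s.
Proof.
move=> s0 r0 r1; have [s1|s1] := leP s 1.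
  apply: (@le_trans _ _ (1 `^ r)); last by rewrite powR1 lerDl.
  by apply: ge0_ler_powR; rewrite ?nnegrE.
apply: (@le_trans _ _ (s `^ 1)); first by apply: ler_powR => //; exact: ltW.
by rewrite powRr1// lerDr.
Qed.

(** The bound 2 supplies the dominating function of [Z_decay] and the bound 16/s its limit 0. Both
    follow from s^r <= 1 + s; the second uses exp(s/2) >= (1 + s/4)^2. *)
Lemma powR_expR_le (s r : R) : 0 < s -> 0 <= r -> r <= 1 ->
  s `^ r * expR (- (s / 2)) <= Num.min 2 (16 / s).
Proof.
move=> s0 r0 r1; have h := powR_le_1D (ltW s0) r0 r1.
have ep : 0 < expR (s / 2) := expR_gt0 _.
rewrite expRN le_min; apply/andP; split.
  rewrite ler_pdivrMr//; apply: le_trans h _.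
  by have := @expR_ge1Dx R (s / 2); move: (expR _) => y; lra.
rewrite ler_pdivrMr// mulrAC ler_pdivlMr//; apply: le_trans (ler_wpM2r (ltW s0) h) _.
have -> : expR (s / 2) = expR (s / 4) ^+ 2.
  by rewrite expr2 -expRD; congr expR; field.
have h4 : 1 + s / 4 <= expR (s / 4) := expR_ge1Dx _.
have h5 : (1 + s / 4) ^+ 2 <= expR (s / 4) ^+ 2.
  by apply: lerXn2r => //; rewrite nnegrE ?expR_ge0//; lra.
by move: h5; move: (expR _ ^+ 2) => y; rewrite expr2; lra.
Qed.

End HalvingDecay.

(** * Decay of the solution at rate o(t^(-delta)) *)

Section Decay.
Context {R : realType}.
Local Notation mR := (measurableTypeR R).
Local Notation mP := (measurableTypeR R * measurableTypeR R)%type.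
Local Notation plane := (@Defs.plane R).
Local Notation leb := (@lebesgue_measure R).
Local Notation w s xi := (enorm (xi : plane) `^ s).

Lemma ae_enorm_gt0 : {ae leb2, forall x : mP, 0 < enorm (x : plane)}.
Proof.
exists ([set (0 : R)] `*` [set (0 : R)]); split.
- by apply: measurableX; exact: measurable_set1.
- have -> : leb2 ([set (0 : R)] `*` [set (0 : R)]) =
      (leb [set 0%R] * leb [set 0%R])%E.
    by apply: product_measure1E; exact: measurable_set1.
  by rewrite lebesgue_measure_set1 mul0e.
- move=> x /= /negP; rewrite lt_neqAle enorm_ge0 andbT negbK eq_sym enorm_eq0 => /eqP ->.
  by split.
Qed.

(** The symbol is bounded by the transported frequency here, so that the derivative falls on the
    first factor and the time integral of the gradient can be used. *)
Lemma integral_bil_le (g h : mP -> R[i]) : cmeas g -> cmeas h ->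
  (\int[leb2]_x (cmod (bil g h x))%:E <=
   c2pi%:E * ((\int[leb2]_y (enorm (y : plane) * cmod (g y))%:E) * \int[leb2]_y (cmod (h y))%:E))%E.
Proof.
move=> mg mh.
have m1 : measurable_fun setT (fun y : mP => (enorm (y : plane) * cmod (g y))%:E).
  by apply/measurable_EFinP; apply: measurable_funM; [exact: measurable_enorm|exact: cmeas_cmod].
have m2 := emeas_cmod mh.
have p1 (y : mP) : (0 <= (enorm (y : plane) * cmod (g y))%:E)%E.
  by rewrite lee_fin mulr_ge0 ?enorm_ge0 ?cmod_ge0.
have p2 y : (0 <= (cmod (h y))%:E)%E by rewrite lee_fin cmod_ge0.
have mI : measurable_fun setT (fun p : mP * mP =>
    (enorm (p.2 : plane) * cmod (g p.2))%:E * (cmod (h (psub p.1 p.2)))%:E)%E.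
  apply: emeasurable_funM; first exact: (measurableT_comp m1).
  exact: (measurableT_comp m2 (@measurable_psub R)).
have mi : measurable_fun setT (fun x => \int[leb2]_y
    ((enorm (y : plane) * cmod (g y))%:E * (cmod (h (psub x y)))%:E))%E.
  by apply: (measurable_integral_param lebP mI) => p; rewrite mule_ge0.
have i0 x : (0 <= \int[leb2]_y
    ((enorm (y : plane) * cmod (g y))%:E * (cmod (h (psub x y)))%:E))%E.
  by apply: int_ge0 => y; rewrite mule_ge0.
have c0 : (0 <= (@c2pi R)%:E)%E by rewrite lee_fin ltW// c2pi_gt0.
rewrite -integral_conv// -intZl//.
apply: le_int.
- by apply: emeas_cmod; exact: cmeas_bil.
- by apply: emeasurable_funM; [exact: measurable_cst|exact: mi].
- by move=> x; rewrite lee_fin cmod_ge0.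
- move=> x; apply: le_trans (cmod_bil_le x mg mh) _; apply: lee_wpmul2l => //.
  apply: le_int.
  + apply/measurable_EFinP; apply: measurable_funM.
      apply: measurableT_comp => //.
      apply: (measurableT_comp (@measurable_kern R) (g := fun y => (x, psub x y))).
      by apply: measurable_fun_pair => //; exact: measurable_psub2.
    apply: measurable_funM; apply: cmeas_cmod => //.
    by apply: (cmeas_comp _ mh); exact: measurable_psub2.
  + by apply: (measurableT_comp mI (measurable_pair1 x)).
  + by move=> y; rewrite lee_fin !mulr_ge0 ?cmod_ge0.
  + move=> y; rewrite -EFinM lee_fin mulrA.
    apply: ler_wpM2r; first exact: cmod_ge0.
    apply: ler_wpM2r; first exact: cmod_ge0.
    by apply: le_trans (ler_kern_sub _ _) _; rewrite /psub subKr.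
Qed.

Variables (w0 : mP -> R[i]) (u : mR * mP -> R[i]) (Q : mP -> \bar R) (delta : R).
Hypotheses (d0 : 0 <= delta) (d1 : delta < 1).
Hypotheses (mw0 : cmeas w0) (mu : cmeas u) (mQ : measurable_fun setT Q) (du : dom u Q).
Hypothesis iQ : (\int[leb2]_x Q x <= (2^-1)%R%:E)%E.
Hypothesis ueq : forall t, ae_eq leb2 setT (fun xi => u (t, xi))
        (fun xi => (heat t 0 xi)%:C%C * w0 xi - duh u t xi).
Hypothesis i0 : (\int[leb2]_x (cmod (w0 x))%:E < +oo)%E.
Hypothesis iw0 : (\int[leb2]_x (w (- delta) x * cmod (w0 x))%:E < +oo)%E.
Hypothesis iw : (\int[leb2]_x ((w (- delta) x)%:E * Q x) < +oo)%E.

Let Q0 := Q_ge0 du.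

Let iQoo : (\int[leb2]_x Q x < +oo)%E.
Proof. by apply: le_lt_trans iQ _; exact: ltry. Qed.

Let B (p : mR * mP) := bil (fun y => u (p.1, y)) (fun y => u (p.1, y)) p.2.

Let mB : cmeas B.
Proof. exact: cmeas_bil_time. Qed.

Let M := Maj delta Q Q.

Let mM : measurable_fun setT M.
Proof. exact: measurable_Maj. Qed.

Let M0 x : (0 <= M x)%E.
Proof. exact: Maj_ge0. Qed.

Let iM : (\int[leb2]_x M x < +oo)%E.
Proof.
apply: le_lt_trans (integral_Maj delta mQ mQ Q0 Q0) _.
by rewrite lte_mul_pinfty ?lee_fin ?ltW ?c2pi_gt0// lte_mul_pinfty// ?int_ge0// ge0_fin_numE// int_ge0.
Qed.

Let wQ0 x : (0 <= (w (- delta) x)%:E * Q x)%E.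
Proof. by rewrite mule_ge0// lee_fin powR_ge0. Qed.

Let iwM : (\int[leb2]_x ((w (- delta) x)%:E * M x) < +oo)%E.
Proof.
apply: le_lt_trans (integral_weight_Maj delta mQ mQ Q0 Q0) _.
have f1 : (\int[leb2]_x Q x)%E \is a fin_num by rewrite ge0_fin_numE// int_ge0.
have f2 : (\int[leb2]_x ((w (- delta) x)%:E * Q x))%E \is a fin_num.
  by rewrite ge0_fin_numE// int_ge0.
rewrite ltey_eq; apply/orP; left; apply: fin_numM => //.
by rewrite fin_numD !fin_numM.
Qed.

(** [Ab] integrated in time last: the total forcing at a given frequency is bounded by the same
    damped convolution as in the fixed point argument. *)
Let integral_time_bil x : (\int[leb]_tau (cmod (B (tau, x)))%:E <= M x)%E.
Proof.
have mabs : measurable_fun setT (fun p : mR * mP => (absk u u x p)%:E).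
  by apply/measurable_EFinP; exact: measurable_absk.
have abs0 (p : mR * mP) : (0 <= (absk u u x p)%:E)%E by rewrite lee_fin absk_ge0.
apply: le_trans (Ab_le_Maj d0 d1 x mu mu mQ mQ du du); rewrite /Ab.
rewrite (@fubini_tonelli1 _ _ _ _ _ leb lebP _ mabs abs0) /fubini_F.
have c0 : (0 <= (@c2pi R)%:E)%E by rewrite lee_fin ltW// c2pi_gt0.
have mi : measurable_fun setT (fun tau => \int[leb2]_y (absk u u x (tau, y))%:E)%E.
  exact: (measurable_integral_param lebP mabs).
rewrite -intZl//; last by move=> tau; exact: int_ge0.
apply: le_int.
- by apply: emeas_cmod; exact: cmeas_pair2.
- by apply: emeasurable_funM => //; exact: measurable_cst.
- by move=> tau; rewrite lee_fin cmod_ge0.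
- by move=> tau; apply: cmod_bil_le; exact: cmeas_pair1.
Qed.

Let I (t tau : R) : R := \1_(`]t / 2, t]%classic) tau.

Let I_ge0 t tau : 0 <= I t tau.
Proof. by rewrite /I indicE. Qed.

Let mI t : measurable_fun setT (I t : mR -> mR).
Proof. exact: measurable_indic. Qed.

Let Eh (t : R) (x : mP) : R := expR (- (t * enorm (x : plane) / 2)).

(** Up to time t/2 at least t/2 is left for damping, whence [Eh]; after t/2 the kernel is merely
    bounded by 1. *)
Let heat_split t tau (x : mP) : 0 <= t -> heat t tau (x : plane) <= Eh t x + I t tau.
Proof.
move=> t0; have [/andP[a b]|n] := boolP (0 <= tau <= t); last first.
  by rewrite (heat_eq0 _ n) addr_ge0 ?expR_ge0.
have [h|h] := leP tau (t / 2).
  rewrite (heatE _ a b) -[leLHS]addr0; apply: lerD => //.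
  rewrite ler_expR lerN2 mulrAC; apply: ler_wpM2r; first exact: enorm_ge0.
  by rewrite lerBrDr; lra.
apply: le_trans (heat_le1 _ _ _) _.
have -> : I t tau = 1.
  by rewrite /I indicE (_ : _ \in _ = true)//; apply: mem_set; rewrite /= in_itv/= h b.
by rewrite lerDr expR_ge0.
Qed.

Let L t x : \bar R := (\int[leb]_tau (I t tau * cmod (B (tau, x)))%:E)%E.

Let mIB t : measurable_fun setT (fun p : mR * mP => (I t p.1 * cmod (B p))%:E).
Proof.
apply/measurable_EFinP; apply: measurable_funM; last exact: cmeas_cmod.
exact: (measurableT_comp (mI t) measurable_fst).
Qed.

Let IB0 t p : (0 <= (I t p.1 * cmod (B p))%:E)%E.
Proof. by rewrite lee_fin mulr_ge0 ?cmod_ge0. Qed.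

Let duh_split t x : 0 <= t ->
  ((cmod (duh u t x))%:E <= (Eh t x)%:E * M x + L t x)%E.
Proof.
move=> t0.
have mBx : cmeas (fun tau => B (tau, x)) by exact: cmeas_pair2.
have mh : measurable_fun setT (fun tau : mR => heat t tau (x : plane) : mR).
  exact: measurable_heat_comp.
have mi : cmeas (fun tau : mR => (heat t tau (x : plane))%:C%C * B (tau, x)).
  by apply: cmeasM => //; exact: cmeas_real.
have mc : measurable_fun setT (fun tau : mR => (cmod (B (tau, x)))%:E) by exact: emeas_cmod.
have mIx : measurable_fun setT (fun tau : mR => (I t tau * cmod (B (tau, x)))%:E).
  exact: (measurableT_comp (mIB t) (measurable_pair2 x)).
have E0 : (0 <= (Eh t x)%:E)%E by rewrite lee_fin expR_ge0.
apply: le_trans (cmod_cintegral_le _ mi) _.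
apply: (@le_trans _ _ ((Eh t x)%:E * (\int[leb]_tau (cmod (B (tau, x)))%:E) + L t x)%E); last first.
  by apply: leeD => //; apply: lee_wpmul2l => //; exact: integral_time_bil.
rewrite -intZl// -?intD//.
- apply: le_int.
  + exact: emeas_cmod.
  + by apply: emeasurable_funD => //; apply: emeasurable_funM => //; exact: measurable_cst.
  + by move=> tau; rewrite lee_fin cmod_ge0.
  + move=> tau; have := heat_split tau x t0; have := heat_ge0 t tau (x : plane).
    move: (heat _ _ _) (B _) => h b h0 hh.
    rewrite -EFinM -EFinD lee_fin cmodM cmod_real ger0_norm// -mulrDl.
    by apply: ler_wpM2r => //; exact: cmod_ge0.
- by apply: emeasurable_funM => //; exact: measurable_cst.
- by move=> tau; rewrite mule_ge0// lee_fin cmod_ge0.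
- by move=> tau; exact: (IB0 t (tau, x)).
- by move=> tau; rewrite lee_fin cmod_ge0.
Qed.

Let N t : \bar R := (\int[leb2]_x (cmod (u (t, x)))%:E)%E.
Let J t : \bar R := (\int[leb2]_x (enorm (x : plane) * cmod (u (t, x)))%:E)%E.
(** Data plus total forcing. Damped by [Eh], its integral [Z] controls the free evolution and the
    part of Duhamel before t/2. *)
Let H x : \bar R := ((cmod (w0 x))%:E + M x)%E.
Let Z t : \bar R := (\int[leb2]_x ((Eh t x)%:E * H x))%E.

Let mut t : cmeas (fun x => u (t, x)) := cmeas_pair1 t mu.

Let H0 x : (0 <= H x)%E.
Proof. by rewrite adde_ge0// lee_fin cmod_ge0. Qed.

Let mH : measurable_fun setT H.
Proof. by apply: emeasurable_funD => //; exact: emeas_cmod. Qed.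

Let mEh t : measurable_fun setT (Eh t : mP -> mR).
Proof.
apply: measurableT_comp => //; apply: measurableT_comp => //.
apply: measurable_funM => //; apply: measurable_funM => //; exact: measurable_enorm.
Qed.

Let mEH t : measurable_fun setT (fun x => (Eh t x)%:E * H x)%E.
Proof. by apply: emeasurable_funM => //; apply/measurable_EFinP; exact: mEh. Qed.

Let EH0 t x : (0 <= (Eh t x)%:E * H x)%E.
Proof. by rewrite mule_ge0// lee_fin expR_ge0. Qed.

Let N0 t : (0 <= N t)%E.
Proof. by apply: int_ge0 => x; rewrite lee_fin cmod_ge0. Qed.

Let J0 t : (0 <= J t)%E.
Proof. by apply: int_ge0 => x; rewrite lee_fin mulr_ge0 ?enorm_ge0 ?cmod_ge0. Qed.

Let Nhalf t : (N t <= (2^-1)%R%:E)%E.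
Proof. exact: le_trans (integral_slice mu mQ du t) iQ. Qed.

Let Nfin t : N t \is a fin_num.
Proof. by rewrite ge0_fin_numE//; apply: le_lt_trans (Nhalf t) _; exact: ltry. Qed.

Let mJ : measurable_fun setT (J : mR -> \bar R).
Proof.
apply: (measurable_integral_param lebP
  (f := fun p : mR * mP => (enorm (p.2 : plane) * cmod (u (p.1, p.2)))%:E)).
  apply/measurable_EFinP; apply: measurable_funM.
    exact: (measurableT_comp (@measurable_enorm R) measurable_snd).
  have -> : (fun p : mR * mP => cmod (u (p.1, p.2))) = (fun p => cmod (u p)).
    by apply/funext => -[].
  exact: cmeas_cmod.
by move=> p; rewrite lee_fin mulr_ge0 ?enorm_ge0 ?cmod_ge0.
Qed.

Let iJ : (\int[leb]_t J t <= (2^-1)%R%:E)%E.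
Proof.
apply: le_trans iQ.
have := integral_time_grad mu mQ du 0; under [X in (X <= _)%E -> _]eq_integral do
  under eq_integral do rewrite powRr0 mul1r.
by under [X in (_ <= X)%E -> _]eq_integral do rewrite powRr0 mul1e.
Qed.

(** The Duhamel part after t/2 receives no damping and is kept as an explicit integral for
    [slice_bootstrap]; all the rest goes into [Z]. *)
Let slice_split t : 0 <= t -> (N t <= Z t + \int[leb]_tau \int[leb2]_x (I t tau * cmod (B (tau, x)))%:E)%E.
Proof.
move=> t0.
have mL : measurable_fun setT (L t).
  apply: (measurable_integral_param leb (f := fun p : mP * mR => (I t p.2 * cmod (B (p.2, p.1)))%:E)).
    exact: (measurableT_comp (mIB t) (measurable_swap (T1 := mP) (T2 := mR))).
  by move=> p; exact: (IB0 t (p.2, p.1)).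
have L0 x : (0 <= L t x)%E by apply: int_ge0 => tau; exact: (IB0 t (tau, x)).
rewrite (@fubini_tonelli _ _ _ _ _ leb lebP (fun p => (I t p.1 * cmod (B p))%:E))//.
rewrite -intD//.
apply: ae_ge0_le_integral => //.
- by move=> x _; rewrite lee_fin cmod_ge0.
- exact: emeas_cmod.
- by move=> x _; apply: adde_ge0; [exact: EH0|exact: L0].
- exact: emeasurable_funD.
- apply: filterS (ueq t) => x /(_ Logic.I) -> _.
  apply: (@le_trans _ _ ((heat t 0 x * cmod (w0 x))%:E + (cmod (duh u t x))%:E)%E).
    rewrite -EFinD lee_fin; apply: le_trans (le_cmodB _ _) _; rewrite cmodM cmod_real.
    by rewrite ger0_norm// heat_ge0.
  rewrite /H ge0_muleDr ?lee_fin ?cmod_ge0// -addeA; apply: leeD; last exact: duh_split.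
  rewrite -EFinM lee_fin; apply: ler_wpM2r; first exact: cmod_ge0.
  rewrite heatE// subr0 ler_expR lerN2 ler_piMr//; last by rewrite invf_le1// ler1n.
  by rewrite mulr_ge0// enorm_ge0.
Qed.

(* Each time step loses the factor [2 `^ delta <= 2] and gains [c2pi * 2^-1]. *)
Let slice_bootstrap t Y : 0 < t -> 0 <= Y ->
  (forall s, t / 2 < s -> s <= t -> s `^ delta * fine (N s) <= Y) ->
  (\int[leb]_tau \int[leb2]_x (I t tau * cmod (B (tau, x)))%:E <= (Y / 16 * t `^ (- delta))%:E)%E.
Proof.
move=> tp Y0 hY.
pose k : R := c2pi * (2 * Y * t `^ (- delta)).
have k0 : 0 <= k by rewrite !mulr_ge0 ?powR_ge0// ltW// c2pi_gt0.
apply: (@le_trans _ _ (\int[leb]_tau (k%:E * J tau))%E).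
  apply: le_int.
  - exact: (measurable_integral_param lebP (mIB t)).
  - by apply: emeasurable_funM => //; exact: measurable_cst.
  - by move=> tau; apply: int_ge0 => x; exact: (IB0 t (tau, x)).
  - move=> tau; have [tI|tI] := boolP (tau \in `]t / 2, t]%classic); last first.
      rewrite integral0_eq ?mule_ge0 ?lee_fin// => x _.
      by rewrite /I indicE (negbTE tI) mul0r.
    under eq_integral do rewrite /I indicE tI mul1r.
    move/set_mem: tI; rewrite /= in_itv/= => /andP[t1 t2].
    have t20 : 0 < t / 2 by rewrite divr_gt0.
    have tau0 : 0 < tau by exact: lt_trans t1.
    apply: le_trans (integral_bil_le (mut tau) (mut tau)) _.
    rewrite /k EFinM -muleA; apply: lee_wpmul2l; first by rewrite lee_fin ltW// c2pi_gt0.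
    rewrite muleC; apply: lee_wpmul2r; first exact: J0.
    rewrite -[leLHS]fineK ?Nfin// lee_fin.
    apply: (@le_trans _ _ (Y * tau `^ (- delta))).
      by rewrite powRN ler_pdivlMr ?powR_gt0// mulrC; exact: hY.
    rewrite mulrAC [leRHS]mulrC; apply: ler_wpM2l => //; rewrite !powRN.
    (* From t < 2 tau and 2^delta <= 2. *)
    have h2 : t `^ delta <= 2 * tau `^ delta.
      apply: (@le_trans _ _ ((2 * (t / 2)) `^ delta)); first by rewrite mulrC divfK.
      rewrite powRM ?(ltW t20)//; apply: ler_pM; [exact: powR_ge0|exact: powR_ge0| |].
        by rewrite -[leRHS]powRr1//; apply: ler_powR; [rewrite ler1n|exact: ltW].
      by apply: ge0_ler_powR; rewrite ?nnegrE// ltW.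
    by rewrite ler_pdivlMr ?powR_gt0// mulrC ler_pdivrMr ?powR_gt0.
rewrite intZl; [|exact: mJ|exact: J0|by rewrite lee_fin].
apply: le_trans (lee_wpmul2l _ iJ) _; first by rewrite lee_fin.
rewrite -EFinM lee_fin /k.
have -> : c2pi * (2 * Y * t `^ (- delta)) * 2^-1 = c2pi * (Y * t `^ (- delta)) by field.
rewrite [leRHS]mulrAC mulrC; apply: ler_wpM2l; last exact: c2pi_le16.
by rewrite mulr_ge0// powR_ge0.
Qed.

Let Zfin t : 0 <= t -> Z t \is a fin_num.
Proof.
move=> t0; rewrite ge0_fin_numE; last by apply: int_ge0 => x; exact: EH0.
apply: (@le_lt_trans _ _ (\int[leb2]_x H x)%E).
  apply: le_int; [exact: mEH|exact: mH|exact: EH0|move=> x].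
  rewrite -[leRHS]mul1e; apply: lee_wpmul2r; first exact: H0.
  rewrite lee_fin /Eh -expR0 ler_expR oppr_le0.
  by rewrite divr_ge0// mulr_ge0// enorm_ge0.
rewrite /H intD//; last by move=> x; rewrite lee_fin cmod_ge0.
  by apply: lte_add_pinfty.
exact: emeas_cmod.
Qed.

(** t^delta exp(-t|x|/2) is |x|^(-delta) times a function of t|x| that is bounded and tends to 0 at
    infinity. The factor |x|^(-delta) is absorbed by the weighted norms of the data and of M, and
    dominated convergence gives a limit 0 instead of a mere bound. *)
Let Z_decay e : 0 < e -> exists T, forall t, T <= t -> t `^ delta * fine (Z t) <= e.
Proof.
move=> e0.
pose h x := cmod (w0 x) + fine (M x).
have h0 x : 0 <= h x by rewrite addr_ge0 ?cmod_ge0 ?fine_ge0.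
have mh : measurable_fun setT (h : mP -> mR).
  apply: measurable_funD; first exact: cmeas_cmod.
  exact: (measurableT_comp (@fine_measurable R _ measurableT) mM).
have aeM : {ae leb2, forall x, M x \is a fin_num}.
  have : leb2.-integrable setT M.
    by apply/integrableP; split => //; under eq_integral do rewrite gee0_abs//.
  by move/integrable_ae => /(_ measurableT); apply: filterS => x /(_ Logic.I).
have mwd := @measurable_weight R (- delta).
have ih : (\int[leb2]_x (w (- delta) x * h x)%:E < +oo)%E.
  apply: (@le_lt_trans _ _ (\int[leb2]_x ((w (- delta) x * cmod (w0 x))%:E +
      (w (- delta) x)%:E * M x))%E).
    apply: le_int.
    - by apply/measurable_EFinP; exact: measurable_funM.
    - apply: emeasurable_funD; first by apply/measurable_EFinP; apply: measurable_funM => //; exact: cmeas_cmod.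
      by apply: emeasurable_funM => //; exact/measurable_EFinP.
    - by move=> x; rewrite lee_fin mulr_ge0// powR_ge0.
    - move=> x; rewrite mulrDr EFinD; apply: leeD => //.
      rewrite EFinM; apply: lee_wpmul2l; first by rewrite lee_fin powR_ge0.
      by case: (M x) (M0 x) => //= r _; rewrite leey.
  rewrite intD.
  - by apply: lte_add_pinfty.
  - by apply/measurable_EFinP; apply: measurable_funM => //; exact: cmeas_cmod.
  - by move=> x; rewrite lee_fin mulr_ge0 ?powR_ge0 ?cmod_ge0.
  - by apply: emeasurable_funM => //; exact/measurable_EFinP.
  - by move=> x; rewrite mule_ge0// lee_fin powR_ge0.
pose g (n : nat) (x : mP) : R := w (- delta) x * h x * Num.min 2 (16 / (n.+1%:R * enorm (x : plane))).
have g0 n (x : mP) : 0 <= Num.min 2 (16 / (n.+1%:R * enorm (x : plane))) :> R.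
  by rewrite le_min ler0n divr_ge0// mulr_ge0// enorm_ge0.
have mg n : measurable_fun setT (g n : mP -> mR).
  apply: measurable_funM; first exact: measurable_funM.
  apply: measurable_minr => //; apply: measurable_funM => //.
  rewrite (_ : (fun x : mP => _) = (fun x => n.+1%:R^-1 * (enorm (x : plane))^-1)).
    by apply: measurable_funM => //; exact: measurable_enormV.
  by apply/funext => x; rewrite invfM.
have cv : (\int[leb2]_x (g n x)%:E)%E @[n --> \oo] --> 0%E.
  apply: (@integral_dominated_cvg0 _ _ _ _ g (fun x : mP => 2 * (w (- delta) x * h x))) => //.
  - by apply: measurable_funM => //; exact: measurable_funM.
  - under eq_integral do rewrite EFinM.
    rewrite intZl.
    + by rewrite lte_mul_pinfty ?lee_fin.
    + by apply/measurable_EFinP; exact: measurable_funM.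
    + by move=> x; rewrite lee_fin mulr_ge0// powR_ge0.
    + by rewrite lee_fin.
  - move=> n x; have p : 0 <= w (- delta) x * h x by rewrite mulr_ge0// powR_ge0.
    rewrite /g mulr_ge0//= mulrC; apply: ler_wpM2r => //.
    by rewrite ge_min lexx.
  - apply: aeW => x; rewrite -(mulr0 (w (- delta) x * h x)); apply: cvgM; first exact: cvg_cst.
    apply: (@squeeze_cvgr _ _ _ _ (fun=> 0) (fun n => n.+1%:R^-1 * (16 * (enorm (x : plane))^-1))).
    + apply: nearW => n; rewrite g0/= ge_min; apply/orP; right.
      by rewrite invfM mulrCA.
    + exact: cvg_cst.
    + rewrite -(mul0r (16 * (enorm (x : plane))^-1)); apply: cvgM; last exact: cvg_cst.
      exact: cvg_harmonic.
have [n hn] : exists n : nat, (\int[leb2]_x (g n x)%:E <= e%:E)%E.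
  have [|n hn] := fine_cvg0_ex cv _ e0; last by exists n; exact: hn.
  by move=> n; apply: int_ge0 => x; rewrite lee_fin !mulr_ge0 ?powR_ge0.
exists n.+1%:R => t tn; have tp : 0 < t by apply: lt_le_trans tn.
suff hZ : ((t `^ delta)%:E * Z t <= e%:E)%E.
  by rewrite -lee_fin EFinM fineK// Zfin// ltW.
rewrite /Z -intZl; [|exact: mEH|exact: EH0|by rewrite lee_fin powR_ge0].
apply: le_trans hn; apply: ae_ge0_le_integral => //.
- by move=> x _; rewrite mule_ge0 ?lee_fin ?powR_ge0.
- by apply: emeasurable_funM; [exact: measurable_cst|exact: mEH].
- by move=> x _; rewrite lee_fin !mulr_ge0 ?powR_ge0.
- by apply/measurable_EFinP; exact: mg.
- apply: filterS2 aeM (ae_enorm_gt0) => x Mx x0 _.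
  rewrite /H -(fineK Mx) -EFinD -!EFinM lee_fin /g -/(h x) mulrA [leRHS]mulrAC.
  apply: ler_wpM2r => //.
  have sp : 0 < t * enorm (x : plane) by rewrite mulr_gt0.
  have -> : t `^ delta = w (- delta) x * (t * enorm (x : plane)) `^ delta.
    rewrite powRM ?ltW// mulrCA powRN mulVf ?mulr1//.
    by rewrite gt_eqF// powR_gt0.
  rewrite -mulrA; apply: ler_wpM2l; first exact: powR_ge0.
  apply: le_trans (powR_expR_le sp d0 (ltW d1)) _.
  rewrite le_min ge_min lexx/= ge_min; apply/orP; right.
  apply: ler_wpM2l => //; rewrite lef_pV2 ?posrE ?mulr_gt0//.
  by apply: ler_wpM2r => //; exact: ltW.
Qed.

(** [halving_decay] for t^delta times the norm: the mass 1/2 of Q gives local boundedness,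
    [slice_split] and [slice_bootstrap] give the inequality with Y/16 <= Y/4, and [Z_decay] the
    vanishing remainder. *)
Lemma sol_decay eps : 0 < eps -> \forall t \near +oo,
  (Xnorm 0 (sol u t) <= (eps * t `^ (- delta))%:E)%E.
Proof.
move=> e0.
have XN t : Xnorm 0 (sol u t) = N t.
  rewrite (Xnorm_sol mu mQ du iQoo); apply: eq_integral => x _.
  by rewrite powRr0 mul1r.
have fN t : 0 <= fine (N t) by rewrite fine_ge0.
have [||||T Tp hT] := @halving_decay R (fun t => t `^ delta * fine (N t))
    (fun t => t `^ delta * fine (Z t)) _ _ _ _ eps e0.
- by move=> t tp; rewrite mulr_ge0// powR_ge0.
- move=> T; exists (T `^ delta * 2^-1) => t tp tT; apply: ler_pM; rewrite ?powR_ge0//.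
    by apply: ge0_ler_powR; rewrite ?nnegrE// ?(ltW tp)// (le_trans (ltW tp)).
  by rewrite -lee_fin fineK.
- move=> t Y tp hY.
  have Y0 : 0 <= Y.
    apply: le_trans (hY t _ (lexx _)); first by rewrite mulr_ge0// powR_ge0.
    by rewrite ltr_pdivrMr// ltr_pMr// ltr1n.
  have := le_trans (slice_split (ltW tp)) (leeD (lexx _) (slice_bootstrap tp Y0 hY)).
  rewrite -(fineK (Zfin (ltW tp))).
  rewrite -(fineK (Nfin t)) -EFinD lee_fin => h.
  have tdp : 0 < t `^ delta by rewrite powR_gt0.
  apply: le_trans (ler_wpM2l (ltW tdp) h) _; rewrite mulrDr; apply: lerD => //.
  rewrite powRN mulrCA divff ?gt_eqF// mulr1.
  by move: Y0; lra.
- exact: Z_decay.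
exists T; split; first exact: num_real.
move=> t tT; have tp : 0 < t by exact: lt_trans tT.
rewrite XN -(fineK (Nfin t)) lee_fin powRN ler_pdivlMr ?powR_gt0// mulrC.
by apply: hT; exact: ltW.
Qed.

End Decay.

(** * Uniqueness of the solution *)

Section AlmostEverywhereIntegral.
Context {R : realType} d (T : measurableType d) (mu : {measure set T -> \bar R}).
Implicit Types (f g h : T -> R[i]) (u : T -> \bar R).

Lemma ae_lty u : measurable_fun setT u -> (forall x, (0 <= u x)%E) ->
  (\int[mu]_x u x < +oo)%E -> {ae mu, forall x, (u x < +oo)%E}.
Proof.
move=> mu' u0 uoo; have : mu.-integrable setT u.
  by apply/integrableP; split => //; under eq_integral do rewrite gee0_abs//.
move=> /integrable_ae => /(_ measurableT); apply: ae_imply => x /(_ I) fx.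
by rewrite -ge0_fin_numE.
Qed.

Lemma ae_eq0 u : measurable_fun setT u -> (forall x, (0 <= u x)%E) ->
  (\int[mu]_x u x <= 0)%E -> {ae mu, forall x, u x = 0%E}.
Proof.
move=> mu' u0 ule; have : (\int[mu]_(x in setT) `|u x| = 0)%E.
  under eq_integral do rewrite gee0_abs//.
  by apply/eqP; rewrite eq_le ule int_ge0.
by move/(ae_eq_integral_abs mu measurableT mu'); apply: ae_imply => x /(_ I).
Qed.

Lemma integral_cmodB_triangle f g h : cmeas f -> cmeas g -> cmeas h ->
  (\int[mu]_x (cmod (f x - h x))%:E <=
   \int[mu]_x (cmod (f x - g x))%:E + \int[mu]_x (cmod (g x - h x))%:E)%E.
Proof.
move=> mf mg mh; rewrite -intD; try (by apply: emeas_cmod; exact: cmeasB);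
  try by move=> x; rewrite lee_fin cmod_ge0.
apply: le_int.
- by apply: emeas_cmod; exact: cmeasB.
- by apply: emeasurable_funD; apply: emeas_cmod; exact: cmeasB.
- by move=> x; rewrite lee_fin cmod_ge0.
- move=> x; rewrite -EFinD lee_fin; apply: le_trans (le_cmodD _ _).
  by rewrite addrA subrK.
Qed.

Lemma integral_cmodBC f g :
  (\int[mu]_x (cmod (f x - g x))%:E = \int[mu]_x (cmod (g x - f x))%:E)%E.
Proof. by apply: eq_integral => x _; rewrite cmodBC. Qed.

Lemma integral_cmod_le_add f g : cmeas f -> cmeas g ->
  (\int[mu]_x (cmod (f x))%:E <=
   \int[mu]_x (cmod (g x))%:E + \int[mu]_x (cmod (f x - g x))%:E)%E.
Proof.
move=> mf mg; have mfg := emeas_cmod (cmeasB mf mg).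
rewrite -intD; [|exact: emeas_cmod|by move=> x; rewrite lee_fin cmod_ge0|exact: mfg|
  by move=> x; rewrite lee_fin cmod_ge0].
apply: le_int.
- exact: emeas_cmod.
- by apply: emeasurable_funD => //; exact: emeas_cmod.
- by move=> x; rewrite lee_fin cmod_ge0.
- move=> x; rewrite -EFinD lee_fin; apply: le_trans (le_cmodD _ _).
  by rewrite addrC subrK.
Qed.

Lemma ae_eq_cmodB f g : cmeas f -> cmeas g -> (\int[mu]_x (cmod (f x - g x))%:E <= 0)%E ->
  ae_eq mu setT f g.
Proof.
move=> mf mg h.
have p x : (0 <= (cmod (f x - g x))%:E)%E by rewrite lee_fin cmod_ge0.
apply: ae_imply (ae_eq0 (emeas_cmod (cmeasB mf mg)) p h) => x [h0] _.
by apply/eqP; rewrite -subr_eq0; apply/eqP; exact: cmod_eq0.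
Qed.

End AlmostEverywhereIntegral.

Section TimeVersion.
Context {R : realType}.
Local Notation mR := (measurableTypeR R).
Local Notation mP := (measurableTypeR R * measurableTypeR R)%type.

Lemma measurable_step (gam : mR -> nat) (h : nat -> mP -> mR) :
  (forall j, measurable [set t | gam t = j]) -> (forall j, measurable_fun setT (h j)) ->
  measurable_fun setT (fun p : mR * mP => h (gam p.1) p.2).
Proof.
move=> mg mh _ Y mY; rewrite setTI.
have -> : (fun p : mR * mP => h (gam p.1) p.2) @^-1` Y =
    \bigcup_j ([set t | gam t = j] `*` (h j @^-1` Y)).
  apply/seteqP; split => p /=; first by move=> hp; exists (gam p.1).
  by move=> [j _ [/= -> ]].
apply: bigcupT_measurable => j; apply: measurableX => //.
by rewrite -[X in measurable X]setTI; exact: mh.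
Qed.

Lemma cmeas_step (gam : mR -> nat) (h : nat -> mP -> R[i]) :
  (forall j, measurable [set t | gam t = j]) -> (forall j, cmeas (h j)) ->
  cmeas (fun p : mR * mP => h (gam p.1) p.2).
Proof.
move=> mg mh; split.
  exact: (measurable_step (h := fun j x => complex.Re (h j x)) mg (fun j => (mh j).1)).
exact: (measurable_step (h := fun j x => complex.Im (h j x)) mg (fun j => (mh j).2)).
Qed.

(* A path that is uniformly continuous in L^1 has a jointly measurable version: step functions
   whose errors are summable converge almost everywhere at every time. *)
Lemma measurable_time_version (g : R -> mP -> R[i]) (T : R) : 0 <= T -> (forall t, cmeas (g t)) ->
  (forall e, 0 < e -> exists n : nat, forall s t, 0 <= s <= T -> 0 <= t <= T ->
    `|t - s| <= n.+1%:R^-1 -> (\int[leb2]_x (cmod (g t x - g s x))%:E <= e%:E)%E) ->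
  exists2 v : mR * mP -> R[i], cmeas v &
    forall t, 0 <= t <= T -> ae_eq leb2 setT (fun x => v (t, x)) (g t).
Proof.
move=> T0 mg gu.
have h2 n : 0 < 2^-1 ^+ n :> R by rewrite exprn_gt0// invr_gt0.
have [k hk] := choice (fun n => gu (2^-1 ^+ n) (h2 n)).
pose N := (Num.truncn T).+1.
have TN : T < N%:R by exact: truncnS_gt.
(* Left-endpoint samples with L^1 error at most 2^(-n); N exceeds T, so [0, T] lies within the
   grid. *)
pose s n (p : mR * mP) := g ((grid N (k n) p.1)%:R / (k n).+1%:R) p.2.
have ms n : cmeas (s n).
  apply: (cmeas_step (gam := grid N (k n)) (h := fun j => g (j%:R / (k n).+1%:R))) => // j.
  exact: measurable_grid.
have sg n t : 0 <= t <= T -> (\int[leb2]_x (cmod (g t x - s n (t, x)))%:E <= (2^-1 ^+ n)%:E)%E.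
  move=> /andP[t0 tT]; have tN : 0 <= t < N%:R by rewrite t0 (le_lt_trans tT).
  have [/andP[a b] c] := grid_near (k n) tN.
  by apply: (hk n _ t _ _ c); rewrite ?t0// a (le_trans b).
have mst n t : cmeas (fun x => s n (t, x)) := cmeas_pair1 t (ms n).
pose e n p := (cmod (s n.+1 p - s n p))%:E.
have e0 n p : (0 <= e n p)%E by rewrite lee_fin cmod_ge0.
have me n : measurable_fun setT (e n) by apply: emeas_cmod; exact: cmeasB.
have met n t : measurable_fun setT (fun x => e n (t, x)).
  exact: (measurableT_comp (me n) (measurable_pair1 t)).
have ie n t : 0 <= t <= T -> (\int[leb2]_x e n (t, x) <= (2 * 2^-1 ^+ n)%:E)%E.
  move=> tT; apply: le_trans (integral_cmodB_triangle leb2 (mst n.+1 t) (mg t) (mst n t)) _.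
  rewrite mulrDl mul1r EFinD; apply: leeD; last exact: sg.
  rewrite integral_cmodBC; apply: le_trans (sg _ _ tT) _.
  by rewrite lee_fin exprS ler_piMl ?(ltW (h2 n))// invf_le1// ler1n.
have itail n t : 0 <= t <= T -> (\int[leb2]_x \sum_(i <oo) e (n + i)%N (t, x) <= (4 * 2^-1 ^+ n)%:E)%E.
  move=> tT; rewrite integral_nneseries//; apply: nneseries_le_bound => [i|m]; first exact: int_ge0.
  apply: (@le_trans _ _ (\sum_(0 <= i < m) (2 * 2^-1 ^+ n * 2^-1 ^+ i)%:E)%E).
    by apply: lee_sum => i _; apply: le_trans (ie _ _ tT) _; rewrite exprD mulrA.
  rewrite sumEFin lee_fin -mulr_sumr.
  have -> : 4 * 2^-1 ^+ n = 2 * 2^-1 ^+ n * 2 :> R by move: (_ ^+ n) => y; ring.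
  by apply: ler_wpM2l; [rewrite mulr_ge0// ltW|exact: ler_geometric_partial_sum].
(* Off G the approximations are replaced by 0, which makes them converge at every point and keeps
   joint measurability. *)
pose G := [set p | (\sum_(i <oo) e i p < +oo)%E].
have mG : measurable G.
  rewrite -[X in measurable X]setTI; apply: emeasurable_fun_infty_o => //.
  exact: measurable_nneseries.
have mI : measurable_fun setT (\1_G : mR * mP -> mR) by exact: measurable_indic.
pose w n p := (\1_G p : R)%:C%C * s n p.
have mw n : cmeas (w n) by apply: cmeasM => //; exact: cmeas_real.
have we n p : ((cmod (w n.+1 p - w n p))%:E <= e n p)%E.
  rewrite /w -mulrBr cmodM cmod_real lee_fin ler_piMl ?cmod_ge0//.
  by rewrite indicE; case: (p \in G); rewrite ?normr1 ?normr0.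
have [|v mv hv] := cseq_lim mw.
  move=> p; have [pG|pG] := boolP (p \in G).
    by apply: le_lt_trans (set_mem pG); apply: lee_nneseries => // i _; rewrite lee_fin cmod_ge0.
  rewrite eseries0// => i _ _.
  by rewrite /w -mulrBr indicE (negbTE pG) mul0r cmod0.
exists v => // t tT.
have mvt : cmeas (fun x => v (t, x)) := cmeas_pair1 t mv.
have aeG : {ae leb2, forall x, G (t, x)}.
  apply: ae_lty; last by apply: le_lt_trans (itail 0%N t tT) _; exact: ltry.
    by apply: measurable_nneseries.
  by move=> x; apply: nneseries_ge0.
apply: ae_eq_cmodB => //; apply/lee_addgt0Pr => eps eps0; rewrite add0e.
have [n hn] := geometric_small 5 eps0.
apply: (@le_trans _ _ ((5 * 2^-1 ^+ n)%:E)); last by rewrite lee_fin.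
apply: le_trans (integral_cmodB_triangle leb2 mvt (mst n t) (mg t)) _.
(* 4 is the sum of the increments from n on, the i-th of which has mass at most 2 times 2^(-i); 1 is
   the sampling error. *)
have -> : (5 * 2^-1 ^+ n)%:E = ((4 * 2^-1 ^+ n)%:E + (2^-1 ^+ n)%:E)%E :> \bar R.
  by rewrite -EFinD; congr EFin; move: (_ ^+ n) => y; ring.
apply: leeD; last by rewrite integral_cmodBC; exact: sg.
apply: le_trans (itail n t tT); apply: ae_ge0_le_integral => //.
- by move=> x _; rewrite lee_fin cmod_ge0.
- by apply: emeas_cmod; exact: cmeasB.
- by move=> x _; apply: nneseries_ge0.
- exact: measurable_nneseries.
- apply: ae_imply aeG => x xG _.
  have -> : s n (t, x) = w n (t, x) by rewrite /w indicE mem_set// mul1r.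
  by apply: le_trans (hv n (t, x)) _; apply: lee_nneseries => // i _; rewrite lee_fin cmod_ge0.
Qed.

End TimeVersion.

Section SegmentInduction.
Context {R : realType}.

(** Induction along an interval: near the supremum of the good points there is a good one, and
    propagation from it reaches slightly past the supremum, unless T comes first. *)
Lemma segment_induction (P : R -> Prop) (T : R) : 0 <= T -> P 0 ->
  (forall x, 0 <= x <= T -> exists2 r, 0 < r &
    forall y z, 0 <= y <= T -> 0 <= z <= T -> `|y - x| < r -> `|z - x| < r -> P y -> P z) ->
  P T.
Proof.
move=> T0 P0 step.
pose S := [set y | 0 <= y <= T /\ P y].
have S0 : S 0 by split; rewrite ?lexx.
have hS : has_sup S by split; [exists 0|exists T => y [/andP[]]].
have sup0 : 0 <= sup S by apply: sup_upper_bound.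
have supT : sup S <= T by apply: sup_le_ub; [exists 0|move=> y [/andP[]]].
have [r r0 hr] := step (sup S) ltac:(by rewrite sup0).
have [y [yT Py] ys] := sup_adherent r0 hS.
have ysup : y <= sup S by apply: sup_upper_bound.
pose z := Num.min T (sup S + r / 2).
have r2 : 0 < r / 2 by rewrite divr_gt0.
have z0 : 0 <= z <= T by rewrite ge_min lexx andbT le_min T0 addr_ge0// ltW.
have sz : sup S <= z by rewrite le_min supT lerDl ltW.
have zr : z <= sup S + r / 2 by rewrite ge_min lexx orbT.
have Pz : P z.
  apply: (hr y) => //.
    by rewrite ler0_norm ?subr_le0//; lra.
  by rewrite ger0_norm ?subr_ge0//; lra.
have zs : z <= sup S by apply: sup_upper_bound.
have : z = T.
  by move: zs; rewrite /z /Num.min; case: ifP => // _; lra.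
by move=> <-.
Qed.

End SegmentInduction.

(** * Comparison of two jointly measurable spectra *)

Section SpectrumUniqueness.
Context {R : realType}.
Local Notation mR := (measurableTypeR R).
Local Notation mP := (measurableTypeR R * measurableTypeR R)%type.
Local Notation plane := (@Defs.plane R).
Local Notation leb := (@lebesgue_measure R).
Local Notation CI := (cintegral leb2 setT).

Lemma cintble_bil_ae (g : mP -> R[i]) : cintble leb2 g ->
  {ae leb2, forall x, cintble leb2 (fun y => (kern x (psub x y))%:C%C * (g y * g (psub x y)))}.
Proof.
move=> cg; have mg := cintble_meas cg.
apply: ae_imply (cintble_ae1 (m1 := lebP) (m2 := lebP) (cintble_conv cg cg)) => x h.
apply: (cintble_bM (M := enorm (x : plane))) => //.
  apply: cmeas_real; apply: (measurableT_comp (@measurable_kern R) (g := fun y => (x, psub x y))).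
  by apply: measurable_fun_pair => //; exact: measurable_psub2.
by move=> y; rewrite cmod_real ler_kern.
Qed.

(** Bilinear splitting B(g, g) - B(h, h) = B(g - h, g) + B(h, g - h), carried out under the integral
    at those x where both integrals converge. *)
Lemma cmod_bilB_le (g h : mP -> R[i]) : cintble leb2 g -> cintble leb2 h ->
  {ae leb2, forall x, ((cmod (bil g g x - bil h h x))%:E <= (c2pi * enorm (x : plane))%:E *
    \int[leb2]_y ((cmod (g y - h y))%:E * (cmod (g (psub x y)))%:E +
      (cmod (h y))%:E * (cmod (g (psub x y) - h (psub x y)))%:E))%E}.
Proof.
move=> cg ch; have mg := cintble_meas cg; have mh := cintble_meas ch.
have mgh := cmeasB mg mh.
apply: ae_imply (ae_and (cintble_bil_ae cg) (cintble_bil_ae ch)) => x [c1 c2].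
have sh (f : mP -> R[i]) : cmeas f -> cmeas (fun y => f (psub x y)).
  by move=> mf; apply: (cmeas_comp _ mf); exact: measurable_psub2.
have cp := @c2pi_gt0 R.
rewrite /bil -mulrBr -cintegralB// cmodM cmod_real (ger0_norm (ltW cp)) !EFinM -muleA.
apply: lee_wpmul2l; first by rewrite lee_fin ltW.
have mI : measurable_fun setT (fun y => (cmod (g y - h y))%:E * (cmod (g (psub x y)))%:E +
      (cmod (h y))%:E * (cmod (g (psub x y) - h (psub x y)))%:E)%E.
  apply: emeasurable_funD; apply: emeasurable_funM; apply: emeas_cmod => //; first exact: sh.
  exact: (sh _ mgh).
have I0 y : (0 <= (cmod (g y - h y))%:E * (cmod (g (psub x y)))%:E +
      (cmod (h y))%:E * (cmod (g (psub x y) - h (psub x y)))%:E)%E.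
  by rewrite -!EFinM -EFinD lee_fin addr_ge0// mulr_ge0 ?cmod_ge0.
rewrite -intZl ?lee_fin ?enorm_ge0//.
have c12 := cintbleB c1 c2.
apply: le_trans (cmod_cintegral_le_int c12) _; apply: le_int.
- exact: emeas_cmod (cintble_meas c12).
- by apply: emeasurable_funM => //; exact: measurable_cst.
- by move=> y; rewrite lee_fin cmod_ge0.
- move=> y; rewrite -(EFinM (cmod (g y - h y))) -(EFinM (cmod (h y))) -EFinD -EFinM lee_fin.
  have kx := ler_kern x (psub x y); move: (kern _ _) (g (psub x y)) (h (psub x y)) kx => k g' h' kx.
  have -> : k%:C%C * (g y * g') - k%:C%C * (h y * h') =
      k%:C%C * ((g y - h y) * g' + h y * (g' - h')) by ring.
  rewrite cmodM cmod_real; apply: ler_pM; rewrite ?cmod_ge0//.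
  by apply: le_trans (le_cmodD _ _) _; rewrite !cmodM.
Qed.

Variables (w0 : mP -> R[i]) (u v : mR * mP -> R[i]) (T : R).
Hypotheses (mu : cmeas u) (mv : cmeas v) (T0 : 0 <= T).
Hypothesis u1 : forall t, 0 <= t <= T -> (\int[leb2]_x (cmod (u (t, x)))%:E <= 1)%E.
Hypothesis v1 : forall t, 0 <= t <= T -> (\int[leb2]_x (cmod (v (t, x)))%:E <= 1)%E.
Hypothesis ueq : forall t, 0 <= t <= T -> ae_eq leb2 setT (fun xi => u (t, xi))
        (fun xi => (heat t 0 xi)%:C%C * w0 xi - duh u t xi).
Hypothesis veq : forall t, 0 <= t <= T -> ae_eq leb2 setT (fun xi => v (t, xi))
        (fun xi => (heat t 0 xi)%:C%C * w0 xi - duh v t xi).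

Let B (f : mR * mP -> R[i]) (p : mR * mP) := bil (fun y => f (p.1, y)) (fun y => f (p.1, y)) p.2.

Let D (p : mR * mP) : R := cmod (B v p - B u p).

Let psi (p : mR * mP) : R := cmod (v p - u p).

Let N (t : R) : \bar R := (\int[leb2]_x (psi (t, x))%:E)%E.

Let ut t : cmeas (fun x => u (t, x)) := cmeas_pair1 t mu.
Let vt t : cmeas (fun x => v (t, x)) := cmeas_pair1 t mv.

Let D0 p : 0 <= D p. Proof. exact: cmod_ge0. Qed.
Let psi0 p : 0 <= psi p. Proof. exact: cmod_ge0. Qed.

Let mD : measurable_fun setT (D : mR * mP -> mR).
Proof. by apply: cmeas_cmod; apply: cmeasB; exact: cmeas_bil_time. Qed.

Let mpsi : measurable_fun setT (psi : mR * mP -> mR).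
Proof. by apply: cmeas_cmod; exact: cmeasB. Qed.

Let mpsit t : measurable_fun setT (fun x => (psi (t, x))%:E).
Proof. by apply/measurable_EFinP; exact: (measurableT_comp mpsi (measurable_pair1 t)). Qed.

Let N0 t : (0 <= N t)%E.
Proof. by apply: int_ge0 => x; rewrite lee_fin. Qed.

Let mN : measurable_fun setT (N : mR -> \bar R).
Proof.
apply: (measurable_integral_param lebP (f := fun p => (psi p)%:E)).
  exact/measurable_EFinP.
by move=> p; rewrite lee_fin.
Qed.

Let N_le2 t : 0 <= t <= T -> (N t <= 2%:E)%E.
Proof.
move=> tT; apply: (@le_trans _ _ (\int[leb2]_x ((cmod (v (t, x)))%:E + (cmod (u (t, x)))%:E))%E).
  apply: le_int => //; last by move=> x; rewrite -EFinD lee_fin le_cmodB.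
    by apply: emeasurable_funD; exact: emeas_cmod.
  by move=> x; rewrite lee_fin.
rewrite intD; try exact: emeas_cmod; try by move=> x; rewrite lee_fin cmod_ge0.
have -> : (2%:E = 1 + 1 :> \bar R)%E by rewrite -EFinD.
by apply: leeD; [exact: v1|exact: u1].
Qed.

Let cint (f : mR * mP -> R[i]) t : cmeas f -> (\int[leb2]_x (cmod (f (t, x)))%:E <= 1)%E ->
  cintble leb2 (fun x => f (t, x)).
Proof.
move=> mf h; apply/cintbleP; split; first exact: cmeas_pair1.
by apply: le_lt_trans h _; exact: ltry.
Qed.

(* The heat kernel absorbs the derivative in the nonlinearity. *)
Let weighted_D (h : mP -> \bar R) tau : 0 <= tau <= T -> measurable_fun setT h ->
  (forall x, 0 <= h x)%E -> (forall x, (enorm (x : plane))%:E * h x <= 1)%E ->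
  (\int[leb2]_x (h x * (D (tau, x))%:E) <= (8^-1)%R%:E * N tau)%E.
Proof.
move=> tT mh h0 h1.
have m1 := emeas_cmod (vt tau); have m2 := emeas_cmod (ut tau); have m3 := mpsit tau.
have p1 x : (0 <= (cmod (v (tau, x)))%:E)%E by rewrite lee_fin cmod_ge0.
have p2 x : (0 <= (cmod (u (tau, x)))%:E)%E by rewrite lee_fin cmod_ge0.
have p3 x : (0 <= (psi (tau, x))%:E)%E by rewrite lee_fin.
pose C x := (\int[leb2]_y ((psi (tau, y))%:E * (cmod (v (tau, psub x y)))%:E +
  (cmod (u (tau, y)))%:E * (psi (tau, psub x y))%:E))%E.
have mc (a b : mP -> \bar R) : measurable_fun setT a -> measurable_fun setT b ->
    measurable_fun setT (fun p : mP * mP => a p.2 * b (psub p.1 p.2))%E.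
  move=> ma mb; apply: emeasurable_funM; first exact: (measurableT_comp ma).
  exact: (measurableT_comp mb (@measurable_psub R)).
have mci (a b : mP -> \bar R) : measurable_fun setT a -> measurable_fun setT b ->
    (forall x, 0 <= a x)%E -> (forall x, 0 <= b x)%E ->
    measurable_fun setT (fun x => \int[leb2]_y (a y * b (psub x y)))%E.
  move=> ma mb a0 b0; apply: (measurable_integral_param lebP (mc _ _ ma mb)).
  by move=> p; rewrite mule_ge0.
have CE x : C x = (\int[leb2]_y ((psi (tau, y))%:E * (cmod (v (tau, psub x y)))%:E) +
    \int[leb2]_y ((cmod (u (tau, y)))%:E * (psi (tau, psub x y))%:E))%E.
  rewrite /C intD//.
  - exact: (measurableT_comp (mc _ _ m3 m1) (measurable_pair1 x)).
  - by move=> y; rewrite mule_ge0.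
  - exact: (measurableT_comp (mc _ _ m2 m3) (measurable_pair1 x)).
  - by move=> y; rewrite mule_ge0.
have C0 x : (0 <= C x)%E by apply: int_ge0 => y; rewrite adde_ge0// mule_ge0.
have mC : measurable_fun setT C.
  rewrite (_ : C = (fun x => \int[leb2]_y ((psi (tau, y))%:E * (cmod (v (tau, psub x y)))%:E) +
    \int[leb2]_y ((cmod (u (tau, y)))%:E * (psi (tau, psub x y))%:E))%E); last exact/funext.
  apply: emeasurable_funD; first exact: (mci _ _ m3 m1 p3 p1).
  exact: (mci _ _ m2 m3 p2 p3).
have iC : (\int[leb2]_x C x <= 2%:E * N tau)%E.
  under eq_integral do rewrite CE.
  rewrite intD; last 4 first.
  - exact: (mci _ _ m3 m1 p3 p1).
  - by move=> x; apply: int_ge0 => y; rewrite mule_ge0.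
  - exact: (mci _ _ m2 m3 p2 p3).
  - by move=> x; apply: int_ge0 => y; rewrite mule_ge0.
  have -> : (2%:E * N tau = N tau + N tau)%E by rewrite mule_natl mule2n.
  rewrite (integral_conv m3 m1 p3 p1) (integral_conv m2 m3 p2 p3); apply: leeD.
    by rewrite -[leRHS]mule1; apply: lee_wpmul2l; [exact: N0|exact: v1].
  by rewrite -[leRHS]mul1e; apply: lee_wpmul2r; [exact: N0|exact: u1].
have cp := @c2pi_gt0 R; have c16 := @c2pi_le16 R.
apply: (@le_trans _ _ (\int[leb2]_x (c2pi%:E * C x))%E).
  apply: ae_ge0_le_integral => //.
  - by move=> x _; rewrite mule_ge0// lee_fin.
  - apply: emeasurable_funM => //; apply/measurable_EFinP.
    exact: (measurableT_comp mD (measurable_pair1 tau)).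
  - by move=> x _; rewrite mule_ge0// lee_fin ltW.
  - by apply: emeasurable_funM => //; exact: measurable_cst.
  - have := cmod_bilB_le (cint mv (v1 tT)) (cint mu (u1 tT)).
    apply: ae_imply => x hx _; apply: le_trans (lee_wpmul2l (h0 x) hx) _.
    rewrite EFinM -muleA muleCA; apply: lee_wpmul2l; first by rewrite lee_fin ltW.
    by rewrite muleA -[leRHS]mul1e; apply: lee_wpmul2r; [exact: C0|rewrite muleC; exact: h1].
rewrite intZl ?lee_fin ?(ltW cp)//.
(* 1/8 is 2/16: two convolutions with functions of mass at most 1, and [c2pi] at most 1/16. *)
apply: (@le_trans _ _ (c2pi%:E * (2%:E * N tau))%E).
  by apply: lee_wpmul2l => //; rewrite lee_fin ltW.
rewrite muleA; apply: lee_wpmul2r; first exact: N0.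
by rewrite -EFinM lee_fin; lra.
Qed.

(** The weight 1/(1 + |x|) makes the integrand integrable in time and frequency together. At a fixed
    frequency it is a nonzero constant and can be divided out again. *)
Let duh_ae f t : cmeas f -> 0 <= t <= T ->
  (forall tau, 0 <= tau <= T -> (\int[leb2]_x (cmod (f (tau, x)))%:E <= 1)%E) ->
  {ae leb2, forall x, cintble leb (fun tau => (heat t tau x)%:C%C * B f (tau, x))}.
Proof.
move=> mf /andP[t0 tT] f1.
have f1' tau : 0 <= tau <= t -> (\int[leb2]_x (cmod (f (tau, x)))%:E <= 1)%E.
  by move=> /andP[a b]; apply: f1; rewrite a (le_trans b).
have h := @cintble_duhamel R f 1 t mf ler01 f1' (fun x : mP => (1 + enorm (x : plane))^-1) 1.
have e1 (x : mP) : 0 < 1 + enorm (x : plane) := enorm1_gt0 x.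
have {}h := h (@measurable_enorm1V R).
have a1 (x : mP) : 0 <= (1 + enorm (x : plane))^-1 by rewrite invr_ge0 ltW.
have a2 (x : mP) : enorm (x : plane) * (1 + enorm (x : plane))^-1 <= 1.
  by rewrite ler_pdivrMr// mul1r lerDr.
apply: ae_imply (cintble_ae2 (m1 := leb) (m2 := lebP) (h a1 a2)) => x hx.
have := cintbleZ (1 + enorm (x : plane))%:C%C hx; congr cintble; apply/funext => tau /=.
have key (e m k : R) (b : R[i]) : e * m = 1 -> e%:C%C * ((k * m)%:C%C * b) = k%:C%C * b.
  by move=> em; rewrite mulrA -rmorphM mulrCA em mulr1.
by apply: key; rewrite divff// gt_eqF//; exact: e1.
Qed.

Let psi_le t : 0 <= t <= T -> {ae leb2, forall x, ((psi (t, x))%:E <=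
  \int[leb]_tau (heat t tau x * D (tau, x))%:E)%E}.
Proof.
move=> tT; have c1 := duh_ae mv tT v1; have c2 := duh_ae mu tT u1.
have E := ae_and (ae_and c1 c2) (ae_and (veq tT) (ueq tT)).
apply: ae_imply E => x [[h1 h2] [/(_ I) e1 /(_ I) e2]].
rewrite /psi e1 e2.
have -> : (heat t 0 x)%:C%C * w0 x - duh v t x - ((heat t 0 x)%:C%C * w0 x - duh u t x) =
    - (duh v t x - duh u t x).
  by move: (duh v t x) (duh u t x) (_ * _) => b c p; ring.
rewrite cmodN /duh -cintegralB//.
apply: le_trans (cmod_cintegral_le_int (cintbleB h1 h2)) _.
apply: le_of_eq; apply: eq_integral => tau _.
by rewrite -mulrBr cmodM cmod_real ger0_norm// heat_ge0.
Qed.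

Let a (t : R) : R := \1_(`[0, T]%classic) t.

Let a0 t : 0 <= a t. Proof. by rewrite /a indicE. Qed.

Let a_in t : 0 <= t <= T -> a t = 1.
Proof. by move=> tT; rewrite /a indicE mem_set// /= in_itv. Qed.

Let a_out t : ~~ (0 <= t <= T) -> a t = 0.
Proof. by move=> tT; rewrite /a indicE memNset// /= in_itv/=; apply/negP. Qed.

Let ma : measurable_fun setT (a : mR -> mR).
Proof. exact: measurable_indic. Qed.

Let mHD t : measurable_fun setT (fun p : mR * mP => (heat t p.1 p.2 * D p)%:E).
Proof. by apply/measurable_EFinP; apply: measurable_funM => //; exact: measurable_heat. Qed.

Let HD0 t (p : mR * mP) : (0 <= (heat t p.1 p.2 * D p)%:E)%E.
Proof. by rewrite lee_fin mulr_ge0// heat_ge0. Qed.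

Let N_le t : 0 <= t <= T -> (N t <= \int[leb]_tau \int[leb2]_x (heat t tau x * D (tau, x))%:E)%E.
Proof.
move=> tT.
rewrite (@fubini_tonelli _ _ _ _ _ leb lebP (fun p : mR * mP => (heat t p.1 p.2 * D p)%:E))//.
have mi : measurable_fun setT (fun x => \int[leb]_tau (heat t tau x * D (tau, x))%:E)%E.
  apply: (measurable_integral_param leb (f := fun p : mP * mR => (heat t p.2 p.1 * D (p.2, p.1))%:E)).
    exact: (measurableT_comp (mHD t) (measurable_swap (T1 := mP) (T2 := mR))).
  by move=> p; exact: (HD0 t (p.2, p.1)).
apply: ae_ge0_le_integral => //.
- by move=> x _; rewrite lee_fin.
- by move=> x _; apply: int_ge0 => tau; exact: (HD0 t (tau, x)).
- by apply: ae_imply (psi_le tT) => x h _.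
Qed.

(** After Tonelli the final time t is integrated first; the resulting weight h in frequency
    satisfies |x| h(x) <= 1 by [integral_heat], which is what [weighted_D] asks for. *)
Let Psi_le : (\int[leb]_t ((a t)%:E * N t) <= (8^-1)%R%:E * \int[leb]_t ((a t)%:E * N t))%E.
Proof.
pose F (z : (mR * mR) * mP) := (a z.1.1 * (heat z.1.1 z.1.2 z.2 * D (z.1.2, z.2)))%:E.
have m1 : measurable_fun setT (fun z : (mR * mR) * mP => z.1.1).
  exact: (measurableT_comp measurable_fst measurable_fst).
have m2 : measurable_fun setT (fun z : (mR * mR) * mP => z.1.2).
  exact: (measurableT_comp measurable_snd measurable_fst).
have mF : measurable_fun setT F.
  apply/measurable_EFinP; apply: measurable_funM; first exact: (measurableT_comp ma m1).
  apply: measurable_funM; first exact: measurable_heat_comp.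
  by apply: (measurableT_comp mD (g := fun z : (mR * mR) * mP => (z.1.2, z.2))); exact: measurable_fun_pair.
have F0 z : (0 <= F z)%E by rewrite lee_fin !mulr_ge0// heat_ge0.
pose G (q : mR * mR) := (\int[leb2]_x F (q, x))%E.
have mG : measurable_fun setT G by exact: (measurable_integral_param lebP mF F0).
have G0 q : (0 <= G q)%E by apply: int_ge0.
apply: (@le_trans _ _ (\int[leb]_t \int[leb]_tau G (t, tau))%E).
  apply: le_int.
  - by apply: emeasurable_funM => //; exact/measurable_EFinP.
  - exact: (measurable_integral_param leb mG).
  - by move=> t; rewrite mule_ge0// lee_fin.
  - move=> t; have [tT|tT] := boolP (0 <= t <= T); last by rewrite a_out// mul0e int_ge0.
    rewrite a_in// mul1e; apply: le_trans (N_le tT) _; apply: le_of_eq.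
    apply: eq_integral => tau _; apply: eq_integral => x _.
    by rewrite /F /= a_in// mul1r.
rewrite (@fubini_tonelli _ _ _ _ _ leb leb G)//.
rewrite -intZl ?lee_fin//; last 2 first.
- by apply: emeasurable_funM => //; exact/measurable_EFinP.
- by move=> t; rewrite mule_ge0// lee_fin.
have mG' : measurable_fun setT (fun tau => \int[leb]_t G (t, tau))%E.
  apply: (measurable_integral_param leb (f := fun q : mR * mR => G (q.2, q.1))).
    exact: (measurableT_comp mG (measurable_swap (T1 := mR) (T2 := mR))).
  by move=> q; exact: G0.
apply: le_int; first exact: mG'.
- by apply: emeasurable_funM; [exact: measurable_cst|apply: emeasurable_funM => //; exact/measurable_EFinP].
- by move=> tau; apply: int_ge0.
move=> tau; rewrite /G.
have mFt : measurable_fun setT (fun p : mR * mP => F ((p.1, tau), p.2)).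
  apply: (measurableT_comp mF (g := fun p : mR * mP => ((p.1, tau), p.2))).
  by apply: measurable_fun_pair => //; exact: measurable_fun_pair.
rewrite (@fubini_tonelli _ _ _ _ _ leb lebP (fun p : mR * mP => F ((p.1, tau), p.2)))//.
have [tT|tT] := boolP (0 <= tau <= T); last first.
  rewrite integral0_eq ?mule_ge0 ?lee_fin// => x _.
  rewrite integral0_eq// => t _; rewrite /F /=.
  have [h|h] := boolP (0 <= tau <= t); last by rewrite heat_eq0// mul0r mulr0.
  rewrite a_out ?mul0r//; apply: contra tT => /andP[_ tT].
  by case/andP: h => -> /le_trans ->.
rewrite a_in// mul1e.
pose h x := (\int[leb]_t (a t * heat t tau x)%:E)%E.
have mhh : measurable_fun setT (fun p : mP * mR => (a p.2 * heat p.2 tau p.1)%:E).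
  apply/measurable_EFinP; apply: measurable_funM; first exact: (measurableT_comp ma measurable_snd).
  exact: measurable_heat_comp.
have hh0 (p : mP * mR) : (0 <= (a p.2 * heat p.2 tau p.1)%:E)%E.
  by rewrite lee_fin mulr_ge0// heat_ge0.
have mh : measurable_fun setT h by exact: (measurable_integral_param leb mhh).
have h0 x : (0 <= h x)%E by apply: int_ge0 => t; exact: (hh0 (x, t)).
apply: le_trans (weighted_D tT mh h0 _).
  apply: le_of_eq; apply: eq_integral => x _.
  rewrite /h -intZr; first by apply: eq_integral => t _; rewrite /F /= mulrA EFinM.
  - exact: (measurableT_comp mhh (measurable_pair1 x)).
  - by move=> t; exact: (hh0 (x, t)).
  - by rewrite lee_fin.
move=> x; apply: le_trans (integral_heat tau (x : plane)).
apply: lee_wpmul2l; first by rewrite lee_fin enorm_ge0.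
apply: le_int.
- exact: (measurableT_comp mhh (measurable_pair1 x)).
- by apply/measurable_EFinP; exact: measurable_heat_time.
- by move=> t; exact: (hh0 (x, t)).
- by move=> t; rewrite lee_fin ler_piMl ?heat_ge0// /a indicE; case: (_ \in _).
Qed.

Let maN : measurable_fun setT (fun t : mR => (a t)%:E * N t)%E.
Proof. by apply: emeasurable_funM => //; exact/measurable_EFinP. Qed.

Let aN0 t : (0 <= (a t)%:E * N t)%E.
Proof. by rewrite mule_ge0// lee_fin. Qed.

(** Finiteness is what allows the inequality with factor 1/8 to conclude that the integral is 0;
    norms at most 1 on a bounded interval provide it. *)
Let Psi_fin : (\int[leb]_t ((a t)%:E * N t) < +oo)%E.
Proof.
apply: (@le_lt_trans _ _ (\int[leb]_t (2%:E * (a t)%:E))%E).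
  apply: le_int => //; first by apply: emeasurable_funM => //; exact/measurable_EFinP.
  move=> t; rewrite muleC; have [tT|tT] := boolP (0 <= t <= T).
    by apply: lee_wpmul2r; [rewrite lee_fin|exact: N_le2].
  by rewrite a_out// !mule0.
rewrite intZl; [|by apply/measurable_EFinP; exact: ma|by move=> t; rewrite lee_fin|by rewrite lee_fin].
have -> : (\int[leb]_t (a t)%:E = (T - 0)%:E)%E.
  by rewrite integral_indic// setIT; exact: lebesgue_cc T0.
by rewrite -EFinM; exact: ltry.
Qed.

Let aeN : {ae leb, forall t, ((a t)%:E * N t = 0)%E}.
Proof.
apply: ae_eq0 => //; move: Psi_le Psi_fin.
have : (0 <= \int[leb]_t ((a t)%:E * N t))%E by exact: int_ge0.
case: (\int[leb]_t _)%E => [r| |]//.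
by rewrite -EFinM !lee_fin => r0 h _; lra.
Qed.

(** Passes from almost every time to every time: the difference at t is bounded by an integral over
    earlier times, at almost all of which the two nonlinearities already agree. *)
Lemma mild_spectrum_unique t : 0 <= t <= T -> ae_eq leb2 setT (fun x => v (t, x)) (fun x => u (t, x)).
Proof.
move=> tT; apply: ae_eq_cmodB => //; apply: le_trans (N_le tT) _.
apply: (@le_trans _ _ (\int[leb]_tau (cst 0%E tau))%E); last by rewrite integral0.
apply: ae_ge0_le_integral => //.
- by move=> tau _; apply: int_ge0 => x; exact: (HD0 t (tau, x)).
- exact: (measurable_integral_param lebP (mHD t)).
- apply: ae_imply aeN => tau /= aN _.
  have [h|h] := boolP (0 <= tau <= t); last first.
    by under eq_integral do rewrite (heat_eq0 _ h) mul0r; rewrite integral0.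
  have tauT : 0 <= tau <= T by case/andP: h => -> /le_trans ->//; case/andP: tT.
  have Nt : N tau = 0%E by move: aN; rewrite a_in// mul1e.
  have e1 (x : mP) : 0 < 1 + enorm (x : plane) := enorm1_gt0 x.
  have mV : measurable_fun setT (fun x : mP => ((1 + enorm (x : plane))^-1)%:E).
    by apply/measurable_EFinP; exact: measurable_enorm1V.
  have V0 (x : mP) : (0 <= ((1 + enorm (x : plane))^-1)%:E)%E by rewrite lee_fin invr_ge0 ltW.
  have V1 (x : mP) : ((enorm (x : plane))%:E * ((1 + enorm (x : plane))^-1)%:E <= 1)%E.
    by rewrite -EFinM lee_fin ler_pdivrMr// mul1r lerDr.
  have h0 := weighted_D tauT mV V0 V1; rewrite Nt mule0 in h0.
  have mDt : measurable_fun setT (fun x => (D (tau, x))%:E).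
    by apply/measurable_EFinP; exact: (measurableT_comp mD (measurable_pair1 tau)).
  have VD0 (x : mP) : (0 <= ((1 + enorm (x : plane))^-1)%:E * (D (tau, x))%:E)%E.
    by rewrite mule_ge0// lee_fin.
  have aeD : {ae leb2, forall x, D (tau, x) = 0}.
    apply: ae_imply (ae_eq0 (emeasurable_funM mV mDt) VD0 h0) => x.
    by rewrite -EFinM => -[/eqP]; rewrite mulf_eq0 invr_eq0 gt_eqF//= => /eqP.
  apply: (@le_trans _ _ (\int[leb2]_x (cst 0%E x))%E); last by rewrite integral0.
  apply: ae_ge0_le_integral => //.
  - by move=> x _; exact: (HD0 t (tau, x)).
  - exact: (measurableT_comp (mHD t) (measurable_pair1 tau)).
  - by apply: ae_imply aeD => x Dx _; rewrite Dx mulr0.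
Qed.

End SpectrumUniqueness.

(** * From a continuous path of distributions to its spectra *)

Section PathContinuity.
Context {R : realType}.
Local Notation mR := (measurableTypeR R).
Local Notation mP := (measurableTypeR R * measurableTypeR R)%type.
Local Notation leb := (@lebesgue_measure R).

Lemma inv_nat_lt (r : R) : 0 < r -> exists n : nat, n.+1%:R^-1 < r.
Proof.
move=> r0; exists (Num.truncn r^-1).
by rewrite -[ltRHS]invrK ltf_pV2 ?posrE ?invr_gt0//; exact: truncnS_gt.
Qed.

(** Heine's theorem by [segment_induction]: the property P says that the tolerance e is met on
    [0, x] with some mesh. Pairs of times beyond the good point y lie near x, and both are compared
    with x. *)
Lemma L1_uniform_continuity (g : R -> mP -> R[i]) (T : R) : 0 <= T -> (forall t, cmeas (g t)) ->
  (forall x e, 0 <= x -> 0 < e -> exists2 r, 0 < r & forall s, 0 <= s -> `|s - x| < r ->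
     (\int[leb2]_y (cmod (g s y - g x y))%:E <= e%:E)%E) ->
  forall e, 0 < e -> exists n : nat, forall s t, 0 <= s <= T -> 0 <= t <= T ->
    `|t - s| <= n.+1%:R^-1 -> (\int[leb2]_x (cmod (g t x - g s x))%:E <= e%:E)%E.
Proof.
move=> T0 mg gc e e0.
have e2 : 0 < e / 2 by rewrite divr_gt0.
pose P x := exists n : nat, forall s t, 0 <= s -> s <= t -> t <= x -> t - s <= n.+1%:R^-1 ->
  (\int[leb2]_x (cmod (g t x - g s x))%:E <= e%:E)%E.
suff [n hn] : P T.
  exists n => s t /andP[s0 sT] /andP[t0 tT] st; have [h|h] := leP s t.
    by apply: hn => //; apply: le_trans (ler_norm _) st.
  by rewrite integral_cmodBC; apply: hn => //; [exact: ltW|rewrite distrC in st; apply: le_trans (ler_norm _) st].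
apply: (segment_induction T0).
  exists 0%N => s t s0 st t0 _.
  have -> : t = s by apply/eqP; rewrite eq_le st (le_trans t0 s0).
  by under eq_integral do rewrite subrr cmod0; rewrite integral0 lee_fin ltW.
move=> x /andP[x0 xT]; have [r r0 hr] := gc x (e / 2) x0 e2.
have r2 : 0 < r / 2 by rewrite divr_gt0.
exists (r / 2) => // y z /andP[y0 yT] /andP[z0 zT] yx zx [n hn].
have [n0 hn0] := inv_nat_lt r2.
exists (maxn n n0) => s t s0 st tz ts.
have le1 (m : nat) : (m <= maxn n n0)%N -> t - s <= m.+1%:R^-1.
  by move=> mn; apply: le_trans ts _; rewrite lef_pV2 ?posrE// ler_nat.
have [ty|yt] := leP t y; first by apply: hn => //; apply: le1; exact: leq_maxl.
have ts2 := le_lt_trans (le1 n0 (leq_maxr _ _)) hn0.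
move: yx zx; rewrite !ltr_norml => /andP[y1 y2] /andP[z1 z2].
apply: le_trans (integral_cmodB_triangle leb2 (mg t) (mg x) (mg s)) _.
have -> : e%:E = ((e / 2)%:E + (e / 2)%:E)%E by rewrite -EFinD -splitr.
apply: leeD; last rewrite integral_cmodBC; apply: hr => //.
- by apply: le_trans st.
- by rewrite ltr_norml; apply/andP; split; lra.
- by rewrite ltr_norml; apply/andP; split; lra.
Qed.

Lemma duh0 (f : mR * mP -> R[i]) x : cmeas f -> duh f 0 x = 0.
Proof.
move=> mf; rewrite -(cintegral0 leb); apply: cintegral_ae.
- apply: cmeasM; first by apply: cmeas_real; exact: measurable_heat_comp.
  exact: (cmeas_pair2 x (cmeas_bil_time mf mf)).
- exact: cmeas_cst.
- exists [set 0]; split => [||tau /= h].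
  + exact: measurable_set1.
  + exact: lebesgue_measure_set1.
  + apply/eqP; apply: contra_notT h => t0 _.
    by rewrite heat_eq0 ?mul0r// -eq_le eq_sym.
Qed.

Lemma cvg_Xcapnorm_L1 delta (eta : R -> @dist R) (g : R -> mP -> R[i]) :
  (forall t, 0 <= t -> spec (eta t) (g t)) -> in_Cb delta eta ->
  forall x e, 0 <= x -> 0 < e -> exists2 r, 0 < r & forall s, 0 <= s -> `|s - x| < r ->
     (\int[leb2]_y (cmod (g s y - g x y))%:E <= e%:E)%E.
Proof.
move=> sg [_ cg _] x e x0 e0.
have : \forall s \near within `[0, +oo[ (nbhs x), (Xcapnorm delta (Defs.dsub (eta s) (eta x)) < e%:E)%E.
  by apply: (cg x x0 [set y | (y < e%:E)%E]); apply: open_ereal_lt'; rewrite lte_fin.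
move=> /nbhs_ballP[r r0 hr]; exists r => // s s0 sx.
have := hr s _ _; rewrite /ball /= distrC in_itv/= s0 => /(_ sx isT) h.
have := spec_dsub (sg s s0) (sg x x0) => /(Xnorm_spec 0) E.
apply: le_trans (ltW h); rewrite /Xcapnorm le_max E; apply/orP; left.
by apply: le_of_eq; apply: eq_integral => y _; rewrite powRr0 mul1r.
Qed.

End PathContinuity.

Section Uniqueness.
Context {R : realType}.
Local Notation mR := (measurableTypeR R).
Local Notation mP := (measurableTypeR R * measurableTypeR R)%type.
Local Notation leb := (@lebesgue_measure R).
Variables (w0 : mP -> R[i]) (u : mR * mP -> R[i]) (Q : mP -> \bar R) (delta : R) (theta0 : @dist R).
Hypotheses (mu : cmeas u) (mQ : measurable_fun setT Q) (du : dom u Q).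
Hypothesis iQ : (\int[leb2]_x Q x <= (2^-1)%R%:E)%E.
Hypothesis ueq : forall t, ae_eq leb2 setT (fun xi => u (t, xi))
        (fun xi => (heat t 0 xi)%:C%C * w0 xi - duh u t xi).
Hypothesis sp0 : spec theta0 w0.
Variable eta : R -> @dist R.
Hypotheses (etaCb : in_Cb delta eta) (eta_mild : mild_solution theta0 eta).

(** The path is constrained at nonnegative times only; the value 0 before time 0 makes every slice
    measurable and integrable. *)
Let g (t : R) : mP -> R[i] := if 0 <= t then hat (eta t) else fun=> 0.

Let sg t : 0 <= t -> spec (eta t) (g t).
Proof.
move=> t0; have [h _ _] := etaCb; rewrite /g t0.
by have [/inX0_spec[]] := h t t0.
Qed.

Let cg t : cintble leb2 (g t).
Proof.
rewrite /g; case: ifPn => t0; last exact: cintble0.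
have [h _ _] := etaCb.
by have [/inX0_spec[]] := h t t0.
Qed.

Let mg t : cmeas (g t). Proof. exact: cintble_meas (cg t). Qed.

Let gc := cvg_Xcapnorm_L1 sg etaCb.

Let ut t : cmeas (fun x => u (t, x)) := cmeas_pair1 t mu.

Let u_half t : (\int[leb2]_x (cmod (u (t, x)))%:E <= (2^-1)%R%:E)%E.
Proof. exact: le_trans (integral_slice mu mQ du t) iQ. Qed.

(** Both sides are spectra of [eta t], one by the choice of v and the other by the integral
    equation; a spectrum is unique almost everywhere. *)
Let spectrum_eq (v : mR * mP -> R[i]) (A t : R) : cmeas v -> 0 <= A -> 0 <= t ->
  (forall tau, 0 <= tau <= t -> ae_eq leb2 setT (fun x => v (tau, x)) (g tau)) ->
  (forall tau, 0 <= tau <= t -> (\int[leb2]_x (cmod (g tau x))%:E <= A%:E)%E) ->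
  ae_eq leb2 setT (fun x => v (t, x)) (fun x => (heat t 0 x)%:C%C * w0 x - duh v t x).
Proof.
move=> mv A0 t0 vg gA.
have sv tau : 0 <= tau <= t -> spec (eta tau) (fun x => v (tau, x)).
  move=> tt; have /andP[tau0 _] := tt.
  apply: (spec_ae (sg tau0) (cmeas_pair1 tau mv)).
  by apply: ae_imply (vg tau tt) => x h /h ->.
have vA tau : 0 <= tau <= t -> (\int[leb2]_x (cmod (v (tau, x)))%:E <= A%:E)%E.
  move=> tt; rewrite (integral_cmod_ae (cmeas_pair1 tau mv) (mg tau) (vg tau tt)).
  exact: gA.
have := spec_mild sp0 mv A0 t0 vA sv.
move=> /(dist_eq_spec (eta_mild t0)) h.
by apply: (spec_unique (sv t _) h); rewrite t0/=.
Qed.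

(** Uniform continuity gives a jointly measurable version of g, and norms at most 1 put it within
    the scope of [mild_spectrum_unique]. *)
Let local z : 0 <= z -> (forall s, 0 <= s <= z -> (\int[leb2]_x (cmod (g s x))%:E <= 1)%E) ->
  forall s, 0 <= s <= z -> ae_eq leb2 setT (g s) (fun x => u (s, x)).
Proof.
move=> z0 g1; have [v mv vg] := measurable_time_version z0 mg (L1_uniform_continuity z0 mg gc).
have v1 t : 0 <= t <= z -> (\int[leb2]_x (cmod (v (t, x)))%:E <= 1)%E.
  move=> tz; rewrite (integral_cmod_ae (cmeas_pair1 t mv) (mg t) (vg t tz)); exact: g1.
have u1 t : 0 <= t <= z -> (\int[leb2]_x (cmod (u (t, x)))%:E <= 1)%E.
  by move=> _; apply: le_trans (u_half t) _; rewrite lee_fin invf_le1// ler1n.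
have veq t : 0 <= t <= z -> ae_eq leb2 setT (fun x => v (t, x))
    (fun x => (heat t 0 x)%:C%C * w0 x - duh v t x).
  move=> /andP[t0 tz]; apply: (spectrum_eq mv ler01 t0) => tau /andP[a b].
    by apply: vg; rewrite a (le_trans b).
  by apply: g1; rewrite a (le_trans b).
move=> s sz; have uv := mild_spectrum_unique mu mv z0 u1 v1 (fun t _ => ueq t) veq sz.
by apply: ae_imply (ae_and (vg s sz) uv) => x [/(_ I) <- /(_ I) <-].
Qed.

(** At time 0 the Duhamel terms vanish and both spectra reduce to the data. Only the slice at 0
    matters, so it is extended constantly in time to be jointly measurable. *)
Let initial : ae_eq leb2 setT (g 0) (fun x => u (0, x)).
Proof.
pose v (p : mR * mP) := g 0 p.2.
have mv : cmeas v by apply: (cmeas_comp _ (mg 0)).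
have i0 : (\int[leb2]_x (cmod (g 0 x))%:E)%E \is a fin_num.
  rewrite ge0_fin_numE; first exact: cintble_lty (cg 0).
  by apply: int_ge0 => x; rewrite lee_fin cmod_ge0.
have tau0 (tau : R) : 0 <= tau <= 0 -> tau = 0 by move=> h; apply/eqP; rewrite eq_le andbC.
have h : ae_eq leb2 setT (g 0) (fun x => (heat 0 0 x)%:C%C * w0 x - duh v 0 x).
  apply: (@spectrum_eq v (fine (\int[leb2]_x (cmod (g 0 x))%:E)%E) 0 mv) => //.
  - by apply: fine_ge0; apply: int_ge0 => x; rewrite lee_fin cmod_ge0.
  - by move=> tau /tau0 ->; exact: aeW.
  - by move=> tau /tau0 ->; rewrite fineK.
apply: ae_imply (ae_and h (ueq 0)) => x [/(_ I) -> /(_ I) ->] _.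
by rewrite !duh0.
Qed.

(* The set of times up to which the two spectra agree propagates: near such a time the second
   solution has norm at most 1, and [local] applies. *)
Lemma sol_unique t : 0 <= t -> dist_eq (eta t) (sol u t).
Proof.
move=> t0.
pose P x := forall s, 0 <= s <= x -> ae_eq leb2 setT (g s) (fun x => u (s, x)).
suff h : P t.
  have ss := spec_sol mu mQ du (le_lt_trans iQ (ltry _)) t.
  apply: spec_dist_eq ss; apply: (spec_ae (sg t0)); first exact: ut.
  by apply: h; rewrite t0/=.
apply: (segment_induction t0).
  by move=> s h; have -> : s = 0 by [apply/eqP; rewrite eq_le andbC]; exact: initial.
(* Near x the second spectrum stays within 1/4 of its value at x, hence within 1/2 of its value at
   y, where agreement with u bounds its mass by 1/2; the total is 1. *)
move=> x /andP[x0 _]; have e4 : 0 < 4^-1 :> R by rewrite invr_gt0.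
have [r r0 hr] := gc x0 e4; exists r => // y z /andP[y0 _] /andP[z0 _] yx zx Py.
apply: local => // s /andP[s0 sz]; have [sy|ys] := leP s y.
  rewrite (integral_cmod_ae (mg s) (ut s) (Py s _)) ?s0//.
  by apply: le_trans (u_half s) _; rewrite lee_fin invf_le1// ler1n.
have sx : `|s - x| < r.
  by move: yx zx; rewrite !ltr_norml => /andP[a b] /andP[c d]; apply/andP; split; lra.
apply: le_trans (integral_cmod_le_add leb2 (mg s) (mg y)) _.
have -> : (1%:E = (2^-1)%R%:E + ((4^-1)%R%:E + (4^-1)%R%:E) :> \bar R)%E.
  by rewrite -!EFinD; congr EFin; lra.
apply: leeD.
  by rewrite (integral_cmod_ae (mg y) (ut y) (Py y _)) ?y0/=.
apply: le_trans (integral_cmodB_triangle leb2 (mg s) (mg x) (mg y)) _.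
by apply: leeD; [exact: hr|rewrite integral_cmodBC; exact: hr].
Qed.

End Uniqueness.

Theorem theorem1p7 (R : realType) (delta : R) (theta0 : @dist R) :
  0 <= delta -> delta < 1 ->
  inXcap delta theta0 ->
  (Xnorm 0 theta0 < (2 `^ (- (3 - delta)))%:E)%E ->
  exists theta : R -> @dist R,
    [/\ in_Cb delta theta /\ mild_solution theta0 theta,
        (forall eta : R -> @dist R,
           in_Cb delta eta -> mild_solution theta0 eta ->
           forall t : R, 0 <= t -> dist_eq (eta t) (theta t)),
        in_L1 delta (fun t => gradient (theta t))
      & forall eps : R, 0 < eps -> \forall t \near +oo,
          (Xnorm 0 (theta t) <= (eps * t `^ (- delta))%:E)%E].
Proof.
move=> d0 d1 [X0 Xd] small.
have [sp0 cw0] := inX0_spec X0; have mw0 := cintble_meas cw0.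
have N0 : (\int[leb2]_x (cmod (hat theta0 x))%:E = Xnorm 0 theta0)%E.
  by apply: eq_integral => x _; rewrite powRr0 mul1r.
have [_ _ Xd_fin] := Xd.
have fin r : (Xnorm r theta0 < +oo)%E -> (fine (Xnorm r theta0))%:E = Xnorm r theta0.
  by move=> h; rewrite fineK// ge0_fin_numE// Xnorm_ge0.
have X0_fin : (Xnorm 0 theta0 < +oo)%E by apply: lt_trans small _; exact: ltry.
pose a0 := fine (Xnorm 0 theta0); pose b0 := fine (Xnorm (- delta) theta0).
have a00 : 0 <= a0 by rewrite fine_ge0// Xnorm_ge0.
have b00 : 0 <= b0 by rewrite fine_ge0// Xnorm_ge0.
have a04 : a0 <= 4^-1.
  (* As delta < 1, the exponent -(3 - delta) is at most -2. *)
  have h : 2 `^ (- (3 - delta)) <= 4^-1.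
    apply: (@le_trans _ _ (2 `^ (- 2%:R))).
      by apply: ler_powR; [rewrite ler1n|rewrite lerN2; lra].
    by rewrite powRN powR_mulrn// lef_pV2 ?posrE ?exprn_gt0//; rewrite expr2; lra.
  apply: le_trans h; rewrite -lee_fin /a0 fin//; exact: ltW.
have w0a : (\int[leb2]_x (cmod (hat theta0 x))%:E <= a0%:E)%E by rewrite N0 /a0 fin.
have w0b : (\int[leb2]_x ((enorm x `^ (- delta))%:E * (cmod (hat theta0 x))%:E) <= b0%:E)%E.
  by rewrite /b0 fin.
have [u [Q [[mu mQ] du iQ iw ueq]]] := picard d0 d1 mw0 a00 b00 a04 w0a w0b.
have iQoo := le_lt_trans iQ (ltry _).
exists (sol u); split.
- split; first exact: (sol_in_Cb mw0 mu mQ du iQoo ueq iw).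
  exact: (sol_mild mw0 mu mQ du iQoo ueq sp0).
- move=> eta etaCb eta_mild; exact: (sol_unique mu mQ du iQ ueq sp0 etaCb eta_mild).
- exact: (gradient_in_L1 mw0 mu mQ du iQoo ueq iw).
- move=> eps; apply: (sol_decay d0 d1 mw0 mu mQ du iQ ueq _ _ iw).
    by rewrite N0.
  exact: Xd_fin.
Qed.
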